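(* Let $\Omega\subset\mathbb{R}^{n+1}$, $n\ge2$, be a 1-sided CAD, and let $L=-\operatorname{div}(A\nabla)$ be a real (not necessarily symmetric) elliptic operator. Then for every $\beta\in(0,\alpha_1]$, where $\alpha_1\in(0,1)$ is the De Giorgi/Nash exponent of $L$, and for every growth function $\varphi\in\mathcal G_\beta$, we have $$\|u\|_{\dot{\mathscr C}^\varphi(\Omega)}\approx\|u\|_{\mathscr C^{*,\varphi}(\Omega)}\qquad\text{for all }u\in W^{1,2}_{\mathrm{loc}}(\Omega)\text{ with }Lu=0\text{ in the weak sense in }\Omega,$$ where the implicit constants depend only on $n$, the 1-sided CAD constants, the ellipticity constant of $L$, and $C_\varphi$. In particular, setting $$\dot{\mathscr C}_L^\varphi(\Omega):=\{u\in W^{1,2}_{\mathrm{loc}}(\Omega)\cap\dot{\mathscr C}^\varphi(\Omega):Lu=0\text{ weakly in }\Omega\},\qquad \mathscr C_L^{*,\varphi}(\Omega):=\{u\in W^{1,2}_{\mathrm{loc}}(\Omega)\cap\mathscr C^{*,\varphi}(\Omega):Lu=0\text{ weakly in }\Omega\},$$ one has $$\dot{\mathscr C}_L^\varphi(\Omega)=\mathscr C_L^{*,\varphi}(\Omega)\quad\text{and}\quad\dot{\mathscr C}_L^\varphi(\Omega)/\mathbb{R}=\mathscr C_L^{*,\varphi}(\Omega)/\mathbb{R},\quad\text{with equivalent norms}.$$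
   Context: $\delta(X):=\operatorname{dist}(X,\partial\Omega)$. $a\approx b$ means $C^{-1}a\le b\le Ca$ (both sides possibly infinite). Growth functions: $\varphi:(0,\infty)\to(0,\infty)$ is a growth function if it is non-decreasing and $\varphi(t)\to0$ as $t\to0^+$. For $\beta\in(0,1)$, $\varphi\in\mathcal G_\beta$ if there is a constant $C_\varphi$ with $\int_0^t\varphi(s)\frac{ds}{s}+t^\beta\int_t^\infty\frac{\varphi(s)}{s^\beta}\frac{ds}{s}\le C_\varphi\,\varphi(t)$ for all $t>0$. Spaces: $\|u\|_{\dot{\mathscr C}^\varphi(\Omega)}:=\sup_{X\ne Y\in\Omega}\frac{|u(X)-u(Y)|}{\varphi(|X-Y|)}$ and $\dot{\mathscr C}^\varphi(\Omega)$ is the set of $u:\Omega\to\mathbb{R}$ for which it is finite. $\|u\|_{\mathscr C^{*,\varphi}(\Omega)}:=\sup_{x\in\partial\Omega,\,0<r<\infty}\frac1{\varphi(r)}\Big(\frac1{r^n}\iint_{B(x,r)\cap\Omega}|\nabla u(X)|^2\delta(X)\,dX\Big)^{1/2}$ and $\mathscr C^{*,\varphi}(\Omega)$ is the set of $u\in W^{1,2}_{\mathrm{loc}}(\Omega)$ for which it is finite. Quotients by $\mathbb{R}$ identify functions whose difference is constant and carry the induced norms. 1-sided CAD (chord-arc domain): an open set $\Omega$ satisfying the following three conditions, whose constants are the 1-sided CAD constants. (1) $\partial\Omega$ is Ahlfors–David regular (ADR): there is $C>1$ with $C^{-1}r^n\le\mathcal H^n(\partial\Omega\cap B(x,r))\le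 Cr^n$ for all $x\in\partial\Omega$, $0<r<\operatorname{diam}(\partial\Omega)$. (2) Corkscrew condition: there is $c_0\in(0,1)$ such that for every $x\in\partial\Omega$ and $0<r<\operatorname{diam}(\partial\Omega)$ there is a ball $B(X',c_0r)\subset B(x,r)\cap\Omega$. (3) Harnack chain condition: there are $K_1,K_2>1$ such that for all $X,X'\in\Omega$ there are balls $B_1,\dots,B_N\subset\Omega$ with $N\le K_1(2+\log_2^+\Pi(X,X'))$, $\Pi(X,X'):=\frac{|X-X'|}{\min\{\delta(X),\delta(X')\}}$, such that $X\in B_1$, $X'\in B_N$, $B_k\cap B_{k+1}\ne\emptyset$ for $1\le k\le N-1$, and $K_2^{-1}\operatorname{diam}(B_k)\le\operatorname{dist}(B_k,\partial\Omega)\le K_2\operatorname{diam}(B_k)$ for $1\le k\le N$. Elliptic operators: $L=-\operatorname{div}(A\nabla)$ with $A$ a real (not necessarily symmetric) $(n+1)\times(n+1)$ matrix with entries in $L^\infty(\Omega)$ and such that, for some $\Lambda\ge1$ (the ellipticity constant), $\Lambda^{-1}|\xi|^2\le A(X)\xi\cdot\xi$ and $|A(X)\xi\cdot\eta|\le\Lambda|\xi||\eta|$ for all $\xi,\eta\in\mathbb{R}^{n+1}$ and a.e. $X\in\Omega$. $Lu=0$ in the weak sense in $\Omega$ means $u\in W^{1,2}_{\mathrm{loc}}(\Omega)$ and $\iint_\Omega A\nabla u\cdot\nabla\phi\,dX=0$ for all $\phi\in\mathscr C_c^\infty(\Omega)$; weak solutions are identified with their continuous representatives. De Giorgi/Nash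 exponent: $\alpha_1\in(0,1)$ and $C_1\ge1$ denote constants, depending only on $n$ and the ellipticity constant (they exist by the De Giorgi/Nash theorem), such that for every ball $B$ of radius $R$ and every weak solution $u\in W^{1,2}(2B)$ of $Lu=0$ in $2B$ (the concentric double), $\sup_{\overline B}|u|+\sup_{X\ne Y\in\overline B}\frac{|u(X)-u(Y)|}{(|X-Y|/R)^{\alpha_1}}\le C_1\Big(\frac1{|2B|}\iint_{2B}|u|^2\Big)^{1/2}$. *)

(* Defs.v *)
From HB Require Import structures.
From mathcomp Require Import all_boot all_order all_algebra.
From mathcomp Require Import all_classical all_reals all_analysis.

Set Implicit Arguments.
Unset Strict Implicit.
Unset Printing Implicit Defensive.

Import Order.TTheory GRing.Theory Num.Theory.
Import numFieldNormedType.Exports.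

Local Open Scope classical_set_scope.
Local Open Scope ring_scope.

(* The space R^d is 'rV[R]_d. Its library topology is the usual one, but the
   library norm on it is the sup norm; Euclidean balls, distances and diameters
   are therefore defined here from [enorm]. *)

(* The Borel sigma-algebra of R^d, generated by the coordinate functions. *)

Definition row_display : measure_display -> measure_display.
Proof. exact. Qed.

Section measurable_row.
Context {R : realType} (d : nat).

Let coord (i : 'I_d) (x : 'rV[R]_d) : measurableTypeR R := x ord0 i.

Let row_set0 : g_sigma_preimage coord set0.
Proof. exact: sigma_algebra0. Qed.

Let row_setC A : g_sigma_preimage coord A -> g_sigma_preimage coord (~` A).
Proof. exact: sigma_algebraC. Qed.

Let row_bigcup (F : _^nat) : (forall i, g_sigma_preimage coord (F i)) ->
  g_sigma_preimage coord (\bigcup_i (F i)).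
Proof. exact: sigma_algebra_bigcup. Qed.

HB.instance Definition _ := @isMeasurable.Build
  (row_display (measure_tuple_display default_measure_display))
  'rV[R]_d (g_sigma_preimage coord) row_set0 row_setC row_bigcup.

Lemma measurable_row_coord (i : 'I_d) :
  measurable_fun [set: 'rV[R]_d] (fun x => x ord0 i : measurableTypeR R).
Proof.
move=> _ Y mY; rewrite setTI; apply: sub_sigma_algebra => /=.
rewrite -bigcup_seq/=; exists i => /=; first by rewrite mem_index_enum.
by exists Y => //; rewrite setTI.
Qed.

Lemma measurable_fun_row d' (T : measurableType d') (f : T -> 'rV[R]_d) :
  (forall i, measurable_fun [set: T] (fun t => f t ord0 i : measurableTypeR R)) ->
  measurable_fun [set: T] f.
Proof.
move=> mf.
have h : <<s \big[setU/set0]_(i < d)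
    preimage_set_system setT (coord i) measurable >> `<=`
    [set A | measurable (f @^-1` A)].
  apply: smallest_sub.
    split => /=.
    - by rewrite preimage_set0.
    - by move=> A mA; rewrite setTD preimage_setC; exact: measurableC.
    - by move=> F mF; rewrite preimage_bigcup; exact: bigcupT_measurable.
  rewrite -bigcup_seq => A [i _ [B mB <-]] /=; rewrite setTI.
  by rewrite -[X in measurable X]setTI; exact: mf.
by move=> _ A mA; rewrite setTI; exact: h.
Qed.

End measurable_row.

(* Lebesgue measure on R^d: the image of the d-fold product of the Lebesgue
   measure of R under (t, x) |-> (t, x_0, ..., x_(d-1)). *)

Section lebesgue_row.
Context {R : realType}.

Definition row_cons d (p : measurableTypeR R * 'rV[R]_d) : 'rV[R]_d.+1 :=
  \row_i oapp (p.2 ord0) p.1 (unlift ord0 i).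

Definition row_uncons d (x : 'rV[R]_d.+1) : measurableTypeR R * 'rV[R]_d :=
  (x ord0 ord0, \row_i x ord0 (lift ord0 i)).

Lemma row_consK d : cancel (@row_cons d) (@row_uncons d).
Proof.
move=> [t x]; rewrite /row_uncons /row_cons /= mxE unlift_none /=; congr pair.
by apply/rowP => i; rewrite !mxE liftK.
Qed.

Lemma measurable_row_cons d : measurable_fun setT (@row_cons d).
Proof.
apply: measurable_fun_row => i.
under eq_fun do rewrite mxE.
case: unliftP => [j _|_] /=; last exact: measurable_fst.
exact: (measurableT_comp (@measurable_row_coord R d j) measurable_snd).
Qed.

Lemma measurable_row_uncons d : measurable_fun setT (@row_uncons d).
Proof.
apply: measurable_fun_pair; first exact: measurable_row_coord.
apply: measurable_fun_row => i.
under eq_fun do rewrite mxE.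
exact: measurable_row_coord.
Qed.

Section step.
Context d (m : {sigma_finite_measure set 'rV[R]_d -> \bar R}).

Definition lebesgue_row_step : set 'rV[R]_d.+1 -> \bar R :=
  pushforward (@lebesgue_measure R \x m)%E (@row_cons d).

HB.instance Definition _ := Measure.copy lebesgue_row_step
  (measure_function_pushforward__canonical__measure_function_Measure
    (@lebesgue_measure R \x m)%E (@measurable_row_cons d)).

Lemma lebesgue_row_step_sigma_finite : sigma_finite setT lebesgue_row_step.
Proof.
have /sigma_finiteP[F [TF ndF Foo]] := sigma_finiteT (@lebesgue_measure R).
have /sigma_finiteP[G [TG ndG Goo]] := sigma_finiteT m.
exists (fun k => @row_uncons d @^-1` (F k `*` G k)).
  rewrite -preimage_bigcup; apply/esym/seteqP; split => // x _ /=.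
  have [i _ Fi] : (\bigcup_i F i) (row_uncons x).1 by rewrite -TF.
  have [j _ Gj] : (\bigcup_i G i) (row_uncons x).2 by rewrite -TG.
  exists (maxn i j) => //; split.
  - by move: Fi; exact/subsetPset/ndF/leq_maxl.
  - by move: Gj; exact/subsetPset/ndG/leq_maxr.
move=> k; have [mF Fk] := Foo k; have [mG Gk] := Goo k.
have mFG : measurable (F k `*` G k) by exact: measurableX.
split.
  by rewrite -[X in measurable X]setTI; exact: measurable_row_uncons.
rewrite /lebesgue_row_step /pushforward -comp_preimage.
have -> : @row_uncons d \o @row_cons d = id.
  by apply/funext => p; exact: row_consK.
by rewrite preimage_id product_measure1E// lte_mul_pinfty// ge0_fin_numE.
Qed.

HB.instance Definition _ := Measure_isSigmaFinite.Build _ _ _ lebesgue_row_step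
  lebesgue_row_step_sigma_finite.
End step.

Fixpoint lebesgue_row (d : nat) : {sigma_finite_measure set 'rV[R]_d -> \bar R} :=
  match d with
  | 0 => [the {sigma_finite_measure set 'rV[R]_0 -> \bar R} of dirac (0 : 'rV[R]_0)]
  | d'.+1 => [the {sigma_finite_measure set 'rV[R]_d'.+1 -> \bar R} of
               lebesgue_row_step (lebesgue_row d')]
  end.

End lebesgue_row.

Section euclidean.
Context {R : realType} {d : nat}.
Local Notation E := 'rV[R]_d.
Implicit Types (x X Y : E) (A B D : set E).

Definition edot x Y : R := \sum_i x ord0 i * Y ord0 i.

Definition enorm x : R := Num.sqrt (edot x x).

Definition eball x (r : R) : set E := [set Y | enorm (Y - x) < r].

Definition eclosed_ball x (r : R) : set E := [set Y | enorm (Y - x) <= r].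

(* The maximum with 0 gives the empty set diameter 0. *)
Definition ediam A : \bar R :=
  maxe 0%E (ereal_sup [set z | exists X Y, [/\ A X, A Y & z = (enorm (X - Y))%:E]]).

Definition edist_set A B : \bar R :=
  ereal_inf [set z | exists X Y, [/\ A X, B Y & z = (enorm (X - Y))%:E]].

Definition boundary A : set E := closure A `\` A°.

Definition delta D X : R := inf [set enorm (X - Y) | Y in boundary D].

(* The s-dimensional Hausdorff measure, without a normalizing constant. *)
Definition hausdorff_pre (s : nat) (e : R) A : \bar R :=
  ereal_inf [set (\sum_(0 <= i <oo) ediam (F i) ^+ s)%E | F in
    [set F : nat -> set E |
      A `<=` \bigcup_i F i /\ forall i, (ediam (F i) <= e%:E)%E]].

Definition hausdorff (s : nat) A : \bar R :=
  ereal_sup [set hausdorff_pre s e A | e in [set e : R | 0 < e]].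

End euclidean.

Section one_sided_cad.
Context {R : realType} {n : nat}.
Local Notation E := 'rV[R]_n.+1.

Definition ADR (C : R) (S : set E) :=
  forall (x : E) (r : R), S x -> 0 < r -> (r%:E < ediam S)%E ->
    ((C^-1 * r ^+ n)%:E <= hausdorff n (S `&` eball x r) <= (C * r ^+ n)%:E)%E.

Definition corkscrew (c0 : R) (D : set E) :=
  forall (x : E) (r : R), boundary D x -> 0 < r ->
    (r%:E < ediam (boundary D))%E ->
    exists X : E, eball X (c0 * r) `<=` eball x r `&` D.

Definition log2p (t : R) : R := Num.max 0 (ln t / ln 2).

(* The balls are eball (c k) (rho k) for 1 <= k <= N. *)
Definition harnack_chain (K1 K2 : R) (D : set E) :=
  forall X X' : E, D X -> D X' ->
  exists (N : nat) (c : nat -> E) (rho : nat -> R),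
    [/\ (1 <= N)%N,
        N%:R <= K1 * (2 + log2p
          (enorm (X - X') / Num.min (delta D X) (delta D X'))),
        eball (c 1%N) (rho 1%N) X /\ eball (c N) (rho N) X',
        (forall k, (1 <= k < N)%N ->
          eball (c k) (rho k) `&` eball (c k.+1) (rho k.+1) !=set0) &
        forall k, (1 <= k <= N)%N ->
          let B := eball (c k) (rho k) in
          [/\ 0 < rho k, B `<=` D,
              (K2^-1%:E * ediam B <= edist_set B (boundary D))%E &
              (edist_set B (boundary D) <= K2%:E * ediam B)%E]].

(* The boundary is required to be nonempty, as is implicit in the use of the
   distance to it. *)
Definition one_sided_CAD (C c0 K1 K2 : R) (D : set E) :=
  [/\ open D, boundary D !=set0, ADR C (boundary D), corkscrew c0 D &
      harnack_chain K1 K2 D].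

End one_sided_cad.

Section weak_solutions.
Context {R : realType} {d : nat}.
Local Notation E := 'rV[R]_d.
Local Notation mu := (@lebesgue_row R d).
Implicit Types (D K : set E) (u f : E -> R) (G : E -> E) (A : E -> 'M[R]_d).

Definition basis_row (i : 'I_d) : E := delta_mx ord0 i.

Definition partial (i : 'I_d) f : E -> R := fun X => 'D_(basis_row i) f X.

Definition smooth f := forall s : seq 'I_d,
  let g := foldr partial f s in
  continuous g /\ forall i X, derivable g X (basis_row i).

Definition test_function D f :=
  let S := closure [set X | f X != 0] in [/\ smooth f, compact S & S `<=` D].

Definition grad f : E -> E := fun X => \row_i partial i f X.

Definition is_weak_grad D u G :=
  [/\ measurable_fun D G,
      (forall K, compact K -> K `<=` D -> forall i,
        mu.-integrable K (fun X => (G X ord0 i)%:E)) &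
      forall f, test_function D f -> forall i,
        (\int[mu]_(X in D) (u X * partial i f X)%:E =
         - \int[mu]_(X in D) (G X ord0 i * f X)%:E)%E].

(* A weak gradient is unique up to a null set: [weak_grad D u] is any one. *)
Definition weak_grad D u : E -> E := xget (fun=> 0) [set G | is_weak_grad D u G].

Definition W12 D u :=
  [/\ measurable_fun D u, (\int[mu]_(X in D) (u X ^+ 2)%:E < +oo)%E,
      is_weak_grad D u (weak_grad D u) &
      (\int[mu]_(X in D) (enorm (weak_grad D u X) ^+ 2)%:E < +oo)%E].

Definition W12loc D u :=
  [/\ measurable_fun D u,
      (forall K, compact K -> K `<=` D ->
        (\int[mu]_(X in K) (u X ^+ 2)%:E < +oo)%E),
      is_weak_grad D u (weak_grad D u) &
      forall K, compact K -> K `<=` D ->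
        (\int[mu]_(X in K) (enorm (weak_grad D u X) ^+ 2)%:E < +oo)%E].

(* The column vector M xi, written as a row. *)
Definition mxact (M : 'M[R]_d) (xi : E) : E := xi *m M^T.

Definition elliptic D (Lambda : R) A :=
  [/\ forall i j, measurable_fun D (fun X => A X i j),
      (exists M : R, {ae mu, forall X, D X -> forall i j, `|A X i j| <= M}) &
      {ae mu, forall X, D X -> forall xi eta : E,
        Lambda^-1 * enorm xi ^+ 2 <= edot (mxact (A X) xi) xi /\
        `|edot (mxact (A X) xi) eta| <= Lambda * enorm xi * enorm eta}].

(* Functions are total; only their values on D matter. The continuity clause
   selects the continuous representative of a weak solution. *)
Definition weak_solution D A u :=
  [/\ W12loc D u,
      (forall f, test_function D f ->
        (\int[mu]_(X in D) (edot (mxact (A X) (weak_grad D u X)) (grad f X))%:E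
         = 0)%E) &
      forall X, D X -> {for X, continuous u}].

Definition DeGiorgi_Nash (Lambda alpha C : R) :=
  forall (x : E) (r : R) A u, let B := eclosed_ball x r in
    let B2 := eball x (2 * r) in
    0 < r -> elliptic B2 Lambda A -> W12 B2 u -> weak_solution B2 A u ->
    (ereal_sup [set `|u X|%:E | X in B] +
     ereal_sup [set z | exists X Y, [/\ B X, B Y, X != Y &
        z = (`|u X - u Y| / (enorm (X - Y) / r) `^ alpha)%:E]]
     <= C%:E * sqrte ((mu B2)^-1 * \int[mu]_(X in B2) (u X ^+ 2)%:E))%E.

End weak_solutions.
Arguments DeGiorgi_Nash {R} d Lambda alpha C.

Section growth.
Context {R : realType}.
Implicit Types (phi : R -> R).

Definition growth_function phi :=
  [/\ forall t, 0 < t -> 0 < phi t,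
      forall s t, 0 < s -> s <= t -> phi s <= phi t &
      phi t @[t --> 0^'+] --> 0].

Definition growth_class (beta C : R) phi :=
  forall t : R, 0 < t ->
   (\int[lebesgue_measure]_(s in `]0%R, t[) (phi s / s)%:E +
    (t `^ beta)%:E *
      \int[lebesgue_measure]_(s in `]t, +oo[) (phi s / s `^ beta / s)%:E
    <= (C * phi t)%:E)%E.

End growth.

Section spaces.
Context {R : realType} {n : nat}.
Local Notation E := 'rV[R]_n.+1.
Local Notation mu := (@lebesgue_row R n.+1).
Implicit Types (D : set E) (u v : E -> R) (phi : R -> R) (A : E -> 'M[R]_n.+1).

Definition holder_norm phi D u : \bar R :=
  ereal_sup [set z | exists X Y, [/\ D X, D Y, X != Y &
    z = (`|u X - u Y| / phi (enorm (X - Y)))%:E]].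

Definition carleson_norm phi D u : \bar R :=
  ereal_sup [set z | exists x r, [/\ boundary D x, 0 < r &
    z = ((phi r)^-1%:E * sqrte ((r ^+ n)^-1%:E *
      \int[mu]_(X in eball x r `&` D)
        (enorm (weak_grad D u X) ^+ 2 * delta D X)%:E))%E]].

Definition holder_space phi D : set (E -> R) :=
  [set u | (holder_norm phi D u < +oo)%E].

Definition carleson_space phi D : set (E -> R) :=
  [set u | W12loc D u /\ (carleson_norm phi D u < +oo)%E].

Definition holder_solutions phi D A : set (E -> R) :=
  [set u | weak_solution D A u] `&` holder_space phi D.

Definition carleson_solutions phi D A : set (E -> R) :=
  [set u | weak_solution D A u] `&` carleson_space phi D.

(* The quotient of a space S of functions on D by the constants is the set of
   classes of its elements. *)
Definition const_class D u : set (E -> R) :=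
  [set v | exists c : R, forall X, D X -> v X = u X + c].

Definition quotient_const D (S : set (E -> R)) : set (set (E -> R)) :=
  const_class D @` S.

Definition quotient_norm (N : (E -> R) -> \bar R) (K : set (E -> R)) : \bar R :=
  ereal_inf (N @` K).

Definition approx_eq (C : R) (a b : \bar R) : Prop :=
  (C^-1%:E * a <= b)%E /\ (b <= C%:E * a)%E.

End spaces.

(* Main.v *)
(* Both inequalities are reduced to Whitney balls B(P, k delta(P)).

   To bound the Holder norm, the Poincare inequality turns the Carleson energy on
   a Whitney ball into a mean oscillation of u, which the De Giorgi/Nash estimate
   makes pointwise: it is of size phi(delta(P)). Points X and Y that are closer to
   each other than to the boundary lie in one such ball, and the Holder exponent
   alpha1 >= beta is what the tail part of the condition on phi requires. If
   t = |X - Y| is larger, X is joined to a point at distance about t from the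
   boundary through corkscrew points at the scales t / 2^k, successive ones being
   linked by boundedly many Harnack balls, and likewise Y; the oscillations
   add up to the sum of the phi(t / 2^k), which the Dini part of the condition on
   phi bounds by a multiple of phi(t).

   Conversely, by the Caccioppoli inequality the energy on a Whitney ball is at
   most a multiple of phi(delta)^2 delta^(n - 1). The regularity of the boundary
   shows that the layer r / 2^(k+1) <= delta < r / 2^k of B(x, r) is covered by at most
   C 2^(k n) Whitney balls, and the contributions phi(r / 2^k)^2 r^n are summed as before. *)

Require Import Defs.
From mathcomp Require Import all_boot all_order all_algebra.
From mathcomp Require Import all_classical all_reals all_analysis.
From mathcomp Require Import measurable_realfun zify ring lra.
Import Order.TTheory GRing.Theory Num.Theory.
Import numFieldNormedType.Exports.
Local Open Scope classical_set_scope.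
Local Open Scope ring_scope.

Set Implicit Arguments.
Unset Strict Implicit.
Unset Printing Implicit Defensive.

(** * Euclidean geometry *)

Section euclid.
Context {R : realType} {d : nat}.
Local Notation E := 'rV[R]_d.
Implicit Types (x y z X Y : E) (A B D : set E).

(** Three features of the definitions shape the argument. [weak_grad] is an arbitrary choice, made
    anew on each set, and [DeGiorgi_Nash] refers to the choice made on its ball; weak gradients are
    therefore shown to be unique almost everywhere on balls before that estimate is applied to a
    solution on [D]. The weak equation admits only smooth test functions, so that Caccioppoli, like
    Poincare, passes through mollifications and their L2 convergence. The regularity and corkscrew
    conditions hold only below the diameter of the boundary, whereas both norms see all scales;
    larger scales get a separate argument in [corkscrew_point] and [boundary_cover].

    The final constant may not depend on the domain: each main estimate therefore first produces its
    constant and only then quantifies over [D], [A], [u] and [phi]. Cubes carry the analysis, since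
    Tonelli and product bumps live on them, and balls carry the geometry; the value of
    [interior_ratio] reconciles the two. *)

Lemma edotC x y : edot x y = edot y x.
Proof. by apply: eq_bigr => i _; rewrite mulrC. Qed.

Lemma edotDl x y z : edot (x + y) z = edot x z + edot y z.
Proof. by rewrite -big_split; apply: eq_bigr => i _; rewrite /= mxE mulrDl. Qed.

Lemma edotZl a x y : edot (a *: x) y = a * edot x y.
Proof. by rewrite mulr_sumr; apply: eq_bigr => i _; rewrite /= mxE mulrA. Qed.

Lemma edotDr x y z : edot x (y + z) = edot x y + edot x z.
Proof. by rewrite ![edot x _]edotC edotDl. Qed.

Lemma edotZr a x y : edot x (a *: y) = a * edot x y.
Proof. by rewrite ![edot x _]edotC edotZl. Qed.

Lemma edot_ge0 x : 0 <= edot x x.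
Proof. by apply: sumr_ge0 => i _; rewrite -expr2 sqr_ge0. Qed.

Lemma enorm_ge0 x : 0 <= enorm x. Proof. exact: sqrtr_ge0. Qed.

Lemma enorm2 x : enorm x ^+ 2 = edot x x.
Proof. by rewrite sqr_sqrtr ?edot_ge0. Qed.

Lemma enorm0 : enorm (0 : E) = 0.
Proof.
rewrite /enorm /edot big1 ?sqrtr0// => i _; by rewrite mxE mul0r.
Qed.

Lemma enormZ a x : enorm (a *: x) = `|a| * enorm x.
Proof.
by rewrite /enorm edotZl edotZr mulrA -expr2 sqrtrM ?sqr_ge0// sqrtr_sqr.
Qed.

Lemma enormN x : enorm (- x) = enorm x.
Proof. by rewrite -scaleN1r enormZ normrN1 mul1r. Qed.

Lemma enormB x y : enorm (x - y) = enorm (y - x).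
Proof. by rewrite -enormN opprB. Qed.

(** The squared length of |y| x - |x| y equals 2 |x| |y| (|x| |y| - x.y); dividing requires the
    cases |x| = 0 and |y| = 0 to be treated apart. *)
Lemma edot_le x y : edot x y <= enorm x * enorm y.
Proof.
have [ny0|ny0] := eqVneq (enorm y) 0.
  have: edot y y = 0 by rewrite -enorm2 ny0 expr0n.
  move/eqP; rewrite psumr_eq0 => [|i _]; last by rewrite -expr2 sqr_ge0.
  move=> /allP y0; rewrite ny0 mulr0 /edot big1// => i _.
  have /(_ (mem_index_enum i)) := y0 i; rewrite -expr2 sqrf_eq0 => /eqP ->.
  by rewrite mulr0.
have ny : 0 < enorm y by rewrite lt_neqAle eq_sym ny0 enorm_ge0.
have := edot_ge0 ((enorm y) *: x + (- enorm x) *: y).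
rewrite !edotDl !edotDr !edotZl !edotZr -!enorm2 (edotC y x) => H.
have [nx0|nx] : enorm x = 0 \/ 0 < enorm x.
  by have := enorm_ge0 x; rewrite le_eqVlt => /orP[/eqP|]; auto.
  have : edot x x = 0 by rewrite -enorm2 nx0 expr0n.
  move/eqP; rewrite psumr_eq0 => [|i _]; last by rewrite -expr2 sqr_ge0.
  move=> /allP y0; rewrite nx0 mul0r /edot big1// => i _.
  have /(_ (mem_index_enum i)) := y0 i; rewrite -expr2 sqrf_eq0 => /eqP ->.
  by rewrite mul0r.
rewrite -subr_ge0 -(@pmulr_rge0 _ (2 * enorm x * enorm y)); last first.
  by rewrite !mulr_gt0.
by apply: le_trans H _; rewrite le_eqVlt; apply/orP; left; apply/eqP; ring.
Qed.

Lemma edot_norm_le x y : `|edot x y| <= enorm x * enorm y.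
Proof.
rewrite ler_norml edot_le andbT lerNl.
by rewrite -[X in X <= _]mulN1r -edotZl scaleN1r -(enormN x) edot_le.
Qed.

Lemma enormD x y : enorm (x + y) <= enorm x + enorm y.
Proof.
rewrite -(@ler_pXn2r _ 2) ?nnegrE ?addr_ge0 ?enorm_ge0// enorm2.
rewrite edotDl !edotDr -!enorm2 (edotC y x).
have := edot_le x y; nra.
Qed.

Lemma enorm_tri y x z : enorm (x - z) <= enorm (x - y) + enorm (y - z).
Proof. by rewrite -[x - z](subrKA y) enormD. Qed.

Lemma coord_le_enorm x i : `|x ord0 i| <= enorm x.
Proof.
rewrite -sqrtr_sqr ler_wsqrtr// /edot (bigD1 i)//= -expr2 lerDl.
by apply: sumr_ge0 => j _; rewrite -expr2 sqr_ge0.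
Qed.

(** The crude factor d, in place of its square root, is the one on which the comparison of cubes
    with balls and [interior_ratio] are calibrated. *)
Lemma enorm_le_coord x a : 0 <= a -> (forall i, `|x ord0 i| <= a) ->
  enorm x <= d%:R * a.
Proof.
move=> a0 H; rewrite -(@ler_pXn2r _ 2) ?nnegrE ?mulr_ge0 ?enorm_ge0 ?ler0n//.
rewrite enorm2 /edot.
apply: (@le_trans _ _ (\sum_(i < d) a ^+ 2)).
  apply: ler_sum => i _; rewrite -expr2 -real_normK ?num_real//.
  by rewrite ler_pXn2r ?nnegrE.
rewrite sumr_const card_ord -[_ *+ _]mulr_natl exprMn ler_wpM2r ?sqr_ge0//.
case: (d) => [|m]; first by rewrite expr0n.
by rewrite expr2 ler_peMl ?ler0n// ler1n.
Qed.

Lemma mxnorm_le_enorm x : `|x| <= enorm x.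
Proof.
rewrite [leLHS]/Num.norm/= mx_normrE; apply/bigmax_leP; split; first exact: enorm_ge0.
by move=> [i j] _ /=; rewrite (ord1 i) coord_le_enorm.
Qed.

Lemma coord_le_mxnorm x i : `|x ord0 i| <= `|x|.
Proof.
rewrite [leRHS]/Num.norm /= mx_normrE; apply/bigmax_geP; right => /=.
by exists (ord0, i).
Qed.

Lemma enorm_le_mxnorm x : enorm x <= d%:R * `|x|.
Proof. by apply: enorm_le_coord => // i; exact: coord_le_mxnorm. Qed.

Lemma enorm_eq0 x : enorm x = 0 -> x = 0.
Proof. by move=> h; apply/normr0_eq0/eqP; rewrite eq_le normr_ge0 andbT -h mxnorm_le_enorm. Qed.

Lemma enorm_gt0 x : x != 0 -> 0 < enorm x.
Proof.
by move=> x0; rewrite lt_neqAle enorm_ge0 andbT eq_sym; apply: contra_neq x0 => /enorm_eq0.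
Qed.

Lemma lipschitz_row_continuous (f : E -> R) (L : R) :
  (forall x y, `|f x - f y| <= L * enorm (x - y)) -> continuous f.
Proof.
move=> H x; apply/(@cvgrPdist_le _ _ _ (nbhs x)) => e e0.
near=> y; rewrite (le_trans (H x y))//.
apply: (@le_trans _ _ ((`|L| + 1) * (d%:R + 1) * `|x - y|)).
  apply: le_trans (ler_wpM2r (enorm_ge0 _) (ler_norm L)) _.
  rewrite -mulrA ler_pM ?enorm_ge0 ?lerDl//.
  by rewrite (le_trans (enorm_le_mxnorm _))// ler_wpM2r// lerDl.
have K0 : 0 < (`|L| + 1) * (d%:R + 1) by rewrite mulr_gt0 // ltr_wpDl// ler0n.
rewrite -ler_pdivlMl// mulrC; near: y.
apply: (@cvgr_dist_le _ _ _ (nbhs x) _ id x) => //.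
by rewrite divr_gt0.
Unshelve. all: by end_near. Qed.

Lemma enorm_lip x y : `|enorm x - enorm y| <= enorm (x - y).
Proof.
rewrite ler_norml lerBlDr lerNl opprB lerBlDr; apply/andP; split.
  by rewrite enormB -{1}(subrK x y) enormD.
by rewrite -{1}(subrK y x) enormD.
Qed.

Lemma enormB_lip x y z : `|enorm (x - z) - enorm (y - z)| <= enorm (x - y).
Proof. by apply: le_trans (enorm_lip _ _) _; rewrite opprB addrA subrK. Qed.

Lemma continuous_enormB z : continuous (fun x => enorm (x - z)).
Proof.
by apply: (@lipschitz_row_continuous _ 1) => x y; rewrite mul1r enormB_lip.
Qed.

Lemma eball_open x r : open (eball x r).
Proof.
have -> : eball x r = (fun y => enorm (y - x)) @^-1` [set t | t < r] by [].
by apply: open_comp => [y _|]; [exact: continuous_enormB|exact: open_lt].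
Qed.

Lemma eclosed_ball_closed x r : closed (eclosed_ball x r).
Proof.
have -> : eclosed_ball x r = (fun y => enorm (y - x)) @^-1` [set t | t <= r] by [].
by apply: closed_comp => [y _|]; [exact: continuous_enormB|exact: closed_le].
Qed.

Lemma eclosed_ball_compact x r : compact (eclosed_ball x r).
Proof.
apply: bounded_closed_compact; last exact: eclosed_ball_closed.
exists (`|x| + r); split; first exact: num_real.
move=> M xM y /= yx; apply: le_trans (ltW xM).
rewrite -[y](subrK x) addrC (le_trans (ler_normD _ _))// lerD2l.
exact: le_trans (mxnorm_le_enorm _) yx.
Qed.

Lemma eballS x r s : r <= s -> eball x r `<=` eball x s.
Proof. by move=> rs y /lt_le_trans; apply. Qed.

Lemma eball_closed_ball x r : eball x r `<=` eclosed_ball x r.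
Proof. by move=> y /ltW. Qed.

Lemma eclosed_ball_eball x r s : r < s -> eclosed_ball x r `<=` eball x s.
Proof. by move=> rs y /le_lt_trans; apply. Qed.

(** Cubes are products of intervals: their measure, Tonelli on them and the supports of product
    bumps are explicit. *)
Definition cube x (r : R) : set E := [set y | forall i, `|y ord0 i - x ord0 i| < r].

Lemma eball_cube x r : eball x r `<=` cube x r.
Proof.
move=> y yx i; apply: le_lt_trans yx.
by have := coord_le_enorm (y - x) i; rewrite !mxE.
Qed.

Lemma cube_eclosed_ball x r : 0 <= r -> cube x r `<=` eclosed_ball x (d%:R * r).
Proof.
by move=> r0 y yx; apply: enorm_le_coord => // i; rewrite !mxE ltW.
Qed.

Lemma cubeS x r s : r <= s -> cube x r `<=` cube x s.
Proof. by move=> rs y h i; apply: lt_le_trans (h i) rs. Qed.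

Lemma nbhs_eball x A : nbhs x A -> exists2 r, 0 < r & eball x r `<=` A.
Proof.
move=> /nbhs_ballP[r /= r0 rA]; exists r => // y yx; apply: rA.
rewrite -ball_normE /= -opprB normrN.
exact: le_lt_trans (mxnorm_le_enorm _) yx.
Qed.

Lemma open_eball A x : open A -> A x -> exists2 r, 0 < r & eball x r `<=` A.
Proof. by move=> oA Ax; apply: nbhs_eball; exact: open_nbhs_nbhs. Qed.

Lemma eball_nbhs x r : 0 < r -> nbhs x (eball x r).
Proof.
move=> r0; apply: open_nbhs_nbhs; split; first exact: eball_open.
by rewrite /eball /= subrr enorm0.
Qed.

Lemma closure_eball A x : closure A x <-> forall r, 0 < r -> exists2 y, A y & enorm (y - x) < r.
Proof.
split => [cA r r0|H B /nbhs_eball[r r0 rB]].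
  by have [y [Ay yr]] := cA _ (eball_nbhs x r0); exists y.
by have [y Ay yr] := H r r0; exists y; split => //; exact: rB.
Qed.

End euclid.

(** * Distance to the boundary *)

Section dist_boundary.
Context {R : realType} {d : nat}.
Local Notation E := 'rV[R]_d.
Variable D : set E.
Hypothesis (oD : open D) (bD : boundary D !=set0).
Implicit Types (x y X Y : E).

Lemma boundary_notin x : boundary D x -> ~ D x.
Proof. by move=> [_ +] Dx; apply; rewrite (interior_id _).1. Qed.

Let delta_has_inf X : has_inf [set enorm (X - Y) | Y in boundary D].
Proof.
split; first by have [b Db] := bD; exists (enorm (X - b)), b.
by exists 0 => _ [y _ <-]; exact: enorm_ge0.
Qed.

Lemma delta_le X y : boundary D y -> delta D X <= enorm (X - y).
Proof. by move=> by_; apply: inf_lbound; [exact: (delta_has_inf X).2|exists y]. Qed.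

Lemma delta_ge X r : (forall y, boundary D y -> r <= enorm (X - y)) -> r <= delta D X.
Proof.
by move=> h; apply: lb_le_inf; [exact: (delta_has_inf X).1|move=> _ [y by_ <-]; exact: h].
Qed.

Lemma delta_lt X r : delta D X < r -> exists2 y, boundary D y & enorm (X - y) < r.
Proof.
move=> h; have [|_ [y by_ <-] yr] := @inf_adherent _ _ (r - delta D X) _ (delta_has_inf X).
  by rewrite subr_gt0.
by exists y => //; move: yr; rewrite -/(delta D X) => yr; lra.
Qed.

Lemma delta_ge0 X : 0 <= delta D X.
Proof. by apply: delta_ge => y _; exact: enorm_ge0. Qed.

Lemma delta_lipD X Y : delta D X <= delta D Y + enorm (X - Y).
Proof.
rewrite -lerBlDr; apply: delta_ge => y by_; rewrite lerBlDr.
by rewrite (le_trans (delta_le X by_))// [leRHS]addrC enorm_tri.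
Qed.

Lemma delta_lip X Y : `|delta D X - delta D Y| <= enorm (X - Y).
Proof.
rewrite ler_norml lerBlDl delta_lipD andbT lerNl opprB lerBlDl enormB.
exact: delta_lipD.
Qed.

Lemma delta_gt0 X : D X -> 0 < delta D X.
Proof.
move=> DX; have [r r0 rD] := open_eball oD DX.
apply: lt_le_trans r0 _; apply: delta_ge => y by_; rewrite leNgt; apply/negP => yr.
by apply: (boundary_notin by_); apply: rD; rewrite /eball /= enormB.
Qed.

(* The last point of the segment from X which stays in D would be a boundary point. *)
Lemma segment_boundary X Y : D X -> ~ D Y ->
  exists2 t, 0 <= t <= 1 & boundary D (X + t *: (Y - X)).
Proof.
move=> DX nDY; pose p t := X + t *: (Y - X).
have pB s t : enorm (p s - p t) = `|s - t| * enorm (Y - X).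
  have -> : p s - p t = (s - t) *: (Y - X) by rewrite /p [in RHS]scalerBl opprD addrACA subrr add0r.
  by rewrite enormZ.
pose S := [set t | 0 <= t <= 1 /\ D (p t)].
have S0 : S 0 by split; rewrite ?lexx ?ler01// /p scale0r addr0.
have Sub : has_sup S by split; [exists 0|exists 1 => t [/andP[]]].
pose T := sup S.
have T0 : 0 <= T by apply: sup_ubound => //; exact: Sub.2.
have T1 : T <= 1 by apply: ge_sup; [exists 0|move=> t [/andP[]]].
exists T; first by rewrite T0 T1.
have XY : 0 < enorm (Y - X).
  by apply: enorm_gt0; rewrite subr_eq0; apply/eqP => YX; apply: nDY; rewrite YX.
split.
  apply/closure_eball => r r0.
  have [|t St Tt] := @sup_adherent _ S (r / enorm (Y - X)) _ Sub; first exact: divr_gt0.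
  have tT : t <= T by apply: sup_ubound => //; exact: Sub.2.
  exists (p t); first by case: St.
  rewrite pB ler0_norm ?subr_le0// opprB -ltr_pdivlMr// ltrBlDr.
  by rewrite -ltrBlDl.
rewrite (interior_id _).1// => DT.
have [r r0 rD] := open_eball oD DT.
have [T1'|T1'] := eqVneq T 1.
  apply: nDY; have -> : Y = p T by rewrite /p T1' scale1r addrC subrK.
  by [].
have T1'' : T < 1 by rewrite lt_neqAle T1' T1.
pose t := Num.min 1 (T + r / enorm (Y - X) / 2).
have Tt : T < t by rewrite lt_min T1'' ltrDl !divr_gt0.
suff : t <= T by rewrite leNgt Tt.
apply: sup_ubound; first exact: Sub.2.
split; first by rewrite (le_trans T0 (ltW Tt)) ge_min lexx.
apply: rD; rewrite /eball /= pB gtr0_norm ?subr_gt0// -ltr_pdivlMr// ltrBlDl.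
rewrite /t gt_min; apply/orP; right; rewrite ltrD2l ltr_pdivrMr//.
by rewrite ltr_pMr ?divr_gt0// ltr1n.
Qed.

(** A point of the ball outside D would, by [segment_boundary], put a boundary point closer to X
    than [delta D X]. *)
Lemma eball_delta_sub X r : D X -> r <= delta D X -> eball X r `<=` D.
Proof.
move=> DX rd Y YX; apply: contrapT => nDY.
have [t /andP[t0 t1] bt] := segment_boundary DX nDY.
have := delta_le X bt; rewrite opprD addNKr enormN enormZ ger0_norm//.
move=> /(le_trans rd); rewrite leNgt; apply/negP; rewrite negbK.
by apply: le_lt_trans YX; rewrite ler_piMl ?enorm_ge0.
Qed.

End dist_boundary.

(** * Lebesgue measure on R^d *)

Section row_measurability.
Context {R : realType} {d : nat}.
Local Notation E := 'rV[R]_d.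

Lemma cube_measurable (x : E) r : measurable (cube x r).
Proof.
have -> : cube x r = \bigcap_(i in [set: 'I_d])
    ((fun y : E => y ord0 i) @^-1` [set t | `|t - x ord0 i| < r]).
  apply/seteqP; split => y /= H i; first by move=> _; exact: H.
  by apply: H.
apply: fin_bigcap_measurable => // i _.
rewrite -[X in measurable X]setTI; apply: (@measurable_row_coord R d i) => //.
apply: open_measurable.
have -> : [set t : R | `|t - x ord0 i| < r] = (fun t => `|t - x ord0 i|) @^-1` [set t | t < r] by [].
apply: open_comp => [t _|]; last exact: open_lt.
by apply: cvg_norm; apply: cvgB; [exact: cvg_id|exact: cvg_cst].
Qed.

(** The sigma-algebra is generated by the coordinates. An open set is recovered as the union of the
    countably many rational cubes inside it: a cube of half-side 1/(N+1) whose centre is that close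
    to x stays within 2d/(N+1) of x. *)
Lemma open_measurable_row (A : set E) : open A -> measurable A.
Proof.
move=> oA.
pose q (p : 'rV[rat]_d * nat) : set E := cube (map_mx ratr p.1) (p.2.+1%:R^-1).
have -> : A = \bigcup_p (if `[< q p `<=` A >] then q p else set0).
  apply/seteqP; split => [x Ax|x [p _]]; last by case: asboolP => // pA; exact: pA.
  have [r r0 rA] := open_eball oA Ax.
  have [N Nr] : exists N, d%:R * (2 * N.+1%:R^-1) < r.
    have [N] := @ltr_add_invr R 0 (r / (2 * d.+1%:R)) ltac:(by rewrite divr_gt0// mulr_gt0).
    rewrite add0r ltr_pdivlMr ?mulr_gt0// => H; exists N; apply: le_lt_trans H.
    rewrite mulrCA [leRHS]mulrC -mulrA ler_wpM2l// ler_wpM2r ?invr_ge0// ler_nat.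
    exact: leqnSn.
  have N0 : 0 < N.+1%:R^-1 :> R by rewrite invr_gt0.
  have /choice[p Hp] : forall i, exists q, `|x ord0 i - ratr q| < N.+1%:R^-1.
    move=> i.
    have [q0] := @rat_in_itvoo R (x ord0 i - N.+1%:R^-1) (x ord0 i + N.+1%:R^-1) ltac:(by rewrite ltrBlDr -addrA ltrDl addr_gt0).
    by rewrite in_itv /= => /andP[h1 h2]; exists q0; rewrite distrC ltr_distl h1 h2.
  exists (\row_i p i, N) => //; case: asboolP => [_|[]].
    by move=> i /=; rewrite !mxE.
  move=> y yq; apply: rA; apply: le_lt_trans Nr; apply: enorm_le_coord.
    by rewrite mulr_ge0// ltW.
  move=> i; have := yq i; have := Hp i; rewrite /= !mxE => h1 h2.
  apply: le_trans (ler_distD (ratr (p i)) _ _) _.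
  by rewrite mulr_natl mulr2n lerD ?(ltW h2)// distrC (ltW h1).
apply: countable_bigcupT_measurable; first exact: countableP.
by move=> p; case: asboolP => // _; exact: cube_measurable.
Qed.

Lemma closed_measurable_row (A : set E) : closed A -> measurable A.
Proof. by move=> /closed_openC/open_measurable_row/measurableC; rewrite setCK. Qed.

Lemma continuous_measurable_row (f : E -> R) : continuous f ->
  measurable_fun setT (f : E -> measurableTypeR R).
Proof.
move=> cf; apply: (measurability (@RGenOpens.G R)).
  exact: RGenOpens.measurableE.
move=> _ [_ [a [b ->] <-]]; rewrite setTI; apply: open_measurable_row.
apply: open_comp => // *; exact: cf.
Qed.

End row_measurability.

(** * Tonelli and affine changes of variables *)

Section row_tonelli.
Context {R : realType}.
Local Notation mu d := (@lebesgue_row R d).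
Local Open Scope ereal_scope.

Lemma ge0_integral_rowS d (f : 'rV[R]_d.+1 -> \bar R) :
  measurable_fun setT f -> (forall x, 0 <= f x) ->
  \int[mu d.+1]_x f x =
  \int[lebesgue_measure]_t \int[mu d]_x f (row_cons (t, x)).
Proof.
move=> mf f0.
have mc := @measurable_row_cons R d.
transitivity (\int[(lebesgue_measure \x mu d)]_p f (row_cons p)).
  by rewrite [LHS](ge0_integral_pushforward mc).
by rewrite fubini_tonelli1//; apply: measurableT_comp.
Qed.

Lemma measurable_row_cons2 d (t : R) : measurable_fun setT (fun x : 'rV[R]_d => row_cons (t, x)).
Proof.
apply: measurableT_comp; first exact: measurable_row_cons.
exact: measurable_fun_pair.
Qed.

Lemma measurable_row_tonelli d (f : 'rV[R]_d.+1 -> \bar R) :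
  measurable_fun setT f -> (forall x, 0 <= f x) ->
  measurable_fun setT (fun t => \int[mu d]_x f (row_cons (t, x))).
Proof.
move=> mf f0.
apply: (@measurable_fun_fubini_tonelli_F _ _ _ _ _ (mu d) (f \o @row_cons R d)) => //.
  by apply: measurableT_comp => //; exact: measurable_row_cons.
by move=> p; exact: f0.
Qed.

(** By uniqueness of Lebesgue measure: a times its image under x -> a x + b gives every interval its
    length. *)
Lemma ge0_integral_affine1_gt0 (a b : R) (f : R -> \bar R) : (0 < a)%R ->
  measurable_fun setT f -> (forall x, 0 <= f x) ->
  \int[lebesgue_measure]_x f x =
  a%:E * \int[lebesgue_measure]_x f (a * x + b)%R.
Proof.
move=> a0 mf f0.
have mphi : measurable_fun setT (fun x : measurableTypeR R => (a * x + b)%R : measurableTypeR R).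
  apply: measurable_funD => //; exact: measurable_funM.
have na : (0 <= a)%R by exact: ltW.
pose nu := mscale (NngNum na)
  (measure_function_pushforward__canonical__measure_function_Measure (@lebesgue_measure R) mphi).
have H : forall A, measurable A -> lebesgue_measure A = nu A.
  apply: (@lebesgue_measure_unique R nu) => _ [[u v] _ <-] /=.
  rewrite /nu /mscale /pushforward /=.
  rewrite [X in _ = _ * X](_ : _ = lebesgue_measure [set` `](u - b) / a, (v - b) / a]]%R); last first.
    congr lebesgue_measure.
    apply/seteqP; split => x /=; rewrite !in_itv /= ltr_pdivrMr// ler_pdivlMr// => /andP[? ?];
    by apply/andP; split; lra.
  rewrite [LHS]lebesgue_measure_itv [in RHS]lebesgue_measure_itv /= !lte_fin.
  rewrite ltr_pM2r ?invr_gt0// ltrBlDr subrK; case: ifPn => _; last by rewrite mule0.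
  by rewrite -!EFinB -EFinM; congr EFin; field; rewrite gt_eqF.
rewrite [LHS](@eq_measure_integral _ _ _ _ nu); last by move=> A mA _; exact: H.
rewrite (ge0_integral_mscale _ measurableT)//=; congr (_ * _).
by rewrite [LHS](ge0_integral_pushforward mphi).
Qed.

Lemma ge0_integralN1 (f : R -> \bar R) :
  measurable_fun setT f -> (forall x, 0 <= f x) ->
  \int[lebesgue_measure]_x f x = \int[lebesgue_measure]_x f (- x)%R.
Proof.
move=> mf f0.
have mphi : measurable_fun setT (fun x : measurableTypeR R => (- x)%R : measurableTypeR R) by exact: oppr_measurable.
rewrite [RHS](_ : _ = \int[pushforward lebesgue_measure (fun x : measurableTypeR R => (- x)%R : measurableTypeR R)]_x f x); last first.
  by rewrite [RHS](ge0_integral_pushforward mphi).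
apply: eq_measure_integral => A mA _; apply/esym.
exact: lebesgue_measureN.
Qed.

Lemma ge0_integral_affine1 (a b : R) (f : R -> \bar R) : a != 0%R ->
  measurable_fun setT f -> (forall x, 0 <= f x) ->
  \int[lebesgue_measure]_x f x =
  (`|a|)%:E * \int[lebesgue_measure]_x f (a * x + b)%R.
Proof.
move=> a0 mf f0; have [a1|a1|a1] := ltgtP a 0%R; last by rewrite a1 eqxx in a0.
  rewrite (ltr0_norm a1) (@ge0_integral_affine1_gt0 (- a)%R b)//; last by rewrite oppr_gt0.
  congr (_ * _); rewrite [LHS]ge0_integralN1//; last first.
    apply: measurableT_comp => //; apply: measurable_funD => //; exact: measurable_funM.
  by apply: eq_integral => x _; rewrite mulrNN.
by rewrite (gtr0_norm a1) (@ge0_integral_affine1_gt0 a b).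
Qed.

Lemma measurable_row_affine d (a : R) (b : 'rV[R]_d) :
  measurable_fun setT (fun x : 'rV[R]_d => (a *: x + b)%R).
Proof.
apply: measurable_fun_row => i.
under eq_fun do rewrite !mxE.
apply: measurable_funD => //; apply: measurable_funM => //.
exact: measurable_row_coord.
Qed.

(** Induction on d through Tonelli. The cases a = 1 and a = -1 are the translations and reflections
    that convolution requires. *)
Lemma ge0_integral_row_affine d (a : R) (b : 'rV[R]_d) (f : 'rV[R]_d -> \bar R) : a != 0%R ->
  measurable_fun setT f -> (forall x, 0 <= f x) ->
  \int[mu d]_x f x = (`|a| ^+ d)%:E * \int[mu d]_x f (a *: x + b)%R.
Proof.
move=> a0; elim: d b f => [|d IH] b f mf f0.
  by rewrite expr0 mul1e; apply: eq_integral => x _; congr f; apply/rowP => -[].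
have mg : measurable_fun setT (fun x : 'rV[R]_d.+1 => f (a *: x + b)%R).
  by apply: measurableT_comp => //; exact: measurable_row_affine.
rewrite ge0_integral_rowS// [in RHS]ge0_integral_rowS//.
pose b' : 'rV[R]_d := (\row_i b ord0 (lift ord0 i))%R.
have e t x : (a *: row_cons (t, x) + b = row_cons (a * t + b ord0 ord0, a *: x + b'))%R.
  apply/rowP => i; rewrite !mxE /=; case: unliftP => [j ->|->] /=; last by [].
  by rewrite !mxE.
rewrite (@ge0_integral_affine1 a (b ord0 ord0) (fun t => \int[mu d]_x f (row_cons (t, x)))); last 3 first.
- exact: a0.
- exact: measurable_row_tonelli.
- by move=> t; apply: integral_ge0.
rewrite exprS EFinM -muleA; congr (_ * _).
rewrite -ge0_integralZl//; first last.
- by move=> t _; exact: integral_ge0.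
- by apply: (@measurable_row_tonelli _ (fun x => f (a *: x + b)%R)) => //.
apply: eq_integral => t _.
rewrite (IH b') //; last first.
  by apply: measurableT_comp => //; exact: measurable_row_cons2.
by congr (_ * _); apply: eq_integral => x _; rewrite e.
Qed.

Lemma ge0_integral_row_shift d (b : 'rV[R]_d) (f : 'rV[R]_d -> \bar R) :
  measurable_fun setT f -> (forall x, 0 <= f x) ->
  \int[mu d]_x f (x - b)%R = \int[mu d]_x f x.
Proof.
move=> mf f0; rewrite (@ge0_integral_row_affine _ 1%R (- b)%R f)// normr1 expr1n mul1e.
by under [RHS]eq_integral do rewrite scale1r.
Qed.

Lemma ge0_integral_row_reflect d (b : 'rV[R]_d) (f : 'rV[R]_d -> \bar R) :
  measurable_fun setT f -> (forall x, 0 <= f x) ->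
  \int[mu d]_x f (b - x)%R = \int[mu d]_x f x.
Proof.
move=> mf f0; rewrite (@ge0_integral_row_affine _ (-1)%R b f)// ?oppr_eq0 ?oner_eq0//.
rewrite normrN1 expr1n mul1e.
by under [RHS]eq_integral do rewrite scaleN1r addrC.
Qed.

Lemma cube_row_cons d (x : 'rV[R]_d.+1) r t (y : 'rV[R]_d) :
  cube x r (row_cons (t, y)) <->
  (`|t - x ord0 ord0| < r)%R /\ cube (\row_i x ord0 (lift ord0 i))%R r y.
Proof.
split=> [h|[h1 h2] i].
  split; first by have := h ord0; rewrite mxE unlift_none.
  by move=> i; have := h (lift ord0 i); rewrite !mxE liftK.
rewrite mxE; case: unliftP => [j ->|->] //=.
by have := h2 j; rewrite mxE.
Qed.

Lemma lebesgue_row_cube d (x : 'rV[R]_d) r : (0 < r)%R ->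
  mu d (cube x r) = ((2 * r) ^+ d)%:E.
Proof.
move=> r0; elim: d x => [|d IH] x.
  rewrite expr0 /= diracE mem_set// => -[].
  by move=> i; case.
rewrite -[cube x r]setIT -integral_indic//; last exact: cube_measurable.
rewrite ge0_integral_rowS//; last first.
  by apply/measurable_EFinP; apply: measurable_indic; exact: cube_measurable.
pose x' : 'rV[R]_d := (\row_i x ord0 (lift ord0 i))%R.
transitivity (\int[lebesgue_measure]_t (((2 * r) ^+ d)%:E * (\1_(ball (x ord0 ord0) r) t)%:E)).
  apply: eq_integral => t _; rewrite -(IH x') -[cube x' r]setIT -integral_indic//; last exact: cube_measurable.
  have -> : \1_(ball (x ord0 ord0) r) t = (`|t - x ord0 ord0| < r)%R%:R%R :> R.
    rewrite indicE; congr ((nat_of_bool _)%:R)%R; apply/idP/idP; rewrite -ball_normE /= ?inE /= distrC//.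
  case: ltP => h.
    rewrite mule1; apply: eq_integral => y _; rewrite !indicE; congr ((nat_of_bool _)%:R%:E).
    apply/idP/idP; rewrite !inE; first by move=> /cube_row_cons[].
    by move=> ?; apply/cube_row_cons.
  rewrite mule0 integral0_eq// => y _; rewrite indicE memNset// => /cube_row_cons[h1 _].
  by have := le_lt_trans h h1; rewrite ltxx.
rewrite ge0_integralZl//; last first.
- by rewrite lee_fin exprn_ge0// mulr_ge0// ltW.
- by apply/measurable_EFinP; apply: measurable_indic; exact: measurable_ball.
rewrite integral_indic//; last exact: measurable_ball.
rewrite setIT [X in _ * X](lebesgue_measure_ball (x ord0 ord0) (ltW r0)).
by rewrite exprSr EFinM mulr_natl.
Qed.

Lemma lebesgue_row_eball_le d (x : 'rV[R]_d) r : (0 < r)%R ->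
  mu d (eball x r) <= ((2 * r) ^+ d)%:E.
Proof.
move=> r0; rewrite -(lebesgue_row_cube x r0); apply: le_measure; rewrite ?inE.
- by apply: open_measurable_row; exact: eball_open.
- exact: cube_measurable.
- exact: eball_cube.
Qed.

(** The inner cube has half-side r / (d + 1): [cube_eclosed_ball] puts it into a closed ball of
    radius d r / (d + 1), which is strictly less than r. *)
Lemma lebesgue_row_eball_ge d (x : 'rV[R]_d) r : (0 < r)%R ->
  ((2 * (r / d.+1%:R)) ^+ d)%:E <= mu d (eball x r).
Proof.
move=> r0; rewrite -(lebesgue_row_cube x) ?divr_gt0//; apply: le_measure; rewrite ?inE.
- exact: cube_measurable.
- by apply: open_measurable_row; exact: eball_open.
- move=> y /cube_eclosed_ball h; apply: le_lt_trans (h _) _; first by rewrite divr_ge0// ltW.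
  by rewrite mulrA ltr_pdivrMr// mulrC ltr_pM2l// ltr_nat.
Qed.

End row_tonelli.

(** * Smooth bumps and convolution *)

Section flat_bumps.
Context {R : realType}.

(** A quadratic Taylor remainder is a criterion for derivatives that survives integration against a
    function, as in [conv_is_derive]. *)
Lemma is_derive_quadratic (V : normedModType R) (f : V -> R) (a v : V) (l C : R) :
  (forall h : R, `|f (h *: v + a) - f a - h * l| <= C * h ^+ 2) -> is_derive a v f l.
Proof.
move=> H.
have lim : (fun h : R => h^-1 *: ((f \o shift a) (h *: v) - f a)) @ 0^' --> l.
  apply/(@cvgrPdist_le _ _ _ (0^')) => e e0.
  near=> h.
  have h0 : h != 0 by near: h; exact: nbhs_dnbhs_neq.
  rewrite /= distrC.
  have -> : h^-1 *: (f (h *: v + a) - f a) - l = h^-1 * (f (h *: v + a) - f a - h * l).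
    by rewrite [h^-1 *: _]/(h^-1 * _) mulrBr mulKf.
  rewrite normrM normfV ler_pdivrMl ?normr_gt0//.
  apply: le_trans (H h) _; rewrite -(real_normK (num_real h)) expr2 mulrA mulrC ler_wpM2l//.
  apply: (@le_trans _ _ ((`|C| + 1) * `|h|)).
    by rewrite ler_wpM2r// (le_trans (ler_norm _))// lerDl.
  have C0 : 0 < `|C| + 1 by rewrite ltr_wpDl.
  rewrite -ler_pdivlMl// mulrC.
  near: h; apply: dnbhs0_le; exact: divr_gt0.
split; first by apply/cvg_ex; exists l.
exact/cvg_lim.
Unshelve. all: by end_near. Qed.

(** For p = 1 this is the classical function exp(-1/t), flat at 0. Polynomial factors make the
    family closed under derivation: p is sent to X^2 (p - p'). *)
Definition flat (p : {poly R}) (t : R) : R :=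
  if 0 < t then p.[t^-1] * expR (- t^-1) else 0.

Lemma poly_expR_bounded (p : {poly R}) :
  exists2 M, 0 <= M & forall y, 0 < y -> `|p.[y] * expR (- y)| <= M.
Proof.
(* exp(y / k) is at least y / k; raise this to the power k. *)
have powk (k : nat) (y : R) : 0 < y -> y ^+ k * expR (- y) <= k%:R ^+ k.
  move=> y0; rewrite expRN -ler_pdivlMr ?invr_gt0 ?expR_gt0// invrK.
  case: k => [|k]; first by rewrite !expr0 mul1r -expR0 ler_expR ltW.
  have k0 : 0 < k.+1%:R :> R by [].
  have -> : y = (y / k.+1%:R) * k.+1%:R by rewrite divfK ?gt_eqF.
  rewrite expRM_natr exprMn mulrC ler_pM2l ?exprn_gt0//.
  apply: lerXn2r; rewrite ?nnegrE ?expR_ge0 ?divr_ge0 ?ltW//.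
  by apply: lt_le_trans (expR_ge1Dx _); rewrite ltrDr.
exists (\sum_(i < size p) `|p`_i| * i%:R ^+ i).
  by apply: sumr_ge0 => i _; rewrite mulr_ge0// exprn_ge0.
move=> y y0; rewrite horner_coef mulr_suml (le_trans (ler_norm_sum _ _ _))//.
apply: ler_sum => i _; rewrite -mulrA normrM ler_wpM2l// ger0_norm ?powk//.
by rewrite mulr_ge0 ?expR_ge0// exprn_ge0// ltW.
Qed.

Lemma flat_bounded p : exists M, forall t, `|flat p t| <= M.
Proof.
have [M M0 H] := poly_expR_bounded p.
exists M => t; rewrite /flat; case: ifPn => t0; last by rewrite normr0.
by apply: H; rewrite invr_gt0.
Qed.

Lemma flat_derive p (t : R) : is_derive t (1 : R) (flat p) (flat ('X^2 * (p - p^`())) t).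
Proof.
have [t0|t0|<-] := ltgtP 0 t.
- have e : \near t, p.[t^-1] * expR (- t^-1) = flat p t.
    near=> s; rewrite /flat ifT//; near: s; exact: lt_nbhsr.
  apply: near_eq_is_derive e _.
  have t0' : t != 0 by rewrite gt_eqF.
  have dV : is_derive t 1 (fun s : R => s^-1) (- t ^- 2 *: 1).
    exact: (@is_deriveV _ id t _ _ t0').
  have d1 := @is_derive1_comp _ (horner p) _ _ _ _ (is_derive_poly p t^-1) dV.
  have d2 := @is_derive1_comp _ expR (fun s => - s^-1) t _ _ (is_derive_expR (- t^-1)) (is_deriveN dV).
  apply: (is_derive_eq (is_deriveM d1 d2)).
  rewrite /flat t0 !hornerE /= /GRing.scale /=.
  by field.
- have e : \near t, 0 = flat p t.
    near=> s; rewrite /flat ifF//; apply/negbTE; rewrite -leNgt ltW//.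
    near: s; exact: lt_nbhsl.
  apply: near_eq_is_derive e _.
  by rewrite /flat ifF; [exact: is_derive_cst|apply/negbTE; rewrite -leNgt ltW].
(* At the origin, boundedness of y^2 p(y) exp(-y) read at y = 1/h says that |flat p h| is at most M
   h^2. *)
- have [M M0 H] := poly_expR_bounded ('X^2 * p).
  apply: (@is_derive_quadratic _ _ _ _ _ M) => h.
  rewrite /flat ltxx subr0 mulr0 subr0 addr0 [h *: 1]mulr1.
  case: ifPn => h0; last by rewrite normr0 mulr_ge0// sqr_ge0.
  have := H h^-1; rewrite invr_gt0 => /(_ h0).
  rewrite hornerM hornerXn -mulrA normrM ger0_norm ?sqr_ge0//.
  by rewrite exprVn ler_pdivrMl ?exprn_gt0// [h ^+ 2 * M]mulrC.
Unshelve. all: by end_near. Qed.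

(** A syntactic class of bounded functions closed under derivation, so that bounds on all
    derivatives come by induction instead of by computation. *)
Inductive nice : (R -> R) -> Prop :=
| nice_flat p : nice (flat p)
| nice_cst c : nice (cst c)
| nice_add f g : nice f -> nice g -> nice (fun t => f t + g t)
| nice_mul f g : nice f -> nice g -> nice (fun t => f t * g t)
| nice_affine f a b : nice f -> nice (fun t => f (a * t + b)).

Lemma nice_bounded f : nice f -> exists M, forall t, `|f t| <= M.
Proof.
elim=> [p|c|{}f g _ [M HM] _ [N HN]|{}f g _ [M HM] _ [N HN]|{}f a b _ [M HM]].
- exact: flat_bounded.
- by exists `|c|.
- by exists (M + N) => t; rewrite (le_trans (ler_normD _ _))// lerD.
- by exists (M * N) => t; rewrite normrM ler_pM.
- by exists M.
Qed.

Lemma nice_derive f : nice f -> exists2 g, nice g & forall t : R, is_derive t (1 : R) f (g t).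
Proof.
elim=> [p|c|{}f g nf [f' nf' Hf] ng [g' ng' Hg]|{}f g nf [f' nf' Hf] ng [g' ng' Hg]|{}f a b nf [f' nf' Hf]].
- exists (flat ('X^2 * (p - p^`()))); [exact: nice_flat|exact: flat_derive].
- by exists (cst 0); [exact: nice_cst|move=> t; exact: is_derive_cst].
- exists (fun t => f' t + g' t); first exact: nice_add.
  by move=> t; exact: is_deriveD.
- exists (fun t => f t * g' t + g t * f' t).
    by apply: nice_add; apply: nice_mul.
  by move=> t; exact: is_deriveM.
- exists (fun t => f' (a * t + b) * a).
    by apply: nice_mul; [exact: nice_affine|exact: (nice_cst a)].
  move=> t; have dg : is_derive t (1 : R) (fun t => a * t + b) a.
    apply: (@is_derive_quadratic _ _ _ _ _ 0) => h.
    by rewrite [h *: 1]mulr1 mulrDr mul0r normr_le0; apply/eqP; ring.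
  exact: (is_derive1_comp (Hf _) dg).
Qed.

Lemma derive_continuous (f g : R -> R) : (forall t : R, is_derive t (1 : R) f (g t)) -> continuous f.
Proof. by move=> H t; apply: differentiable_continuous; apply/derivable1_diffP; case: (H t). Qed.

Lemma MVT_bound (f g : R -> R) M : (forall t : R, is_derive t (1 : R) f (g t)) ->
  (forall t, `|g t| <= M) -> forall s t, `|f s - f t| <= M * `|s - t|.
Proof.
move=> H HM.
have cf (a b : R) : {within `[a, b], continuous f}.
  by apply: continuous_subspaceT; exact: derive_continuous H.
have le s t : s <= t -> `|f t - f s| <= M * `|t - s|.
  move=> st; have [c _ ->] := @MVT_segment _ f g s t st (fun x _ => H x) (cf s t).
  by rewrite normrM ler_wpM2r.
by move=> s t; case: (leP s t) => [/le|/ltW/le] //; rewrite distrC [`|t - s|]distrC.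
Qed.

Lemma taylor_bound (f g h : R -> R) M : (forall t : R, is_derive t (1 : R) f (g t)) ->
  (forall t : R, is_derive t (1 : R) g (h t)) -> (forall t, `|h t| <= M) ->
  forall t e, `|f (e + t) - f t - e * g t| <= M * e ^+ 2.
Proof.
move=> fg gh hM t e.
have cf (a b : R) : {within `[a, b], continuous f}.
  by apply: continuous_subspaceT; exact: derive_continuous fg.
have M0 : 0 <= M by apply: le_trans (hM 0).
have key a b c : c \in `[a, b] -> `|g c - g a| <= M * `|b - a| /\ `|g c - g b| <= M * `|b - a|.
  rewrite in_itv /= => /andP[h1 h2]; split; apply: le_trans (MVT_bound gh hM _ _) _;
  rewrite ler_wpM2l// [leRHS]ger0_norm ?subr_ge0 ?(le_trans h1)//.
    by rewrite ger0_norm ?subr_ge0// lerD2r.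
  by rewrite ler0_norm ?subr_le0// opprB lerD2l lerN2.
rewrite -(real_normK (num_real e)).
have [e0|e0] := leP 0 e.
  have [c cI E] := @MVT_segment _ f g t (e + t) ltac:(by rewrite lerDr) (fun x _ => fg x) (cf _ _).
  rewrite E addrK [g c * e]mulrC -mulrBr normrM expr2 mulrCA ler_wpM2l//.
  by have [+ _] := key _ _ _ cI; rewrite addrK.
have [c cI E] := @MVT_segment _ f g (e + t) t ltac:(by rewrite gerDr ltW) (fun x _ => fg x) (cf _ _).
have -> : f (e + t) - f t = g c * e.
  by rewrite -opprB E opprD addrCA subrr addr0 mulrN opprK.
rewrite [g c * e]mulrC -mulrBr normrM expr2 mulrCA ler_wpM2l//.
by have [_ +] := key _ _ _ cI; rewrite opprD addrCA subrr addr0 normrN.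
Qed.

End flat_bumps.

(** * Smooth functions and products of one-dimensional bumps *)

Section product_bumps.
Context {R : realType} {d : nat}.
Local Notation E := 'rV[R]_d.
Implicit Types (X Y x y : E) (f g k : E -> R).

Definition c1_partials f := continuous f /\ forall i X, derivable f X (basis_row i).

(** [smooth] quantifies over all iterated partial derivatives. Exhibiting a class of C^1 functions
    that is stable under [partial] replaces every computation of higher derivatives. *)
Lemma smooth_of_stable_class (P : (E -> R) -> Prop) :
  (forall f, P f -> c1_partials f) -> (forall f i, P f -> P (partial i f)) ->
  forall f, P f -> smooth f.
Proof.
move=> H1 H2 f Pf s.
have : P (foldr (@partial R d) f s) by elim: s => [//|i s IH] /=; exact: H2.
exact: H1.
Qed.

Lemma smooth_c1 f : smooth f -> c1_partials f.
Proof. by move=> /(_ [::]). Qed.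

Lemma smooth_partial f i : smooth f -> smooth (partial i f).
Proof. by move=> sf s; have := sf (rcons s i); rewrite foldr_rcons. Qed.

Lemma derive_le_lipschitz f X v L : derivable f X v ->
  (forall h : R, `|f (h *: v + X) - f X| <= L * `|h|) -> `|'D_v f X| <= L.
Proof.
move=> df H.
have h1 : (fun h : R => `|h^-1 *: (f (h *: v + X) - f X)|) @ 0^' --> `|'D_v f X|.
  exact: cvg_norm.
apply: (cvgr_to_le h1).
near=> h.
have h0 : h != 0 by near: h; exact: nbhs_dnbhs_neq.
by rewrite normrM normfV ler_pdivrMl ?normr_gt0// mulrC H.
Unshelve. all: by end_near. Qed.

Definition bounded_lipschitz f :=
  exists M, (forall X, `|f X| <= M) /\ forall X Y, `|f X - f Y| <= M * enorm (X - Y).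

Lemma bounded_lipschitzM f g : bounded_lipschitz f -> bounded_lipschitz g ->
  bounded_lipschitz (fun X => f X * g X).
Proof.
move=> [M [Mb Ml]] [N [Nb Nl]].
have M0 : 0 <= M by apply: le_trans (Mb 0).
have N0 : 0 <= N by apply: le_trans (Nb 0).
have MN := mulr_ge0 M0 N0.
exists (2 * (M * N)); split=> [X|X Y].
  by rewrite normrM (le_trans (ler_pM _ _ (Mb X) (Nb X)))// ler_peMl// ler1n.
have -> : f X * g X - f Y * g Y = f X * (g X - g Y) + (f X - f Y) * g Y by ring.
rewrite (le_trans (ler_normD _ _))// !normrM mulr_natl mulr2n mulrDl lerD//.
  by rewrite -mulrA ler_pM.
by rewrite mulrAC ler_pM.
Qed.

Lemma bounded_lipschitz_coord (b : R -> R) i : nice b -> bounded_lipschitz (fun X => b (X ord0 i)).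
Proof.
move=> nb; have [M HM] := nice_bounded nb; have [b' nb' Hb] := nice_derive nb.
have [M' HM'] := nice_bounded nb'.
exists (M + M'); split=> [X|X Y].
  by rewrite (le_trans (HM _))// lerDl (le_trans _ (HM' 0)).
rewrite (le_trans (MVT_bound Hb HM' _ _))//.
have M0 : 0 <= M by apply: le_trans (HM 0).
apply: ler_pM => //; first by apply: le_trans (HM' 0).
  by rewrite lerDr.
by have := coord_le_enorm (X - Y) i; rewrite !mxE.
Qed.

Lemma bounded_lipschitz_prod (b : 'I_d -> R -> R) (s : seq 'I_d) : (forall i, nice (b i)) ->
  bounded_lipschitz (fun X => \prod_(i <- s) b i (X ord0 i)).
Proof.
move=> nb; elim: s => [|i s IH].
  exists 1; split => [X|X Y]; rewrite !big_nil ?normr1// subrr normr0 mul1r.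
  exact: enorm_ge0.
have -> : (fun X => \prod_(j <- i :: s) b j (X ord0 j)) =
    (fun X => b i (X ord0 i) * \prod_(j <- s) b j (X ord0 j)).
  by apply/funext => X; rewrite big_cons.
by apply: bounded_lipschitzM => //; exact: bounded_lipschitz_coord.
Qed.

(* Bumps are products of one-dimensional ones: only derivatives of functions of one real variable are then ever computed. *)
Definition product_form k := exists2 b : 'I_d -> R -> R, (forall i, nice (b i)) &
  k = fun X => \prod_i b i (X ord0 i).

Lemma product_form_lipschitz k : product_form k -> bounded_lipschitz k.
Proof. by move=> [b nb ->]; exact: bounded_lipschitz_prod. Qed.

(** The remainder is uniform in X, which allows it to be integrated under a convolution. Only the
    i-th factor varies with h; the others are bounded by N. *)
Lemma product_form_taylor k i : product_form k ->
  exists k' M, product_form k' /\ forall X (h : R),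
    `|k (h *: basis_row i + X) - k X - h * k' X| <= M * h ^+ 2.
Proof.
move=> [b nb ->].
have [b' nb' Hb] := nice_derive (nb i).
have [b'' nb'' Hb'] := nice_derive nb'.
have [M HM] := nice_bounded nb''.
have [N [HN _]] := bounded_lipschitz_prod ([seq j <- index_enum 'I_d | j != i]) nb.
exists (fun X => \prod_j (if j == i then b' else b j) (X ord0 j)), (M * N); split.
  by exists (fun j => if j == i then b' else b j) => // j; case: ifP.
move=> X h.
have e1 (c : 'I_d -> R -> R) Y : \prod_j c j (Y ord0 j) =
    c i (Y ord0 i) * \prod_(j <- [seq j <- index_enum 'I_d | j != i]) c j (Y ord0 j).
  by rewrite (bigD1 i)//= big_filter.
rewrite !(e1 b) (e1 (fun j => if j == i then b' else b j)) eqxx.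
set P := \prod_(j <- _) b j (X ord0 j).
have -> : \prod_(j <- [seq j <- index_enum 'I_d | j != i]) b j ((h *: basis_row i + X) ord0 j) = P.
  rewrite /P !big_filter; apply: eq_bigr => j /negbTE ji.
  by rewrite !mxE eqxx ji mulr0 add0r.
have -> : \prod_(j <- [seq j <- index_enum 'I_d | j != i]) (if j == i then b' else b j) (X ord0 j) = P.
  by rewrite /P !big_filter; apply: eq_bigr => j /negbTE ->.
rewrite !mxE !eqxx mulr1.
have -> : b i (h + X ord0 i) * P - b i (X ord0 i) * P - h * (b' (X ord0 i) * P) =
  (b i (h + X ord0 i) - b i (X ord0 i) - h * b' (X ord0 i)) * P by ring.
rewrite normrM mulrAC ler_pM//.
  exact: taylor_bound Hb Hb' HM _ _.
exact: (HN X).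
Qed.

Lemma product_form_is_derive k i : product_form k -> exists2 k', product_form k' &
  forall X, is_derive X (basis_row i) k (k' X).
Proof.
move=> /(@product_form_taylor _ i)[k' [M [kk' H]]]; exists k' => // X.
exact: is_derive_quadratic (H X).
Qed.

Lemma product_form_partial k i : product_form k -> product_form (partial i k).
Proof.
move=> /(@product_form_is_derive _ i)[k' kk' H]; suff -> : partial i k = k' by [].
by apply/funext => X; apply: derive_val.
Qed.

Lemma product_form_taylor_partial k i : product_form k -> exists M, forall X (h : R),
    `|k (h *: basis_row i + X) - k X - h * partial i k X| <= M * h ^+ 2.
Proof.
move=> /(@product_form_taylor _ i)[k' [M [kk' H]]]; exists M => X h.
suff -> : partial i k X = k' X by [].
by apply: derive_val; exact: is_derive_quadratic (H X).
Qed.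

Lemma product_form_smooth k : product_form k -> smooth k.
Proof.
move: k; apply: smooth_of_stable_class; last by move=> *; exact: product_form_partial.
move=> k kk; split.
  have [M [_ Ml]] := product_form_lipschitz kk; exact: lipschitz_row_continuous Ml.
by move=> i X; have [k' _ /(_ X)[]] := product_form_is_derive i kk.
Qed.

Lemma product_form_affine k (a : R) (b : E) : product_form k -> product_form (fun X => k (a *: X + b)).
Proof.
move=> [c nc ->]; exists (fun i t => c i (a * t + b ord0 i)).
  by move=> i; exact: nice_affine.
by apply/funext => X; apply: eq_bigr => i _; rewrite !mxE.
Qed.

(** The Leibniz rule turns a product of two smooth functions into a sum of two such products; sums
    of products are thus stable under [partial]. *)
Inductive smooth_alg : (E -> R) -> Prop :=
| smooth_alg_mul f g : smooth f -> smooth g -> smooth_alg (fun X => f X * g X)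
| smooth_alg_add f g : smooth_alg f -> smooth_alg g -> smooth_alg (fun X => f X + g X).

Lemma partialM f g i : c1_partials f -> c1_partials g ->
  partial i (fun X => f X * g X) = fun X => f X * partial i g X + g X * partial i f X.
Proof. by move=> [_ df] [_ dg]; apply/funext => X; rewrite /partial deriveM. Qed.

Lemma c1_partialsM f g : c1_partials f -> c1_partials g -> c1_partials (fun X => f X * g X).
Proof.
move=> [cf df] [cg dg]; split=> [X|i X]; last exact: derivableM.
exact: (continuousM (cf X) (cg X)).
Qed.

Lemma c1_partialsD f g : c1_partials f -> c1_partials g -> c1_partials (fun X => f X + g X).
Proof.
move=> [cf df] [cg dg]; split=> [X|i X]; last exact: derivableD.
exact: (continuousD (cf X) (cg X)).
Qed.

Lemma smooth_alg_smooth f : smooth_alg f -> smooth f.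
Proof.
have c1 g : smooth_alg g -> c1_partials g.
  elim=> {}g h; first by move=> /smooth_c1 cg /smooth_c1 ch; exact: c1_partialsM.
  by move=> _ cg _ ch; exact: c1_partialsD.
move: f; apply: smooth_of_stable_class => // f i.
elim=> [g h sg sh|g h ag IHg ah IHh].
  rewrite partialM; try exact: smooth_c1.
  exact: (smooth_alg_add (smooth_alg_mul sg (smooth_partial i sh)) (smooth_alg_mul sh (smooth_partial i sg))).
have -> : partial i (fun X => g X + h X) = fun X => partial i g X + partial i h X.
  by apply/funext => X; rewrite /partial deriveD//; [case: (c1 g)|case: (c1 h)].
exact: smooth_alg_add.
Qed.

Lemma smoothM f g : smooth f -> smooth g -> smooth (fun X => f X * g X).
Proof. by move=> sf sg; apply: smooth_alg_smooth; exact: smooth_alg_mul. Qed.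

Definition bump1 (t : R) := flat 1 (1 + t) * flat 1 (1 - t).

Lemma flat1_ge0 (t : R) : 0 <= flat 1 t.
Proof. by rewrite /flat; case: ifP => // _; rewrite hornerC mul1r expR_ge0. Qed.

Lemma flat1_le1 (t : R) : flat 1 t <= 1.
Proof.
rewrite /flat; case: ifP => // t0; rewrite hornerC mul1r -expR0 ler_expR.
by rewrite oppr_le0 invr_ge0 ltW.
Qed.

Lemma bump1_nice : nice bump1.
Proof.
apply: (@nice_mul _ (fun t => flat 1 (1 + t)) (fun t => flat 1 (1 - t))).
  have -> : (fun t => flat 1 (1 + t)) = (fun t : R => flat 1 (1 * t + 1)).
    by apply/funext => t; rewrite mul1r addrC.
  by apply: nice_affine; exact: nice_flat.
have -> : (fun t => flat 1 (1 - t)) = (fun t : R => flat 1 (-1 * t + 1)).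
  by apply/funext => t; rewrite mulN1r addrC.
by apply: nice_affine; exact: nice_flat.
Qed.

Lemma bump1_ge0 t : 0 <= bump1 t.
Proof. by rewrite mulr_ge0// flat1_ge0. Qed.

Lemma bump1_le1 t : bump1 t <= 1.
Proof. by rewrite mulr_ile1 ?flat1_ge0 ?flat1_le1. Qed.

Lemma bump1_eq0 t : 1 <= `|t| -> bump1 t = 0.
Proof.
rewrite lter_normr => /orP[] h; rewrite /bump1 /flat.
  by rewrite [X in _ * X]ifF ?mulr0//; apply/negbTE; rewrite -leNgt subr_le0.
by rewrite ifF ?mul0r//; apply/negbTE; rewrite -leNgt addrC -lerBrDr sub0r lerNr.
Qed.

(** For |t| at most 1/2, both 1 + t and 1 - t are at least 1/2, where exp(-1/s) is at least
    exp(-2). *)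
Definition bump_low : R := expR (-4).

Lemma bump_low_gt0 : 0 < bump_low. Proof. exact: expR_gt0. Qed.

Lemma bump1_ge t : `|t| <= 2^-1 -> bump_low <= bump1 t.
Proof.
rewrite ler_norml => /andP[h1 h2].
have low (s : R) : 2^-1 <= s -> expR (-2) <= flat 1 s.
  move=> hs; have s0 : 0 < s by lra.
  rewrite /flat s0 hornerC mul1r ler_expR lerN2 -[leRHS]invrK lef_pV2 ?posrE ?invr_gt0//.
have -> : bump_low = expR (-2) * expR (-2) by rewrite -expRD /bump_low; congr expR; ring.
by rewrite ler_pM ?expR_ge0 ?low//; lra.
Qed.

Definition bump (c : E) (r : R) X := \prod_i bump1 ((X ord0 i - c ord0 i) / r).

Lemma bump_product_form c r : product_form (bump c r).
Proof.
exists (fun i t => bump1 (r^-1 * t + - c ord0 i / r)).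
  by move=> i; apply: nice_affine; exact: bump1_nice.
by apply/funext => X; apply: eq_bigr => i _; rewrite mulrBl mulrC mulNr.
Qed.

Lemma bump_ge0 c r X : 0 <= bump c r X.
Proof. by apply: prodr_ge0 => i _; exact: bump1_ge0. Qed.

Lemma bump_le1 c r X : bump c r X <= 1.
Proof. by apply: prodr_ile1 => i _; rewrite bump1_ge0 bump1_le1. Qed.

Lemma bump_neq0 c r X : 0 < r -> bump c r X != 0 -> cube c r X.
Proof.
move=> r0 b0 i; rewrite ltNge; apply: contra b0 => h; rewrite /bump (bigD1 i)//=.
rewrite bump1_eq0 ?mul0r// normrM normfV (gtr0_norm r0) ler_pdivlMr// mul1r//.
Qed.

Lemma bump_ge c r X : 0 < r -> cube c (r / 2) X -> bump_low ^+ d <= bump c r X.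
Proof.
move=> r0 cX; rewrite -[d in _ ^+ d]card_ord -prodr_const.
apply: ler_prod => i _; rewrite ltW ?bump_low_gt0//= bump1_ge//.
by rewrite normrM normfV (gtr0_norm r0) ler_pdivrMr// mulrC ltW.
Qed.

(** M bounds the derivative of [bump1]; the remaining factors are at most 1 and the scaling
    contributes 1 / r. *)
Lemma bump_partial_bounded : exists M, 0 <= M /\ forall c r i X, 0 < r ->
  `|partial i (bump c r) X| <= M / r.
Proof.
have [b' nb' Hb] := nice_derive bump1_nice.
have [M HM] := nice_bounded nb'.
have M0 : 0 <= M by apply: le_trans (HM 0).
exists M; split => // c r i X r0.
apply: derive_le_lipschitz.
  by have [_ dk] := smooth_c1 (product_form_smooth (bump_product_form c r)).
move=> h; rewrite /bump (bigD1 i)//= [X in _ - X](bigD1 i)//=.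
set P := \prod_(j | j != i) bump1 ((X ord0 j - c ord0 j) / r).
have -> : \prod_(j | j != i) bump1 (((h *: basis_row i + X) ord0 j - c ord0 j) / r) = P.
  by apply: eq_bigr => j /negbTE ji; rewrite !mxE eqxx ji mulr0 add0r.
rewrite -mulrBl normrM.
have P1 : `|P| <= 1.
  rewrite ger0_norm; first by apply: prodr_ile1 => j _; rewrite bump1_ge0 bump1_le1.
  by apply: prodr_ge0 => j _; exact: bump1_ge0.
apply: le_trans (ler_pM _ _ (MVT_bound Hb HM _ _) P1) _ => //.
rewrite mulr1 -mulrBl !mxE !eqxx mulr1.
have -> : h + X ord0 i - c ord0 i - (X ord0 i - c ord0 i) = h by ring.
by rewrite normrM normfV (gtr0_norm r0) [_ * r^-1]mulrC mulrA.
Qed.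

End product_bumps.

(** * Convolution with product bumps *)

Section convolution.
Context {R : realType} {d : nat}.
Local Notation E := 'rV[R]_d.
Local Notation mu := (@lebesgue_row R d).
Implicit Types (U : set E) (u f g k : E -> R) (x y z : E).

Lemma integrableM_bounded U f g M : measurable U -> mu.-integrable U (EFin \o f) ->
  measurable_fun U g -> (forall x, U x -> `|g x| <= M) ->
  mu.-integrable U (fun x => (f x * g x)%:E).
Proof.
move=> mU intf mg gM.
have mf : measurable_fun U f by apply/measurable_EFinP; case/integrableP: intf.
apply: (@le_integrable _ _ _ mu U mU _ (fun x => (`|M|)%:E * (EFin \o f) x)%E).
- by apply/measurable_EFinP; exact: measurable_funM.
- move=> x Ux /=; rewrite lee_fin !normrM mulrC ler_wpM2r// normr_id.
  exact: le_trans (gM _ Ux) (ler_norm _).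
- exact: integrableZl.
Qed.

Lemma product_form_comp_measurable k x : product_form k -> measurable_fun setT (fun z : E => k (x - z)).
Proof.
move=> kk.
have -> : (fun z => k (x - z)) = (fun z => k (-1 *: z + x)).
  by apply/funext => z; rewrite scaleN1r addrC.
apply: continuous_measurable_row.
by have [] := smooth_c1 (product_form_smooth (product_form_affine (-1) x kk)).
Qed.

(** The integral runs over U, so that u has to be integrable only there, while the result is smooth
    on the whole space. *)
Definition conv U u k (x : E) : R := \int[mu]_(z in U) (u z * k (x - z)).

Section conv_smooth.
Variables (U : set E) (u : E -> R).
Hypotheses (mU : measurable U) (intu : mu.-integrable U (EFin \o u)).

Lemma integrable_conv k x : product_form k -> mu.-integrable U (fun z => (u z * k (x - z))%:E).
Proof.
move=> kk; have [M [HM _]] := product_form_lipschitz kk.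
apply: (@integrableM_bounded _ _ _ M) => //.
by apply: measurable_funTS; exact: product_form_comp_measurable.
Qed.

Let N := \int[mu]_(z in U) `|u z|.

Lemma conv_lipschitz k : product_form k -> exists M, forall x y, `|conv U u k x - conv U u k y| <= M * enorm (x - y).
Proof.
move=> kk; have [M [_ HM]] := product_form_lipschitz kk.
exists (N * M) => x y.
have ix := integrable_conv x kk; have iy := integrable_conv y kk.
rewrite /conv -RintegralB//.
have iB : mu.-integrable U (EFin \o (fun z => u z * k (x - z) - u z * k (y - z))).
  by apply: (integrableB mU ix iy).
apply: le_trans (le_normr_Rintegral mU iB) _.
have iu : mu.-integrable U (EFin \o (fun z => `|u z|)) by exact: integrable_norm.
rewrite /N -mulrA -RintegralZr//.
apply: le_Rintegral => //.
- exact: integrable_norm.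
- by apply: (integrableZr mU (M * enorm (x - y)) iu).
- move=> z Uz; rewrite -mulrBr normrM ler_wpM2l//.
  by apply: le_trans (HM _ _) _; rewrite opprB addrA subrK.
Qed.

Lemma conv_is_derive k i x : product_form k ->
  is_derive x (basis_row i) (conv U u k) (conv U u (partial i k) x).
Proof.
move=> kk; have [M HM] := product_form_taylor_partial i kk.
apply: (@is_derive_quadratic _ _ _ _ _ _ (N * M)) => h.
have kk' := product_form_partial i kk.
have i1 := integrable_conv (h *: basis_row i + x) kk.
have i0 := integrable_conv x kk.
have i2 := integrable_conv x kk'.
have i2' : mu.-integrable U (fun z => (h * (u z * partial i k (x - z)))%:E).
  exact: (integrableZl mU h i2).
have iB : mu.-integrable U (EFin \o (fun z => u z * k (h *: basis_row i + x - z) - u z * k (x - z))).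
  exact: (integrableB mU i1 i0).
have iC : mu.-integrable U (EFin \o (fun z => u z * k (h *: basis_row i + x - z) - u z * k (x - z)
    - h * (u z * partial i k (x - z)))).
  exact: (integrableB mU iB i2').
rewrite /conv -RintegralB// -RintegralZl// -RintegralB//.
apply: le_trans (le_normr_Rintegral mU iC) _.
have iu : mu.-integrable U (EFin \o (fun z => `|u z|)) by exact: integrable_norm.
rewrite /N -mulrA -RintegralZr//.
apply: le_Rintegral => //.
- exact: integrable_norm.
- by apply: (integrableZr mU (M * h ^+ 2) iu).
- move=> z Uz; rewrite mulrCA -!mulrBr normrM ler_wpM2l//.
  have -> : h *: basis_row i + x - z = h *: basis_row i + (x - z) by rewrite addrA.
  exact: HM.
Qed.

Lemma conv_partial k i : product_form k -> partial i (conv U u k) = conv U u (partial i k).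
Proof. by move=> kk; apply/funext => x; apply: derive_val; exact: conv_is_derive. Qed.

Lemma conv_smooth k : product_form k -> smooth (conv U u k).
Proof.
move=> kk; apply: (@smooth_of_stable_class _ _ (fun f => exists2 k, product_form k & f = conv U u k)).
- move=> _ [{}k {}kk ->]; split.
    by have [M HM] := conv_lipschitz kk; exact: lipschitz_row_continuous HM.
  by move=> i x; case: (conv_is_derive i x kk).
- move=> _ i [{}k {}kk ->]; exists (partial i k); first exact: product_form_partial.
  exact: conv_partial.
- by exists k.
Qed.

End conv_smooth.

Definition closed_cube (c : E) r : set E := [set y | forall i, `|y ord0 i - c ord0 i| <= r].

Lemma closed_cube_closed (c : E) r : closed (closed_cube c r).
Proof.
move=> y cy i; rewrite leNgt; apply/negP => h.
have e0 : 0 < `|y ord0 i - c ord0 i| - r by rewrite subr_gt0.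
have [z [zc /= zy]] := cy _ (eball_nbhs y e0).
have := zc i; rewrite leNgt => /negP; apply.
have h1 := coord_le_enorm (z - y) i; rewrite !mxE in h1.
have := ler_distD (z ord0 i) (y ord0 i) (c ord0 i); rewrite (distrC (y ord0 i) (z ord0 i)) => h2.
have h3 : `|z ord0 i - y ord0 i| < `|y ord0 i - c ord0 i| - r by exact: le_lt_trans h1 zy.
lra.
Qed.

Lemma closed_cube_eclosed_ball c r : 0 <= r -> closed_cube c r `<=` eclosed_ball c (d%:R * r).
Proof. by move=> r0 y yc; apply: enorm_le_coord => // i; rewrite !mxE. Qed.

Lemma closed_cube_compact c r : 0 <= r -> compact (closed_cube c r).
Proof.
move=> r0; apply: (subclosed_compact _ (@eclosed_ball_compact _ _ c (d%:R * r))).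
  exact: closed_cube_closed.
exact: closed_cube_eclosed_ball.
Qed.

Lemma cube_closed_cube c r : cube c r `<=` closed_cube c r.
Proof. by move=> y h i; exact: ltW. Qed.

Lemma closed_cube_cube c r s : r < s -> closed_cube c r `<=` cube c s.
Proof. by move=> rs y h i; exact: le_lt_trans (h i) rs. Qed.

Lemma partial_eq0 f i x : (\near x, f x = 0) -> partial i f x = 0.
Proof.
move=> h; apply: derive_val; apply: near_eq_is_derive (is_derive_cst 0 x (basis_row i)).
by near=> z; apply/esym; near: z.
Unshelve. all: by end_near. Qed.

Lemma partial_support f i x : partial i f x != 0 -> closure [set X | f X != 0] x.
Proof.
move=> p0; apply: contrapT => nc.
have := @closed_closure _ [set X | f X != 0] => /closed_openC oC.
have : nbhs x (~` closure [set X | f X != 0]) by exact: open_nbhs_nbhs.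
move=> nx; move/eqP: p0; apply; apply: partial_eq0; near=> z.
have nz : (~` closure [set X | f X != 0]) z by near: z.
by apply/eqP; apply: contrapT => /negP fz; apply: nz; exact: subset_closure.
Unshelve. all: by end_near. Qed.

Lemma partial_product_form_reflect k i x z : product_form k ->
  partial i (fun z => k (x - z)) z = - partial i k (x - z).
Proof.
move=> kk; apply: derive_val.
have [M HM] := product_form_taylor_partial i kk.
apply: (@is_derive_quadratic _ _ _ _ _ _ M) => h.
have := HM (x - z) (- h).
rewrite sqrrN mulrN mulNr.
by have -> : - h *: basis_row i + (x - z) = x - (h *: basis_row i + z)
  by rewrite opprD scaleNr addrCA.
Qed.

Lemma integral_support (D U : set E) (f : E -> \bar R) : U `<=` D ->
  (forall x, D x -> ~ U x -> f x = 0%E) ->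
  (\int[mu]_(x in D) f x = \int[mu]_(x in U) f x)%E.
Proof.
move=> UD H; rewrite integral_mkcond [RHS]integral_mkcond; apply: eq_integral => x _.
rewrite !patchE; case: ifPn => Dx; case: ifPn => Ux //.
  by apply: H; [rewrite inE in Dx|move=> Ux'; rewrite mem_set in Ux].
by rewrite inE in Ux; rewrite mem_set// in Dx; exact: UD.
Qed.

Lemma test_function_reflect k x (S D : set E) : product_form k -> compact S -> S `<=` D ->
  (forall z, k (x - z) != 0 -> S z) -> test_function D (fun z => k (x - z)).
Proof.
move=> kk cS SD kS.
have clS : closure [set z | k (x - z) != 0] `<=` S.
  rewrite (closure_id S).1; last exact: (compact_closed (@norm_hausdorff _ _) cS).
  exact: closure_subset.
split; last exact: subset_trans clS SD.
  have -> : (fun z => k (x - z)) = (fun z => k (-1 *: z + x)).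
    by apply/funext => z; rewrite scaleN1r addrC.
  by apply: product_form_smooth; exact: product_form_affine.
apply: (subclosed_compact _ cS clS).
exact: closed_closure.
Qed.

(** z -> k (x - z) is itself a test function, and its partial derivative is minus that of k at x -
    z; this sign cancels the one in the definition of a weak gradient. *)
Lemma conv_weak_grad D U u (G : E -> E) k x (S : set E) i :
  measurable U -> mu.-integrable U (EFin \o u) -> is_weak_grad D u G -> U `<=` D ->
  product_form k -> compact S -> S `<=` U -> (forall z, k (x - z) != 0 -> S z) ->
  conv U u (partial i k) x = conv U (fun z => G z ord0 i) k x.
Proof.
move=> mU intu [_ _ wG] UD kk cS SU kS.
have tf : test_function D (fun z => k (x - z)).
  by apply: test_function_reflect cS _ kS => //; exact: subset_trans UD.
have := wG _ tf i.
have nU z : ~ U z -> k (x - z) = 0.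
  by move=> nUz; apply/eqP; apply: contrapT => /negP/kS/SU.
rewrite (integral_support (U := U))//; last first.
  move=> z _ nUz; rewrite (_ : partial _ _ _ = 0) ?mulr0//.
  apply/eqP; apply: contrapT => /negP/partial_support.
  move=> /(closure_subset kS); rewrite -(closure_id S).1 ?(compact_closed (@norm_hausdorff _ _))//.
  by move/SU.
  exact: (compact_closed (@norm_hausdorff _ _) cS).
rewrite [X in (- X)%E](integral_support (U := U))//; last first.
  by move=> z _ nUz; rewrite nU// mulr0.
have i1 := integrable_conv mU intu x (product_form_partial i kk).
under eq_integral do rewrite partial_product_form_reflect// mulrN -mulN1r EFinM.
rewrite integralZl// EFinN mulN1e => /(congr1 (fun w => fine (- w)%E)).
by rewrite !oppeK.
Qed.

End convolution.

(** * The Poincare inequality for smooth functions *)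

Section tonelli_on_sets.
Context {R : realType} d1 d2 (T1 : measurableType d1) (T2 : measurableType d2).
Variables (m1 : {sigma_finite_measure set T1 -> \bar R})
  (m2 : {sigma_finite_measure set T2 -> \bar R}) (f : T1 * T2 -> \bar R).
Hypotheses (mf : measurable_fun setT f) (f0 : forall p, (0 <= f p)%E).
Variables (A : set T1) (B : set T2).
Hypotheses (mA : measurable A) (mB : measurable B).
Local Open Scope ereal_scope.

Let fAB := f \_ (A `*` B).
Let mfAB : measurable_fun setT fAB.
Proof.
apply/(measurable_restrictT _ (measurableX mA mB)); exact: measurable_funTS.
Qed.
Let fAB0 p : 0 <= fAB p. Proof. by rewrite erestrict_ge0. Qed.

Let fABE1 x : \int[m2]_y fAB (x, y) = ((fun x => \int[m2]_(y in B) f (x, y)) \_ A) x.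
Proof.
rewrite patchE; case: ifPn => xA.
  rewrite [RHS]integral_mkcond; apply: eq_integral => y _; rewrite /fAB !patchE.
  by rewrite in_setX xA.
by rewrite integral0_eq// => y _; rewrite /fAB patchE in_setX (negbTE xA).
Qed.

Let fABE2 y : \int[m1]_x fAB (x, y) = ((fun y => \int[m1]_(x in A) f (x, y)) \_ B) y.
Proof.
rewrite patchE; case: ifPn => yB.
  rewrite [RHS]integral_mkcond; apply: eq_integral => x _; rewrite /fAB !patchE.
  by rewrite in_setX yB andbT.
by rewrite integral0_eq// => x _; rewrite /fAB patchE in_setX (negbTE yB) andbF.
Qed.

Lemma tonelli_on : \int[m1]_(x in A) \int[m2]_(y in B) f (x, y) =
  \int[m2]_(y in B) \int[m1]_(x in A) f (x, y).
Proof.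
rewrite integral_mkcond [RHS]integral_mkcond.
under eq_integral do rewrite -fABE1.
under [RHS]eq_integral do rewrite -fABE2.
exact: fubini_tonelli.
Qed.

Lemma measurable_tonelli_on_F : measurable_fun A (fun x => \int[m2]_(y in B) f (x, y)).
Proof.
apply/(measurable_restrictT _ mA).
rewrite (_ : _ \_ _ = fun x => \int[m2]_y fAB (x, y)); last first.
  by apply/funext => x; rewrite fABE1.
exact: (@measurable_fun_fubini_tonelli_F _ _ _ _ _ m2 fAB).
Qed.

Lemma measurable_tonelli_on_G : measurable_fun B (fun y => \int[m1]_(x in A) f (x, y)).
Proof.
apply/(measurable_restrictT _ mB).
rewrite (_ : _ \_ _ = fun y => \int[m1]_x fAB (x, y)); last first.
  by apply/funext => x; rewrite fABE2.
exact: (@measurable_fun_fubini_tonelli_G _ _ _ _ _ m1 fAB).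
Qed.

End tonelli_on_sets.

Section poincare_smooth.
Context {R : realType}.
Local Notation mu d := (@lebesgue_row R d).
Local Notation leb := (@lebesgue_measure R).

Lemma derivable_oo_is_derive (F f : R -> R) a b : (forall t, is_derive t (1 : R) F (f t)) ->
  derivable_oo_LRcontinuous F a b.
Proof.
move=> H; have cF := derive_continuous H; split.
- by move=> x _; case: (H x).
- exact/cvg_at_right_filter/cF.
- exact/cvg_at_left_filter/cF.
Qed.

(** Cauchy-Schwarz for g(b) - g(a), obtained by integrating (g' - l)^2 >= 0 with l the mean slope: 2
    l g' - l^2 has the explicit primitive F. *)
Lemma sqr_increment_le (g g' : R -> R) (a b : R) : a < b ->
  (forall t, is_derive t (1 : R) g (g' t)) -> continuous g' ->
  (((g b - g a) ^+ 2)%:E <= (b - a)%:E * \int[leb]_(x in `[a, b]) (g' x ^+ 2)%:E)%E.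
Proof.
move=> ab dg cg'.
pose l := (g b - g a) / (b - a).
pose f t := 2 * l * g' t - l ^+ 2.
pose F t := 2 * l * g t - l ^+ 2 * t.
have dF t : is_derive t (1 : R) F (f t).
  have dZ : is_derive t (1 : R) (fun t => 2 * l * g t) (2 * l * g' t).
    exact: (is_deriveZ (2 * l) (dg t)).
  have dL : is_derive t (1 : R) (fun t => l ^+ 2 * t) (l ^+ 2).
    by apply: (@is_derive_quadratic _ _ _ _ _ _ 0) => h;
    rewrite [h *: 1]mulr1 mul0r normr_le0; apply/eqP; ring.
  exact: (is_deriveB dZ dL).
have cf : continuous f.
  by move=> t; apply: cvgB; [apply: cvgM; [exact: cvg_cst|exact: cg']|exact: cvg_cst].
have cs : continuous (fun t => g' t ^+ 2).
  by move=> t; apply: cvgM; exact: cg'.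
have Ef : (\int[leb]_(x in `[a, b]) (f x)%:E = (F b)%:E - (F a)%:E)%E.
  apply: continuous_FTC2 => //.
  - exact: continuous_subspaceT.
  - exact: derivable_oo_is_derive dF.
  - by move=> x _; rewrite derive1E; apply: derive_val.
have le1 : (\int[leb]_(x in `[a, b]) (f x)%:E <= \int[leb]_(x in `[a, b]) (g' x ^+ 2)%:E)%E.
  apply: le_integral => //.
  - apply: continuous_compact_integrable; first exact: segment_compact.
    exact: continuous_subspaceT.
  - apply: continuous_compact_integrable; first exact: segment_compact.
    exact: continuous_subspaceT.
  - move=> x _; rewrite lee_fin /f -subr_ge0.
    have -> : g' x ^+ 2 - (2 * l * g' x - l ^+ 2) = (g' x - l) ^+ 2 by ring.
    exact: sqr_ge0.
have ba : 0 < b - a by rewrite subr_gt0.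
apply: le_trans (lee_wpmul2l _ le1); last by rewrite lee_fin ltW.
rewrite Ef -EFinB -EFinM lee_fin le_eqVlt; apply/orP; left; apply/eqP.
by rewrite /F /l; field; rewrite gt_eqF.
Qed.

Lemma sqr_increment_ball (g g' : R -> R) (c r s t : R) : 0 < r ->
  (forall t, is_derive t (1 : R) g (g' t)) -> continuous g' ->
  ball c r s -> ball c r t ->
  (((g t - g s) ^+ 2)%:E <= (2 * r)%:E * \int[leb]_(x in ball c r) (g' x ^+ 2)%:E)%E.
Proof.
move=> r0 dg cg'.
wlog st : s t / s <= t.
  move=> H; case: (leP s t) => [|/ltW] st bs bt; first exact: H.
  by rewrite -sqrrN opprB; exact: H.
move=> bs' bt'.
have [bs bt] : `|c - s| < r /\ `|c - t| < r by move: bs' bt'; rewrite -!ball_normE.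
have ms : measurable_fun setT (fun x : R => (g' x ^+ 2)%:E).
  apply/measurable_EFinP; apply: measurable_funX.
  by apply: measurable_realfun.continuous_measurable_fun.
move: st; rewrite le_eqVlt => /orP[/eqP ->|st].
  rewrite subrr expr0n/= mule_ge0 ?lee_fin ?mulr_ge0 ?(ltW r0)//.
  by apply: integral_ge0 => x _; rewrite lee_fin sqr_ge0.
apply: le_trans (sqr_increment_le st dg cg') _.
apply: lee_pmul.
- by rewrite lee_fin subr_ge0 ltW.
- by apply: integral_ge0 => x _; rewrite lee_fin sqr_ge0.
- by rewrite lee_fin; move: bs bt; rewrite !ltr_norml; lra.
- apply: ge0_subset_integral => //.
  + exact: measurable_ball.
  + exact: measurable_funTS.
  + by move=> x _; rewrite lee_fin sqr_ge0.
  + move=> x /=; rewrite -ball_normE /= in_itv/= => /andP[? ?].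
    by move: bs bt; rewrite !ltr_norml => /andP[? ?] /andP[? ?]; apply/andP; split; lra.
Qed.

Lemma continuous_to_row (T : topologicalType) d (phi : T -> 'rV[R]_d) :
  (forall x e, 0 < e -> \forall y \near x, enorm (phi y - phi x) < e) -> continuous phi.
Proof.
move=> H x A /nbhs_eball[e e0 eA]; rewrite /nbhs/=.
by near=> y; apply: eA; near: y; exact: H.
Unshelve. all: by end_near. Qed.

Lemma row_consB d s t (x y : 'rV[R]_d) :
  row_cons (s, x) - row_cons (t, y) = row_cons (s - t, x - y).
Proof. by apply/rowP => i; rewrite !mxE; case: unliftP => [j|] _ //=; rewrite !mxE. Qed.

Lemma row_cons_basis0 d (s h : R) (x : 'rV[R]_d) :
  row_cons (h + s, x) = h *: basis_row ord0 + row_cons (s, x).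
Proof.
apply/rowP => i; rewrite !mxE; case: unliftP => [j ->|->] /=.
  by rewrite ?mulr0 ?add0r.
by rewrite ?eqxx ?mulr1.
Qed.

Lemma row_cons_basisS d (s h : R) (x : 'rV[R]_d) i :
  row_cons (s, h *: basis_row i + x) = h *: basis_row (lift ord0 i) + row_cons (s, x).
Proof.
apply/rowP => j; rewrite !mxE; case: unliftP => [j' ->|->] /=.
  by rewrite !mxE eqxx /= (inj_eq lift_inj).
by rewrite ?eqxx /= mulr0 add0r.
Qed.

Lemma enorm_row_cons d (s : R) (x : 'rV[R]_d) : enorm (row_cons (s, x)) <= `|s| + enorm x.
Proof.
rewrite -(@ler_pXn2r _ 2) ?nnegrE ?addr_ge0 ?enorm_ge0// enorm2.
rewrite /edot big_ord_recl !mxE unlift_none /=.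
under eq_bigr do rewrite mxE liftK /=.
rewrite -/(edot x x) -enorm2 -expr2 -[s ^+ 2](real_normK (num_real s)).
have := enorm_ge0 x; have := normr_ge0 s; nra.
Qed.

Lemma row_cons_continuous_r d (s : R) : continuous (fun x : 'rV[R]_d => row_cons (s, x)).
Proof.
apply: continuous_to_row => x e e0; near=> y.
rewrite row_consB subrr (le_lt_trans (enorm_row_cons _ _))// normr0 add0r.
by near: y; exact: eball_nbhs.
Unshelve. all: by end_near. Qed.

Lemma row_cons_continuous_l d (x : 'rV[R]_d) : continuous (fun s : R => row_cons (s, x)).
Proof.
apply: continuous_to_row => s e e0; near=> t.
rewrite row_consB subrr (le_lt_trans (enorm_row_cons _ _))// enorm0 addr0.
rewrite distrC; near: t; apply: (@cvgr_dist_lt _ _ _ (nbhs s) _ id s) => //.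
Unshelve. all: by end_near. Qed.

Lemma ge0_integral_rowS_cube d (c : 'rV[R]_d.+1) r (f : 'rV[R]_d.+1 -> \bar R) :
  measurable_fun setT f -> (forall x, 0 <= f x)%E ->
  (\int[mu d.+1]_(x in cube c r) f x =
   \int[leb]_(t in ball (c ord0 ord0) r) \int[mu d]_(x in cube (\row_i c ord0 (lift ord0 i)) r)
     f (row_cons (t, x)))%E.
Proof.
move=> mf f0; rewrite integral_mkcond ge0_integral_rowS; first last.
- by move=> x; rewrite erestrict_ge0.
- by apply/(measurable_restrictT _ (cube_measurable c r)); exact: measurable_funTS.
rewrite [RHS]integral_mkcond; apply: eq_integral => t _.
rewrite [RHS]patchE; case: ifPn => ht.
  rewrite [RHS]integral_mkcond; apply: eq_integral => x _; rewrite !patchE.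
  congr (if _ then _ else _); apply/idP/idP; rewrite !inE; first by move=> /cube_row_cons[].
  move=> hx; apply/cube_row_cons; split => //.
  by move: ht; rewrite inE -ball_normE /= distrC.
rewrite integral0_eq// => x _; rewrite patchE memNset// => /cube_row_cons[h _].
by move: ht; rewrite notin_setE -ball_normE /= distrC.
Qed.

Definition continuously_differentiable d (v : 'rV[R]_d -> R) :=
  c1_partials v /\ forall i, continuous (partial i v).

Lemma is_derive_row_cons0 d (v : 'rV[R]_d.+1 -> R) (x : 'rV[R]_d) (t : R) :
  derivable v (row_cons (t, x)) (basis_row ord0) ->
  is_derive t (1 : R) (fun t => v (row_cons (t, x))) (partial ord0 v (row_cons (t, x))).
Proof.
have e : (fun h : R => h^-1 *: (((fun t => v (row_cons (t, x))) \o shift t) (h *: 1) - v (row_cons (t, x)))) =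
         (fun h : R => h^-1 *: ((v \o shift (row_cons (t, x))) (h *: basis_row ord0) - v (row_cons (t, x)))).
  by apply/funext => h /=; rewrite -row_cons_basis0 [h *: 1]mulr1.
move=> dv; split; first by rewrite /derivable e.
by rewrite /derive e.
Qed.

Lemma partial_row_consS d (v : 'rV[R]_d.+1 -> R) (s : R) i (x : 'rV[R]_d) :
  (derivable v (row_cons (s, x)) (basis_row (lift ord0 i)) ->
     derivable (fun x => v (row_cons (s, x))) x (basis_row i)) /\
  partial i (fun x => v (row_cons (s, x))) x = partial (lift ord0 i) v (row_cons (s, x)).
Proof.
have e : (fun h : R => h^-1 *: (((fun x => v (row_cons (s, x))) \o shift x) (h *: basis_row i) - v (row_cons (s, x)))) =
         (fun h : R => h^-1 *: ((v \o shift (row_cons (s, x))) (h *: basis_row (lift ord0 i)) - v (row_cons (s, x)))).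
  by apply/funext => h /=; rewrite -row_cons_basisS.
by split=> [dv|]; rewrite ?/derivable /partial ?/derive e.
Qed.

Lemma continuously_differentiable_section d (v : 'rV[R]_d.+1 -> R) (s : R) :
  continuously_differentiable v -> continuously_differentiable (fun x => v (row_cons (s, x))).
Proof.
move=> [[cv dv] cp]; split; first split.
- by move=> x; apply: continuous_comp; [exact: row_cons_continuous_r|exact: cv].
- by move=> i x; apply (partial_row_consS v s i x).1.
move=> i; rewrite (_ : partial i _ = fun x => partial (lift ord0 i) v (row_cons (s, x))).
  by move=> x; apply: continuous_comp; [exact: row_cons_continuous_r|exact: cp].
by apply/funext => x; rewrite (partial_row_consS v s i x).2.
Qed.

Lemma measurable_sqr_continuous d (f : 'rV[R]_d -> R) : continuous f ->
  measurable_fun setT (fun x => (f x ^+ 2)%:E).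
Proof.
by move=> cf; apply/measurable_EFinP; apply: measurable_funX; exact: continuous_measurable_row.
Qed.

Lemma exists_le_average (c r eta : R) (F : R -> \bar R) : 0 < r -> 0 < eta ->
  measurable_fun setT F -> (forall t, 0 <= F t)%E ->
  exists2 s, ball c r s & ((2 * r)%:E * F s <= \int[leb]_(t in ball c r) F t + eta%:E)%E.
Proof.
move=> r0 eta0 mF F0; set I := (\int[leb]_(t in _) _)%E.
have I0 : (0 <= I)%E by apply: integral_ge0.
have [Ioo|Ifin] := eqVneq I +oo%E.
  by exists c; [exact: ballxx|rewrite Ioo leey].
have If : I \is a fin_num by rewrite ge0_fin_numE// ltey.
apply: contrapT => H.
have H' t : ball c r t -> (((fine I + eta) / (2 * r))%:E <= F t)%E.
  move=> ct; rewrite leNgt; apply/negP => lt; apply: H; exists t => //.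
  rewrite -(fineK If) -EFinD; apply: le_trans (lee_wpmul2l _ (ltW lt)) _.
    by rewrite lee_fin mulr_ge0// ltW.
  by rewrite -EFinM lee_fin mulrC divfK// gt_eqF// mulr_gt0.
have : (\int[leb]_(t in ball c r) ((fine I + eta) / (2 * r))%:E <= I)%E.
  apply: ge0_le_integral => //; first exact: measurable_ball.
  - by move=> t _; rewrite lee_fin divr_ge0 ?addr_ge0 ?mulr_ge0 ?fine_ge0// ltW.
  - exact: measurable_funTS.
rewrite integral_cst; last exact: measurable_ball.
rewrite [X in (_ * X)%E](lebesgue_measure_ball c (ltW r0)) -EFinM -(fineK If) lee_fin.
by rewrite -[r *+ 2]mulr_natl divfK ?gt_eqF ?mulr_gt0//; rewrite leNgt ltrDl eta0.
Qed.

(** In [poincare_smooth], l = 2 r is the side of the cube, p the constant in dimension d, A the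
    energy of the first partial derivative and I that of the others; F and G are the energy and the
    oscillation on the chosen slice. Some of them may be infinite. *)
Lemma poincare_step_arith (l p eta : R) (F G A I : \bar R) : 0 < l -> 0 < p -> l ^+ 2 <= p ->
  0 < eta -> (0 <= F)%E -> (0 <= G)%E -> (0 <= A)%E -> (0 <= I)%E ->
  (l%:E * F <= I + (eta / (p * 4))%:E)%E ->
  (G <= p%:E * F + (eta / (l * 4))%:E)%E ->
  (((2 * l)%:E * A + 2%:E * G) * l%:E <= (2 * p)%:E * (A + I) + eta%:E)%E.
Proof.
move=> l0 p0 lp e0 F0 G0 A0 I0 HF HG.
have p2 : (0 < (2 * p)%:E)%E by rewrite lte_fin mulr_gt0.
have oo x : x = +oo%E -> ((2 * p)%:E * x + eta%:E = +oo)%E by move=> ->; rewrite gt0_muley.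
move: A0 I0 HF; case: A => [A||] // A0.
  case: I => [I||] // I0 HF; last by rewrite addey// oo// leey.
  have : (F < +oo)%E.
    rewrite ltey; apply/eqP => Foo; move: HF; rewrite Foo gt0_muley ?lte_fin//.
  move: F0 HF HG; case: F => [F||] // F0 HF HG _.
  have : (G < +oo)%E by apply: le_lt_trans HG _; rewrite -EFinM -EFinD ltry.
  move: G0 HG; case: G => [G||] // G0 HG _.
  move: A0 I0 F0 G0 HF HG; rewrite -!(EFinM, EFinD) !lee_fin => A0 I0 F0 G0 HF HG.
  have h1 : l * G <= l * (p * F + eta / (l * 4)) by rewrite ler_wpM2l// ltW.
  have h2 : p * (l * F) <= p * (I + eta / (p * 4)) by rewrite ler_wpM2l// ltW.
  have h3 : l ^+ 2 * A <= p * A by rewrite ler_wpM2r.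
  have e1 : l * (p * F + eta / (l * 4)) = p * (l * F) + eta / 4 by field; rewrite gt_eqF.
  have e2 : p * (I + eta / (p * 4)) = p * I + eta / 4 by field; rewrite gt_eqF.
  nra.
by case: I => [I||] // I0 _; rewrite ?addye// ?oo ?leey.
Qed.

(* By induction on d: m is the constant obtained on a slice whose energy is at
   most average; eta absorbs that the average is only nearly attained. *)
Lemma poincare_smooth d (c : 'rV[R]_d) r eta (v : 'rV[R]_d -> R) : 0 < r -> 0 < eta ->
  continuously_differentiable v ->
  exists m, (\int[mu d]_(x in cube c r) ((v x - m) ^+ 2)%:E <=
    (2 ^+ d * (2 * r) ^+ 2)%:E * \sum_(i < d) \int[mu d]_(x in cube c r) (partial i v x ^+ 2)%:E
    + eta%:E)%E.
Proof.
move=> r0; elim: d c eta v => [|d IH] c eta v eta0 cdv.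
  exists (v 0); rewrite integral0_eq; last first.
    by move=> x _; rewrite (_ : x = 0) ?subrr ?expr0n//; apply/rowP => -[].
  by rewrite big_ord0 mule0 add0e lee_fin ltW.
have [[cv dv] cp] := cdv.
set c' : 'rV[R]_d := \row_i c ord0 (lift ord0 i).
pose F (s : R) := (\sum_(i < d) \int[mu d]_(x in cube c' r)
  (partial (lift ord0 i) v (row_cons (s, x)) ^+ 2)%:E)%E.
have mv i : measurable_fun setT (fun x => (partial i v x ^+ 2)%:E).
  exact: measurable_sqr_continuous.
have mvc i : measurable_fun setT ((fun x => (partial i v x ^+ 2)%:E) \o @row_cons R d).
  by apply: measurableT_comp => //; exact: measurable_row_cons.
have mc' := cube_measurable c' r.
have F0 s : (0 <= F s)%E.
  by apply: sume_ge0 => i _; apply: integral_ge0 => x _; rewrite lee_fin sqr_ge0.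
have mS i : measurable_fun setT (fun s : R => (\int[mu d]_(x in cube c' r)
    (partial (lift ord0 i) v (row_cons (s, x)) ^+ 2)%:E)%E).
  apply: (measurable_tonelli_on_F (mu d) (mvc (lift ord0 i))) => //.
  by move=> p; rewrite lee_fin sqr_ge0.
have mF : measurable_fun setT F by apply: emeasurable_sum => i; exact: mS.
have mI : measurable (ball (c ord0 ord0) r) by exact: measurable_ball.
have IF : (\int[leb]_(t in ball (c ord0 ord0) r) F t =
    \sum_(i < d) \int[mu d.+1]_(x in cube c r) (partial (lift ord0 i) v x ^+ 2)%:E)%E.
  rewrite ge0_integral_sum//; first last.
  - by move=> i t _; apply: integral_ge0 => x _; rewrite lee_fin sqr_ge0.
  - by move=> i; apply: measurable_funTS; exact: mS.
  by apply: eq_bigr => i _; rewrite ge0_integral_rowS_cube// => x; rewrite lee_fin sqr_ge0.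
pose p : R := 2 ^+ d * (2 * r) ^+ 2.
have p0 : 0 < p by rewrite mulr_gt0// exprn_gt0// mulr_gt0.
pose e1 := eta / (p * 4).
pose e2 := eta / (2 * r * 4).
have e10 : 0 < e1 by rewrite divr_gt0// mulr_gt0.
have e20 : 0 < e2 by rewrite divr_gt0// !mulr_gt0.
have [s cs Fs] := exists_le_average (c ord0 ord0) r0 e10 mF F0.
have [m Hm] := IH c' e2 _ e20 (continuously_differentiable_section s cdv).
exists m.
have mvm : measurable_fun setT (fun x => ((v x - m) ^+ 2)%:E).
  apply: (@measurable_sqr_continuous _ (fun x => v x - m)) => x.
  exact: (continuousB (cv x) (@cst_continuous _ _ m x)).
rewrite ge0_integral_rowS_cube//; last by move=> x; rewrite lee_fin sqr_ge0.
pose H x := (\int[leb]_(t in ball (c ord0 ord0) r) (partial ord0 v (row_cons (t, x)) ^+ 2)%:E)%E.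
have H0 x : (0 <= H x)%E by apply: integral_ge0 => t _; rewrite lee_fin sqr_ge0.
have mH : measurable_fun (cube c' r) H.
  apply: (measurable_tonelli_on_G leb (mvc ord0)) => //.
  by move=> q; rewrite lee_fin sqr_ge0.
pose G x := ((v (row_cons (s, x)) - m) ^+ 2)%:E.
have mG : measurable_fun setT G.
  apply: (@measurable_sqr_continuous _ (fun x => v (row_cons (s, x)) - m)) => x.
  exact: (continuousB (continuous_comp (@row_cons_continuous_r _ s x) (cv (row_cons (s, x))))
    (@cst_continuous _ _ m x)).
have r2 : 0 <= 2 * r by rewrite mulr_ge0// ltW.
(* Move from (t, x) to (s, x) along the first coordinate, where the increment is bounded through
   [H x] uniformly in t, and compare with m on the slice s. *)
have stepA t : ball (c ord0 ord0) r t ->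
    (\int[mu d]_(x in cube c' r) ((v (row_cons (t, x)) - m) ^+ 2)%:E <=
     (2 * (2 * r))%:E * \int[mu d]_(x in cube c' r) H x + 2%:E * \int[mu d]_(x in cube c' r) G x)%E.
  move=> ct.
  have pG x : (0 <= G x)%E by rewrite lee_fin sqr_ge0.
  have mG' := measurable_funTS (D := cube c' r) mG.
  have r4 : (0 <= (2 * (2 * r))%:E)%E by rewrite lee_fin mulr_ge0.
  have two : (0 <= 2%:E :> \bar R)%E by rewrite lee_fin.
  rewrite -!ge0_integralZl// -ge0_integralD//; first last.
  - exact: measurable_funeM.
  - by move=> x _; rewrite mule_ge0.
  - exact: measurable_funeM.
  - by move=> x _; rewrite mule_ge0.
  apply: ge0_le_integral => //.
  - by move=> x _; rewrite lee_fin sqr_ge0.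
  - apply: measurable_funTS; apply: (measurableT_comp mvm); exact: measurable_row_cons2.
  - by apply: emeasurable_funD; exact: measurable_funeM.
  move=> x _; have dv0 u : is_derive u (1 : R) (fun t => v (row_cons (t, x))) (partial ord0 v (row_cons (u, x))).
    by apply: is_derive_row_cons0; exact: dv.
  have cp0 : continuous (fun u => partial ord0 v (row_cons (u, x))).
    by move=> u; apply: continuous_comp; [exact: row_cons_continuous_l|exact: cp].
  have := sqr_increment_ball r0 dv0 cp0 cs ct; rewrite -/(H x) => Hx.
  apply: (@le_trans _ _ (2%:E * ((v (row_cons (t, x)) - v (row_cons (s, x))) ^+ 2)%:E + 2%:E * G x)%E).
    rewrite /G -!EFinM -EFinD lee_fin -subr_ge0.
    set a := v _; set b := v _.
    have -> : 2 * (a - b) ^+ 2 + 2 * (b - m) ^+ 2 - (a - m) ^+ 2 = (a - b - (b - m)) ^+ 2 by ring.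
    exact: sqr_ge0.
  by rewrite leeD2r// (EFinM 2 (2 * r)) -muleA lee_wpmul2l// lee_fin.
pose K := ((2 * (2 * r))%:E * \int[mu d]_(x in cube c' r) H x + 2%:E * \int[mu d]_(x in cube c' r) G x)%E.
have K0 : (0 <= K)%E.
  apply: adde_ge0; apply: mule_ge0; rewrite ?lee_fin ?mulr_ge0//; try (by apply: integral_ge0 => x _; rewrite ?lee_fin ?sqr_ge0//; exact: H0). exact: ltW.
apply: (@le_trans _ _ (\int[leb]_(t in ball (c ord0 ord0) r) K)%E).
  apply: ge0_le_integral => //.
  - by move=> t _; apply: integral_ge0 => x _; rewrite lee_fin sqr_ge0.
  - apply: measurable_funTS.
    apply: (@measurable_tonelli_on_F _ _ _ _ _ (mu d) (fun q => ((v (row_cons q) - m) ^+ 2)%:E)) => //.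
      by apply: (measurableT_comp mvm); exact: measurable_row_cons.
    by move=> q; rewrite lee_fin sqr_ge0.
rewrite integral_cst// [X in (_ * X)%E](lebesgue_measure_ball (c ord0 ord0) (ltW r0)).
have EH : (\int[mu d]_(x in cube c' r) H x =
    \int[mu d.+1]_(x in cube c r) (partial ord0 v x ^+ 2)%:E)%E.
  rewrite ge0_integral_rowS_cube//; last by move=> x; rewrite lee_fin sqr_ge0.
  by rewrite (@tonelli_on _ _ _ _ _ leb (mu d) _ (mvc ord0))// => q; rewrite lee_fin sqr_ge0.
rewrite big_ord_recl -IF /K EH.
set A0 := (\int[mu d.+1]_(x in cube c r) (partial ord0 v x ^+ 2)%:E)%E.
have A00 : (0 <= A0)%E by apply: integral_ge0 => x _; rewrite lee_fin sqr_ge0.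
have IF0 : (0 <= \int[leb]_(t in ball (c ord0 ord0) r) F t)%E by apply: integral_ge0.
move: Fs Hm; rewrite -/p.
have -> : (\sum_(i < d) \int[mu d]_(x in cube c' r) (partial i (fun y => v (row_cons (s, y))) x ^+ 2)%:E)%E = F s.
  by apply: eq_bigr => i _; apply: eq_integral => x _; rewrite (partial_row_consS v s i x).2.
rewrite -/G -[r *+ 2]mulr_natl.
have -> : (2 ^+ d.+1 * (2 * r) ^+ 2 = 2 * p)%R by rewrite /p exprS -!mulrA.
have pr : (2 * r) ^+ 2 <= p.
  by rewrite /p ler_peMl ?sqr_ge0// exprn_ege1// ler1n.
have G0 : (0 <= \int[mu d]_(x in cube c' r) G x)%E.
  by apply: integral_ge0 => x _; rewrite lee_fin sqr_ge0.
move=> Fs Hm; apply: (poincare_step_arith _ p0 pr eta0 (F0 s) G0 A00 IF0 Fs Hm).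
by rewrite mulr_gt0.
Qed.

End poincare_smooth.

(** * Density and mollification *)

Section dominated_zero.
Context {R : realType} dd (T : measurableType dd) (mu : {measure set T -> \bar R}).

Lemma dominated_to_zero (U : set T) (f_ : nat -> T -> R) (g : T -> R) (eta : R) :
  measurable U -> (forall n, measurable_fun U (f_ n)) ->
  (forall x, U x -> f_ n x @[n --> \oo] --> 0) ->
  mu.-integrable U (EFin \o g) -> (forall n x, U x -> `|f_ n x| <= g x) -> 0 < eta ->
  exists N, forall n, (N <= n)%N -> (\int[mu]_(x in U) (`|f_ n x|)%:E <= eta%:E)%E.
Proof.
move=> mU mf f0 ig fg eta0.
have [|||||_ H _] := @dominated_convergence _ _ _ mu U mU (fun n => EFin \o f_ n) (cst 0%E) (EFin \o g).
- by move=> n; apply/measurable_EFinP.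
- exact: measurable_cst.
- by apply: aeW => x Ux; apply/fine_cvgP; split; [exact: nearW|exact: f0].
- exact: ig.
- by apply: aeW => x n Ux /=; rewrite lee_fin fg.
have /fine_cvgP[Hf Hc] := H.
have := @cvgr_le _ _ _ _ _ _ Hc eta eta0; move=> [N1 _ HN1]; have [N2 _ HN2] := Hf.
exists (maxn N1 N2) => n; rewrite geq_max => /andP[n1 n2].
have h2 := HN2 _ n2; have h1 := HN1 _ n1; rewrite /= in h1 h2.
have e : (\int[mu]_(x in U) `|(f_ n x)%:E - 0%E| = \int[mu]_(x in U) (`|f_ n x|)%:E)%E.
  by apply: eq_integral => x _; rewrite sube0.
by rewrite -e -(fineK h2) lee_fin.
Qed.

End dominated_zero.

Section contractions.
Context {R : realType}.
Implicit Types a p q : R.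

Lemma min_contraction a p q : `|Num.min a p - Num.min a q| <= `|p - q|.
Proof.
have h1 := ler_norm (p - q); have h2 := ler_norm (q - p); rewrite distrC in h2.
rewrite /Num.min; case: ltP => ?; case: ltP => ?; rewrite ?subrr ?normr0// ler_norml;
by apply/andP; split; lra.
Qed.

Lemma max_contraction a p q : `|Num.max a p - Num.max a q| <= `|p - q|.
Proof.
have h1 := ler_norm (p - q); have h2 := ler_norm (q - p); rewrite distrC in h2.
rewrite /Num.max; case: ltP => ?; case: ltP => ?; rewrite ?subrr ?normr0// ler_norml;
by apply/andP; split; lra.
Qed.

End contractions.

(** * Lipschitz approximation of indicator functions *)

Section approximation_sets.
Context {R : realType} {d : nat}.
Local Notation E := 'rV[R]_d.
Local Notation mu := (@lebesgue_row R d).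
Variables (U : set E) (w : E -> R).
Hypotheses (mU : measurable U) (w0 : forall x, 0 <= w x) (intw : mu.-integrable U (EFin \o w)).

Definition unit_lipschitz (l : E -> R) := bounded_lipschitz l /\ forall x, 0 <= l x <= 1.

Lemma bounded_lipschitz_measurable (l : E -> R) : bounded_lipschitz l -> measurable_fun setT l.
Proof. by move=> [M [_ HM]]; apply: continuous_measurable_row; exact: lipschitz_row_continuous HM. Qed.

Let approximable (A : set E) := measurable A /\ forall eta, 0 < eta ->
  exists2 l, unit_lipschitz l & (\int[mu]_(x in U) (`|\1_A x - l x| * w x)%:E <= eta%:E)%E.

Lemma bounded_lipschitz_cst (c : R) : bounded_lipschitz ((fun=> c) : E -> R).
Proof.
exists `|c|; split=> // x y; by rewrite subrr normr0 mulr_ge0 ?enorm_ge0.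
Qed.

Lemma bounded_lipschitzD (f g : E -> R) : bounded_lipschitz f -> bounded_lipschitz g ->
  bounded_lipschitz (fun x => f x + g x).
Proof.
move=> [M [M1 M2]] [N [N1 N2]]; exists (M + N); split=> [x|x y].
  by rewrite (le_trans (ler_normD _ _))// lerD.
by rewrite opprD addrACA (le_trans (ler_normD _ _))// mulrDl lerD.
Qed.

Lemma bounded_lipschitzZ (c : R) (f : E -> R) : bounded_lipschitz f ->
  bounded_lipschitz (fun x => c * f x).
Proof. by apply: bounded_lipschitzM; exact: bounded_lipschitz_cst. Qed.

Lemma unit_lipschitzC l : unit_lipschitz l -> unit_lipschitz (fun x => 1 - l x).
Proof.
move=> [bl l01]; split; last by move=> x; have := l01 x; lra.
have -> : (fun x => 1 - l x) = (fun x => 1 + (-1) * l x) by apply/funext => x; rewrite mulN1r.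
by apply: bounded_lipschitzD; [exact: bounded_lipschitz_cst|exact: bounded_lipschitzZ].
Qed.

Lemma unit_lipschitzM l k : unit_lipschitz l -> unit_lipschitz k ->
  unit_lipschitz (fun x => l x * k x).
Proof.
move=> [bl l01] [bk k01]; split; first exact: bounded_lipschitzM.
by move=> x; have /andP[? ?] := l01 x; have /andP[? ?] := k01 x; rewrite mulr_ge0 ?mulr_ile1.
Qed.

Let mw : measurable_fun U w.
Proof. by apply/measurable_EFinP; case/integrableP: intw. Qed.

Let mdiff A l : measurable A -> unit_lipschitz l ->
  measurable_fun U (fun x => (`|\1_A x - l x| * w x)%:E).
Proof.
move=> mA [/bounded_lipschitz_measurable ml _]; apply/measurable_EFinP.
apply: measurable_funM => //; apply: measurableT_comp => //.
apply: measurable_funB; [exact: measurable_indic|exact: measurable_funTS].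
Qed.

Let diff_ge0 A (l : E -> R) x : (0 <= (`|\1_A x - l x| * w x)%:E)%E.
Proof. by rewrite lee_fin mulr_ge0. Qed.

Let approximableC A : approximable A -> approximable (~` A).
Proof.
move=> [mA H]; split; first exact: measurableC.
move=> eta /H[l ul Hl]; exists (fun x => 1 - l x); first exact: unit_lipschitzC.
rewrite (eq_integral (fun x => (`|\1_A x - l x| * w x)%:E))// => x _.
congr ((_ * _)%:E); rewrite -normrN; congr Num.norm.
by rewrite !indicE in_setC; case: (x \in A) => /=; ring.
Qed.

Let approximableU A B : approximable A -> approximable B -> approximable (A `|` B).
Proof.
move=> [mA HA] [mB HB]; split; first exact: measurableU.
move=> eta eta0; have e2 : 0 < eta / 2 by rewrite divr_gt0.
have [l ul Hl] := HA _ e2; have [k uk Hk] := HB _ e2.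
(* The Lipschitz counterpart of the indicator of a union. The error splits into those of l and k,
   with factors of absolute value at most 1. *)
have ulk : unit_lipschitz (fun x => 1 - (1 - l x) * (1 - k x)).
  by apply: unit_lipschitzC; apply: unit_lipschitzM; exact: unit_lipschitzC.
exists (fun x => 1 - (1 - l x) * (1 - k x)).
  exact: ulk.
apply: (@le_trans _ _ (\int[mu]_(x in U) ((`|\1_A x - l x| * w x)%:E + (`|\1_B x - k x| * w x)%:E))%E).
  apply: ge0_le_integral => //.
  - by move=> x _; rewrite lee_fin mulr_ge0.
  - by apply: (mdiff _ ulk); exact: measurableU.
  - by apply: emeasurable_funD; exact: mdiff.
  move=> x _; rewrite -EFinD lee_fin -mulrDl ler_wpM2r//.
  have [/andP[l0 l1] /andP[k0 k1]] := (ul.2 x, uk.2 x).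
  have -> : \1_(A `|` B) x - (1 - (1 - l x) * (1 - k x)) =
     (\1_A x - l x) * (1 - k x) + (\1_B x - k x) * (1 - \1_A x) :> R.
    by rewrite !indicE in_setU; case: (x \in A); case: (x \in B); rewrite /=; ring.
  have i01 : (0 <= 1 - \1_A x :> R) && (1 - \1_A x <= 1 :> R) by rewrite indicE; case: (x \in A) => /=; lra.
  apply: le_trans (ler_normD _ _) _; rewrite !normrM lerD// ler_piMr//.
    by rewrite ger0_norm; lra.
  by move: i01 => /andP[? ?]; rewrite ger0_norm.
rewrite ge0_integralD//; [|exact: mdiff|exact: mdiff].
by rewrite [eta](splitr eta) EFinD leeD.
Qed.

Let approximable0 : approximable set0.
Proof.
split=> // eta eta0; exists (fun=> 0).
  by split; [exact: bounded_lipschitz_cst|move=> x; rewrite lexx ler01].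
by rewrite integral0_eq ?lee_fin ?ltW// => x _; rewrite indic0 subrr normr0 mul0r.
Qed.

Let approximable_bigcup (F : (set E)^nat) : (forall n, approximable (F n)) -> approximable (\bigcup_n F n).
Proof.
move=> aF; have mF n : measurable (F n) by case: (aF n).
have mFo : measurable (\bigcup_n F n) by exact: bigcupT_measurable.
split => // eta eta0; pose G n := \big[setU/set0]_(i < n) F i.
have aG n : approximable (G n).
  by elim: n => [|n IH]; rewrite /G ?big_ord0// big_ord_recr; exact: approximableU.
have e2 : 0 < eta / 2 by rewrite divr_gt0.
have mG n : measurable (G n) by case: (aG n).
have [|||||N HN] := @dominated_to_zero _ _ _ mu U
   (fun n x => (\1_(\bigcup_n F n) x - \1_(G n) x) * w x) w (eta / 2) mU.
- move=> n; apply: measurable_funM => //.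
  by apply: measurable_funB; exact: measurable_indic.
- move=> x Ux; apply: cvg_near_cst.
  have [[m _ Fm]|nF] := pselect ((\bigcup_n F n) x).
    near=> n; rewrite !indicE !mem_set ?subrr ?mul0r//; last by exists m.
    rewrite /G -bigcup_mkord; exists m => //=; near: n; exact: nbhs_infty_gt.
  near=> n; rewrite !indicE !memNset ?subrr ?mul0r// /G -bigcup_mkord => -[k _ Fk].
  by apply: nF; exists k.
- exact: intw.
- move=> n x Ux; rewrite normrM (ger0_norm (w0 x)) ler_piMl//.
  by rewrite !indicE; case: (x \in _); case: (x \in _); rewrite /= ?subrr ?subr0 ?sub0r ?normrN ?normr1 ?normr0.
- exact: e2.
have [_ /(_ _ e2)[l ul Hl]] := aG N.
exists l => //.
apply: (@le_trans _ _ (\int[mu]_(x in U) ((`|(\1_(\bigcup_n F n) x - \1_(G N) x) * w x|)%:E + (`|\1_(G N) x - l x| * w x)%:E))%E).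
  apply: ge0_le_integral => //.
  - exact: mdiff.
  - apply: emeasurable_funD; last exact: mdiff.
    apply/measurable_EFinP; apply: measurableT_comp => //; apply: measurable_funM => //.
    by apply: measurable_funB; exact: measurable_indic.
  move=> x _; rewrite -EFinD lee_fin normrM (ger0_norm (w0 x)) -mulrDl ler_wpM2r//.
  exact: ler_distD.
rewrite ge0_integralD//; first last.
- exact: mdiff.
- apply/measurable_EFinP; apply: measurableT_comp => //; apply: measurable_funM => //.
  by apply: measurable_funB; exact: measurable_indic.
by rewrite [eta](splitr eta) EFinD leeD// HN.
Unshelve. all: by end_near. Qed.

Let sigma_approximable : sigma_algebra setT approximable.
Proof.
split; [exact: approximable0| |exact: approximable_bigcup].
by move=> A aA; rewrite setTD; exact: approximableC.
Qed.

Let approximable_halfspace i a : approximable [set x : E | a < x ord0 i].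
Proof.
have mA : measurable [set x : E | a < x ord0 i].
  have -> : [set x : E | a < x ord0 i] = (fun x : E => x ord0 i) @^-1` [set` `]a, +oo[].
    by apply/seteqP; split => x /=; rewrite in_itv/= andbT.
  by rewrite -[X in measurable X]setTI; exact: measurable_row_coord.
split=> // eta eta0.
(* Ramps of slope n, which converge pointwise to the indicator of the open half-space. *)
pose l n (x : E) : R := Num.min 1 (n%:R * Num.max 0 (x ord0 i - a)).
have l01 n x : 0 <= l n x <= 1.
  by rewrite /l le_min ler01 ge_min lexx /= mulr_ge0// le_max lexx.
have ul n : unit_lipschitz (l n).
  split => //; exists (1 + n%:R); split=> [x|x y].
    by have /andP[? ?] := l01 n x; rewrite ger0_norm// (le_trans (_ : _ <= 1))// lerDl.
  apply: le_trans (min_contraction _ _ _) _.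
  rewrite -mulrBr normrM ger0_norm// ler_pM// ?lerDr//.
  apply: le_trans (max_contraction _ _ _) _.
  have := coord_le_enorm (x - y) i; rewrite !mxE; apply: le_trans.
  by have -> : x ord0 i - a - (y ord0 i - a) = x ord0 i - y ord0 i by ring.
have [|||||N HN] := @dominated_to_zero _ _ _ mu U
   (fun n x => (\1_[set x : E | a < x ord0 i] x - l n x) * w x) w eta mU.
- move=> n; apply: measurable_funM => //.
  apply: measurable_funB; first exact: measurable_indic.
  by apply: measurable_funTS; apply: bounded_lipschitz_measurable; case: (ul n).
- move=> x Ux; apply: cvg_near_cst.
  rewrite indicE; have [h|h] := ltP a (x ord0 i).
    have [m Hm] : exists m, 1 <= m%:R * (x ord0 i - a).
      have h0 : 0 < x ord0 i - a by rewrite subr_gt0.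
      exists (Num.bound (x ord0 i - a)^-1); rewrite -ler_pdivrMr// div1r ltW//.
      by apply: archi_boundP; rewrite invr_ge0 ltW.
    near=> n; rewrite mem_set//= /l max_r ?subr_ge0 ?(ltW h)// min_l ?subrr ?mul0r//.
    apply: le_trans Hm _; rewrite ler_wpM2r ?subr_ge0 ?(ltW h)// ler_nat.
    by near: n; exact: nbhs_infty_ge.
  near=> n; rewrite memNset /=; last by apply/negP; rewrite -leNgt.
  by rewrite /l max_l ?subr_le0// mulr0 min_r// subrr mul0r.
- exact: intw.
- move=> n x Ux; rewrite normrM (ger0_norm (w0 x)) ler_piMl//.
  by rewrite !indicE; have := l01 n x; case: (x \in _) => /= /andP[? ?]; rewrite ler_norml; apply/andP; split; lra.
- exact: eta0.
exists (l N) => //.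
rewrite (eq_integral (fun x => (`|(\1_[set x : E | a < x ord0 i] x - l N x) * w x|)%:E)) ?HN// => x _.
by rewrite normrM (ger0_norm (w0 x)).
Unshelve. all: by end_near. Qed.

(** The approximable sets form a sigma-algebra containing the half-spaces x_i > a, which generate
    all measurable sets. The weight w is constant for density in L2, and is |g| times a cutoff in
    the uniqueness of weak gradients. *)
Lemma approximation_measurable (A : set E) (eta : R) : measurable A -> 0 < eta ->
  exists2 l, unit_lipschitz l & (\int[mu]_(x in U) (`|\1_A x - l x| * w x)%:E <= eta%:E)%E.
Proof.
move=> mA eta0; suff : approximable A by case=> _; exact.
move: A mA.
suff h : <<s \big[setU/set0]_(i < d) preimage_set_system setT
    (fun x : E => x ord0 i : measurableTypeR R) measurable >> `<=` approximable by [].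
apply: smallest_sub => //.
rewrite -bigcup_seq => A [i _ [B mB <-]] /=; rewrite setTI.
move: B mB; rewrite (RGenOInfty.measurableE R).
apply: (@smallest_sub _ (sigma_algebra setT) (@RGenOInfty.G R) [set B | approximable ((fun x : E => x ord0 i) @^-1` B)]).
  have [s0 sC sU] := sigma_approximable.
  split.
  - by rewrite /= preimage_set0.
  - by move=> B aB; rewrite /= setTD preimage_setC; exact: approximableC.
  - by move=> F aF; rewrite /= preimage_bigcup; exact: approximable_bigcup.
move=> _ [a ->] /=.
have -> : (fun x : E => x ord0 i) @^-1` [set` `]a, +oo[] = [set x | a < x ord0 i].
  by apply/seteqP; split => x /=; rewrite in_itv/= andbT.
exact: approximable_halfspace.
Qed.

End approximation_sets.

(** * Square integrable functions and density of Lipschitz functions *)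

Section square_integrable.
Context {R : realType} {d : nat}.
Local Notation E := 'rV[R]_d.
Local Notation mu := (@lebesgue_row R d).
Variables (U : set E).
Hypotheses (mU : measurable U).
Implicit Types (f g h l : E -> R).

Definition square_integrable f := measurable_fun U f /\ mu.-integrable U (fun x => (f x ^+ 2)%:E).

Lemma measurable_sqr f : measurable_fun U f -> measurable_fun U (fun x => (f x ^+ 2)%:E).
Proof. by move=> mf; apply/measurable_EFinP; exact: measurable_funX. Qed.

Lemma sqr_integral_ge0 f : (0 <= \int[mu]_(x in U) (f x ^+ 2)%:E)%E.
Proof. by apply: integral_ge0 => x _; rewrite lee_fin sqr_ge0. Qed.

Lemma square_integrableP f : measurable_fun U f ->
  (\int[mu]_(x in U) (f x ^+ 2)%:E < +oo)%E -> square_integrable f.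
Proof.
move=> mf foo; split=> //; apply/integrableP; split; first exact: measurable_sqr.
under eq_integral do rewrite gee0_abs ?lee_fin ?sqr_ge0//.
exact: foo.
Qed.

Lemma square_integrable_lty f : square_integrable f -> (\int[mu]_(x in U) (f x ^+ 2)%:E < +oo)%E.
Proof. by move=> [_ /integrable_lty]; exact. Qed.

Lemma square_integrableM f g : square_integrable f -> square_integrable g ->
  mu.-integrable U (fun x => (f x * g x)%:E).
Proof.
move=> [mf f2] [mg g2].
apply: (le_integrable mU _ _ (integrableD mU f2 g2)).
- by apply/measurable_EFinP; exact: measurable_funM.
- move=> x _; rewrite /= lee_fin [leRHS]ger0_norm ?addr_ge0 ?sqr_ge0//.
  by rewrite normrM -(real_normK (num_real (f x))) -(real_normK (num_real (g x))); have := sqr_ge0 (`|f x| - `|g x|); have := sqr_ge0 (`|f x|); have := sqr_ge0 (`|g x|); nra.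
Qed.

Lemma integral_sqrD_le f g : measurable_fun U f -> measurable_fun U g ->
  (\int[mu]_(x in U) ((f x + g x) ^+ 2)%:E <=
   2%:E * \int[mu]_(x in U) (f x ^+ 2)%:E + 2%:E * \int[mu]_(x in U) (g x ^+ 2)%:E)%E.
Proof.
move=> mf mg.
have p h x : (0 <= (h x ^+ 2)%:E :> \bar R)%E by rewrite lee_fin sqr_ge0.
have m2f := measurable_sqr mf; have m2g := measurable_sqr mg.
have two : (0 <= 2%:E :> \bar R)%E by rewrite lee_fin.
rewrite -!ge0_integralZl// -ge0_integralD//; first last.
- exact: measurable_funeM.
- by move=> x _; rewrite mule_ge0.
- exact: measurable_funeM.
- by move=> x _; rewrite mule_ge0.
apply: ge0_le_integral => //.
- by move=> x _; rewrite lee_fin sqr_ge0.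
- by apply: measurable_sqr; exact: measurable_funD.
- by apply: emeasurable_funD; exact: measurable_funeM.
move=> x _; rewrite -!EFinM -EFinD lee_fin -subr_ge0.
have -> : 2 * f x ^+ 2 + 2 * g x ^+ 2 - (f x + g x) ^+ 2 = (f x - g x) ^+ 2 by ring.
exact: sqr_ge0.
Qed.

Lemma integral_sqrZ f (c : R) : measurable_fun U f ->
  (\int[mu]_(x in U) ((c * f x) ^+ 2)%:E = (c ^+ 2)%:E * \int[mu]_(x in U) (f x ^+ 2)%:E)%E.
Proof.
move=> mf; rewrite -ge0_integralZl//; first by apply: eq_integral => x _; rewrite exprMn EFinM.
- exact: measurable_sqr.
- by move=> x _; rewrite lee_fin sqr_ge0.
- by rewrite lee_fin sqr_ge0.
Qed.

Lemma square_integrableD f g : square_integrable f -> square_integrable g ->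
  square_integrable (fun x => f x + g x).
Proof.
move=> sf sg; apply: square_integrableP; first exact: measurable_funD sf.1 sg.1.
apply: le_lt_trans (integral_sqrD_le sf.1 sg.1) _.
have := square_integrable_lty sf; have := square_integrable_lty sg.
have := sqr_integral_ge0 f; have := sqr_integral_ge0 g.
case: (\int[mu]_(x in U) (f x ^+ 2)%:E)%E => // a; case: (\int[mu]_(x in U) (g x ^+ 2)%:E)%E => // b _ _ _ _.
by rewrite -!EFinM -EFinD ltry.
Qed.

Lemma square_integrableZ f (c : R) : square_integrable f -> square_integrable (fun x => c * f x).
Proof.
move=> sf; apply: square_integrableP; first exact: measurable_funM (measurable_cst _) sf.1.
rewrite (integral_sqrZ _ sf.1).
have := square_integrable_lty sf; have := sqr_integral_ge0 f.
by case: (\int[mu]_(x in U) (f x ^+ 2)%:E)%E => // a _ _; rewrite -EFinM ltry.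
Qed.

Hypothesis Uoo : (mu U < +oo)%E.

Lemma integrable_cst_on (c : R) : mu.-integrable U (EFin \o cst c).
Proof.
apply/integrableP; split; first exact/measurable_EFinP.
rewrite [X in (X < _)%E](eq_integral (cst (`|c|%:E)))// integral_cst//.
by rewrite -ge0_fin_numE ?mule_ge0// fin_numM// ge0_fin_numE.
Qed.

Lemma bounded_square_integrable f M : measurable_fun U f -> (forall x, U x -> `|f x| <= M) ->
  square_integrable f.
Proof.
move=> mf fM; split=> //.
have i1 : mu.-integrable U (EFin \o cst (M ^+ 2)) by exact: integrable_cst_on.
apply: (le_integrable mU _ _ i1); first exact: measurable_sqr.
move=> x Ux /=; rewrite lee_fin normrX (ger0_norm (sqr_ge0 _)).
rewrite ler_pXn2r ?nnegrE//; first exact: fM.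
exact: le_trans (fM _ Ux).
Qed.

Lemma square_integrable_integrable f : square_integrable f -> mu.-integrable U (EFin \o f).
Proof.
move=> sf; have s1 : square_integrable (cst 1).
  by apply: (@bounded_square_integrable _ 1) => // x _; rewrite normr1.
have := square_integrableM sf s1.
by apply: eq_integrable => // x _; rewrite /= mulr1.
Qed.

Let approx g := measurable_fun U g /\ forall eta, 0 < eta ->
  exists2 l, bounded_lipschitz l & (\int[mu]_(x in U) ((g x - l x) ^+ 2)%:E <= eta%:E)%E.

Let ml l : bounded_lipschitz l -> measurable_fun U l.
Proof. by move=> /bounded_lipschitz_measurable ?; exact: measurable_funTS. Qed.

Let approxD f g : approx f -> approx g -> approx (fun x => f x + g x).
Proof.
move=> [mf Hf] [mg Hg]; split; first exact: measurable_funD.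
move=> eta eta0; have e4 : 0 < eta / 4 by rewrite divr_gt0.
have [l bl Hl] := Hf _ e4; have [k bk Hk] := Hg _ e4.
exists (fun x => l x + k x); first exact: bounded_lipschitzD.
under eq_integral do rewrite opprD addrACA.
have mfl : measurable_fun U (fun x => f x - l x) by apply: measurable_funB => //; exact: ml.
have mgk : measurable_fun U (fun x => g x - k x) by apply: measurable_funB => //; exact: ml.
apply: le_trans (integral_sqrD_le mfl mgk) _.
have -> : eta%:E = (2%:E * (eta / 4)%:E + 2%:E * (eta / 4)%:E)%E.
  by rewrite -!EFinM -EFinD; congr EFin; field.
by rewrite leeD// lee_wpmul2l// lee_fin.
Qed.

Let approxZ f c : approx f -> approx (fun x => c * f x).
Proof.
move=> [mf Hf]; split; first exact: measurable_funM.
move=> eta eta0; have c0 : 0 < c ^+ 2 + 1 by rewrite ltr_wpDl// sqr_ge0.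
have [l bl Hl] := Hf _ (divr_gt0 eta0 c0).
exists (fun x => c * l x); first exact: bounded_lipschitzZ.
under eq_integral do rewrite -mulrBr.
rewrite integral_sqrZ; last by apply: measurable_funB => //; exact: ml.
apply: le_trans (lee_wpmul2l _ Hl) _; first by rewrite lee_fin sqr_ge0.
by rewrite -EFinM lee_fin mulrA ler_pdivrMr// mulrC ler_wpM2l ?ltW// ltrDl.
Qed.

Let approx_indic A : measurable A -> approx (\1_A).
Proof.
move=> mA; split; first exact: measurable_indic.
move=> eta eta0.
have i1 : mu.-integrable U (EFin \o cst 1) by exact: integrable_cst_on.
have [l [bl l01] Hl] := approximation_measurable mU (fun=> ler01) i1 mA eta0.
exists l => //; apply: le_trans Hl; apply: ge0_le_integral => //.
- by move=> x _; rewrite lee_fin sqr_ge0.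
- apply: measurable_sqr; apply: measurable_funB; [exact: measurable_indic|exact: ml].
- apply/measurable_EFinP; apply: measurable_funM => //; apply: measurableT_comp => //.
  apply: measurable_funB; [exact: measurable_indic|exact: ml].
move=> x _; rewrite lee_fin mulr1 -(real_normK (num_real _)) expr2 ler_piMl//.
by rewrite indicE; have /andP[? ?] := l01 x; case: (x \in A) => /=; rewrite ler_norml; apply/andP; split; lra.
Qed.

Let approx_sum I (s : seq I) (F : I -> E -> R) : (forall i, approx (F i)) ->
  approx (fun x => \sum_(i <- s) F i x).
Proof.
move=> aF; elim: s => [|i s IH].
  have -> : (fun x => \sum_(i <- [::]) F i x) = (fun x => 0 * \1_setT x).
    by apply/funext => x; rewrite big_nil mul0r.
  by apply: approxZ; exact: approx_indic.
have -> : (fun x => \sum_(j <- i :: s) F j x) = (fun x => F i x + \sum_(j <- s) F j x).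
  by apply/funext => x; rewrite big_cons.
exact: approxD.
Qed.

Let approx_limit f (f_ : nat -> E -> R) : measurable_fun U f -> (forall n, approx (f_ n)) ->
  (forall eta, 0 < eta -> exists n, (\int[mu]_(x in U) ((f x - f_ n x) ^+ 2)%:E <= eta%:E)%E) ->
  approx f.
Proof.
move=> mf af H; split => // eta eta0; have e4 : 0 < eta / 4 by rewrite divr_gt0.
have [n Hn] := H _ e4; have [mfn /(_ _ e4)[l bl Hl]] := af n.
exists l => //.
have -> : (fun x => ((f x - l x) ^+ 2)%:E) = (fun x => ((f x - f_ n x + (f_ n x - l x)) ^+ 2)%:E).
  by apply/funext => x; rewrite addrA subrK.
have mfl : measurable_fun U (fun x => f x - f_ n x) by apply: measurable_funB.
have mgk : measurable_fun U (fun x => f_ n x - l x) by apply: measurable_funB => //; exact: ml.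
apply: le_trans (integral_sqrD_le mfl mgk) _.
have -> : eta%:E = (2%:E * (eta / 4)%:E + 2%:E * (eta / 4)%:E)%E.
  by rewrite -!EFinM -EFinD; congr EFin; field.
by rewrite leeD// lee_wpmul2l// lee_fin.
Qed.

Let approx_ge0 g : square_integrable g -> (forall x, 0 <= g x) -> approx g.
Proof.
move=> [mg g2] g0.
have mEg : measurable_fun U (EFin \o g) by apply/measurable_EFinP.
have p0 x : U x -> (0 <= (EFin \o g) x)%E by rewrite lee_fin.
pose g_ n := measurable_fun_approximation.approx U (EFin \o g) n.
have ag n : approx (g_ n).
  apply: (@approxD (fun x => \sum_(k < n * 2 ^ n) k%:R / 2 ^+ n * \1_(dyadic_approx U (EFin \o g) n k) x)
    (fun x => n%:R * \1_(integer_approx U (EFin \o g) n) x)).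
    apply: approx_sum => k; apply: approxZ; apply: approx_indic.
    rewrite /dyadic_approx; case: ifPn => // _; rewrite -preimage_comp.
    by apply: mEg => //; apply/measurable_image_EFin; exact: measurable_itv.
  by apply: approxZ; apply: approx_indic; exact: emeasurable_fun_c_infty.
apply: (approx_limit mg ag) => eta eta0.
have [|||||N HN] := @dominated_to_zero _ _ _ mu U (fun n x => (g x - g_ n x) ^+ 2) (fun x => g x ^+ 2) eta mU.
- by move=> n; apply: measurable_funX; apply: measurable_funB => //; case: (ag n).
- move=> x Ux; have h := @cvg_approx _ _ _ U (EFin \o g) x p0 Ux (ltry _).
  have -> : 0 = (g x - g x) ^+ 2 by rewrite subrr expr0n.
  by apply: cvgM; apply: cvgB => //; exact: cvg_cst.
- exact: g2.
- move=> n x Ux; rewrite ger0_norm ?sqr_ge0// ler_pXn2r ?nnegrE//; last first.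
    by rewrite subr_ge0 -lee_fin; exact: (le_approx n p0 Ux).
  rewrite gerBl /g_ /measurable_fun_approximation.approx addr_ge0//.
    by apply: sumr_ge0 => k _; rewrite mulr_ge0// divr_ge0// exprn_ge0.
- exact: eta0.
exists N; apply: le_trans (HN N (leqnn _)); rewrite le_eqVlt; apply/orP; left; apply/eqP.
by apply: eq_integral => x _; rewrite ger0_norm ?sqr_ge0.
Qed.

(** From indicators to simple functions, then to nonnegative functions by their dyadic
    approximations, and finally to f through its positive and negative parts. *)
Lemma lipschitz_dense f eta : square_integrable f -> 0 < eta ->
  exists2 l, bounded_lipschitz l & (\int[mu]_(x in U) ((f x - l x) ^+ 2)%:E <= eta%:E)%E.
Proof.
move=> sf eta0; suff : approx f by case=> _; exact.
have mf := sf.1.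
have h (e : R) : square_integrable (fun x => Num.max (e * f x) 0).
  apply: square_integrableP.
    by apply: measurable_maxr => //; exact: measurable_funM.
  apply: le_lt_trans (square_integrable_lty (square_integrableZ e sf)).
  apply: ge0_le_integral => //.
  - by move=> x _; rewrite lee_fin sqr_ge0.
  - by apply: measurable_sqr; apply: measurable_maxr => //; exact: measurable_funM.
  - by apply: measurable_sqr; exact: measurable_funM.
  move=> x _; rewrite lee_fin; have [h|h] := leP (e * f x) 0.
    by rewrite expr2 mul0r sqr_ge0.
  by [].
have -> : f = fun x => Num.max (1 * f x) 0 + (-1) * Num.max (-1 * f x) 0.
  by apply/funext => x; rewrite mul1r !mulN1r; case: leP => h1; case: leP => h2; lra.
apply: approxD; last apply: approxZ; apply: approx_ge0 => // x; by rewrite le_max lexx orbT.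
Qed.

End square_integrable.

(** * Mollification in L2 *)

Section mollification.
Context {R : realType} {d : nat}.
Local Notation E := 'rV[R]_d.
Local Notation mu := (@lebesgue_row R d).
Implicit Types (U Q : set E) (f g h l v : E -> R) (x y z : E) (e : R).

(** Bumps are not normalized: mollifications divide by this mass, whose exact value never enters. *)
Definition bump_mass e : R := fine (\int[mu]_x (bump 0 e x)%:E).

Lemma bump_measurable (c : E) e : measurable_fun setT (bump c e).
Proof.
apply: continuous_measurable_row.
by have [] := smooth_c1 (product_form_smooth (bump_product_form c e)).
Qed.

Lemma bump_le_indic (c : E) e x : 0 < e -> bump c e x <= \1_(cube c e) x.
Proof.
move=> e0; rewrite indicE; case: (boolP (x \in _)) => [_|]; first exact: bump_le1.
move=> h; rewrite le_eqVlt; apply/orP; left.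
by apply: contraNT h => /(bump_neq0 e0) h; rewrite inE.
Qed.

Lemma integral_bump e : 0 < e -> (\int[mu]_x (bump 0 e x)%:E)%E = (bump_mass e)%:E.
Proof.
move=> e0; rewrite /bump_mass fineK// ge0_fin_numE; last first.
  by apply: integral_ge0 => x _; rewrite lee_fin bump_ge0.
apply: (@le_lt_trans _ _ (\int[mu]_x (\1_(cube (0 : E) e) x)%:E)%E).
  apply: ge0_le_integral => //.
  - by move=> x _; rewrite lee_fin bump_ge0.
  - by apply/measurable_EFinP; exact: bump_measurable.
  - by apply/measurable_EFinP; apply: measurable_indic; exact: cube_measurable.
  - by move=> x _; rewrite lee_fin bump_le_indic.
rewrite integral_indic// ?setIT; last exact: cube_measurable.
by rewrite [X in (X < _)%E](lebesgue_row_cube (0 : E) e0) ltry.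
Qed.

Lemma bump_mass_gt0 e : 0 < e -> 0 < bump_mass e.
Proof.
move=> e0; rewrite -lte_fin -integral_bump//.
have h0 : 0 < bump_low ^+ d * e ^+ d :> R by rewrite mulr_gt0 ?exprn_gt0 ?bump_low_gt0.
apply: (@lt_le_trans _ _ (bump_low ^+ d * e ^+ d)%:E); first by rewrite lte_fin.
have -> : (bump_low ^+ d * e ^+ d)%:E = (\int[mu]_x ((bump_low ^+ d)%:E * (\1_(cube (0 : E) (e / 2)) x)%:E))%E.
  have mc : measurable (cube (0 : E) (e / 2)) by exact: cube_measurable.
  have e2 : 0 < e / 2 by rewrite divr_gt0.
  rewrite ge0_integralZl//; try (by apply/measurable_EFinP; exact: measurable_indic);
    try (by rewrite lee_fin exprn_ge0// ltW// bump_low_gt0).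
  rewrite integral_indic// setIT [X in (_ * X)%E](lebesgue_row_cube (0 : E) e2) -EFinM.
  by congr (_ * _ ^+ _)%:E; rewrite mulrC divfK.
apply: ge0_le_integral => //.
- by move=> x _; rewrite -EFinM lee_fin mulr_ge0// exprn_ge0// ltW// bump_low_gt0.
- apply: measurable_funeM; apply/measurable_EFinP; apply: measurable_indic; exact: cube_measurable.
- by apply/measurable_EFinP; exact: bump_measurable.
move=> x _; rewrite -EFinM lee_fin indicE; case: (boolP (x \in _)) => [|_].
  by rewrite inE mulr1 => /bump_ge; exact.
by rewrite mulr0 bump_ge0.
Qed.

Lemma integral_bump_shift e z : 0 < e -> (\int[mu]_x (bump 0 e (x - z))%:E)%E = (bump_mass e)%:E.
Proof.
move=> e0; rewrite (@ge0_integral_row_shift _ _ z (fun x => (bump 0 e x)%:E)) ?integral_bump//.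
  by apply/measurable_EFinP; exact: bump_measurable.
by move=> x; rewrite lee_fin bump_ge0.
Qed.

Lemma integral_bump_reflect e x : 0 < e -> (\int[mu]_z (bump 0 e (x - z))%:E)%E = (bump_mass e)%:E.
Proof.
move=> e0; rewrite (@ge0_integral_row_reflect _ _ x (fun x => (bump 0 e x)%:E)) ?integral_bump//.
  by apply/measurable_EFinP; exact: bump_measurable.
by move=> z; rewrite lee_fin bump_ge0.
Qed.

Lemma bump_neq0_reflect e x z : 0 < e -> bump 0 e (x - z) != 0 -> cube x e z.
Proof.
by move=> e0 /(bump_neq0 e0) h i; have := h i; rewrite !mxE subr0 distrC.
Qed.

Section fixed_set.
Variables (U : set E).
Hypotheses (mU : measurable U) (Uoo : (mu U < +oo)%E).

Let bump_refl_meas e x : measurable_fun U (fun z => bump 0 e (x - z)).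
Proof. by apply: measurable_funTS; exact: product_form_comp_measurable (bump_product_form _ _). Qed.

Lemma integrable_bump e x : mu.-integrable U (fun z => (bump 0 e (x - z))%:E).
Proof.
have := @integrableM_bounded _ _ U (cst 1) (fun z => bump 0 e (x - z)) 1 mU.
move=> /(_ (integrable_cst_on mU Uoo 1) (bump_refl_meas e x)) H.
have /H : forall z, U z -> `|bump 0 e (x - z)| <= 1 by move=> z _; rewrite ger0_norm ?bump_ge0 ?bump_le1.
by apply: eq_integrable => // z _; rewrite /= mul1r.
Qed.

Lemma integral_bump_le e x : 0 < e -> \int[mu]_(z in U) bump 0 e (x - z) <= bump_mass e.
Proof.
move=> e0; rewrite -lee_fin -(integral_bump_reflect x e0) /Rintegral fineK; last first.
  exact: integrable_fin_num (integrable_bump e x).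
apply: ge0_subset_integral => //.
  by apply/measurable_EFinP; exact: product_form_comp_measurable (bump_product_form _ _).
by move=> z _; rewrite lee_fin bump_ge0.
Qed.

Lemma integral_bump_in e x : 0 < e -> cube x e `<=` U ->
  \int[mu]_(z in U) bump 0 e (x - z) = bump_mass e.
Proof.
move=> e0 xU; rewrite /Rintegral -(integral_support (D := setT))//.
  by rewrite integral_bump_reflect.
move=> z _ nUz; apply/eqP; rewrite eqe; apply: contrapT => /negP.
by move=> /(bump_neq0_reflect e0)/xU.
Qed.

Lemma conv_bump_approx e v x (a eta : R) : 0 < e -> mu.-integrable U (EFin \o v) ->
  cube x e `<=` U -> (forall z, cube x e z -> `|v z - a| <= eta) ->
  `|conv U v (bump 0 e) x - bump_mass e * a| <= bump_mass e * eta.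
Proof.
move=> e0 iv xU H.
have ib := integrable_bump e x.
have ivb := integrable_conv mU iv x (bump_product_form 0 e).
have iab : mu.-integrable U (fun z => (a * bump 0 e (x - z))%:E) by exact: (integrableZl mU a ib).
have ieb : mu.-integrable U (fun z => (eta * bump 0 e (x - z))%:E) by exact: (integrableZl mU eta ib).
rewrite mulrC -(integral_bump_in e0 xU) -RintegralZl// /conv -RintegralB// mulrC -RintegralZl//.
have iB : mu.-integrable U (EFin \o (fun z => v z * bump 0 e (x - z) - a * bump 0 e (x - z))).
  exact: (integrableB mU ivb iab).
apply: le_trans (le_normr_Rintegral mU iB) _.
apply: le_Rintegral => //; first exact: integrable_norm.
move=> z Uz; rewrite -mulrBl normrM (ger0_norm (bump_ge0 _ _ _)).
have [->|/(bump_neq0_reflect e0) zx] := eqVneq (bump 0 e (x - z)) 0; first by rewrite !mulr0.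
by rewrite ler_wpM2r ?bump_ge0 ?H.
Qed.

Lemma conv_bump_le e v x (M : R) : 0 < e -> mu.-integrable U (EFin \o v) -> 0 <= M ->
  (forall z, U z -> `|v z| <= M) -> `|conv U v (bump 0 e) x| <= bump_mass e * M.
Proof.
move=> e0 iv M0 H.
have ib := integrable_bump e x.
have ivb := integrable_conv mU iv x (bump_product_form 0 e).
have iMb : mu.-integrable U (fun z => (M * bump 0 e (x - z))%:E) by exact: (integrableZl mU M ib).
apply: le_trans (le_normr_Rintegral mU ivb) _.
apply: (@le_trans _ _ (\int[mu]_(z in U) (M * bump 0 e (x - z)))).
  apply: le_Rintegral => //; first exact: integrable_norm.
  by move=> z Uz; rewrite normrM (ger0_norm (bump_ge0 _ _ _)) ler_wpM2r ?bump_ge0 ?H.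
by rewrite RintegralZl// mulrC ler_wpM2r// integral_bump_le.
Qed.

Lemma conv_bump_measurable e v : mu.-integrable U (EFin \o v) ->
  measurable_fun setT (conv U v (bump 0 e)).
Proof.
move=> iv; apply: continuous_measurable_row.
by have [] := smooth_c1 (conv_smooth mU iv (bump_product_form 0 e)).
Qed.

(** Jensen's inequality, by integrating 2 lam g <= g^2 + lam^2 against the bump and taking the
    optimal lam = c / m. *)
Lemma conv_bump_jensen e g x : 0 < e -> square_integrable U g ->
  ((conv U g (bump 0 e) x ^+ 2)%:E <=
   (bump_mass e)%:E * \int[mu]_(z in U) (g z ^+ 2 * bump 0 e (x - z))%:E)%E.
Proof.
move=> e0 sg; have m0 := bump_mass_gt0 e0.
have ig := square_integrable_integrable mU Uoo sg.
have [mg i2] := sg.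
have ib := integrable_bump e x.
have igb := integrable_conv mU ig x (bump_product_form 0 e).
have i2b := integrable_conv mU i2 x (bump_product_form 0 e).
rewrite -(@fineK _ (\int[mu]_(z in U) _)%E); last exact: integrable_fin_num i2b.
rewrite -EFinM lee_fin -/(Rintegral _ _ _).
set c := conv _ _ _ _; set J := \int[mu]_(z in U) _; set m := bump_mass e.
pose lam := c / m.
have h : 2 * lam * c <= J + lam ^+ 2 * m.
  have i1 : mu.-integrable U (fun z => (2 * lam * (g z * bump 0 e (x - z)))%:E).
    exact: (integrableZl mU (2 * lam) igb).
  have i3 : mu.-integrable U (fun z => (lam ^+ 2 * bump 0 e (x - z))%:E).
    exact: (integrableZl mU (lam ^+ 2) ib).
  have i4 : mu.-integrable U (EFin \o (fun z => g z ^+ 2 * bump 0 e (x - z) + lam ^+ 2 * bump 0 e (x - z))).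
    exact: (integrableD mU i2b i3).
  rewrite /c /conv -RintegralZl//.
  apply: (@le_trans _ _ (\int[mu]_(z in U) (g z ^+ 2 * bump 0 e (x - z) + lam ^+ 2 * bump 0 e (x - z)))).
    apply: le_Rintegral => // z _; rewrite mulrA -mulrDl ler_wpM2r ?bump_ge0// -subr_ge0.
    have -> : g z ^+ 2 + lam ^+ 2 - 2 * lam * g z = (g z - lam) ^+ 2 by ring.
    exact: sqr_ge0.
  rewrite RintegralD// RintegralZl// lerD2l ler_wpM2l ?sqr_ge0//.
  exact: integral_bump_le.
have e1 : 2 * lam * c = 2 * (c ^+ 2 / m) by rewrite /lam; field; rewrite gt_eqF.
have e2 : lam ^+ 2 * m = c ^+ 2 / m by rewrite /lam; field; rewrite gt_eqF.
have : c ^+ 2 / m <= J by lra.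
by rewrite ler_pdivrMr// mulrC.
Qed.

Lemma measurable_row_sub : measurable_fun setT (fun p : E * E => p.1 - p.2).
Proof.
apply: measurable_fun_row => i; under eq_fun do rewrite !mxE.
apply: measurable_funB.
  exact: (measurableT_comp (@measurable_row_coord R d i) measurable_fst).
exact: (measurableT_comp (@measurable_row_coord R d i) measurable_snd).
Qed.

(** Young's inequality: after Jensen, Tonelli leaves the integral of the bump in x, which is at most
    its mass. *)
Lemma conv_bump_L2 e g Q : 0 < e -> measurable Q -> square_integrable U g ->
  (\int[mu]_(x in Q) (conv U g (bump 0 e) x ^+ 2)%:E <=
   (bump_mass e ^+ 2)%:E * \int[mu]_(z in U) (g z ^+ 2)%:E)%E.
Proof.
move=> e0 mQ sg; have m0 := bump_mass_gt0 e0.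
have ig := square_integrable_integrable mU Uoo sg.
have [mg i2] := sg.
(* g is extended by 0, since Tonelli is applied to a function measurable on the whole product. *)
pose f (p : E * E) : \bar R := (((g \_ U) p.2) ^+ 2 * bump 0 e (p.1 - p.2))%:E.
have mgU : measurable_fun setT (g \_ U) by apply/(measurable_restrictT _ mU).
have mf : measurable_fun setT f.
  apply/measurable_EFinP; apply: measurable_funM.
    by apply: measurable_funX; apply: (measurableT_comp mgU); exact: measurable_snd.
  by apply: (measurableT_comp (bump_measurable 0 e)); exact: measurable_row_sub.
have f0 p : (0 <= f p)%E by rewrite lee_fin mulr_ge0 ?sqr_ge0 ?bump_ge0.
have Ef x : (\int[mu]_(z in U) (g z ^+ 2 * bump 0 e (x - z))%:E = \int[mu]_(z in U) f (x, z))%E.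
  by apply: eq_integral => z Uz; rewrite /f /= patchE Uz.
apply: (@le_trans _ _ ((bump_mass e)%:E * \int[mu]_(x in Q) \int[mu]_(z in U) f (x, z))%E).
  have mF := measurable_tonelli_on_F mu mf f0 mQ mU.
  rewrite -ge0_integralZl//; first last.
  - by rewrite lee_fin ltW.
  - by move=> x _; exact: integral_ge0.
  apply: ge0_le_integral => //.
  - by move=> x _; rewrite lee_fin sqr_ge0.
  - by apply/measurable_EFinP; apply: measurable_funX; apply: measurable_funTS; exact: conv_bump_measurable.
  - exact: measurable_funeM.
  by move=> x _; rewrite -Ef conv_bump_jensen.
rewrite (tonelli_on mu mu mf f0 mQ mU).
have -> : (bump_mass e ^+ 2)%:E = ((bump_mass e)%:E * (bump_mass e)%:E)%E by rewrite -EFinM -expr2.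
rewrite -muleA; apply: lee_wpmul2l; first by rewrite lee_fin ltW.
have -> : ((bump_mass e)%:E * \int[mu]_(z in U) (g z ^+ 2)%:E = \int[mu]_(z in U) ((bump_mass e)%:E * (g z ^+ 2)%:E))%E.
  by rewrite ge0_integralZl//; try (by exact: measurable_sqr); try (by rewrite lee_fin ltW);
    move=> x _; rewrite lee_fin sqr_ge0.
apply: ge0_le_integral => //.
- by move=> z _; exact: integral_ge0.
- exact: (measurable_tonelli_on_G mu mf f0 mQ mU).
- by apply: measurable_funeM; exact: measurable_sqr.
move=> z Uz.
have -> : (\int[mu]_(x in Q) f (x, z) = (g z ^+ 2)%:E * \int[mu]_(x in Q) (bump 0 e (x - z))%:E)%E.
  rewrite -ge0_integralZl//.
  - by apply: eq_integral => x _; rewrite /f /= patchE mem_set.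
  - apply/measurable_EFinP; apply: measurable_funTS.
    by have /continuous_measurable_row := (smooth_c1 (product_form_smooth (product_form_affine 1 (- z) (bump_product_form 0 e)))).1;
       under eq_fun do rewrite scale1r.
  - by move=> x _; rewrite lee_fin bump_ge0.
  - by rewrite lee_fin sqr_ge0.
rewrite muleC lee_wpmul2r ?lee_fin ?sqr_ge0// -(integral_bump_shift z e0).
apply: ge0_subset_integral => //.
  apply/measurable_EFinP.
  by have /continuous_measurable_row := (smooth_c1 (product_form_smooth (product_form_affine 1 (- z) (bump_product_form 0 e)))).1;
       under eq_fun do rewrite scale1r.
by move=> x _; rewrite lee_fin bump_ge0.
Qed.

(** Through a Lipschitz approximation l of g: [A] is controlled by the contraction [conv_bump_L2]
    applied to g - l, [B] by the Lipschitz constant of l, [C] by density. Each is at most eta / 16,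
    and (2 + 4 + 4) / 16 is below 1. *)
Lemma mollification_cvg g Q e0 eta : 0 < e0 -> 0 < eta -> measurable Q ->
  (forall x, Q x -> cube x e0 `<=` U) -> square_integrable U g ->
  exists2 e1, 0 < e1 & forall e, 0 < e -> e < e1 ->
  (\int[mu]_(x in Q) ((conv U g (bump 0 e) x / bump_mass e - g x) ^+ 2)%:E <= eta%:E)%E.
Proof.
move=> e00 eta0 mQ QU sg.
have eta8 : 0 < eta / 16 by rewrite divr_gt0.
have QsU : Q `<=` U by move=> x Qx; apply: (QU x Qx) => i; rewrite subrr normr0.
have [l bl Hl] := lipschitz_dense mU Uoo sg eta8.
have [M [lM lL]] := bl.
have M0 : 0 <= M by apply: le_trans (lM 0).
have ml : measurable_fun setT l := bounded_lipschitz_measurable bl.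
have sl : square_integrable U l.
  by apply: (bounded_square_integrable mU Uoo (measurable_funTS ml)) => x _.
have sgl : square_integrable U (fun x => g x - l x).
  have := square_integrableD mU sg (square_integrableZ mU (-1) sl).
  by under eq_fun do rewrite mulN1r.
have [mg i2] := sg.
have ig := square_integrable_integrable mU Uoo sg.
have il := square_integrable_integrable mU Uoo sl.
have igl := square_integrable_integrable mU Uoo sgl.
have Qoo : (mu Q < +oo)%E by apply: le_lt_trans Uoo; apply: le_measure => //; rewrite inE.
pose q := fine (mu Q).
have q0 : 0 <= q by exact: fine_ge0.
(* Taking e at most 1 bounds e^2 by e, and a choice of e2 linear in eta is enough. *)
have [e2 e20 He2] : exists2 e2, 0 < e2 & forall e, 0 < e -> e < e2 -> (M * (d%:R * e)) ^+ 2 * q <= eta / 16.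
  pose K := (M * d%:R) ^+ 2 * q + 1.
  have K0 : 0 < K by rewrite ltr_wpDl// mulr_ge0// sqr_ge0.
  exists (Num.min 1 (eta / 16 / K)); first by rewrite lt_min ltr01 divr_gt0.
  move=> e ep; rewrite lt_min => /andP[e1 ek].
  apply: (@le_trans _ _ (K * e)); last by rewrite mulrC -ler_pdivlMr// ltW.
  apply: (@le_trans _ _ ((M * d%:R) ^+ 2 * q * e)).
    rewrite mulrA exprMn mulrAC ler_wpM2l ?mulr_ge0 ?sqr_ge0//.
    by rewrite expr2 ler_piMl ?ltW.
  by rewrite ler_wpM2r ?(ltW ep)// lerDl.
exists (Num.min e0 e2); first by rewrite lt_min e00.
move=> e e0'; rewrite lt_min => /andP[ee0 ee2].
have m0 := bump_mass_gt0 e0'.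
set m := bump_mass e in m0 *.
pose A x := conv U (fun x => g x - l x) (bump 0 e) x / m.
pose B x := conv U l (bump 0 e) x / m - l x.
pose C x := l x - g x.
have split x : conv U g (bump 0 e) x / m - g x = A x + (B x + C x).
  have -> : conv U g (bump 0 e) x = conv U (fun x => g x - l x) (bump 0 e) x + conv U l (bump 0 e) x.
    have i1 := integrable_conv mU igl x (bump_product_form 0 e).
    have i3 := integrable_conv mU il x (bump_product_form 0 e).
    rewrite /conv -RintegralD//; apply: eq_Rintegral => z _; ring.
  rewrite /A /B /C; ring.
under eq_integral do rewrite split.
have mA : measurable_fun Q A.
  apply: measurable_funM => //; apply: measurable_funTS; exact: conv_bump_measurable.
have mB : measurable_fun Q B.
  apply: measurable_funB; last exact: measurable_funTS.
  by apply: measurable_funM => //; apply: measurable_funTS; exact: conv_bump_measurable.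
have mC : measurable_fun Q C.
  by apply: measurable_funB; [exact: measurable_funTS|exact: measurable_funS mg].
apply: le_trans (integral_sqrD_le mQ mA (measurable_funD mB mC)) _.
have hA : (\int[mu]_(x in Q) (A x ^+ 2)%:E <= (eta / 16)%:E)%E.
  rewrite /A; under eq_integral do rewrite mulrC.
  rewrite (@integral_sqrZ _ _ Q mQ (conv U (fun x => g x - l x) (bump 0 e))); last first.
    by apply: measurable_funTS; exact: conv_bump_measurable.
  apply: le_trans (lee_wpmul2l _ (conv_bump_L2 e0' mQ sgl)) _; first by rewrite lee_fin sqr_ge0.
  by rewrite muleA -EFinM -exprMn mulVf ?gt_eqF// expr1n mul1e.
have hB : (\int[mu]_(x in Q) (B x ^+ 2)%:E <= (eta / 16)%:E)%E.
  apply: (@le_trans _ _ (\int[mu]_(x in Q) (((M * (d%:R * e)) ^+ 2)%:E))%E).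
    apply: ge0_le_integral => //.
    - by move=> x _; rewrite lee_fin sqr_ge0.
    - exact: measurable_sqr.
    move=> x Qx; rewrite lee_fin -(real_normK (num_real _)) ler_pXn2r ?nnegrE ?mulr_ge0 ?(ltW e0')//.
    have xU : cube x e `<=` U by apply: subset_trans (QU x Qx); apply: cubeS; exact: ltW.
    have := @conv_bump_approx e l x (l x) (M * (d%:R * e)) e0' il xU.
    move=> /(_ _)/wrap[].
      move=> z zx; apply: le_trans (lL _ _) _; rewrite ler_wpM2l//.
      by apply: cube_eclosed_ball zx; exact: ltW.
    rewrite -/m -ler_pdivrMl// mulrC.
    have {1}<- : `|m^-1| = m^-1 by rewrite ger0_norm// invr_ge0 ltW.
    rewrite -normrM.
    suff -> : (conv U l (bump 0 e) x - m * l x) * m^-1 = B x by [].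
    by rewrite /B mulrBl mulrAC divff ?mul1r// gt_eqF.
  have Eq : (mu Q = q%:E)%E by rewrite fineK// ge0_fin_numE.
  by rewrite integral_cst// [X in (_ * X)%E]Eq -EFinM lee_fin He2.
have hC : (\int[mu]_(x in Q) (C x ^+ 2)%:E <= (eta / 16)%:E)%E.
  apply: le_trans Hl; rewrite /C; under eq_integral do rewrite -sqrrN opprB.
  apply: ge0_subset_integral => //; last by move=> x _; rewrite lee_fin sqr_ge0.
  by apply: measurable_sqr; apply: measurable_funB => //; exact: measurable_funTS.
have := integral_sqrD_le mQ mB mC.
have := sqr_integral_ge0 Q A; have := sqr_integral_ge0 Q B; have := sqr_integral_ge0 Q C.
move: hA hB hC.
case: (\int[mu]_(x in Q) (A x ^+ 2)%:E)%E => // a; case: (\int[mu]_(x in Q) (B x ^+ 2)%:E)%E => // b.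
case: (\int[mu]_(x in Q) (C x ^+ 2)%:E)%E => // c ha hb hc c0 b0 a0.
have := sqr_integral_ge0 Q (fun x => B x + C x).
case: (\int[mu]_(x in Q) ((B x + C x) ^+ 2)%:E)%E => // bc.
move: ha hb hc; rewrite -!EFinM -!EFinD !lee_fin; lra.
Qed.

End fixed_set.

End mollification.

(** * Weak gradients *)

Section test_functions.
Context {R : realType} {d : nat}.
Local Notation E := 'rV[R]_d.
Local Notation mu := (@lebesgue_row R d).
Implicit Types (D S K U : set E) (f g h u v : E -> R) (x y z : E) (e : R).

Let mcst D (c : R) : measurable_fun D (cst c : E -> R).
Proof. exact: measurable_cst. Qed.

Lemma compact_measurable_row K : compact K -> measurable K.
Proof. by move=> /(compact_closed (@norm_hausdorff _ _)); exact: closed_measurable_row. Qed.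

Lemma integrable_indic_finite U : measurable U -> (mu U < +oo)%E -> mu.-integrable setT (EFin \o \1_U).
Proof.
move=> mU Uoo; apply/integrableP; split; first by apply/measurable_EFinP; exact: measurable_indic.
rewrite (eq_integral (fun x => (\1_U x)%:E)); first by rewrite integral_indic// setIT.
by move=> x _; rewrite /= ger0_norm.
Qed.

Lemma compact_row_bounded K : compact K -> exists2 r, 0 < r & K `<=` eball (0 : E) r.
Proof.
move=> /compact_bounded[M [Mr HM]]; exists (d.+1%:R * (`|M| + 1)); first by rewrite mulr_gt0// ltr_wpDl.
move=> x Kx; rewrite /eball /= subr0; apply: le_lt_trans (enorm_le_mxnorm _) _.
have : `|x| <= `|M| + 1 by apply: HM => //; rewrite ltr_pwDr// ler_norm.
move=> h; apply: (@le_lt_trans _ _ (d%:R * (`|M| + 1))); first by rewrite ler_wpM2l.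
by rewrite ltr_pM2r ?ltr_nat// ltr_wpDl.
Qed.

Lemma compact_finite_measure K : compact K -> (mu K < +oo)%E.
Proof.
move=> cK; have [r r0 Kr] := compact_row_bounded cK.
apply: (@le_lt_trans _ _ (mu (eball (0 : E) r))).
  apply: le_measure => //; rewrite inE; first exact: compact_measurable_row.
  by apply: open_measurable_row; exact: eball_open.
by apply: le_lt_trans (lebesgue_row_eball_le _ r0) _; rewrite ltry.
Qed.

Lemma compact_support_bounded f S : continuous f -> compact S ->
  (forall x, ~ S x -> f x = 0) -> exists2 M, 0 <= M & forall x, `|f x| <= M.
Proof.
move=> cf cS f0; have cfS : {within S, continuous f} by exact: continuous_subspaceT.
have [M [Mr HM]] := compact_bounded (continuous_compact cfS cS).
exists (`|M| + 1); first by rewrite addr_ge0.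
move=> x; have [Sx|nSx] := pselect (S x); last by rewrite f0// normr0 addr_ge0.
by apply: (HM (`|M| + 1)); [rewrite ltr_pwDr// ler_norm|exists x].
Qed.

Lemma test_function_eq0 D f x : test_function D f -> ~ closure [set X | f X != 0] x -> f x = 0.
Proof.
by move=> _ h; apply/eqP; apply: contrapT => /negP fx; apply: h; exact: subset_closure.
Qed.

Lemma test_partial_eq0 D f i x : test_function D f ->
  ~ closure [set X | f X != 0] x -> partial i f x = 0.
Proof.
by move=> _ h; apply/eqP; apply: contrapT => /negP/partial_support.
Qed.

Lemma test_function_sub D U f : D `<=` U -> test_function D f -> test_function U f.
Proof. by move=> DU [sf cS SD]; split=> //; exact: subset_trans DU. Qed.

Lemma integrable_compact_support D S h f M : measurable D -> measurable_fun D h -> compact S -> S `<=` D ->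
  mu.-integrable S (EFin \o h) -> continuous f -> (forall x, `|f x| <= M) ->
  (forall x, ~ S x -> f x = 0) -> mu.-integrable D (fun x => (h x * f x)%:E).
Proof.
move=> mD mh cS SD ih cf fM f0; have mS := compact_measurable_row cS.
have mf : measurable_fun setT f by exact: continuous_measurable_row.
have iS : mu.-integrable S (fun x => (h x * f x)%:E).
  by apply: (integrableM_bounded mS ih (measurable_funTS mf)) => x _; exact: fM.
apply/integrableP; split.
  apply/measurable_EFinP; apply: measurable_funM => //; exact: measurable_funTS.
rewrite (integral_support (U := S))//; first by case/integrableP: iS.
by move=> x _ nS; rewrite f0// mulr0 abse0.
Qed.

Lemma integrable_test_like S f M : compact S -> continuous f -> (forall x, `|f x| <= M) ->
  (forall x, ~ S x -> f x = 0) -> mu.-integrable setT (EFin \o f).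
Proof.
move=> cS cf fM f0.
have := integrable_compact_support measurableT (@mcst setT 1) cS (@subsetT _ S)
  (integrable_cst_on (compact_measurable_row cS) (compact_finite_measure cS) 1) cf fM f0.
by apply: eq_integrable => // x _; rewrite /= mul1r.
Qed.

Lemma integral_row_shift (b : E) (f : E -> \bar R) : measurable_fun setT f ->
  (\int[mu]_x f (x - b)%R = \int[mu]_x f x)%E.
Proof.
move=> mf; rewrite integralE [RHS]integralE; congr (_ - _)%E.
  rewrite -[RHS](@ge0_integral_row_shift _ _ b (f^\+)%E).
  - by apply: eq_integral => x _; rewrite !funeposE.
  - exact: measurable_funepos.
  - by move=> x; exact: funepos_ge0.
rewrite -[RHS](@ge0_integral_row_shift _ _ b (f^\-)%E).
- by apply: eq_integral => x _; rewrite !funenegE.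
- exact: measurable_funeneg.
- by move=> x; exact: funeneg_ge0.
Qed.

(** By translation invariance the difference f (x + h e_i) - f x has integral 0, while its Taylor
    remainder is at most M h^2 on a fixed ball. This is what makes weak gradients insensitive to
    constants. *)
Lemma integral_partial_eq0 D f i : measurable D -> test_function D f ->
  (\int[mu]_(x in D) (partial i f x)%:E = 0)%E.
Proof.
move=> mD tf; have [sf cS SD] := tf.
set S := closure _ in cS SD.
have mS := compact_measurable_row cS.
have sf1 := smooth_partial i sf; have sf2 := smooth_partial i sf1.
have [cf df] := smooth_c1 sf; have [cf1 df1] := smooth_c1 sf1; have [cf2 _] := smooth_c1 sf2.
have f0 x : ~ S x -> f x = 0 by exact: test_function_eq0 tf.
have f10 x : ~ S x -> partial i f x = 0 by exact: test_partial_eq0 tf.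
have f20 x : ~ S x -> partial i (partial i f) x = 0.
  move=> nS; apply/eqP; apply: contrapT => /negP/partial_support.
  have : [set X | partial i f X != 0] `<=` S by move=> y; exact: partial_support.
  move=> /closure_subset; rewrite -(closure_id S).1; last exact: closed_closure.
  by move=> H /H.
have [M M0 HM] := compact_support_bounded cf2 cS f20.
have [r r0 Sr] := compact_row_bounded cS.
pose B := eball (0 : E) (r + 1).
have mB : measurable B by apply: open_measurable_row; exact: eball_open.
have SB : S `<=` B by apply: subset_trans Sr _; apply: eballS; rewrite lerDl.
have Boo : (mu B < +oo)%E.
  by apply: le_lt_trans (lebesgue_row_eball_le _ _) _; rewrite ?ltry ?addr_gt0.
have [Mf Mf0 HMf] := compact_support_bounded cf cS f0.
have [Mp Mp0 HMp] := compact_support_bounded cf1 cS f10.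
have i0 : mu.-integrable setT (EFin \o f) := integrable_test_like cS cf HMf f0.
have i1 : mu.-integrable setT (EFin \o partial i f) := integrable_test_like cS cf1 HMp f10.
rewrite (integral_support (U := S) (D := D))//; last by move=> x _ /f10 ->.
rewrite -(integral_support (U := S) (D := setT))//; last by move=> x _ /f10 ->.
have i1f := integrable_fin_num measurableT i1.
rewrite -(fineK i1f) -/(Rintegral _ _ _); congr EFin.
apply/eqP; rewrite -normr_le0; apply/ler_addgt0Pl => eta eta0; rewrite addr0.
pose q := fine (mu B); have q0 : 0 <= q by exact: fine_ge0.
have Eq : (mu B = q%:E)%E by rewrite fineK// ge0_fin_numE.
have K0 : 0 < M * q + 1 by rewrite ltr_wpDl// mulr_ge0.
(* h <= 1 keeps the support of the translated function inside B, whose radius exceeds r by 1; the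
   second bound makes M q h at most eta. *)
pose h := Num.min 1 (eta / (M * q + 1)).
have h0 : 0 < h by rewrite lt_min ltr01 divr_gt0.
have h1 : h <= 1 by rewrite ge_min lexx.
pose b := h *: basis_row i : E.
have ish : mu.-integrable setT (EFin \o (fun x => f (x - - b))).
  apply/integrableP; split.
    apply/measurable_EFinP; apply: (measurableT_comp (continuous_measurable_row cf)).
    by have := measurable_row_affine 1 (- - b); under eq_fun do rewrite scale1r.
  rewrite (@ge0_integral_row_shift _ _ (- b) (fun x => `|(EFin \o f) x|%E)); first by case/integrableP: i0.
  - by apply: measurableT_comp => //; apply/measurable_EFinP; exact: continuous_measurable_row.
  - by [].
have Esh : \int[mu]_x f (x - - b) = \int[mu]_x f x.
  rewrite /Rintegral; congr fine.
  apply: (integral_row_shift (- b) (f := EFin \o f)).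
  by apply/measurable_EFinP; exact: continuous_measurable_row.
have ihp : mu.-integrable setT (EFin \o (fun x => h * partial i f x)) by exact: (integrableZl measurableT h i1).
have ids : mu.-integrable setT (EFin \o (fun x => f (x - - b) - f x)) by exact: (integrableB measurableT ish i0).
have iall : mu.-integrable setT (EFin \o (fun x => f (x - - b) - f x - h * partial i f x)).
  exact: (integrableB measurableT ids ihp).
have E1 : \int[mu]_x (f (x - - b) - f x - h * partial i f x) = - (h * \int[mu]_x partial i f x).
  by rewrite RintegralB// RintegralB// Esh subrr sub0r RintegralZl.
have iB : mu.-integrable setT (EFin \o (fun x => M * h ^+ 2 * \1_B x)).
  exact: (integrableZl measurableT (M * h ^+ 2) (integrable_indic_finite mB Boo)).
have key : h * `|\int[mu]_x partial i f x| <= M * h ^+ 2 * q.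
  rewrite -{1}(gtr0_norm h0) -normrM -normrN -E1.
  apply: le_trans (le_normr_Rintegral measurableT iall) _.
  have -> : M * h ^+ 2 * q = \int[mu]_x (M * h ^+ 2 * \1_B x).
    rewrite RintegralZl//; last exact: integrable_indic_finite.
    by rewrite /Rintegral integral_indic// setIT [X in fine X]Eq.
  apply: le_Rintegral => //; first exact: integrable_norm.
  move=> x _; rewrite (_ : x - - b = b + x); last by rewrite opprK addrC.
  have [xB|xB] := pselect (B x).
    rewrite indicE mem_set// mulr1.
    have dd y : is_derive y (basis_row i) f (partial i f y) by split => //; exact: df.
    have dd1 y : is_derive y (basis_row i) (partial i f) (partial i (partial i f) y) by split => //; exact: df1.
    have line (g g' : E -> R) : (forall y, is_derive y (basis_row i) g (g' y)) ->
        forall t : R, is_derive t (1 : R) (fun t : R => g (t *: basis_row i + x)) (g' (t *: basis_row i + x)).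
      move=> dg t; have [dv1 dv2] := dg (t *: basis_row i + x).
      have e : (fun s : R => s^-1 *: (((fun t : R => g (t *: basis_row i + x)) \o shift t) (s *: 1) - g (t *: basis_row i + x))) =
        (fun s : R => s^-1 *: ((g \o shift (t *: basis_row i + x)) (s *: basis_row i) - g (t *: basis_row i + x))).
        by apply/funext => s /=; rewrite [s *: 1]mulr1 scalerDl addrA.
      by split; rewrite ?/derivable ?/derive e.
    have := taylor_bound (line _ _ dd) (line _ _ dd1) (fun t => HM _) 0 h.
    by rewrite scale0r add0r addr0.
  have nS y : ~ B y -> ~ S y by move=> nB /SB.
  rewrite indicE memNset// mulr0 (f0 x (nS _ xB)) (f10 x (nS _ xB)) mulr0 !subr0 f0 ?normr0// => Sx.
  apply: xB; rewrite /B /eball /= subr0.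
  have := Sr _ Sx; rewrite /eball /= subr0 => xr.
  have := enormD (b + x) (- b); rewrite addrC addKr enormN enormZ (gtr0_norm h0) => hh.
  apply: le_lt_trans hh _; apply: ltr_leD xr _.
  have : enorm (basis_row i : E) <= 1.
    have := @enormZ R d 1 (basis_row i); rewrite scale1r normr1 mul1r => _.
    rewrite -(@ler_pXn2r _ 2) ?nnegrE ?enorm_ge0// enorm2 expr1n /edot (bigD1 i)//= big1; last first.
      by move=> j /negbTE ji; rewrite !mxE ji andbF mul0r.
    by rewrite !mxE !eqxx mulr1 addr0.
  by move=> e1; apply: mulr_ile1; rewrite ?enorm_ge0 ?(ltW h0).
have : `|\int[mu]_x partial i f x| <= M * q * h.
  by rewrite -(ler_pM2l h0) (le_trans key)// le_eqVlt; apply/orP; left; apply/eqP; ring.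
move=> H; apply: le_trans H _; apply: (@le_trans _ _ ((M * q + 1) * h)).
  by rewrite ler_wpM2r ?(ltW h0)// lerDl.
by rewrite mulrC -ler_pdivlMr// /h ge_min lexx orbT.
Qed.

Section weak_gradients.
Implicit Types (G : E -> E).

Lemma weak_grad_restrict D U u G : measurable D -> measurable U -> U `<=` D ->
  is_weak_grad D u G -> is_weak_grad U u G.
Proof.
move=> mD mU UD [mG iG wG]; split.
- exact: measurable_funS mG.
- by move=> K cK KU i; apply: iG => //; exact: subset_trans UD.
move=> f tf i; have := wG f (test_function_sub UD tf) i.
have [_ cS SU] := tf.
rewrite (integral_support (U := U))//; last first.
  by move=> x _ nU; rewrite (test_partial_eq0 i tf) ?mulr0// => /SU.
move=> ->; rewrite (integral_support (U := U))// => x _ nU.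
by rewrite (test_function_eq0 tf) ?mulr0// => /SU.
Qed.

Lemma square_integrable_compact_integrable K u : compact K -> measurable_fun K u ->
  (\int[mu]_(x in K) (u x ^+ 2)%:E < +oo)%E -> mu.-integrable K (EFin \o u).
Proof.
move=> cK mu_ uoo; have mK := compact_measurable_row cK.
apply: square_integrable_integrable => //; first exact: compact_finite_measure.
exact: square_integrableP.
Qed.

Lemma is_weak_grad_shift D u v c G : measurable D -> measurable_fun D u ->
  (forall K, compact K -> K `<=` D -> (\int[mu]_(x in K) (u x ^+ 2)%:E < +oo)%E) ->
  (forall x, D x -> v x = u x + c) -> is_weak_grad D u G -> is_weak_grad D v G.
Proof.
move=> mD mu_ lu vu [mG iG wG]; split=> // f tf i; rewrite -wG//.
have [sf cS SD] := tf.
have [cf1 _] := smooth_c1 (smooth_partial i sf).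
have f10 x := @test_partial_eq0 _ _ i x tf.
have [Mp Mp0 HMp] := compact_support_bounded cf1 cS f10.
have iu := square_integrable_compact_integrable cS (measurable_funS mD SD mu_) (lu _ cS SD).
have i1 := integrable_compact_support mD mu_ cS SD iu cf1 HMp f10.
have ic := integrable_compact_support mD (@mcst D c) cS SD
  (integrable_cst_on (compact_measurable_row cS) (compact_finite_measure cS) c) cf1 HMp f10.
transitivity (\int[mu]_(x in D) ((u x * partial i f x)%:E + (c * partial i f x)%:E))%E.
  by apply: eq_integral => x; rewrite inE => /vu ->; rewrite mulrDl EFinD.
rewrite integralD// -[RHS]adde0; congr (_ + _)%E.
have ip : mu.-integrable D (EFin \o partial i f).
  have := integrable_compact_support mD (@mcst D 1) cS SD
    (integrable_cst_on (compact_measurable_row cS) (compact_finite_measure cS) 1) cf1 HMp f10.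
  by apply: eq_integrable => // x _; rewrite /= mul1r.
by under eq_integral do rewrite EFinM; rewrite integralZl// integral_partial_eq0// mule0.
Qed.

(** An equality of functions, not only almost everywhere: u and v have the same set of weak
    gradients, so the same one is chosen. *)
Lemma weak_grad_shift D u v c : measurable D -> measurable_fun D u ->
  (forall K, compact K -> K `<=` D -> (\int[mu]_(x in K) (u x ^+ 2)%:E < +oo)%E) ->
  (forall K, compact K -> K `<=` D -> (\int[mu]_(x in K) (v x ^+ 2)%:E < +oo)%E) ->
  (forall x, D x -> v x = u x + c) -> weak_grad D v = weak_grad D u.
Proof.
move=> mD mu_ lu lv vu; rewrite /weak_grad; congr xget; apply/funext => G; apply/propext; split.
  apply: (@is_weak_grad_shift _ _ _ (- c)) => //.
    apply: (@eq_measurable_fun _ _ _ _ D (fun x => u x + c)).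
      by move=> x; rewrite inE => /vu ->.
    exact: measurable_funD.
  by move=> x /vu ->; rewrite addrK.
exact: is_weak_grad_shift vu.
Qed.

End weak_gradients.

End test_functions.

(** * Uniqueness of weak gradients on balls *)

Section weak_grad_uniqueness.
Context {R : realType} {d : nat}.
Local Notation E := 'rV[R]_d.
Local Notation mu := (@lebesgue_row R d).
Implicit Types (D S K U : set E) (f g h l u v : E -> R) (x y z : E) (e : R).

Section orthogonal_to_tests.
Variables (P : E) (r : R) (g : E -> R).
Let B := eball P r.
Hypotheses (mg : measurable_fun B g)
  (ig : forall K, compact K -> K `<=` B -> mu.-integrable K (EFin \o g))
  (g0 : forall f, test_function B f -> (\int[mu]_(x in B) (g x * f x)%:E = 0)%E).

Let mB : measurable B. Proof. by apply: open_measurable_row; exact: eball_open. Qed.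

(** Orthogonality to smooth test functions extends to Lipschitz functions supported well inside the
    ball, since their mollifications are test functions that converge uniformly. *)
Let integral_lipschitz_eq0 s l : 0 < s -> 0 < r -> bounded_lipschitz l ->
  (forall x, ~ eclosed_ball P (r - 2 * s) x -> l x = 0) ->
  \int[mu]_(x in eclosed_ball P (r - s)) (g x * l x) = 0.
Proof.
move=> s0 r0 bl l0; have [L [lL lip]] := bl.
have L0 : 0 <= L by apply: le_trans (lL 0).
set K' := eclosed_ball P (r - s).
have cK' : compact K' by exact: eclosed_ball_compact.
have mK' := compact_measurable_row cK'.
have K'B : K' `<=` B by apply: eclosed_ball_eball; rewrite gtrBl.
have ml : measurable_fun setT l := bounded_lipschitz_measurable bl.
have Boo : (mu B < +oo)%E by apply: le_lt_trans (lebesgue_row_eball_le _ r0) _; rewrite ltry.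
have il : mu.-integrable B (EFin \o l).
  apply: (square_integrable_integrable mB Boo).
  by apply: (bounded_square_integrable mB Boo (measurable_funTS ml)) => x _.
have igK := ig cK' K'B.
have igl : mu.-integrable K' (EFin \o (fun x => g x * l x)).
  by apply: (integrableM_bounded mK' igK (measurable_funTS ml)) => x _; exact: lL.
have inorm : mu.-integrable K' (EFin \o (fun x => `|g x|)) by exact: integrable_norm.
pose J := \int[mu]_(x in K') `|g x|.
have J0 : 0 <= J by apply: Rintegral_ge0.
apply/eqP; rewrite -normr_le0; apply/ler_addgt0Pl => eta eta0; rewrite addr0.
have C0 : 0 < L * d%:R * J + 1 by rewrite ltr_wpDl// !mulr_ge0.
(* The first bound gives d e <= s / 2, so the mollification of l, which lives within r - 2 s of P,
   is supported in K'; the second makes the uniform error, integrated against |g|, at most eta. *)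
pose e := Num.min (s / (2 * d.+1%:R)) (eta / (L * d%:R * J + 1)).
have e0 : 0 < e by rewrite lt_min !divr_gt0// mulr_gt0.
have de : d%:R * e <= s / 2.
  have e1 : e <= s / (2 * d.+1%:R) by rewrite ge_min lexx.
  apply: le_trans (ler_wpM2l (ler0n _ _) e1) _.
  rewrite mulrA ler_pdivrMr ?mulr_gt0// mulrA divfK// mulrC ler_pM2l// ler_nat; exact: leqnSn.
have ds : s / 2 < s by rewrite ltr_pdivrMr// ltr_pMr// ltr1n.
pose k := bump (0 : E) e.
have pk : product_form k by exact: bump_product_form.
pose m := @bump_mass R d e.
have m0 : 0 < m by exact: bump_mass_gt0.
pose phi := conv B l k.
have phi0 x : ~ K' x -> phi x = 0.
  move=> nK; rewrite /phi /conv /Rintegral integral0_eq// => z Bz.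
  have [k0|/(bump_neq0_reflect e0) zx] := eqVneq (k (x - z)) 0; first by rewrite k0 mulr0.
  rewrite l0 ?mul0r// => zK; apply: nK; rewrite /K' /eclosed_ball /=.
  have := cube_eclosed_ball (ltW e0) zx; rewrite /eclosed_ball /= enormB => xz.
  apply: le_trans (enorm_tri z _ _) _; move: zK; rewrite /eclosed_ball /= => zK; lra.
have tphi : test_function B phi.
  have clS : closure [set x | phi x != 0] `<=` K'.
    rewrite [X in _ `<=` X](closure_id K').1; last exact: eclosed_ball_closed.
    by apply: closure_subset => x /= /eqP nz; apply: contrapT => /phi0.
  split; [exact: conv_smooth|by apply: (subclosed_compact _ cK' clS); exact: closed_closure|].
  exact: subset_trans clS K'B.
have E0 : \int[mu]_(x in K') (g x * phi x) = 0.
  rewrite /Rintegral -(integral_support (D := B))//; first by rewrite g0.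
  by move=> x _ nK; rewrite phi0// mulr0.
have phib x : `|phi x| <= m * L by apply: conv_bump_le => // z _.
have mphi : measurable_fun setT phi by exact: conv_bump_measurable.
have igphi : mu.-integrable K' (EFin \o (fun x => g x * phi x)).
  by apply: (integrableM_bounded mK' igK (measurable_funTS mphi)) => x _; exact: phib.
have imgl : mu.-integrable K' (EFin \o (fun x => m * (g x * l x))) by exact: (integrableZl mK' m igl).
have E1 : \int[mu]_(x in K') (m * (g x * l x) - g x * phi x) = m * \int[mu]_(x in K') (g x * l x).
  by rewrite RintegralB// E0 subr0 RintegralZl.
have : m * `|\int[mu]_(x in K') (g x * l x)| <= m * (L * (d%:R * e)) * J.
  rewrite -{1}(gtr0_norm m0) -normrM -E1.
  have iD : mu.-integrable K' (EFin \o (fun x => m * (g x * l x) - g x * phi x)).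
    exact: (integrableB mK' imgl igphi).
  apply: le_trans (le_normr_Rintegral mK' iD) _.
  rewrite /J -RintegralZl//; apply: le_Rintegral => //.
  - exact: integrable_norm.
  - exact: (integrableZl mK' _ inorm).
  move=> x Kx.
  have -> : m * (g x * l x) - g x * phi x = - ((phi x - m * l x) * g x) by ring.
  rewrite normrN normrM ler_wpM2r//.
  apply: conv_bump_approx => //.
    move=> z /(cube_eclosed_ball (ltW e0)); rewrite /eclosed_ball /B /eball /= => zx.
    have := enorm_tri x z P; move: Kx; rewrite /K' /eclosed_ball /=; lra.
  move=> z /(cube_eclosed_ball (ltW e0)) zx; apply: le_trans (lip _ _) _.
  by rewrite ler_wpM2l.
rewrite -mulrA ler_pM2l// => H; apply: le_trans H _.
apply: (@le_trans _ _ ((L * d%:R * J + 1) * e)).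
  have -> : L * (d%:R * e) * J = L * d%:R * J * e by ring.
  by rewrite ler_wpM2r ?(ltW e0)// lerDl.
by rewrite mulrC -ler_pdivlMr// /e ge_min lexx orbT.
Qed.

(** g is tested against psi times a Lipschitz approximation of the indicator of g > 0. In the limit
    the nonnegative integral of g^+ psi is at most 0, hence g^+ psi vanishes almost everywhere. *)
Let ae_le0 s : 0 < s -> 0 < r -> {ae mu, forall x, eball P (r - 2 * s) x -> g x <= 0}.
Proof.
move=> s0 r0; set K' := eclosed_ball P (r - s).
have cK' : compact K' by exact: eclosed_ball_compact.
have mK' := compact_measurable_row cK'.
have K'B : K' `<=` B by apply: eclosed_ball_eball; rewrite gtrBl.
have igK := ig cK' K'B.
have mgK : measurable_fun K' g by exact: measurable_funS mg.
(* A Lipschitz weight, positive exactly on the ball of radius r - 2 s and therefore supported where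
   [integral_lipschitz_eq0] applies. *)
pose psi x := Num.max 0 (r - 2 * s - enorm (x - P)).
have psi0 x : 0 <= psi x by rewrite le_max lexx.
have psir x : `|psi x| <= r.
  rewrite ger0_norm// /psi ge_max (ltW r0)/=.
  by have := enorm_ge0 (x - P); lra.
have bpsi : bounded_lipschitz psi.
  exists (r + 1); split=> [x|x y]; first by rewrite (le_trans (psir x))// lerDl.
  apply: le_trans (max_contraction _ _ _) _.
  have -> : r - 2 * s - enorm (x - P) - (r - 2 * s - enorm (y - P)) = - (enorm (x - P) - enorm (y - P)) by ring.
  rewrite normrN; apply: le_trans (enormB_lip _ _ _) _.
  by rewrite ler_peMl ?enorm_ge0// lerDr ltW.
have mpsi := bounded_lipschitz_measurable bpsi.
pose w x := `|(g \_ K') x| * psi x.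
have iw0 : mu.-integrable K' (fun x => (`|g x| * psi x)%:E).
  by apply: (integrableM_bounded mK' (integrable_norm igK) (measurable_funTS mpsi)) => x _; exact: psir.
have iw : mu.-integrable K' (EFin \o w).
  by apply: eq_integrable iw0 => // x xK; rewrite /w /= patchE xK.
have w0 x : 0 <= w x by rewrite mulr_ge0.
pose A := K' `&` [set x | 0 < g x].
have mA : measurable A.
  have -> : A = K' `&` g @^-1` [set` `]0, +oo[].
    by apply/seteqP; split => x /=; rewrite /A /= in_itv/= andbT.
  exact: mgK.
have iA : mu.-integrable K' (EFin \o (fun x => g x * (psi x * \1_A x))).
  apply: (@integrableM_bounded _ _ _ _ _ r mK' igK).
    by apply: measurable_funM; [exact: measurable_funTS|exact: measurable_indic].
  move=> x _; rewrite normrM -[leRHS]mulr1 ler_pM//.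
  by rewrite indicE; case: (_ \in _); rewrite ?normr1 ?normr0.
have pA x : K' x -> 0 <= g x * (psi x * \1_A x).
  move=> Kx; rewrite indicE; case: (boolP (x \in A)) => [|_]; last by rewrite !mulr0.
  by rewrite inE => -[_ /= gx]; rewrite mulr1 mulr_ge0// ltW.
have small : \int[mu]_(x in K') (g x * (psi x * \1_A x)) <= 0.
  apply/ler_addgt0Pl => eta eta0; rewrite addr0.
  have [l [bl l01] Hl] := approximation_measurable mK' w0 iw mA eta0.
  have bpl := bounded_lipschitzM bpsi bl.
  have E0 := integral_lipschitz_eq0 s0 r0 bpl.
  have {}E0 : \int[mu]_(x in K') (g x * (psi x * l x)) = 0.
    apply: E0 => x nK; rewrite /psi max_l ?mul0r// subr_le0 leNgt; apply/negP => h.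
    by apply: nK; rewrite /eclosed_ball /= ltW.
  have ml := bounded_lipschitz_measurable bl.
  have ilp : mu.-integrable K' (EFin \o (fun x => g x * (psi x * l x))).
    apply: (@integrableM_bounded _ _ _ _ _ r mK' igK).
      by apply: measurable_funM; exact: measurable_funTS.
    move=> x _; rewrite normrM -[leRHS]mulr1 ler_pM//.
    by have /andP[? ?] := l01 x; rewrite ger0_norm.
  rewrite -[leLHS]subr0 -E0 -RintegralB//.
  have iD : mu.-integrable K' (EFin \o (fun x => g x * (psi x * \1_A x) - g x * (psi x * l x))).
    exact: (integrableB mK' iA ilp).
  have iW : mu.-integrable K' (EFin \o (fun x => `|\1_A x - l x| * w x)).
    have : mu.-integrable K' (fun x => (w x * `|\1_A x - l x|)%:E).
      apply: (@integrableM_bounded _ _ _ _ _ 1 mK' iw).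
        apply: measurableT_comp => //; apply: measurable_funB; first exact: measurable_indic.
        exact: measurable_funTS.
      move=> x _; rewrite normr_id; have /andP[? ?] := l01 x; rewrite indicE.
      by case: (_ \in _) => /=; rewrite ler_norml; apply/andP; split; lra.
    by apply: eq_integrable => // x _; rewrite /= mulrC.
  apply: (@le_trans _ _ (\int[mu]_(x in K') (`|\1_A x - l x| * w x))).
    apply: le_Rintegral => // x Kx; rewrite /w patchE mem_set//.
    have -> : g x * (psi x * \1_A x) - g x * (psi x * l x) = (\1_A x - l x) * (g x * psi x) by ring.
    by rewrite (le_trans (ler_norm _))// !normrM (ger0_norm (psi0 x)).
  by rewrite -lee_fin /Rintegral fineK//; exact: integrable_fin_num iW.
have z0 : (\int[mu]_(x in K') `|(g x * (psi x * \1_A x))%:E| = 0)%E.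
  have e : (\int[mu]_(x in K') `|(g x * (psi x * \1_A x))%:E| = \int[mu]_(x in K') (g x * (psi x * \1_A x))%:E)%E.
    by apply: eq_integral => x; rewrite inE => Kx; rewrite gee0_abs// lee_fin pA.
  apply/eqP; rewrite eq_le; apply/andP; split; last by apply: integral_ge0.
  by rewrite e -(fineK (integrable_fin_num mK' iA)) lee_fin.
have /ae_eq_integral_abs := z0 => /(_ mK').
move=> /(_ (measurable_int _ iA)).
apply: filterS => x H xP.
have Kx : K' x by rewrite /K' /eclosed_ball /= ltW// (lt_trans xP)// ltrD2l ltrN2 ltr_pMl// ltr1n.
rewrite leNgt; apply/negP => gx.
have := H Kx; move=> -[]; rewrite indicE mem_set; last by split.
move/eqP; rewrite mulr1 mulf_eq0 gt_eqF//= /psi gt_eqF// lt_max subr_gt0.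
by move: xP; rewrite /eball /= => ->; rewrite orbT.
Qed.

Lemma ball_ae_le0 : 0 < r -> {ae mu, forall x, B x -> g x <= 0}.
Proof.
move=> r0.
have : {ae mu, forall x, forall m : nat, eball P (r - 2 * (r / m.+1%:R)) x -> g x <= 0}.
  by apply/ae_foralln => m; apply: ae_le0 => //; rewrite divr_gt0.
apply: filterS => x H Bx.
have [m] := @ltr_add_invr R 0 ((r - enorm (x - P)) / (2 * r)) ltac:(by rewrite divr_gt0 ?subr_gt0// mulr_gt0).
rewrite add0r => Hm; apply: (H m); rewrite /eball /=.
by move: Hm; rewrite ltr_pdivlMr ?mulr_gt0//; set q := m.+1%:R^-1; nra.
Qed.

End orthogonal_to_tests.

Lemma ball_ae_eq0 P r g : 0 < r -> measurable_fun (eball P r) g ->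
  (forall K, compact K -> K `<=` eball P r -> mu.-integrable K (EFin \o g)) ->
  (forall f, test_function (eball P r) f -> (\int[mu]_(x in eball P r) (g x * f x)%:E = 0)%E) ->
  {ae mu, forall x, eball P r x -> g x = 0}.
Proof.
move=> r0 mg ig g0.
have h1 := ball_ae_le0 mg ig g0 r0.
have h2 : {ae mu, forall x, eball P r x -> - g x <= 0}.
  apply: ball_ae_le0 => //.
  - exact: measurableT_comp.
  - by move=> K cK KB; have := integrableN (ig K cK KB); apply: eq_integrable => //; exact: compact_measurable_row.
  move=> f tf; under eq_integral do rewrite mulNr -mulrN.
  apply: g0; have [sf cS SB] := tf.
  have e0 : [set X | - f X != 0] = [set X | f X != 0] by apply/seteqP; split => x /=; rewrite oppr_eq0.
  split; rewrite ?e0//.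
  have -> : (fun x => - f x) = (fun x => (fun=> -1) x * f x) by apply/funext => x; rewrite mulN1r.
  apply: smoothM => //.
  apply: (@smooth_of_stable_class _ _ (fun f => exists c, f = fun=> c)) => [_ [c ->]|_ i [c ->]|].
  - by split=> [x|i x]; [exact: cst_continuous|exact: derivable_cst].
  - by exists 0; apply/funext => x; exact: derive_cst.
  - by exists (-1).
apply: filterS2 h1 h2 => x h1 h2 Bx; apply/eqP.
by rewrite eq_le h1//= -oppr_le0 h2.
Qed.

Lemma weak_grad_ball_unique P r u (G1 G2 : E -> E) : 0 < r ->
  is_weak_grad (eball P r) u G1 -> is_weak_grad (eball P r) u G2 ->
  {ae mu, forall x, eball P r x -> G1 x = G2 x}.
Proof.
move=> r0 [mG1 iG1 wG1] [mG2 iG2 wG2].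
have mB : measurable (eball P r) by apply: open_measurable_row; exact: eball_open.
have mco (G : E -> E) i : measurable_fun (eball P r) G -> measurable_fun (eball P r) (fun x => G x ord0 i).
  by move=> mG; exact: (measurableT_comp (@measurable_row_coord R d i) mG).
suff H i : {ae mu, forall x, eball P r x -> G1 x ord0 i - G2 x ord0 i = 0}.
  have := @filter_forall _ _ _ _ (ae_filter_ringOfSetsType mu) H.
  by apply: filterS => x Hx Bx; apply/rowP => i; apply/eqP; rewrite -subr_eq0; apply/eqP/Hx.
apply: ball_ae_eq0 => //.
- by apply: measurable_funB; exact: mco.
- move=> K cK KB; have := integrableB (compact_measurable_row cK) (iG1 K cK KB i) (iG2 K cK KB i).
  by apply: eq_integrable => //; exact: compact_measurable_row.
move=> f tf; have := wG1 f tf i; rewrite (wG2 f tf i) => /oppe_inj E12.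
have [sf cS SB] := tf; have [cf _] := smooth_c1 sf.
have f0 x := @test_function_eq0 _ _ _ f x tf.
have [M _ fM] := compact_support_bounded cf cS f0.
have i1 := integrable_compact_support mB (mco _ i mG1) cS SB (iG1 _ cS SB i) cf fM f0.
have i2 := integrable_compact_support mB (mco _ i mG2) cS SB (iG2 _ cS SB i) cf fM f0.
transitivity (\int[mu]_(x in eball P r) ((G1 x ord0 i * f x)%:E - (G2 x ord0 i * f x)%:E))%E.
  by apply: eq_integral => x _; rewrite mulrBl EFinB.
by rewrite integralB// E12 subee//; exact: integrable_fin_num i1.
Qed.

Lemma is_weak_grad_weak_grad D u G : is_weak_grad D u G -> is_weak_grad D u (weak_grad D u).
Proof. by move=> wG; rewrite /weak_grad; apply: xgetPex; exists G. Qed.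

(** The gradients chosen on the ball and on D are unrelated: [DeGiorgi_Nash] speaks of the former,
    the Carleson energy of the latter. *)
Lemma weak_grad_ball_ae D P r u G : measurable D -> 0 < r -> eball P r `<=` D -> is_weak_grad D u G ->
  {ae mu, forall x, eball P r x -> weak_grad (eball P r) u x = G x}.
Proof.
move=> mD r0 BD wG.
have mB : measurable (eball P r) by apply: open_measurable_row; exact: eball_open.
have wB := weak_grad_restrict mD mB BD wG.
exact: weak_grad_ball_unique (is_weak_grad_weak_grad wB) wB.
Qed.

End weak_grad_uniqueness.

(** * Poincare and Caccioppoli inequalities *)

Section weak_poincare_caccioppoli.
Context {R : realType} {d : nat}.
Local Notation E := 'rV[R]_d.
Local Notation mu := (@lebesgue_row R d).
Implicit Types (D S K U : set E) (f g h l u v : E -> R) (x y z : E) (e : R).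

Lemma convZ U (c : R) u k x : measurable U -> mu.-integrable U (EFin \o u) -> product_form k ->
  conv U (fun z => c * u z) k x = c * conv U u k x.
Proof.
move=> mU iu pk; rewrite /conv -RintegralZl//; last exact: integrable_conv.
by apply: eq_Rintegral => z _; rewrite mulrA.
Qed.

Lemma cube_finite_measure (P : E) r : 0 < r -> (mu (cube P r) < +oo)%E.
Proof. by move=> r0; rewrite lebesgue_row_cube// ltry. Qed.

Lemma cube_sub (P x : E) r s t : cube P r x -> r + s <= t -> cube x s `<=` cube P t.
Proof.
move=> Px rst z xz i; apply: le_lt_trans (ler_distD (x ord0 i) _ _) _.
by apply: lt_le_trans rst; rewrite addrC ltrD.
Qed.

Lemma closed_cube_sub (P x : E) r s t : closed_cube P r x -> r + s < t -> closed_cube x s `<=` cube P t.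
Proof.
move=> Px rst z xz i; apply: le_lt_trans (ler_distD (x ord0 i) _ _) _.
by apply: le_lt_trans rst; rewrite addrC lerD.
Qed.

(** The normalizing factor is put on u, so that the kernel remains a plain [bump]. *)
Definition mollify U e u := conv U (fun z => (@bump_mass R d e)^-1 * u z) (bump 0 e).

Section mollify_weak_grad.
Variables (D U : set E) (u : E -> R) (G : E -> E) (P : E) (t : R).
Hypotheses (UE : U = cube P t) (t0 : 0 < t) (UD : U `<=` D)
  (wG : is_weak_grad D u G) (su : square_integrable U u)
  (sG : forall i, square_integrable U (fun x => G x ord0 i)).

Let mU : measurable U. Proof. by rewrite UE; exact: cube_measurable. Qed.
Let Uoo : (mu U < +oo)%E. Proof. by rewrite UE; exact: cube_finite_measure. Qed.
Let iu : mu.-integrable U (EFin \o u). Proof. exact: square_integrable_integrable. Qed.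

Lemma mollifyE e x : mollify U e u x = conv U u (bump 0 e) x / @bump_mass R d e.
Proof.
have pf := bump_product_form (0 : E) e.
by rewrite /mollify convZ// mulrC.
Qed.

Lemma mollify_smooth e : smooth (mollify U e u).
Proof.
apply: conv_smooth => //; last exact: bump_product_form.
exact: (integrableZl mU _ iu).
Qed.

Lemma mollify_partial e i x s : 0 < e -> closed_cube P s x -> s + e < t ->
  partial i (mollify U e u) x = conv U (fun z => G z ord0 i) (bump 0 e) x / @bump_mass R d e.
Proof.
move=> e0 Px set_; have pk := bump_product_form (0 : E) e.
rewrite /mollify conv_partial//; last exact: (integrableZl mU _ iu).
rewrite convZ//; last exact: product_form_partial.
rewrite mulrC; congr (_ / _).
have H1 : closed_cube x e `<=` U by rewrite UE; exact: closed_cube_sub Px set_.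
have H2 z : bump 0 e (x - z) != 0 -> closed_cube x e z by move=> /(bump_neq0_reflect e0)/cube_closed_cube.
exact: (conv_weak_grad i mU iu wG UD pk (closed_cube_compact (ltW e0)) H1 H2).
Qed.

(** [poincare_smooth] is applied to a mollification V on the small cube; its partial derivatives
    there are mollifications of G, whose L2 norms do not exceed those of G on the large cube. The
    slack eta avoids passing to the limit in the constant c. *)
Lemma poincare_weak r eta : 0 < r -> r < t -> 0 < eta ->
  exists c, (\int[mu]_(x in cube P r) ((u x - c) ^+ 2)%:E <=
    (2 * (2 ^+ d * (2 * r) ^+ 2))%:E *
      \sum_(i < d) \int[mu]_(x in U) (G x ord0 i ^+ 2)%:E + eta%:E)%E.
Proof.
move=> r0 rt eta0; have eta4 : 0 < eta / 4 by rewrite divr_gt0.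
set Q := cube P r.
have mQ : measurable Q by exact: cube_measurable.
have QU : Q `<=` U by rewrite UE; apply: cubeS; exact: ltW.
have tr : 0 < (t - r) / 2 by rewrite divr_gt0// subr_gt0.
have [|e1 e10 He1] := mollification_cvg mU Uoo tr eta4 mQ _ su.
  by move=> x Qx; rewrite UE; apply: cube_sub Qx _; lra.
pose e := Num.min e1 ((t - r) / 2) / 2.
have e0 : 0 < e by rewrite divr_gt0// lt_min e10.
have ee1 : e < e1.
  by rewrite /e ltr_pdivrMr// (le_lt_trans (_ : _ <= e1)) ?ge_min ?lexx// ltr_pMr// ltr1n.
have etr : e < (t - r) / 2.
  by rewrite /e ltr_pdivrMr// (le_lt_trans (_ : _ <= (t - r) / 2)) ?ge_min ?lexx ?orbT// ltr_pMr// ltr1n.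
have {He1} := He1 e e0 ee1.
set V := mollify U e u.
under eq_integral do rewrite -mollifyE -/V.
move=> HV.
have sV : smooth V by exact: mollify_smooth.
have cdV : continuously_differentiable V.
  by split; [exact: smooth_c1|move=> i; have [] := smooth_c1 (smooth_partial i sV)].
have mV : measurable_fun setT V by apply: continuous_measurable_row; case: cdV => -[].
have [c Hc] := poincare_smooth P r0 eta4 cdV.
exists c.
have m0 := @bump_mass_gt0 R d e e0.
have HP i : (\int[mu]_(x in Q) (partial i V x ^+ 2)%:E <= \int[mu]_(x in U) (G x ord0 i ^+ 2)%:E)%E.
  have iG := square_integrable_integrable mU Uoo (sG i).
  rewrite (eq_integral (fun x => (((@bump_mass R d e)^-1 * conv U (fun z => G z ord0 i) (bump 0 e) x) ^+ 2)%:E)); last first.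
    move=> x; rewrite inE => /cube_closed_cube Qx.
    by rewrite (mollify_partial i e0 Qx) 1?mulrC//; lra.
  rewrite integral_sqrZ//; last by apply: measurable_funTS; exact: conv_bump_measurable.
  apply: le_trans (lee_wpmul2l _ (conv_bump_L2 mU Uoo e0 mQ (sG i))) _; first by rewrite lee_fin sqr_ge0.
  by rewrite muleA -EFinM -exprMn mulVf ?gt_eqF// expr1n mul1e.
have mVu : measurable_fun Q (fun x => u x - V x).
  by apply: measurable_funB; [exact: measurable_funS su.1|exact: measurable_funTS].
have mVc : measurable_fun Q (fun x => V x - c) by apply: measurable_funB => //; exact: measurable_funTS.
have := integral_sqrD_le mQ mVu mVc.
under eq_integral do rewrite addrA subrK.
move=> H; apply: le_trans H _.
have -> : (\int[mu]_(x in Q) ((u x - V x) ^+ 2)%:E = \int[mu]_(x in Q) ((V x - u x) ^+ 2)%:E)%E.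
  by apply: eq_integral => x _; rewrite -sqrrN opprB.
have K0 : 0 <= 2 ^+ d * (2 * r) ^+ 2 :> R by rewrite mulr_ge0 ?sqr_ge0// exprn_ge0.
have S0 : (0 <= \sum_(i < d) \int[mu]_(x in U) (G x ord0 i ^+ 2)%:E)%E.
  by apply: sume_ge0 => i _; exact: sqr_integral_ge0.
have {}Hc : (\int[mu]_(x in Q) ((V x - c) ^+ 2)%:E <= (2 ^+ d * (2 * r) ^+ 2)%:E *
     \sum_(i < d) \int[mu]_(x in U) (G x ord0 i ^+ 2)%:E + (eta / 4)%:E)%E.
  apply: le_trans Hc _; rewrite leeD2r// lee_wpmul2l ?lee_fin//.
  by apply: lee_sum => i _.
apply: le_trans (leeD (lee_wpmul2l _ HV) (lee_wpmul2l _ Hc)) _; rewrite ?lee_fin//.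
have Kp : 0 < 2 ^+ d * (2 * r) ^+ 2 :> R by rewrite mulr_gt0 ?exprn_gt0// mulr_gt0.
move: S0 Kp; move: (2 ^+ d * _) => K; move: (\sum_(i < d) _)%E => [s| |] // S0 Kp.
  by rewrite -!(EFinM, EFinD) lee_fin; lra.
rewrite [X in (_ <= X)%E](_ : _ = +oo%E) ?leey//.
by rewrite gt0_muley ?lte_fin ?mulr_gt0// addye.
Qed.

End mollify_weak_grad.

(** On the exceptional null set A is replaced by the identity, which is elliptic since Lam >= 1.
    Pointwise estimates then hold throughout D and integrals are unaffected. *)
Lemma elliptic_everywhere D Lam (A : E -> 'M[R]_d) : measurable D -> 1 <= Lam -> elliptic D Lam A ->
  exists A' : E -> 'M[R]_d, [/\ forall i j, measurable_fun D (fun X => A' X i j),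
    {ae mu, forall X, A X = A' X \/ ~ D X} &
    forall X, D X -> forall xi eta : E,
        Lam^-1 * enorm xi ^+ 2 <= edot (mxact (A' X) xi) xi /\
        `|edot (mxact (A' X) xi) eta| <= Lam * enorm xi * enorm eta].
Proof.
move=> mD L1 [mA _ [N [mN N0 HN]]].
pose A' X := if X \in N then 1%:M else A X.
exists A'; split.
- move=> i j.
  have -> : (fun X => A' X i j) = fun X => \1_N X * (1%:M : 'M[R]_d) i j + \1_(~` N) X * A X i j.
    by apply/funext => X; rewrite /A' !indicE in_setC; case: (X \in N) => /=; rewrite ?mul1r ?mul0r ?addr0 ?add0r.
  apply: measurable_funD; apply: measurable_funM => //; apply: measurable_indic => //.
  exact: measurableC.
- exists N; split => // X /= H; apply: contrapT => nX; apply: H; left.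
  by rewrite /A' memNset.
move=> X DX xi eta; rewrite /A'; case: (boolP (X \in N)) => XN.
  have -> : mxact 1%:M xi = xi by rewrite /mxact trmx1 mulmx1.
  rewrite -enorm2; split.
    by rewrite ler_piMl ?sqr_ge0// invf_le1// (lt_le_trans ltr01).
  apply: le_trans (edot_norm_le _ _) _; rewrite ler_wpM2r ?enorm_ge0// ler_peMl ?enorm_ge0//.
have : (D X -> forall xi eta : E,
        Lam^-1 * enorm xi ^+ 2 <= edot (mxact (A X) xi) xi /\
        `|edot (mxact (A X) xi) eta| <= Lam * enorm xi * enorm eta).
  by apply: contrapT => H; move/negP: XN; apply; rewrite inE; exact: HN.
by move=> /(_ DX); exact.
Qed.

Lemma enorm_basis (i : 'I_d) : enorm (basis_row i : E) = 1.
Proof.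
rewrite /enorm /edot (bigD1 i)//= big1 ?addr0; first by rewrite !mxE !eqxx mulr1 sqrtr1.
by move=> j ji; rewrite !mxE (negbTE ji) mul0r.
Qed.

(** * The Caccioppoli inequality *)

Section caccioppoli.
Variables (D : set E) (Lam : R) (A : E -> 'M[R]_d) (u : E -> R) (G : E -> E).
Hypotheses (oD : open D) (L1 : 1 <= Lam)
  (mA : forall i j, measurable_fun D (fun X => A X i j))
  (ellA : forall X, D X -> forall xi eta : E,
        Lam^-1 * enorm xi ^+ 2 <= edot (mxact (A X) xi) xi /\
        `|edot (mxact (A X) xi) eta| <= Lam * enorm xi * enorm eta)
  (mu_ : measurable_fun D u)
  (lu : forall K, compact K -> K `<=` D -> (\int[mu]_(x in K) (u x ^+ 2)%:E < +oo)%E)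
  (wG : is_weak_grad D u G)
  (lG : forall K, compact K -> K `<=` D -> (\int[mu]_(x in K) (enorm (G x) ^+ 2)%:E < +oo)%E)
  (eqn : forall f, test_function D f ->
     (\int[mu]_(X in D) (edot (mxact (A X) (G X)) (grad f X))%:E = 0)%E).
Variables (P : E) (r c M : R).
Hypotheses (r0 : 0 < r) (PD : closed_cube P (3 * r) `<=` D) (M0 : 0 <= M)
  (uM : forall z, cube P (3 * r) z -> `|u z - c| <= M).

Let F X := mxact (A X) (G X).
Let U := cube P (3 * r).
Let Q := closed_cube P (2 * r).
Let eta := bump P (2 * r).
Let v z := u z - c.

Let r3 : 0 < 3 * r. Proof. by rewrite mulr_gt0. Qed.
Let r2 : 0 < 2 * r. Proof. by rewrite mulr_gt0. Qed.
Let Lam0 : 0 < Lam. Proof. exact: lt_le_trans L1. Qed.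
Let mD : measurable D. Proof. exact: open_measurable_row. Qed.
Let mU : measurable U. Proof. exact: cube_measurable. Qed.
Let Uoo : (mu U < +oo)%E. Proof. exact: cube_finite_measure. Qed.
Let UD : U `<=` D. Proof. exact: subset_trans (@cube_closed_cube _ _ _ _) PD. Qed.
Let QU : Q `<=` U. Proof. by apply: closed_cube_cube; rewrite ltr_pM2r// ltr_nat. Qed.
Let mQ : measurable Q. Proof. by apply: closed_measurable_row; exact: closed_cube_closed. Qed.

Let mG i : measurable_fun D (fun X => G X ord0 i).
Proof. by case: wG => mG _ _; exact: (measurableT_comp (@measurable_row_coord R d i) mG). Qed.

Let F_coord X i : F X ord0 i = \sum_j G X ord0 j * A X i j.
Proof. by rewrite /F /mxact mxE; apply: eq_bigr => j _; rewrite mxE. Qed.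

Let mF i : measurable_fun D (fun X => F X ord0 i).
Proof.
under eq_fun do rewrite F_coord.
apply: measurable_sum => j; exact: measurable_funM.
Qed.

Let FG_le X i : D X -> `|F X ord0 i| <= Lam * enorm (G X).
Proof.
move=> DX; have [_] := ellA DX (G X) (basis_row i).
have -> : edot (mxact (A X) (G X)) (basis_row i) = F X ord0 i.
  rewrite /edot (bigD1 i)//= [basis_row i ord0 i]mxE !eqxx mulr1 [X in _ + X]big1 ?addr0//.
  by move=> j /negbTE ji; rewrite [basis_row i _ _]mxE ji andbF mulr0.
move=> H; apply: le_trans H _; rewrite ler_piMr ?enorm_basis// mulr_ge0 ?enorm_ge0//.
exact: ltW.
Qed.

Let sG2 : mu.-integrable U (fun x => (enorm (G x) ^+ 2)%:E).
Proof.
have me : measurable_fun D (fun x => enorm (G x) ^+ 2).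
  under eq_fun do rewrite enorm2.
  by apply: measurable_sum => j; exact: measurable_funM.
apply/integrableP; split; first by apply/measurable_EFinP; exact: measurable_funS me.
under eq_integral do rewrite gee0_abs ?lee_fin ?sqr_ge0//.
have cK : compact (closed_cube P (3 * r)) by apply: closed_cube_compact; exact: ltW.
apply: le_lt_trans (lG cK PD); apply: ge0_subset_integral => //.
- exact: compact_measurable_row.
- by apply/measurable_EFinP; exact: measurable_funS me.
- by move=> x _; rewrite lee_fin sqr_ge0.
- exact: cube_closed_cube.
Qed.

Let sG i : square_integrable U (fun X => G X ord0 i).
Proof.
split; first exact: measurable_funS (mG i).
apply: (le_integrable mU _ _ sG2); first by apply: measurable_sqr => //; exact: measurable_funS (mG i).
move=> x _ /=; rewrite lee_fin !ger0_norm ?sqr_ge0// -(real_normK (num_real _)).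
by rewrite ler_pXn2r ?nnegrE ?enorm_ge0// coord_le_enorm.
Qed.

Let sF i : square_integrable U (fun X => F X ord0 i).
Proof.
split; first exact: measurable_funS (mF i).
apply: (le_integrable mU _ _ (integrableZl mU (Lam ^+ 2) sG2)).
  by apply: measurable_sqr => //; exact: measurable_funS (mF i).
move=> x Ux.
have h : F x ord0 i ^+ 2 <= Lam ^+ 2 * enorm (G x) ^+ 2.
  rewrite -exprMn -(real_normK (num_real (F x ord0 i))).
  rewrite ler_pXn2r ?nnegrE ?mulr_ge0 ?enorm_ge0 ?(ltW Lam0)//; exact: FG_le (UD Ux).
by rewrite /= lee_fin ger0_norm ?sqr_ge0// ger0_norm// mulr_ge0 ?sqr_ge0.
Qed.

Let mv : measurable_fun U v.
Proof. by apply: measurable_funB => //; exact: measurable_funS mu_. Qed.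

Let sv : square_integrable U v.
Proof. exact: (bounded_square_integrable mU Uoo mv uM). Qed.

Let wv : is_weak_grad D v G.
Proof. exact: (is_weak_grad_shift mD mu_ lu _ wG). Qed.

Let eta_ge0 x : 0 <= eta x. Proof. exact: bump_ge0. Qed.
Let eta_le1 x : eta x <= 1. Proof. exact: bump_le1. Qed.
Let eta_smooth : smooth eta. Proof. by apply: product_form_smooth; exact: bump_product_form. Qed.
Let eta_supp x : ~ Q x -> eta x = 0.
Proof. by move=> nQ; apply/eqP; apply: contrapT => /negP/(bump_neq0 r2)/cube_closed_cube. Qed.

Section with_scale.
Variables (e B : R).
Hypotheses (e0 : 0 < e) (er : e < r) (Beta : forall i x, `|partial i eta x| <= B) (B0 : 0 <= B).

Let V := mollify U e v.
Let g i x := conv U (fun z => G z ord0 i) (bump 0 e) x / @bump_mass R d e.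
(* V is a mollification of u - c: the weak equation is only stated for smooth test functions. *)
Let f x := eta x * eta x * V x.

Let V_smooth : smooth V. Proof. exact: (mollify_smooth (P := P) (t := 3 * r)). Qed.

Let V_le x : `|V x| <= M.
Proof.
have iv := square_integrable_integrable mU Uoo sv.
have m0 := @bump_mass_gt0 R d e e0.
rewrite /V (mollifyE (P := P) (t := 3 * r))// normrM normfV (gtr0_norm m0) ler_pdivrMr// mulrC.
exact: conv_bump_le.
Qed.

Let V_partial i x : Q x -> partial i V x = g i x.
Proof.
have H : 2 * r + e < 3 * r by rewrite [3 * r](_ : _ = 2 * r + r) ?ltrD2l//; ring.
move=> Qx; exact: (mollify_partial (erefl U) r3 UD wv sv i e0 Qx H).
Qed.

Let f_test : test_function D f.
Proof.
have sub : [set x | f x != 0] `<=` Q.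
  by move=> x /=; apply: contraPP => nQ; rewrite /f eta_supp// !mul0r eqxx.
have clS : closure [set x | f x != 0] `<=` Q.
  by rewrite [X in _ `<=` X](closure_id Q).1; [exact: closure_subset|exact: closed_cube_closed].
have cQ : compact Q by apply: closed_cube_compact; exact: ltW.
split; first exact: (smoothM (smoothM eta_smooth eta_smooth) V_smooth).
  by apply: (subclosed_compact _ cQ clS); exact: closed_closure.
by apply: subset_trans clS _; apply: subset_trans QU UD.
Qed.

Let f_partial i x : partial i f x = eta x ^+ 2 * partial i V x + V x * (2 * eta x * partial i eta x).
Proof.
rewrite /f (partialM i (smooth_c1 (smoothM eta_smooth eta_smooth)) (smooth_c1 V_smooth)).
rewrite (partialM i (smooth_c1 eta_smooth) (smooth_c1 eta_smooth)); ring.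
Qed.

Let eta2_nonQ x (w : R) : ~ Q x -> eta x ^+ 2 * w = 0.
Proof. by move=> nQ; rewrite eta_supp// expr0n mul0r. Qed.

(** On Q the test function eta^2 V has gradient eta^2 g + 2 eta V grad eta, where g is the mollified
    gradient. Replacing g by G costs the two Young terms with parameter t. The cutoff term is
    absorbed into half of the ellipticity term by completing a square, which produces (2 Lam)^-1 on
    the left and 2 Lam^3 on the right. *)
Let pointwise t x : 0 < t -> U x ->
  (2 * Lam)^-1 * (eta x ^+ 2 * enorm (G x) ^+ 2) <=
  edot (F x) (grad f x) + (t / 2 * \sum_i F x ord0 i ^+ 2 +
   (2 * t)^-1 * \sum_i (G x ord0 i - g i x) ^+ 2 * \1_Q x) + 2 * Lam ^+ 3 * M ^+ 2 * (d%:R * B) ^+ 2.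
Proof.
move=> t0 Ux; have DX := UD Ux.
have [e1 _] := ellA DX (G x) (G x).
have [_ e2] := ellA DX (G x) (grad eta x).
have egrad : enorm (grad eta x) <= d%:R * B.
  by apply: enorm_le_coord => // i; rewrite mxE.
have -> : edot (F x) (grad f x) = eta x ^+ 2 * edot (F x) (G x)
    - eta x ^+ 2 * (\sum_i F x ord0 i * (G x ord0 i - g i x) * \1_Q x) + V x * (2 * eta x) * edot (F x) (grad eta x).
  rewrite /edot !mulr_sumr -sumrB -big_split /=; apply: eq_bigr => i _.
  rewrite !mxE f_partial.
  have [Qx|nQ] := pselect (Q x); first by rewrite V_partial// indicE mem_set//=; ring.
  by rewrite !eta2_nonQ//; ring.
have h1 : eta x ^+ 2 * (\sum_i F x ord0 i * (G x ord0 i - g i x) * \1_Q x) <=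
    t / 2 * \sum_i F x ord0 i ^+ 2 + (2 * t)^-1 * \sum_i (G x ord0 i - g i x) ^+ 2 * \1_Q x.
  rewrite !mulr_sumr -big_split /=; apply: ler_sum => i _.
  set a := F x ord0 i; set b := _ - g i x.
  have E01 : 0 <= eta x ^+ 2 <= 1 by rewrite sqr_ge0 exprn_ile1.
  have ab : `|a * b| <= t / 2 * a ^+ 2 + (2 * t)^-1 * b ^+ 2.
    rewrite normrM -(real_normK (num_real a)) -(real_normK (num_real b)) -subr_ge0.
    have -> : t / 2 * `|a| ^+ 2 + (2 * t)^-1 * `|b| ^+ 2 - `|a| * `|b| = t / 2 * (`|a| - `|b| / t) ^+ 2.
      by field; rewrite gt_eqF.
    by rewrite mulr_ge0 ?sqr_ge0// divr_ge0 ?ltW.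
  rewrite indicE; case: (x \in Q); rewrite /= ?mulr1 ?mulr0 ?addr0.
    apply: le_trans (_ : `|eta x ^+ 2 * (a * b)| <= _); first exact: ler_norm.
    move: E01 => /andP[E0 E1].
    by rewrite normrM (ger0_norm E0); apply: le_trans ab; rewrite ler_piMl.
  by rewrite mulr_ge0 ?sqr_ge0// divr_ge0 ?ltW.
set gx := enorm (G x); set W := V x * (2 * eta x) * edot (F x) (grad eta x).
have gx0 : 0 <= gx by exact: enorm_ge0.
have h2 : `|W| <= (2 * Lam)^-1 * (eta x ^+ 2 * gx ^+ 2) + 2 * Lam ^+ 3 * M ^+ 2 * (d%:R * B) ^+ 2.
  have h3 : `|W| <= M * (2 * eta x) * (Lam * gx * (d%:R * B)).
    rewrite /W !normrM (ger0_norm (eta_ge0 x)) [`|2|]ger0_norm//.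
    apply: ler_pM => //; first by rewrite !mulr_ge0.
      by rewrite ler_wpM2r// mulr_ge0.
    by apply: le_trans e2 _; rewrite ler_wpM2l// mulr_ge0// ltW.
  apply: le_trans h3 _; rewrite -subr_ge0.
  set b := d%:R * B.
  have -> : (2 * Lam)^-1 * (eta x ^+ 2 * gx ^+ 2) + 2 * Lam ^+ 3 * M ^+ 2 * b ^+ 2 - M * (2 * eta x) * (Lam * gx * b)
     = (2 * Lam)^-1 * (eta x * gx - 2 * Lam ^+ 2 * M * b) ^+ 2.
    by field; rewrite gt_eqF.
  by rewrite mulr_ge0 ?sqr_ge0// invr_ge0 mulr_ge0// ltW.
have h4 : Lam^-1 * (eta x ^+ 2 * gx ^+ 2) <= eta x ^+ 2 * edot (F x) (G x).
  by rewrite mulrCA ler_wpM2l ?sqr_ge0.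
have h5 : (2 * Lam)^-1 * (eta x ^+ 2 * gx ^+ 2) = Lam^-1 * (eta x ^+ 2 * gx ^+ 2) / 2.
  by field; rewrite gt_eqF.
have := ler_norm (- W); rewrite normrN; move: h1 h2 h4 h5.
move: (eta x ^+ 2 * (\sum_i _)) => S1; lra.
Qed.

Let mg i : measurable_fun setT (g i).
Proof.
apply: measurable_funM => //; apply: conv_bump_measurable => //.
exact: (square_integrable_integrable mU Uoo (sG i)).
Qed.

Lemma caccioppoli_scale t : 0 < t ->
  (((2 * Lam)^-1)%:E * \int[mu]_(x in U) (eta x ^+ 2 * enorm (G x) ^+ 2)%:E <=
   (t / 2)%:E * \sum_i \int[mu]_(x in U) (F x ord0 i ^+ 2)%:E +
   ((2 * t)^-1)%:E * \sum_i \int[mu]_(x in Q) ((g i x - G x ord0 i) ^+ 2)%:E +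
   (2 * Lam ^+ 3 * M ^+ 2 * (d%:R * B) ^+ 2 * (6 * r) ^+ d)%:E)%E.
Proof.
move=> t0.
pose q x := edot (F x) (grad f x).
pose C0 := 2 * Lam ^+ 3 * M ^+ 2 * (d%:R * B) ^+ 2.
have C00 : 0 <= C0 by rewrite /C0 !mulr_ge0 ?sqr_ge0 ?exprn_ge0 ?(ltW Lam0).
have sf : smooth f by case: f_test.
have cQ : compact Q by apply: closed_cube_compact; exact: ltW.
have f0 x : ~ Q x -> f x = 0 by move=> nQ; rewrite /f eta_supp// !mul0r.
have fp0 i x : ~ Q x -> partial i f x = 0.
  move=> nQ; apply/eqP; apply: contrapT => /negP/partial_support.
  have : [set y | f y != 0] `<=` Q by move=> y /= /eqP fy; apply: contrapT => /f0.
  move=> /closure_subset; rewrite -(closure_id Q).1; last exact: closed_cube_closed.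
  by move=> H /H.
have qE x : q x = \sum_i F x ord0 i * partial i f x.
  by rewrite /q /edot; apply: eq_bigr => i _; rewrite [grad f x ord0 i]mxE.
have iq : mu.-integrable U (EFin \o q).
  have : mu.-integrable U (fun x => (\sum_i (F x ord0 i * partial i f x)%:E)%E).
    apply: integrable_sum => // i _.
    have [cf1 _] := smooth_c1 (smooth_partial i sf).
    have [Mp Mp0 HMp] := compact_support_bounded cf1 cQ (fp0 i).
    apply: (integrableM_bounded mU (square_integrable_integrable mU Uoo (sF i)) _ (fun x _ => HMp x)).
    by apply: measurable_funTS; exact: continuous_measurable_row.
  by apply: eq_integrable => // x _; rewrite /= qE sumEFin.
have q0 : (\int[mu]_(x in U) (q x)%:E = 0)%E.
  rewrite -(eqn f_test) (integral_support (D := D) (U := U))// => x _ nU.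
  rewrite -/(F x) -/(q x) qE big1// => i _; rewrite fp0 ?mulr0// => /QU; exact: nU.
pose b i x := (g i x - G x ord0 i) ^+ 2 * \1_Q x.
pose N x : \bar R := ((t / 2)%:E * (\sum_i (F x ord0 i ^+ 2)%:E) + ((2 * t)^-1)%:E * (\sum_i (b i x)%:E) + C0%:E)%E.
have b0 i x : (0 <= (b i x)%:E)%E by rewrite lee_fin mulr_ge0 ?sqr_ge0.
have F20 i x : (0 <= (F x ord0 i ^+ 2)%:E)%E by rewrite lee_fin sqr_ge0.
have mb i : measurable_fun U (fun x => (b i x)%:E).
  apply/measurable_EFinP; apply: measurable_funM; last exact: measurable_indic.
  apply: measurable_funX; apply: measurable_funB; first exact: measurable_funTS.
  exact: measurable_funS (mG i).
have mF2 i : measurable_fun U (fun x => (F x ord0 i ^+ 2)%:E).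
  by apply: measurable_sqr => //; exact: measurable_funS (mF i).
have t20 : (0 <= (t / 2)%:E)%E by rewrite lee_fin divr_ge0 ?ltW.
have t2i0 : (0 <= ((2 * t)^-1)%:E)%E by rewrite lee_fin invr_ge0 mulr_ge0 ?ltW.
have mS1 : measurable_fun U (fun x => \sum_i (F x ord0 i ^+ 2)%:E)%E by apply: emeasurable_sum.
have mS2 : measurable_fun U (fun x => \sum_i (b i x)%:E)%E by apply: emeasurable_sum.
have S10 x : (0 <= \sum_i (F x ord0 i ^+ 2)%:E)%E by apply: sume_ge0.
have S20 x : (0 <= \sum_i (b i x)%:E)%E by apply: sume_ge0.
have EN : (\int[mu]_(x in U) N x = (t / 2)%:E * \sum_i \int[mu]_(x in U) (F x ord0 i ^+ 2)%:E +
   ((2 * t)^-1)%:E * \sum_i \int[mu]_(x in Q) ((g i x - G x ord0 i) ^+ 2)%:E + (C0 * (6 * r) ^+ d)%:E)%E.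
  rewrite ge0_integralD//; first last.
  - by apply: emeasurable_funD; exact: measurable_funeM.
  - by move=> x _; rewrite adde_ge0// mule_ge0.
  rewrite ge0_integralD//; first last.
  - exact: measurable_funeM.
  - by move=> x _; rewrite mule_ge0.
  - exact: measurable_funeM.
  - by move=> x _; rewrite mule_ge0.
  rewrite !ge0_integralZl// !ge0_integral_sum//.
  congr (_ + _ * _ + _)%E.
    apply: eq_bigr => i _; rewrite [LHS](integral_support (U := Q))//.
      by apply: eq_integral => x xQ; rewrite /b indicE xQ mulr1.
    by move=> x _ nQ; rewrite /b indicE memNset// mulr0.
  rewrite integral_cst// [X in (_ * X)%E](lebesgue_row_cube P r3) -EFinM.
  by congr (_ * _ ^+ _)%:E; ring.
have fold_ x : N x = (t / 2 * \sum_i F x ord0 i ^+ 2 + (2 * t)^-1 * \sum_i (G x ord0 i - g i x) ^+ 2 * \1_Q x + C0)%:E.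
  rewrite /N !sumEFin -!EFinM -!EFinD; congr (_ + _ * _ + _)%:E.
  by apply: eq_bigr => i _; rewrite /b -sqrrN opprB.
rewrite -/C0 -EN -ge0_integralZl//; first last.
- by rewrite lee_fin invr_ge0 mulr_ge0 ?ltW.
- by move=> x _; rewrite lee_fin mulr_ge0 ?sqr_ge0.
- apply/measurable_EFinP; apply: measurable_funM.
    by apply: measurable_funX; apply: measurable_funTS; exact: bump_measurable.
  by have /integrableP[/measurable_EFinP] := sG2.
have [Noo|Nfin] := eqVneq (\int[mu]_(x in U) N x)%E +oo%E; first by rewrite Noo leey.
have N0 x : (0 <= N x)%E by rewrite !adde_ge0// mule_ge0.
have mN : measurable_fun U N.
  by apply: emeasurable_funD => //; apply: emeasurable_funD; exact: measurable_funeM.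
have iN : mu.-integrable U N.
  apply/integrableP; split => //.
  by under eq_integral do rewrite gee0_abs//; rewrite ltey.
have ih : mu.-integrable U (fun x => ((2 * Lam)^-1 * (eta x ^+ 2 * enorm (G x) ^+ 2))%:E).
  have ih0 : mu.-integrable U (fun x => (eta x ^+ 2 * enorm (G x) ^+ 2)%:E).
    have : mu.-integrable U (fun x => (enorm (G x) ^+ 2 * eta x ^+ 2)%:E).
      apply: (@integrableM_bounded _ _ _ _ _ 1 mU sG2).
        by apply: measurable_funX; apply: measurable_funTS; exact: bump_measurable.
      by move=> x _; rewrite ger0_norm ?sqr_ge0// exprn_ile1.
    by apply: eq_integrable => // x _; rewrite mulrC.
  exact: (integrableZl mU ((2 * Lam)^-1) ih0).
(* Adding the integral of q, which is 0 by the equation, reduces the claim to the pointwise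
   inequality. *)
rewrite -[leRHS]add0e -q0 -integralD//.
apply: le_integral => //.
- exact: integrableD.
move=> x; rewrite inE => Ux; rewrite fold_ -EFinM -EFinD lee_fin.
have := pointwise t0 Ux; rewrite -/C0 -/(q x); lra.
Qed.

End with_scale.

Lemma caccioppoli_bump B : (forall i x, `|partial i eta x| <= B) -> 0 <= B ->
  (((2 * Lam)^-1)%:E * \int[mu]_(x in U) (eta x ^+ 2 * enorm (G x) ^+ 2)%:E <=
   (2 * Lam ^+ 3 * M ^+ 2 * (d%:R * B) ^+ 2 * (6 * r) ^+ d)%:E)%E.
Proof.
move=> HB B0; apply/lee_addgt0Pr => kap kap0.
have Ffin i : (\int[mu]_(x in U) (F x ord0 i ^+ 2)%:E)%E \is a fin_num.
  by have [_ h] := sF i; exact: integrable_fin_num h.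
pose SF := \sum_i fine (\int[mu]_(x in U) (F x ord0 i ^+ 2)%:E)%E.
have SF0 : 0 <= SF by apply: sumr_ge0 => i _; apply: fine_ge0; exact: sqr_integral_ge0.
have ESF : (\sum_i \int[mu]_(x in U) (F x ord0 i ^+ 2)%:E)%E = SF%:E.
  by rewrite /SF -sumEFin; apply: eq_bigr => i _; rewrite fineK.
(* t is fixed before the mollification scale e: it makes the term with F at most kap / 2. Then e is
   taken so small that each mollification error is below k2, which makes the term with 1 / t at most
   kap / 2. *)
pose t := kap / (SF + 1).
have t0 : 0 < t by rewrite divr_gt0// ltr_wpDl.
pose k2 := t * kap / d.+1%:R.
have k20 : 0 < k2 by rewrite divr_gt0// mulr_gt0.
have H i : exists2 e1, 0 < e1 & forall e, 0 < e -> e < e1 ->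
  (\int[mu]_(x in Q) ((conv U (fun z => G z ord0 i) (bump 0 e) x / @bump_mass R d e - G x ord0 i) ^+ 2)%:E <= k2%:E)%E.
  have r20 : 0 < r / 2 by rewrite divr_gt0.
  apply: (mollification_cvg mU Uoo r20 k20 mQ _ (sG i)) => x Qx.
  apply: subset_trans (@cube_closed_cube _ _ _ _) _; apply: closed_cube_sub Qx _.
  by rewrite [3 * r](_ : _ = 2 * r + r) ?ltrD2l ?ltr_pdivrMr ?ltr_pMr ?ltr1n//; ring.
have [E1 HE1] := choice (fun i => let: ex_intro2 e1 p1 p2 := H i in ex_intro (fun e1 => 0 < e1 /\ forall e, 0 < e -> e < e1 ->
  (\int[mu]_(x in Q) ((conv U (fun z => G z ord0 i) (bump 0 e) x / @bump_mass R d e - G x ord0 i) ^+ 2)%:E <= k2%:E)%E) e1 (conj p1 p2)).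
pose e := \big[Num.min/r]_i E1 i / 2.
have m0 : 0 < \big[Num.min/r]_i E1 i.
  by apply: lt_bigmin => // i _; case: (HE1 i).
have e0 : 0 < e by rewrite divr_gt0.
have em : e < \big[Num.min/r]_i E1 i by rewrite ltr_pdivrMr// ltr_pMr// ltr1n.
have er : e < r by apply: lt_le_trans em _; exact: bigmin_le_id.
have ei i : e < E1 i by apply: lt_le_trans em _; exact: bigmin_le_cond.
apply: le_trans (caccioppoli_scale e0 er HB B0 t0) _.
rewrite ESF.
apply: (@le_trans _ _ ((t / 2)%:E * SF%:E + ((2 * t)^-1)%:E * (\sum_(i < d) k2%:E) +
  (2 * Lam ^+ 3 * M ^+ 2 * (d%:R * B) ^+ 2 * (6 * r) ^+ d)%:E)%E).
  rewrite leeD2r// leeD2l// lee_wpmul2l//; first by rewrite lee_fin invr_ge0 mulr_ge0// ltW.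
  by apply: lee_sum => i _; have [_] := HE1 i; apply.
rewrite sumEFin -!EFinM -!EFinD lee_fin sumr_const card_ord -[k2 *+ d]mulr_natl.
set CC := 2 * Lam ^+ 3 * _ * _ * _.
have h1 : t / 2 * SF <= kap / 2.
  have e1 : t * (SF + 1) = kap by rewrite /t divfK// gt_eqF// ltr_wpDl.
  by nra.
have h2 : (2 * t)^-1 * (d%:R * k2) <= kap / 2.
  have -> : (2 * t)^-1 * (d%:R * k2) = kap / 2 * (d%:R / d.+1%:R).
    have gen (N T K Dd : R) : N != 0 -> T != 0 -> (2 * T)^-1 * (Dd * (T * K / N)) = K / 2 * (Dd / N).
      by move=> N0 T0; field; rewrite N0 T0.
    by apply: gen; rewrite ?pnatr_eq0// gt_eqF.
  by rewrite ler_piMr ?divr_ge0 ?(ltW kap0)// ler_pdivrMr// mul1r ler_nat.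
lra.
Qed.

End caccioppoli.

(** The right-hand side has a supremum bound on u - c in place of its L2 norm: this is what a Holder
    bound provides, and it passes to the mollification inside the test function. *)
Lemma caccioppoli Lam : 1 <= Lam -> exists2 C, 0 < C &
  forall D A u (P : E) r c M, open D -> elliptic D Lam A -> weak_solution D A u ->
    0 < r -> closed_cube P (3 * r) `<=` D -> 0 <= M ->
    (forall z, cube P (3 * r) z -> `|u z - c| <= M) ->
    (\int[mu]_(x in cube P r) (enorm (weak_grad D u x) ^+ 2)%:E <= (C * M ^+ 2 * r ^+ d / r ^+ 2)%:E)%E.
Proof.
move=> L1; have [Mb [Mb0 HMb]] := @bump_partial_bounded R d.
have Lam0 : 0 < Lam by apply: lt_le_trans L1.
(* The cutoff is at least [bump_low ^+ d] on the inner cube, 2 Lam clears the factor on the left, Mb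
   / 2 comes from the cutoff scale 2 r, and 6^d from the volume of the cube of half-side 3 r. *)
pose C := (bump_low ^+ d) ^- 2 * (2 * Lam) * (2 * Lam ^+ 3 * (d%:R * Mb / 2) ^+ 2 * 6 ^+ d).
have l0 : 0 < bump_low ^+ d :> R by rewrite exprn_gt0// bump_low_gt0.
have C0 : 0 <= C.
  by rewrite /C !mulr_ge0 ?invr_ge0 ?sqr_ge0 ?exprn_ge0 ?(ltW Lam0).
exists (C + 1); first by rewrite ltr_wpDl.
move=> D A u P r c M oD ellA [[mu_ lu wG lG] eqn cu] r0 PD M0 uM.
have mD := open_measurable_row oD.
have [A' [mA' AA' ellA']] := elliptic_everywhere mD L1 ellA.
set G := weak_grad D u in wG lG eqn *.
have eqn' f : test_function D f ->
     (\int[mu]_(X in D) (edot (mxact (A' X) (G X)) (grad f X))%:E = 0)%E.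
  move=> tf; rewrite -(eqn f tf).
  have mGi i : measurable_fun D (fun X => G X ord0 i).
    by case: wG => mG _ _; exact: (measurableT_comp (@measurable_row_coord R d i) mG).
  have mp i : measurable_fun D (fun X => grad f X ord0 i).
    under eq_fun do rewrite mxE.
    have [sf _ _] := tf; have [cf1 _] := smooth_c1 (smooth_partial i sf).
    by apply: measurable_funTS; exact: continuous_measurable_row.
  have mm (B : E -> 'M[R]_d) : (forall i j, measurable_fun D (fun X => B X i j)) ->
      measurable_fun D (fun X => (edot (mxact (B X) (G X)) (grad f X))%:E).
    move=> mB; apply/measurable_EFinP; apply: measurable_sum => i; apply: measurable_funM => //.
    under eq_fun do rewrite /mxact mxE; apply: measurable_sum => j; apply: measurable_funM => //.
    by under eq_fun do rewrite mxE; exact: mB.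
  apply: ae_eq_integral => //; [exact: mm|by apply: mm; case: ellA|].
  by apply: filterS AA' => X [-> //|nD /nD].
have r2 : 0 < 2 * r by rewrite mulr_gt0.
have HB i x : `|partial i (bump P (2 * r)) x| <= Mb / (2 * r) by exact: HMb.
have B0 : 0 <= Mb / (2 * r) by rewrite divr_ge0 ?(ltW r2).
have := caccioppoli_bump oD L1 mA' ellA' mu_ lu wG lG eqn' r0 PD M0 uM HB B0.
set I1 := (\int[mu]_(x in cube P (3 * r)) _)%E => H1.
have me : measurable_fun D (fun x => enorm (G x) ^+ 2).
  under eq_fun do rewrite enorm2.
  have mGi i : measurable_fun D (fun X => G X ord0 i).
    by case: wG => mG _ _; exact: (measurableT_comp (@measurable_row_coord R d i) mG).
  by apply: measurable_sum => j; exact: measurable_funM.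
have c3D : cube P (3 * r) `<=` D by exact: subset_trans (@cube_closed_cube _ _ _ _) PD.
have c13 : cube P r `<=` cube P (3 * r) by apply: cubeS; rewrite ler_peMl ?ltW ?ltr1n.
have mc := cube_measurable P r; have mc3 := cube_measurable P (3 * r).
have H2 : (((bump_low ^+ d) ^+ 2)%:E * \int[mu]_(x in cube P r) (enorm (G x) ^+ 2)%:E <= I1)%E.
  rewrite -ge0_integralZl//; first last.
  - by rewrite lee_fin sqr_ge0.
  - by move=> x _; rewrite lee_fin sqr_ge0.
  - by apply/measurable_EFinP; apply: measurable_funS me => //; exact: subset_trans c3D.
  have mEta : measurable_fun (cube P (3 * r)) (fun x => (bump P (2 * r) x ^+ 2 * enorm (G x) ^+ 2)%:E).
    apply/measurable_EFinP; apply: measurable_funM; last exact: measurable_funS me.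
    by apply: measurable_funX; apply: measurable_funTS; exact: bump_measurable.
  apply: (@le_trans _ _ (\int[mu]_(x in cube P r) (bump P (2 * r) x ^+ 2 * enorm (G x) ^+ 2)%:E)%E).
    apply: ge0_le_integral => //.
    - by move=> x _; rewrite -EFinM lee_fin mulr_ge0 ?sqr_ge0.
    - apply: measurable_funeM; apply/measurable_EFinP; apply: measurable_funS me => //; exact: subset_trans c3D.
    - exact: measurable_funS mEta.
    move=> x cx; rewrite -EFinM lee_fin ler_wpM2r ?sqr_ge0// ler_pXn2r ?nnegrE ?(ltW l0) ?bump_ge0//.
    by apply: bump_ge => //; have -> : 2 * r / 2 = r by field.
  apply: ge0_subset_integral => //.
  by move=> x _; rewrite lee_fin mulr_ge0 ?sqr_ge0.
have J0 : (0 <= \int[mu]_(x in cube P r) (enorm (G x) ^+ 2)%:E)%E.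
  by apply: integral_ge0 => x _; rewrite lee_fin sqr_ge0.
have L20 : 0 < (2 * Lam)^-1 by rewrite invr_gt0 mulr_gt0.
have l2 : 0 < (bump_low ^+ d) ^+ 2 :> R by rewrite exprn_gt0.
have : (((2 * Lam)^-1 * (bump_low ^+ d) ^+ 2)%:E * \int[mu]_(x in cube P r) (enorm (G x) ^+ 2)%:E <=
  (2 * Lam ^+ 3 * M ^+ 2 * (d%:R * (Mb / (2 * r))) ^+ 2 * (6 * r) ^+ d)%:E)%E.
  rewrite EFinM -muleA; apply: le_trans H1; rewrite lee_wpmul2l// lee_fin ltW//.
rewrite -lee_pdivlMl ?mulr_gt0// => H3; apply: le_trans H3 _.
rewrite -EFinM lee_fin.
have rd0 : 0 <= M ^+ 2 * r ^+ d / r ^+ 2.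
  by rewrite divr_ge0 ?mulr_ge0 ?sqr_ge0 ?exprn_ge0 ?(ltW r0).
apply: (@le_trans _ _ (C * (M ^+ 2 * r ^+ d / r ^+ 2))); last first.
  have -> : (C + 1) * M ^+ 2 * r ^+ d / r ^+ 2 = C * (M ^+ 2 * r ^+ d / r ^+ 2) + M ^+ 2 * r ^+ d / r ^+ 2.
    by rewrite !mulrDl !mul1r !mulrA.
  by rewrite lerDl.
rewrite le_eqVlt; apply/orP; left; apply/eqP; rewrite /C [(6 * r) ^+ d]exprMn.
move: l0; move: (bump_low ^+ d) (r ^+ d) (6 ^+ d : R) (d%:R : R) => L rd s6 dd l0.
by field; rewrite !gt_eqF.
Qed.

End weak_poincare_caccioppoli.

(** * Interior oscillation of weak solutions *)

Section interior_estimate.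
Context {R : realType} {n : nat}.
Local Notation d := n.+1.
Local Notation E := 'rV[R]_d.
Local Notation mu := (@lebesgue_row R d).
Implicit Types (D S K U : set E) (f g h l u v : E -> R) (x y z P : E) (e r : R).

Lemma measurable_row_comp D (G : E -> E) i : measurable_fun D G -> measurable_fun D (fun x => G x ord0 i).
Proof. by move=> mG; exact: (measurableT_comp (@measurable_row_coord R d i) mG). Qed.

Lemma measurable_enorm2 D (G : E -> E) : measurable_fun D G -> measurable_fun D (fun x => (enorm (G x) ^+ 2)%:E).
Proof.
move=> mG; apply/measurable_EFinP; under eq_fun do rewrite enorm2.
by apply: measurable_sum => j; apply: measurable_funM; exact: measurable_row_comp.
Qed.

Lemma measurable_energy D (A : E -> 'M[R]_d) (G : E -> E) f : measurable D ->
  (forall i j, measurable_fun D (fun X => A X i j)) -> measurable_fun D G -> smooth f ->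
  measurable_fun D (fun X => (edot (mxact (A X) (G X)) (grad f X))%:E).
Proof.
move=> mD mA mG sf; apply/measurable_EFinP; apply: measurable_sum => i; apply: measurable_funM.
  under eq_fun do rewrite /mxact mxE; apply: measurable_sum => j; apply: measurable_funM => //.
    exact: measurable_row_comp.
  by under eq_fun do rewrite mxE; exact: mA.
under eq_fun do rewrite mxE.
have [cf1 _] := smooth_c1 (smooth_partial i sf).
by apply: measurable_funTS; exact: continuous_measurable_row.
Qed.

Lemma elliptic_sub D U Lam (A : E -> 'M[R]_d) : measurable D -> U `<=` D -> elliptic D Lam A -> elliptic U Lam A.
Proof.
move=> mD UD [mA [M HM] HA]; split.
- by move=> i j; exact: measurable_funS (mA i j).
- by exists M; apply: filterS HM => X H /UD; exact: H.
- by apply: filterS HA => X H /UD; exact: H.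
Qed.

(** * Restriction of a weak solution to a ball *)

Section ball_restriction.
Variables (D : set E) (Lam : R) (A : E -> 'M[R]_d) (u : E -> R) (P : E) (r c : R).
Hypotheses (oD : open D) (ellA : elliptic D Lam A) (wu : weak_solution D A u) (r0 : 0 < r)
  (BD : eclosed_ball P r `<=` D).
Let B := eball P r.
Let v x := u x - c.
Let G := weak_grad D u.

Let mD : measurable D. Proof. exact: open_measurable_row. Qed.
Let mB : measurable B. Proof. by apply: open_measurable_row; exact: eball_open. Qed.
Let BcD : B `<=` D. Proof. by apply: subset_trans BD; exact: eball_closed_ball. Qed.
Let Boo : (mu B < +oo)%E.
Proof. by apply: le_lt_trans (lebesgue_row_eball_le _ r0) _; rewrite ltry. Qed.
Let cK : compact (eclosed_ball P r). Proof. exact: eclosed_ball_compact. Qed.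

Let mv : measurable_fun B v.
Proof. by have [[mu_ _ _ _] _ _] := wu; apply: measurable_funB => //; exact: measurable_funS mu_. Qed.

Let sv : square_integrable B v.
Proof.
have [[mu_ lu _ _] _ _] := wu.
have su : square_integrable B u.
  apply: square_integrableP; first exact: measurable_funS mu_.
  apply: le_lt_trans (lu _ cK BD); apply: ge0_subset_integral => //.
  - exact: compact_measurable_row.
  - by apply/measurable_EFinP; apply: measurable_funX; exact: measurable_funS mu_.
  - by move=> x _; rewrite lee_fin sqr_ge0.
  - exact: eball_closed_ball.
apply: (square_integrableD mB su).
by apply: (@bounded_square_integrable _ _ _ mB Boo (cst (- c)) `|c|) => // x _; rewrite normrN.
Qed.

Let wv : is_weak_grad D v G.
Proof. by have [[mu_ lu wG _] _ _] := wu; exact: (is_weak_grad_shift mD mu_ lu _ wG). Qed.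

Let wvB : is_weak_grad B v (weak_grad B v).
Proof. exact: is_weak_grad_weak_grad (weak_grad_restrict mD mB BcD wv). Qed.

Let aeG : {ae mu, forall x, B x -> weak_grad B v x = G x}.
Proof. exact: weak_grad_ball_ae mD r0 BcD wv. Qed.

Let energy_finite : (\int[mu]_(X in B) (enorm (weak_grad B v X) ^+ 2)%:E < +oo)%E.
Proof.
have [[mu_ lu wG lG] _ _] := wu.
have [mG _ _] := wG; have [mGB _ _] := wvB.
have mGB' : measurable_fun B G := measurable_funS mD BcD mG.
rewrite (@ge0_ae_eq_integral _ _ _ mu B _ (fun x => (enorm (G x) ^+ 2)%:E))//.
- apply: le_lt_trans (lG _ cK BD); apply: ge0_subset_integral => //.
  + exact: compact_measurable_row.
  + by apply: measurable_enorm2; exact: measurable_funS mG.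
  + by move=> x _; rewrite lee_fin sqr_ge0.
  + exact: eball_closed_ball.
- exact: measurable_enorm2.
- exact: measurable_enorm2.
- by move=> x _; rewrite lee_fin sqr_ge0.
- by move=> x _; rewrite lee_fin sqr_ge0.
by apply: filterS aeG => x H Bx; rewrite H.
Qed.

Lemma W12_ball : W12 B v.
Proof. by split => //; exact: (square_integrable_lty mB sv). Qed.

(** Prepares [DeGiorgi_Nash] for u - c on a ball. The gradient chosen there agrees almost everywhere
    with the one on D, so the energy and the equation carry over. *)
Lemma weak_solution_ball : weak_solution B A v.
Proof.
have [[mu_ lu wG lG] eqn cu] := wu.
have [mG _ _] := wG; have [mGB _ _] := wvB.
split.
- split => //.
    move=> K cK' KB; apply: le_lt_trans (square_integrable_lty mB sv).
    apply: ge0_subset_integral => //; first exact: compact_measurable_row.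
      by apply: measurable_sqr.
    by move=> x _; rewrite lee_fin sqr_ge0.
  move=> K cK' KB; apply: le_lt_trans energy_finite.
  apply: ge0_subset_integral => //; first exact: compact_measurable_row.
    exact: measurable_enorm2.
  by move=> x _; rewrite lee_fin sqr_ge0.
- move=> f tf; have tfD := test_function_sub BcD tf.
  have [sf cS SB] := tf; have [mA _ _] := ellA.
  have mAB i j : measurable_fun B (fun X => A X i j) by exact: measurable_funS (mA i j).
  rewrite -(eqn f tfD) [RHS](integral_support (U := B))//.
    apply: ae_eq_integral => //.
    - exact: measurable_energy.
    - by apply: measurable_energy => //; exact: measurable_funS mG.
    by apply: filterS aeG => x H Bx; rewrite H.
  move=> x _ nB; rewrite (_ : grad f x = 0); last first.
    by apply/rowP => i; rewrite !mxE (test_partial_eq0 i tf)// => /SB.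
  by rewrite /edot big1// => i _; rewrite [X in _ * X]mxE mulr0.
move=> X BX; have := cu X (BcD BX) => cuX.
exact: (continuousB cuX (@cst_continuous _ _ c X)).
Qed.

End ball_restriction.

(** Both suprema are nonnegative, so a bound on their sum bounds each of them. *)
Lemma ereal_sup_pair_le (S1 S2 : set \bar R) (M x y : \bar R) : S1 x -> S2 y ->
  (forall z : \bar R, S1 z -> 0 <= z)%E -> (forall z : \bar R, S2 z -> 0 <= z)%E ->
  (ereal_sup S1 + ereal_sup S2 <= M)%E -> (x <= M)%E /\ (y <= M)%E.
Proof.
move=> S1x S2y p1 p2 H.
have h1 : (x <= ereal_sup S1)%E by exact: ereal_sup_ubound.
have h2 : (y <= ereal_sup S2)%E by exact: ereal_sup_ubound.
have s1 : (0 <= ereal_sup S1)%E by apply: le_trans (p1 _ S1x) h1.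
have s2 : (0 <= ereal_sup S2)%E by apply: le_trans (p2 _ S2y) h2.
split; apply: le_trans H.
  by apply: le_trans h1 _; rewrite leeDl.
by apply: le_trans h2 _; rewrite leeDr.
Qed.

(** W has the units of u. [poincare_weak] on the cube of half-side 2 r controls u - c in L2 on the
    ball of radius 2 r, and [DeGiorgi_Nash] makes this pointwise at radius r. The slack of
    [poincare_weak] is W^2 r^d, the size of the main term. *)
Lemma interior_estimate Lam alpha C1 : 1 <= C1 -> DeGiorgi_Nash n.+1 Lam alpha C1 ->
  exists2 K, 0 < K & forall D (A : E -> 'M[R]_d) u P r W, open D -> elliptic D Lam A ->
    weak_solution D A u -> 0 < r -> 0 < W -> eclosed_ball P (3 * d%:R * r) `<=` D ->
    (\int[mu]_(x in cube P (3 * r)) (enorm (weak_grad D u x) ^+ 2)%:E <= (W ^+ 2 * r ^+ d / r ^+ 2)%:E)%E ->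
    exists c, (forall X, eclosed_ball P r X -> `|u X - c| <= K * W) /\
      forall X Y, eclosed_ball P r X -> eclosed_ball P r Y -> X != Y ->
        `|u X - u Y| <= K * W * (enorm (X - Y) / r) `^ alpha.
Proof.
move=> C10 DGN.
(* In K1, 16 is (2 (2 r))^2 / r^2 and 1 is the slack. K2 divides by the lower bound for the volume
   of the ball of radius 2 r, in units of r^d. *)
pose K1 : R := 2 * (2 ^+ d * 16) + 1.
pose K2 : R := K1 / (4 / d.+1%:R) ^+ d.
have K10 : 0 < K1 by rewrite addr_gt0 ?mulr_gt0 ?exprn_gt0.
have K20 : 0 < K2 by rewrite divr_gt0// exprn_gt0// divr_gt0.
exists (C1 * Num.sqrt K2); first by rewrite mulr_gt0 ?sqrtr_gt0// (lt_le_trans ltr01).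
move=> D A u P r W oD ellA wu r0 W0 PD HG.
have mD := open_measurable_row oD.
have r2 : 0 < 2 * r by rewrite mulr_gt0.
have r3 : 0 < 3 * r by rewrite mulr_gt0.
set U := cube P (3 * r) in HG.
have cK : compact (eclosed_ball P (3 * d%:R * r)) by exact: eclosed_ball_compact.
have UK : U `<=` eclosed_ball P (3 * d%:R * r).
  by have := @cube_eclosed_ball R d P _ (ltW r3); rewrite mulrA [_ * 3]mulrC.
have UD : U `<=` D := subset_trans UK PD.
have mU : measurable U by exact: cube_measurable.
have [[mu_ lu wG lG] eqn cu] := wu.
have [mG _ _] := wG.
have su : square_integrable U u.
  apply: square_integrableP => //; first exact: measurable_funS mu_.
  apply: le_lt_trans (lu _ cK PD); apply: ge0_subset_integral => //.
  - exact: compact_measurable_row.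
  - by apply: measurable_sqr; exact: measurable_funS mu_.
  - by move=> x _; rewrite lee_fin sqr_ge0.
have mGi i : measurable_fun U (fun x => weak_grad D u x ord0 i).
  by apply: measurable_row_comp; exact: measurable_funS mG.
have sumG : (\sum_(i < d) \int[mu]_(x in U) (weak_grad D u x ord0 i ^+ 2)%:E =
    \int[mu]_(x in U) (enorm (weak_grad D u x) ^+ 2)%:E)%E.
  rewrite -ge0_integral_sum//.
  - by apply: eq_integral => x _; rewrite sumEFin enorm2; congr EFin; apply: eq_bigr => i _; rewrite expr2.
  - by move=> i; exact: measurable_sqr.
  - by move=> i x _; rewrite lee_fin sqr_ge0.
have sG i : square_integrable U (fun x => weak_grad D u x ord0 i).
  apply: square_integrableP => //.
  apply: (@le_lt_trans _ _ (W ^+ 2 * r ^+ d / r ^+ 2)%:E); last exact: ltry.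
  apply: le_trans HG; rewrite -sumG (bigD1 i)//= leeDl// sume_ge0// => j _.
  exact: sqr_integral_ge0.
pose eta := W ^+ 2 * r ^+ d.
have eta0 : 0 < eta by rewrite mulr_gt0 ?exprn_gt0.
have r23 : 2 * r < 3 * r by rewrite ltr_pM2r// ltr_nat.
have [c Hc] := poincare_weak (erefl U) r3 UD wG su sG r2 r23 eta0.
exists c.
set B2 := eball P (2 * r).
have rr : r <= 3 * d%:R * r by rewrite ler_peMl ?(ltW r0)// -natrM ler1n.
have B2D : eclosed_ball P (2 * r) `<=` D.
  move=> x xP; apply: PD; apply: le_trans xP _; rewrite ler_wpM2r ?(ltW r0)//.
  by rewrite -natrM ler_nat mulnS (leq_trans _ (leq_addr _ _)).
have [m Em m0] : exists2 m, mu B2 = m%:E & (4 / d.+1%:R) ^+ d * r ^+ d <= m.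
  have h1 := lebesgue_row_eball_ge P r2.
  have h2 := lebesgue_row_eball_le P r2.
  exists (fine (mu B2)).
    by rewrite fineK// ge0_fin_numE// (le_lt_trans h2)// ltry.
  rewrite -lee_fin fineK ?ge0_fin_numE// ?(le_lt_trans h2) ?ltry//.
  apply: le_trans h1; rewrite lee_fin -exprMn le_eqVlt; apply/orP; left; apply/eqP.
  congr (_ ^+ _); ring.
have mp : 0 < m by apply: lt_le_trans m0; rewrite mulr_gt0 ?exprn_gt0 ?divr_gt0.
have mB2 : measurable B2 by apply: open_measurable_row; exact: eball_open.
have B2Q : B2 `<=` cube P (2 * r) by exact: eball_cube.
have QU : cube P (2 * r) `<=` U by apply: cubeS; exact: ltW.
have HB2 : (\int[mu]_(X in B2) ((u X - c) ^+ 2)%:E <= (K1 * eta)%:E)%E.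
  apply: le_trans.
    apply: (@ge0_subset_integral _ _ _ mu B2 (cube P (2 * r))) => //.
    - exact: cube_measurable.
    - apply: measurable_sqr.
      by apply: measurable_funB => //; apply: measurable_funS mu_ => //; exact: subset_trans UD.
    - by move=> x _; rewrite lee_fin sqr_ge0.
  apply: le_trans Hc _; rewrite sumG.
  apply: (@le_trans _ _ ((2 * (2 ^+ d * (2 * (2 * r)) ^+ 2))%:E * (W ^+ 2 * r ^+ d / r ^+ 2)%:E + eta%:E)%E).
    apply: leeD2r; apply: lee_wpmul2l => //.
    by rewrite lee_fin mulr_ge0// mulr_ge0 ?sqr_ge0 ?exprn_ge0.
  rewrite -EFinM -EFinD lee_fin le_eqVlt; apply/orP; left; apply/eqP.
  rewrite /K1 /eta; move: (r ^+ d) (2 ^+ d : R) => rd s2; field.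
  by rewrite gt_eqF.
have W1 := W12_ball c oD wu r2 B2D.
have W2 := weak_solution_ball c oD ellA wu r2 B2D.
have ell2 : elliptic B2 Lam A.
  by apply: elliptic_sub ellA => //; apply: subset_trans B2D; exact: eball_closed_ball.
have H := DGN P r A (fun x => u x - c) r0 ell2 W1 W2.
move: H.
set bound := (C1%:E * _)%E => H.
have Hb : (bound <= (C1 * Num.sqrt K2 * W)%:E)%E.
  rewrite /bound -mulrA EFinM lee_wpmul2l ?lee_fin ?(le_trans ler01)// Em.
  have I0 : (0 <= \int[mu]_(X in B2) ((u X - c) ^+ 2)%:E)%E by exact: sqr_integral_ge0.
  have If : (\int[mu]_(X in B2) ((u X - c) ^+ 2)%:E)%E \is a fin_num.
    by rewrite ge0_fin_numE// (le_lt_trans HB2)// ltry.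
  rewrite -(fineK If) inver gt_eqF// -EFinM /= lee_fin.
  rewrite -[W in leRHS](ger0_norm (ltW W0)) -sqrtr_sqr -sqrtrM ?(ltW K20)//.
  apply: ler_wsqrtr.
  rewrite -(fineK If) lee_fin in HB2.
  apply: le_trans (ler_wpM2l _ HB2) _; first by rewrite invr_ge0 ltW.
  rewrite ler_pdivrMl// /K2 /eta.
  have h4 : 0 < (4 / d.+1%:R : R) ^+ d by rewrite exprn_gt0 ?divr_gt0.
  move: h4 m0; set h := (4 / _) ^+ d => h4 m0.
  rewrite [leRHS](_ : _ = K1 * W ^+ 2 * (m / h)); last by ring.
  have h5 : r ^+ d <= m / h by rewrite ler_pdivlMr// mulrC.
  rewrite [leLHS](_ : _ = K1 * W ^+ 2 * r ^+ d); last by ring.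
  by apply: ler_wpM2l => //; rewrite mulr_ge0 ?sqr_ge0// ltW.
(* A second point of the ball: the Holder supremum then runs over a nonempty set and is
   nonnegative. *)
pose Q := P + r *: basis_row ord0.
have PQ : P != Q.
  rewrite -subr_eq0 opprD addrA subrr add0r oppr_eq0; apply/eqP => /rowP /(_ ord0).
  by rewrite !mxE !eqxx mulr1 => /eqP; rewrite gt_eqF.
have PP : eclosed_ball P r P by rewrite /eclosed_ball /= subrr enorm0 ltW.
have QP : eclosed_ball P r Q.
  rewrite /eclosed_ball /= addrC addKr enormZ gtr0_norm// ler_piMr ?(ltW r0)//.
  by rewrite enorm_basis.
have key X : eclosed_ball P r X -> `|u X - c| <= C1 * Num.sqrt K2 * W /\ forall Y, eclosed_ball P r Y -> X != Y -> 
    `|u X - u Y| / (enorm (X - Y) / r) `^ alpha <= C1 * Num.sqrt K2 * W.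
  have p1 (z : \bar R) : [set `|u X - c|%:E | X in eclosed_ball P r] z -> (0 <= z)%E.
    by move=> [Z _ <-]; rewrite lee_fin.
  move=> PX; split=> [|Y PY XY].
    have [] := @ereal_sup_pair_le _ _ _ `|u X - c|%:E (`|u P - c - (u Q - c)| / (enorm (P - Q) / r) `^ alpha)%:E _ _ _ _ (le_trans H Hb).
    - by exists X.
    - by exists P, Q.
    - exact: p1.
    - by move=> z [X' [Y' [_ _ _ ->]]]; rewrite lee_fin divr_ge0// powR_ge0.
    by rewrite lee_fin.
  have [] := @ereal_sup_pair_le _ _ _ `|u X - c|%:E (`|u X - c - (u Y - c)| / (enorm (X - Y) / r) `^ alpha)%:E _ _ _ _ (le_trans H Hb).
  - by exists X.
  - by exists X, Y.
  - exact: p1.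
  - by move=> z [X' [Y' [_ _ _ ->]]]; rewrite lee_fin divr_ge0// powR_ge0.
  by rewrite !lee_fin => _; rewrite (_ : u X - c - (u Y - c) = u X - u Y)//; ring.
split=> [X PX|X Y PX PY XY]; first by have [] := key X PX.
have [_ /(_ _ PY XY)] := key X PX.
rewrite ler_pdivrMr//; last by rewrite powR_gt0// divr_gt0// enorm_gt0// subr_eq0.
Qed.

End interior_estimate.

(** * Growth functions *)

Section growth_lemmas.
Context {R : realType}.
Implicit Types (phi : R -> R) (a b r s t C : R).
Local Notation mu := (@lebesgue_measure R).

Section fixed.
Variables (phi : R -> R) (beta C alpha : R).
Hypotheses (gphi : growth_function phi) (cphi : growth_class beta C phi)
  (beta0 : 0 < beta) (beta_alpha : beta <= alpha) (alpha1 : alpha < 1).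

Lemma growth_gt0 t : 0 < t -> 0 < phi t. Proof. by have [H _ _] := gphi; exact: H. Qed.

Lemma growth_le s t : 0 < s -> s <= t -> phi s <= phi t. Proof. by have [_ H _] := gphi; exact: H. Qed.

Let P : set R := `]0, +oo[%classic.
Let mP : measurable P. Proof. exact: measurable_itv. Qed.

Lemma growth_measurable : measurable_fun P phi.
Proof.
apply: (@eq_measurable_fun _ _ _ _ _ (fun t => if 0 < t then phi t else 0)).
  by move=> t; rewrite inE /P /= in_itv /= andbT => ->.
apply: nondecreasing_measurable => // s t st.
case: ifPn => s0; first by rewrite (lt_le_trans s0 st) growth_le.
by case: ifPn => // t0; rewrite ltW// growth_gt0.
Qed.

Lemma growth_kernel_measurable e : measurable_fun P (fun s => (phi s / s `^ e / s)%:E).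
Proof.
apply/measurable_EFinP.
apply: (@eq_measurable_fun _ _ _ _ _ (fun s => phi s * s `^ (- e) * s `^ (-1))).
  by move=> t; rewrite inE /P /= in_itv /= andbT => t0; rewrite powRN powR_inv1// ltW.
apply: measurable_funM; last by apply: measurable_funTS; exact: measurable_powR.
apply: measurable_funM; first exact: growth_measurable.
by apply: measurable_funTS; exact: measurable_powR.
Qed.

Lemma growth_kernel_ge e a : 0 <= e -> 0 < a ->
  ((phi a / (2 * a) `^ e / 2)%:E <= \int[mu]_(s in `]a, (2 * a)%R[) (phi s / s `^ e / s)%:E)%E.
Proof.
move=> e0 a0.
have a2 : a < 2 * a by rewrite ltr_pMl// ltr1n.
apply: (@le_trans _ _ (\int[mu]_(s in `]a, (2 * a)%R[) (phi a / (2 * a) `^ e / (2 * a))%:E)%E).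
  rewrite integral_cst//.
  rewrite [X in (_ * X)%E](@lebesgue_measure_itv R `]a, (2 * a)[) /= lte_fin a2 -EFinB -EFinM lee_fin.
  rewrite le_eqVlt; apply/orP; left; apply/eqP.
  have : (2 * a) `^ e != 0 by rewrite gt_eqF// powR_gt0// mulr_gt0.
  by move: (_ `^ _) => p p0; field; rewrite p0 gt_eqF.
apply: ge0_le_integral => //.
- move=> s _; rewrite lee_fin !divr_ge0 ?powR_ge0 ?ltW ?growth_gt0 ?mulr_gt0//.
- apply: measurable_funS (growth_kernel_measurable e) => // s /=.
  by rewrite /P /= !in_itv /= andbT => /andP[h _]; exact: lt_trans h.
move=> s /=; rewrite in_itv /= => /andP[s1 s2].
have s0 : 0 < s by exact: lt_trans s1.
rewrite lee_fin; apply: ler_pM => //.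
- by rewrite divr_ge0 ?powR_ge0// ltW// growth_gt0.
- by rewrite invr_ge0 ltW// mulr_gt0.
- apply: ler_pM => //; first by rewrite ltW// growth_gt0.
  + by rewrite invr_ge0 powR_ge0.
  + exact: growth_le (ltW _).
  by rewrite lef_pV2 ?posrE ?powR_gt0 ?mulr_gt0// ge0_ler_powR// ?nnegrE ?ltW// mulr_gt0.
by rewrite lef_pV2 ?posrE ?mulr_gt0// ltW.
Qed.

Lemma growth_tail t : 0 < t -> ((t `^ beta)%:E *
  \int[mu]_(s in `]t, +oo[) (phi s / s `^ beta / s)%:E <= (C * phi t)%:E)%E.
Proof.
move=> t0; apply: le_trans (cphi t0); rewrite leeDr//.
apply: integral_ge0 => s /=; rewrite in_itv /= => /andP[s0 _].
by rewrite lee_fin divr_ge0 ?ltW// growth_gt0.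
Qed.

Lemma growth_head t : 0 < t -> (\int[mu]_(s in `]0%R, t[) (phi s / s)%:E <= (C * phi t)%:E)%E.
Proof.
move=> t0; apply: le_trans (cphi t0); rewrite leeDl// mule_ge0//.
  by rewrite lee_fin powR_ge0.
apply: integral_ge0 => s /=; rewrite in_itv /= andbT => s0.
have s1 : 0 < s by exact: lt_trans s0.
by rewrite lee_fin !divr_ge0 ?powR_ge0 ?ltW// growth_gt0.
Qed.

(* On [T, 2T] the kernel of the tail integral from t is at least phi T / (2 T)^beta / (2 T). *)
Lemma growth_upper t T : 0 < t -> t <= T -> phi T <= 4 * C * (T / t) `^ alpha * phi t.
Proof.
move=> t0 tT; have T0 := lt_le_trans t0 tT.
have C0 : 0 <= C * phi t.
  rewrite -lee_fin; apply: le_trans (growth_tail t0); rewrite mule_ge0 ?lee_fin ?powR_ge0//.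
  apply: integral_ge0 => s /=; rewrite in_itv /= andbT => s0.
  have s1 : 0 < s by exact: lt_trans s0.
  by rewrite lee_fin !divr_ge0 ?powR_ge0 ?ltW// growth_gt0.
have tb : 0 < t `^ beta by rewrite powR_gt0.
have H1 : t `^ beta * (phi T / (2 * T) `^ beta / 2) <= C * phi t.
  rewrite -lee_fin; apply: le_trans (growth_tail t0).
  rewrite EFinM lee_wpmul2l ?lee_fin ?(ltW tb)//.
  apply: le_trans (growth_kernel_ge (ltW beta0) T0) _.
  apply: ge0_subset_integral => //.
  - apply: measurable_funS (growth_kernel_measurable beta) => // s /=.
    rewrite /P /= !in_itv /= !andbT => s0; exact: lt_trans t0 s0.
  - move=> s /=; rewrite in_itv /= andbT => s0.
    have s1 : 0 < s by exact: lt_trans s0.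
    by rewrite lee_fin !divr_ge0 ?powR_ge0 ?ltW// growth_gt0.
  by move=> s /=; rewrite !in_itv /= andbT => /andP[s1 _]; exact: le_lt_trans s1.
have E1 : (2 * T) `^ beta = 2 `^ beta * (T / t) `^ beta * t `^ beta.
  by rewrite -mulrA -!powRM// ?divr_ge0 ?ltW// divfK// gt_eqF.
have b2 : 2 `^ beta <= 2 :> R.
  by rewrite -[leRHS]powRr1// ler_powR ?ler1n// (le_trans beta_alpha)// ltW.
have q0 : 0 < (T / t) `^ beta by rewrite powR_gt0// divr_gt0.
have p20 : 0 < 2 `^ beta :> R by rewrite powR_gt0.
have qa : (T / t) `^ beta <= (T / t) `^ alpha by rewrite ler_powR// ler_pdivlMr// mul1r.
have H2 : phi T <= 2 * (2 `^ beta) * (T / t) `^ beta * (C * phi t).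
  rewrite E1 in H1; rewrite -ler_pdivrMl ?mulr_gt0//; apply: le_trans H1.
  rewrite le_eqVlt; apply/orP; left; apply/eqP.
  move: (2 `^ beta) (t `^ beta) ((T / t) `^ beta) p20 tb q0 => x y z x0 y0 z0; field.
  by rewrite !gt_eqF.
apply: le_trans H2 _; rewrite [leRHS](_ : _ = 2 * 2 * (T / t) `^ alpha * (C * phi t)); last by ring.
apply: ler_wpM2r => //; apply: ler_pM => //.
- exact: ltW.
- by rewrite ler_wpM2l.
Qed.

(** The case t = T = 1 of [growth_upper]; in the theorem it excludes Cphi <= 0. *)
Lemma growth_const_ge : 1 <= 4 * C.
Proof.
have := @growth_upper 1 1 ltr01 (lexx _); rewrite divr1 powR1 mulr1 => H.
by rewrite -(ler_pM2r (growth_gt0 ltr01)) mul1r.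
Qed.

(** The doubling property of phi; since alpha < 1 and l >= 1, the power l^alpha may be replaced by
    l. *)
Lemma growth_scale t l : 0 < t -> 1 <= l -> phi (l * t) <= 4 * C * l * phi t.
Proof.
move=> t0 l1; have l0 : 0 < l := lt_le_trans ltr01 l1.
have h : t <= l * t by rewrite ler_peMl// ltW.
apply: le_trans (growth_upper t0 h) _; rewrite mulfK ?gt_eqF//.
apply: ler_wpM2r; first by rewrite ltW// growth_gt0.
apply: ler_wpM2l; first by rewrite (le_trans ler01)// growth_const_ge.
by rewrite -[leRHS]powRr1 ?(ltW l0)// ler_powR// ltW.
Qed.

(** The intervals from r / 2^k to 2 r / 2^k are disjoint, and on each the kernel integrates to at
    least phi(r / 2^k) / 2 by monotonicity. The interval k = 0 forces the upper end 2 r. *)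
Lemma growth_sum_int K r : 0 < r ->
  ((\sum_(k < K) phi (r / 2 ^+ k) / 2)%:E <= \int[mu]_(s in `]0%R, (2 * r)%R[) (phi s / s)%:E)%E.
Proof.
elim: K r => [|K IH] r r0.
  rewrite big_ord0; apply: integral_ge0 => s /=; rewrite in_itv /= => /andP[s0 _].
  by rewrite lee_fin divr_ge0 ?ltW// growth_gt0.
have m0 (T : R) : measurable_fun (`]0, T[%classic : set R) (fun s => (phi s / s)%:E).
  apply: (@eq_measurable_fun _ _ _ _ _ (fun s => (phi s / s `^ 0 / s)%:E)).
    by move=> s _; rewrite powRr0 divr1.
  by apply: measurable_funS (growth_kernel_measurable 0) => // s; rewrite /P /= !in_itv /= andbT => /andP[].
have p0 (T s : R) : `]0, T[%classic s -> (0 <= (phi s / s)%:E)%E.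
  by rewrite /= in_itv /= => /andP[s0 _]; rewrite lee_fin divr_ge0 ?ltW// growth_gt0.
have r2 : r < 2 * r by rewrite ltr_pMl// ltr1n.
have sub : `]0, r[ `|` `]r, (2 * r)[ `<=` `]0, 2 * r[.
  move=> s /= []; rewrite !in_itv /= => /andP[s1 s2].
    by rewrite s1 (lt_trans s2).
  by rewrite s2 (lt_trans r0).
apply: le_trans (_ : (_ <= \int[mu]_(s in `]0%R, r[ `|` `]r, (2 * r)%R[) (phi s / s)%:E)%E) _; last first.
  by apply: ge0_subset_integral => //; [exact: measurableU|exact: m0|move=> s; exact: p0].
rewrite ge0_integral_setU//; last first.
- apply/disj_setPLR => s /=; rewrite !in_itv /= => /andP[_ s1]; apply/negP; rewrite negb_and -!leNgt ltW//.
- by move=> s /sub; exact: p0.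
- by apply: measurable_funS (m0 (2 * r)) => //; exact: sub.
rewrite big_ord_recl expr0 divr1 EFinD addeC; apply: leeD.
  have r20 : 0 < r / 2 by rewrite divr_gt0.
  have := IH _ r20; rewrite [2 * _]mulrC divfK//.
  apply: le_trans; rewrite lee_fin le_eqVlt; apply/orP; left; apply/eqP.
  by apply: eq_bigr => k _; rewrite /bump /= exprS invfM mulrA.
have := @growth_kernel_ge 0 r (lexx _) r0; rewrite powRr0 divr1.
by move/le_trans; apply; rewrite le_eqVlt; apply/orP; left; apply/eqP; apply: eq_integral => s _; rewrite powRr0 divr1.
Qed.

Lemma growth_sum K r : 0 < r -> \sum_(k < K) phi (r / 2 ^+ k) <= 2 * C * phi (2 * r).
Proof.
move=> r0; have r2 : 0 < 2 * r by rewrite mulr_gt0.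
have := le_trans (growth_sum_int K r0) (growth_head r2).
rewrite lee_fin -mulr_suml ler_pdivrMr// => /le_trans; apply.
by rewrite le_eqVlt; apply/orP; left; apply/eqP; ring.
Qed.

End fixed.
End growth_lemmas.

(** * Harnack chains *)

Section chains.
Context {R : realType} {n : nat}.
Local Notation d := n.+1.
Local Notation E := 'rV[R]_d.
Implicit Types (D S B : set E) (u : E -> R) (x y z P Q X Y Z : E) (e r s c M : R).

Lemma ediam_eball_ge x r : 0 < r -> ((r / 2)%:E <= ediam (eball x r))%E.
Proof.
move=> r0; rewrite /ediam le_max; apply/orP; right; apply: ereal_sup_ubound.
exists (x + (r / 2) *: basis_row ord0), x.
have N : enorm (x + (r / 2) *: basis_row ord0 - x) = r / 2.
  by rewrite addrC addKr enormZ enorm_basis mulr1 gtr0_norm// divr_gt0.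
split; last by rewrite N.
  by rewrite /eball /= N ltr_pdivrMr// ltr_pMr// ltr1n.
by rewrite /eball /= subrr enorm0.
Qed.

Lemma ediam_eball_le x r : 0 < r -> (ediam (eball x r) <= (2 * r)%:E)%E.
Proof.
move=> r0; rewrite /ediam ge_max lee_fin mulr_ge0 ?(ltW r0)//=.
apply: ge_ereal_sup => _ [X [Y [XB YB ->]]]; rewrite lee_fin.
apply: le_trans (enorm_tri x X Y) _; rewrite mulr2n mulrDl mul1r; apply: lerD; first exact: ltW.
by rewrite enormB; exact: ltW.
Qed.

Section ball.
Variables (D : set E) (K2 : R) (c : E) (r : R).
Hypotheses (oD : open D) (bD : boundary D !=set0) (K20 : 1 < K2) (r0 : 0 < r).
Let B := eball c r.
Hypotheses (BD : B `<=` D) (lo : (K2^-1%:E * ediam B <= edist_set B (boundary D))%E)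
  (hi : (edist_set B (boundary D) <= K2%:E * ediam B)%E).

Let K2p : 0 < K2. Proof. exact: lt_trans K20. Qed.

Lemma whitney_ball_ge X : B X -> r <= 2 * K2 * delta D X.
Proof.
move=> BX; rewrite mulrAC -ler_pdivrMr// -ler_pdivrMl//; apply: (delta_ge bD) => y Dy.
have : ((K2^-1 * (r / 2))%:E <= (enorm (X - y))%:E)%E.
  apply: (le_trans _ (le_trans lo _)).
    by rewrite EFinM lee_wpmul2l ?lee_fin ?invr_ge0 ?(ltW K2p)// ediam_eball_ge.
  by apply: ereal_inf_lbound; exists X, y.
rewrite lee_fin; apply: le_trans; rewrite le_eqVlt; apply/orP; left; apply/eqP.
by field; rewrite gt_eqF.
Qed.

Lemma whitney_ball_le X : B X -> delta D X <= 2 * (K2 + 1) * r.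
Proof.
move=> BX.
have : ((delta D X - 2 * r)%:E <= (K2 * (2 * r))%:E)%E.
  apply: (@le_trans _ _ (edist_set B (boundary D))).
    apply: le_ereal_inf_tmp => _ [Y [y [BY Dy ->]]]; rewrite lee_fin lerBlDr.
    apply: le_trans (delta_le bD X Dy) _; apply: le_trans (enorm_tri Y X y) _.
    rewrite addrC lerD2l; apply: le_trans (enorm_tri c X Y) _.
    rewrite mulr2n mulrDl mul1r; apply: lerD; first exact: ltW.
    by rewrite enormB; exact: ltW.
  by apply: le_trans hi _; rewrite EFinM lee_wpmul2l ?lee_fin ?(ltW K2p)// ediam_eball_le.
by rewrite lee_fin lerBlDr => /le_trans; apply; rewrite le_eqVlt; apply/orP; left; apply/eqP; ring.
Qed.

(** Combines delta(X) <= 2 (K2 + 1) r with r <= 2 K2 delta(Y), the two bounds for points of a chain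
    ball of radius r. *)
Definition harnack_ratio : R := 2 * (K2 + 1) * (2 * K2).

Lemma whitney_ball_ratio X Y : B X -> B Y -> delta D X <= harnack_ratio * delta D Y.
Proof.
move=> BX BY; apply: le_trans (whitney_ball_le BX) _; rewrite /harnack_ratio -[leRHS]mulrA.
by apply: ler_wpM2l; [rewrite mulr_ge0// ltW// addr_gt0|exact: whitney_ball_ge].
Qed.

Lemma path_osc u (p : nat -> E) M k : (forall i, (i < k)%N -> `|u (p i) - u (p i.+1)| <= M) ->
  `|u (p 0%N) - u (p k)| <= k%:R * M.
Proof.
elim: k => [|k IH] H; first by rewrite subrr normr0 mul0r.
rewrite -[k.+1%:R]natr1 mulrDl mul1r (_ : _ - _ = (u (p 0%N) - u (p k)) + (u (p k) - u (p k.+1))); last by ring.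
apply: le_trans (ler_normD _ _) _; apply: lerD; last exact: H.
by apply: IH => i ik; apply: H; rewrite ltnS ltnW.
Qed.

Lemma eball_segment X Y t : B X -> B Y -> 0 <= t <= 1 -> B (X + t *: (Y - X)).
Proof.
move=> BX BY /andP[t0 t1]; rewrite /B /eball /=.
rewrite (_ : _ - c = (1 - t) *: (X - c) + t *: (Y - c)); last first.
  by apply/rowP => i; rewrite !mxE; ring.
apply: le_lt_trans (enormD _ _) _; rewrite !enormZ !ger0_norm ?subr_ge0//.
have [->|t0'] := eqVneq t 0; first by rewrite subr0 mul1r mul0r addr0.
rewrite [ltRHS](_ : _ = (1 - t) * r + t * r); last by ring.
apply: ler_ltD; first by apply: ler_wpM2l; [rewrite subr_ge0|exact: ltW].
by rewrite ltr_pM2l// lt_neqAle eq_sym t0'.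
Qed.

(** The segment from X to Y stays in the convex ball and is shorter than 2 r <= 4 K2 delta at each
    of its points; cut into J equal pieces, every piece is shorter than k delta. *)
Lemma whitney_ball_osc u (J : nat) k M X Y : 0 < k -> 4 * K2 < k * J%:R -> B X -> B Y ->
  (forall P Q, B P -> enorm (Q - P) < k * delta D P -> `|u P - u Q| <= M) ->
  `|u X - u Y| <= J%:R * M.
Proof.
move=> k0 kJ BX BY H.
have J0 : 0 < J%:R :> R.
  by rewrite -(ltr_pM2l k0) mulr0; apply: lt_trans kJ; rewrite mulr_gt0.
pose p i := X + (i%:R / J%:R) *: (Y - X).
have p0 : p 0%N = X by rewrite /p mul0r scale0r addr0.
have pJ : p J = Y by rewrite /p divff ?gt_eqF// scale1r addrC subrK.
rewrite -{1}p0 -[in X in _ - X]pJ; apply: path_osc => i iJ.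
have Bp : B (p i).
  apply: eball_segment => //; apply/andP; split; first by rewrite divr_ge0.
  by rewrite ler_pdivrMr// mul1r ler_nat ltnW.
apply: H => //.
rewrite (_ : p i.+1 - p i = J%:R^-1 *: (Y - X)); last first.
  by apply/rowP => j; rewrite !mxE -[i.+1%:R]natr1; ring.
rewrite enormZ gtr0_norm ?invr_gt0// ltr_pdivrMl//.
have XY : enorm (Y - X) < 2 * r.
  apply: le_lt_trans (enorm_tri c Y X) _; rewrite mulr2n mulrDl mul1r; apply: ltrD => //.
  by rewrite enormB.
apply: lt_le_trans XY _.
have h := whitney_ball_ge Bp.
have h2 := ltW kJ.
have h3 : 0 < delta D (p i) by apply: delta_gt0 => //; exact: BD.
apply: le_trans (_ : 2 * (2 * K2 * delta D (p i)) <= _); first by rewrite ler_wpM2l.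
rewrite [leRHS](_ : _ = (k * J%:R) * delta D (p i)); last by ring.
by rewrite [leLHS](_ : _ = (4 * K2) * delta D (p i)); [rewrite ler_wpM2r// ltW|ring].
Qed.

End ball.

Lemma log2p_le (t T : R) : 1 <= T -> t <= T -> log2p t <= ln T / ln 2.
Proof.
move=> T1 tT.
have l2 : 0 < ln 2 :> R by rewrite ln_gt0// ltr1n.
have lT : 0 <= ln T by exact: ln_ge0.
rewrite /log2p ge_max divr_ge0 ?(ltW l2)//=.
apply: ler_wpM2r; first by rewrite invr_ge0 ltW.
have [t0|t0] := leP t 0; first by rewrite ln0.
by rewrite ler_ln ?posrE// (lt_le_trans ltr01).
Qed.

(** Z and Z' lie at height comparable to s, so the chain has boundedly many balls, and delta grows
    along it by at most [harnack_ratio] per ball. Hence the oscillation of u is required only at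
    points with delta at most b s, which later keeps phi at scale s. *)
Lemma chain_osc (K1 K2 c C k : R) : 0 < K1 -> 1 < K2 -> 0 < c -> 0 < C -> 0 < k ->
  exists b K : R, [/\ 0 < b, 0 < K & forall D u s M Z Z', open D -> boundary D !=set0 ->
    harnack_chain K1 K2 D -> 0 < s -> 0 <= M -> D Z -> D Z' ->
    c * s <= delta D Z -> c * s <= delta D Z' -> delta D Z <= C * s -> enorm (Z - Z') <= C * s ->
    (forall P Q, D P -> delta D P <= b * s -> enorm (Q - P) < k * delta D P -> `|u P - u Q| <= M) ->
    `|u Z - u Z'| <= K * M].
Proof.
move=> K10 K21 c0 C0 k0.
have K20 : 0 < K2 by exact: lt_trans K21.
(* The ratio of |Z - Z'| to the smaller delta is at most C / c; 1 is added so that ln T is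
   nonnegative. N1 then bounds the number of balls, and J the number of pieces within each. *)
pose T := 1 + C / c.
have T1 : 1 <= T by rewrite lerDl divr_ge0// ltW.
pose N1 := (Num.truncn (K1 * (2 + ln T / ln 2))).+1.
pose J := (Num.truncn (4 * K2 / k)).+1.
pose lam := harnack_ratio K2.
have lam1 : 1 <= lam.
  have h : 1 * 1 <= 2 * (K2 + 1) * (2 * K2).
    apply: ler_pM => //.
      by rewrite -[leLHS]mulr1 ler_pM ?ler1n// lerDr ltW.
    by rewrite -[leLHS]mulr1 ler_pM ?ler1n// ltW.
  by rewrite mulr1 in h.
have lam0 : 0 < lam by exact: lt_le_trans lam1.
exists (lam ^+ N1 * C), (N1%:R * J%:R); split.
- by rewrite mulr_gt0 ?exprn_gt0.
- by rewrite mulr_gt0 ?ltr0n.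
move=> D u s M Z Z' oD bD HC s0 M0 DZ DZ' cZ cZ' CZ ZZ' H.
have [N [x [rho [N0 NK [ZB ZB'] chain balls]]]] := HC Z Z' DZ DZ'.
have NN1 : (N <= N1)%N.
  rewrite -(@ler_nat R); apply: le_trans NK _.
  apply: (@le_trans _ _ (K1 * (2 + ln T / ln 2))); last by rewrite ltW// truncnS_gt.
  rewrite ler_pM2l// lerD2l log2p_le//.
  have m0 : 0 < Num.min (delta D Z) (delta D Z') by rewrite lt_min !delta_gt0.
  rewrite ler_pdivrMr//; apply: le_trans ZZ' _.
  apply: (@le_trans _ _ (C / c * (c * s))); first by rewrite mulrA divfK// gt_eqF.
  apply: ler_pM; rewrite ?(ltW (divr_gt0 _ _)) ?(ltW (mulr_gt0 _ _)) ?lerDr//.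
  by rewrite le_min cZ cZ'.
have kJ : 4 * K2 < k * J%:R by rewrite [k * _]mulrC -ltr_pdivrMr// truncnS_gt.
suff key i : (1 <= i <= N)%N -> forall X, eball (x i) (rho i) X ->
    delta D X <= lam ^+ i * delta D Z /\ `|u Z - u X| <= (i * J)%:R * M.
  have [|_ h] := key N _ Z' ZB'; first by rewrite N0 leqnn.
  apply: le_trans h _; rewrite -natrM ler_wpM2r// ler_nat.
  by rewrite leq_mul2r NN1 orbT.
have up j X : (j <= N)%N -> delta D X <= lam ^+ j * delta D Z -> delta D X <= lam ^+ N1 * C * s.
  move=> jN /le_trans; apply; rewrite -mulrA; apply: ler_pM => //; rewrite ?exprn_ge0 ?(ltW lam0)//.
    exact: delta_ge0.
  by rewrite ler_weXn2l// (leq_trans jN).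
elim: i => [//|[|i] IH] /andP[_ iN] X XB.
  have [r0 BD lo hi] := balls 1%N iN.
  have ratio Y : eball (x 1%N) (rho 1%N) Y -> delta D Y <= lam * delta D Z.
    by move=> YB; exact: (whitney_ball_ratio bD K21 r0 lo hi YB ZB).
  rewrite expr1 mul1n; split; first exact: ratio.
  apply: (whitney_ball_osc oD bD K21 r0 BD lo k0 kJ ZB XB) => P Q PB PQ.
  by apply: H => //; [exact: BD|apply: (up 1%N) => //; rewrite expr1; exact: ratio].
have [Y [YB YB']] : eball (x i.+1) (rho i.+1) `&` eball (x i.+2) (rho i.+2) !=set0 by exact: chain.
have [Y1 Y2] := IH (ltnW iN) Y YB.
have [r0 BD lo hi] := balls i.+2 iN.
have ratio Y' : eball (x i.+2) (rho i.+2) Y' -> delta D Y' <= lam ^+ i.+2 * delta D Z.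
  move=> YB1; apply: le_trans (whitney_ball_ratio bD K21 r0 lo hi YB1 YB') _.
  by rewrite exprS -mulrA ler_wpM2l// ltW.
split; first exact: ratio.
rewrite (_ : u Z - u X = (u Z - u Y) + (u Y - u X)); last by ring.
apply: le_trans (ler_normD _ _) _; rewrite mulSn addnC natrD mulrDl; apply: lerD => //.
apply: (whitney_ball_osc oD bD K21 r0 BD lo k0 kJ YB' XB) => P Q PB PQ.
by apply: H => //; [exact: BD|apply: (up i.+2) => //; exact: ratio].
Qed.

(** If r / 8 is below the diameter of the boundary, the corkscrew condition at radius r / 8 applies.
    Otherwise the boundary lies within r / 8 of x: the point Z at distance r from x towards X is far
    from it, and the segment from X to Z cannot meet it, so Z is in D. The hypothesis r <= |X - x|
    says that D reaches that far. *)
Lemma corkscrew_point c0 D x X r : open D -> boundary D !=set0 -> 0 < c0 < 1 -> corkscrew c0 D ->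
  boundary D x -> D X -> 0 < r -> r <= enorm (X - x) ->
  exists Z, [/\ D Z, enorm (Z - x) <= r & c0 / 8 * r <= delta D Z].
Proof.
move=> oD bD /andP[c00 c01] ck bx DX r0 rX.
have r8 : 0 < r / 8 by rewrite divr_gt0.
have [small|big] := ltP (r / 8)%:E (ediam (boundary D)).
  have [Z HZ] := ck x _ bx r8 small.
  have cr : 0 < c0 * (r / 8) by rewrite mulr_gt0.
  have [Z1 DZ] : (eball x (r / 8) `&` D) Z by apply: HZ; rewrite /eball /= subrr enorm0.
  exists Z; split => //.
    by apply: ltW; apply: lt_le_trans Z1 _; rewrite ler_pdivrMr// ler_peMr ?(ltW r0)// ler1n.
  rewrite mulrAC -mulrA; apply: (delta_ge bD) => y Dy; rewrite leNgt; apply/negP => yZ.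
  have [_ Dy'] : (eball x (r / 8) `&` D) y by apply: HZ; rewrite /eball /= enormB.
  exact: boundary_notin Dy Dy'.
have far y : boundary D y -> enorm (y - x) <= r / 8.
  move=> Dy; rewrite -lee_fin; apply: le_trans big; rewrite /ediam le_max; apply/orP; right.
  by apply: ereal_sup_ubound; exists y, x.
have X0 : 0 < enorm (X - x) by exact: lt_le_trans rX.
pose Z := x + (r / enorm (X - x)) *: (X - x).
have Zx : enorm (Z - x) = r.
  rewrite /Z addrC addKr enormZ gtr0_norm ?divr_gt0// divfK// gt_eqF//.
exists Z; split; last 1 first.
- apply: (delta_ge bD) => y /far yx.
  have := enorm_tri y Z x; rewrite Zx -lerBlDr; apply: le_trans.
  apply: (@le_trans _ _ (r - r / 8)); last by rewrite lerD2l lerN2.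
  rewrite (_ : r - r / 8 = 7 / 8 * r); last by field.
  by rewrite ler_wpM2r ?(ltW r0)// ler_wpM2r// (le_trans (ltW c01))// ler1n.
- apply: contrapT => nDZ.
  have [t /andP[t0 t1] bt] := segment_boundary oD DX nDZ.
  have := far _ bt; rewrite (_ : _ - x = ((1 - t) + t * (r / enorm (X - x))) *: (X - x)); last first.
    by apply/rowP => i; rewrite !mxE; ring.
  rewrite enormZ ger0_norm; last first.
    by apply: addr_ge0; [rewrite subr_ge0|rewrite mulr_ge0// divr_ge0// ltW].
  rewrite mulrDl -mulrA divfK ?gt_eqF//; apply/negP; rewrite -ltNge.
  apply: (@lt_le_trans _ _ ((1 - t) * r + t * r)).
    by rewrite -mulrDl subrK mul1r ltr_pdivrMr// ltr_pMr// ltr1n.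
  by rewrite lerD2r ler_wpM2l// subr_ge0.
by rewrite Zx.
Qed.

End chains.

(** * From Carleson to Holder *)

Section carleson_to_holder.
Context {R : realType} {n : nat}.
Local Notation d := n.+1.
Local Notation E := 'rV[R]_d.
Local Notation mu := (@lebesgue_row R d).
Implicit Types (D S B : set E) (u : E -> R) (x y z P Q X Y Z : E) (e r s c M N : R) (phi : R -> R).

Lemma delta_continuous D : boundary D !=set0 -> continuous (delta D).
Proof. by move=> bD; apply: (@lipschitz_row_continuous _ _ _ 1) => X Y; rewrite mul1r; exact: delta_lip. Qed.

Lemma weighted_gradient_measurable D u : open D -> boundary D !=set0 -> W12loc D u ->
  measurable_fun D (fun X => (enorm (weak_grad D u X) ^+ 2 * delta D X)%:E).
Proof.
move=> oD bD [_ _ [mG _ _] _]; apply/measurable_EFinP; apply: measurable_funM.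
  by apply/measurable_EFinP; exact: measurable_enorm2.
by apply: measurable_funTS; apply: continuous_measurable_row; exact: delta_continuous.
Qed.

Lemma weighted_gradient_ge0 D u X : boundary D !=set0 ->
  (0 <= (enorm (weak_grad D u X) ^+ 2 * delta D X)%:E)%E.
Proof. by move=> bD; rewrite lee_fin mulr_ge0 ?sqr_ge0 ?delta_ge0. Qed.

Lemma carleson_norm_le phi D u N x r : (forall t, 0 < t -> 0 < phi t) -> boundary D !=set0 ->
  (carleson_norm phi D u <= N%:E)%E -> boundary D x -> 0 < r ->
  (\int[mu]_(X in eball x r `&` D) (enorm (weak_grad D u X) ^+ 2 * delta D X)%:E
    <= ((N * phi r) ^+ 2 * r ^+ n)%:E)%E.
Proof.
move=> phi0 bD HN bx r0.
have p0 := phi0 r r0.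
have rn : 0 < r ^+ n by rewrite exprn_gt0.
have : ((phi r)^-1%:E * sqrte ((r ^+ n)^-1%:E *
      \int[mu]_(X in eball x r `&` D) (enorm (weak_grad D u X) ^+ 2 * delta D X)%:E) <= N%:E)%E.
  by apply: le_trans HN; apply: ereal_sup_ubound; exists x, r.
have : (0 <= \int[mu]_(X in eball x r `&` D) (enorm (weak_grad D u X) ^+ 2 * delta D X)%:E)%E.
  by apply: integral_ge0 => X _; exact: weighted_gradient_ge0.
case: (\int[mu]_(X in _) _)%E => [i||] //= i0; last first.
  by rewrite gt0_muley ?lte_fin ?invr_gt0//= gt0_muley ?lte_fin ?invr_gt0.
rewrite !lee_fin in i0 * => H.
have j0 : 0 <= (r ^+ n)^-1 * i by rewrite mulr_ge0// invr_ge0 ltW.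
rewrite ler_pdivrMl// [phi r * N]mulrC in H.
have N0 : 0 <= N * phi r by apply: le_trans H; exact: sqrtr_ge0.
have H2 : (r ^+ n)^-1 * i <= (N * phi r) ^+ 2.
  rewrite -(sqr_sqrtr j0) ler_sqr ?nnegrE ?sqrtr_ge0//.
by move: H2; rewrite ler_pdivrMl// mulrC.
Qed.

(** Chosen so that the cube around P of half-side 3 k delta(P) lies within 3/8 delta(P) of P: its
    half-side is multiplied by d in passing to a ball. *)
Definition interior_ratio : R := (8 * d%:R)^-1.
Local Notation k := interior_ratio.

Lemma interior_ratio_gt0 : 0 < k. Proof. by rewrite invr_gt0 mulr_gt0. Qed.

Lemma interior_ratio_le1 : k <= 1.
Proof. by rewrite invf_le1 ?mulr_gt0// -natrM ler1n muln_gt0. Qed.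

Lemma interior_oscillation Lam alpha C1 : 1 <= C1 -> DeGiorgi_Nash d Lam alpha C1 ->
  exists2 K, 0 < K & forall D (A : E -> 'M[R]_d) u phi N, open D -> boundary D !=set0 ->
    elliptic D Lam A -> weak_solution D A u -> (forall t, 0 < t -> 0 < phi t) -> 0 < N ->
    (carleson_norm phi D u <= N%:E)%E ->
    forall P X Y, D P -> eclosed_ball P (k * delta D P) X -> eclosed_ball P (k * delta D P) Y ->
      X != Y -> `|u X - u Y| <= K * N * phi (2 * delta D P) *
        (enorm (X - Y) / (k * delta D P)) `^ alpha.
Proof.
move=> C10 DGN; have [K K0 HK] := interior_estimate C10 DGN.
(* Solves W^2 (k t)^(d-2) = (2 / t) (N phi(2 t))^2 (2 t)^n for W, with d = n + 1. *)
pose q : R := 2 ^+ d * k ^+ 2 / k ^+ d.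
have k0 := interior_ratio_gt0.
have q0 : 0 < q by rewrite divr_gt0 ?mulr_gt0 ?exprn_gt0.
exists (K * Num.sqrt q); first by rewrite mulr_gt0 ?sqrtr_gt0.
move=> D A u phi N oD bD ellA wu phi0 N0 HN P X Y DP PX PY XY.
have mD := open_measurable_row oD.
set t := delta D P in PX PY *.
have t0 : 0 < t by exact: delta_gt0.
have kt : 0 < k * t by rewrite mulr_gt0.
have p0 : 0 < phi (2 * t) by rewrite phi0 ?mulr_gt0.
pose W := N * phi (2 * t) * Num.sqrt q.
have W0 : 0 < W by rewrite !mulr_gt0 ?sqrtr_gt0.
have E38 : 3 * d%:R * (k * t) = 3 / 8 * t.
  by rewrite /k /interior_ratio; field; rewrite gt_eqF.
have tt : 3 / 8 * t < t by rewrite gtr_pMl// ltr_pdivrMr// mul1r ltr_nat.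
have PD : eclosed_ball P (3 * d%:R * (k * t)) `<=` D.
  rewrite E38; apply: subset_trans (eclosed_ball_eball tt) _.
  exact: (eball_delta_sub oD bD DP).
(* Points of the cube are within 3/8 t of P, hence within (3/8 + 9/8) t < 2 t of y, and their delta
   is at least 5/8 t. The weight delta can thus be replaced by t / 2 in the Carleson integral at
   y. *)
have [y by_ Py] : exists2 y, boundary D y & enorm (P - y) < 9 / 8 * t.
  apply: (delta_lt bD); rewrite -/t -[ltLHS]mul1r ltr_pM2r// ltr_pdivlMr// mul1r ltr_nat//.
have cubeP z : cube P (3 * (k * t)) z -> enorm (z - P) <= 3 / 8 * t.
  move=> /(cube_eclosed_ball _); rewrite -E38.
  have h : 0 <= 3 * (k * t) by rewrite mulr_ge0// ltW.
  by move=> /(_ h); rewrite /eclosed_ball /= mulrCA mulrA.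
have t2 : 0 < 2 * t by rewrite mulr_gt0.
have sub : cube P (3 * (k * t)) `<=` eball y (2 * t) `&` D.
  move=> z Pz; have zP := cubeP z Pz; split.
    rewrite /eball /=; apply: le_lt_trans (enorm_tri P z y) _.
    apply: lt_le_trans (ler_ltD zP Py) _.
    by rewrite -mulrDl ler_wpM2r ?(ltW t0)// -mulrDl -natrD ler_pdivrMr// -natrM ler_nat.
  by apply: PD; rewrite E38.
have dz z : cube P (3 * (k * t)) z -> t / 2 <= delta D z.
  move=> /cubeP zP; have := delta_lipD bD P z; rewrite enormB -/t -lerBlDr; apply: le_trans.
  apply: (@le_trans _ _ (t - 3 / 8 * t)); last by rewrite lerD2l lerN2.
  rewrite (_ : t - _ = 5 / 8 * t); last by field.
  rewrite mulrC ler_wpM2r ?(ltW t0)// ler_pdivlMr// mulrC ler_pdivrMr// -natrM ler_nat//.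
have [w12 _ _] := wu.
have mGd := weighted_gradient_measurable oD bD w12.
have mU : measurable (cube P (3 * (k * t))) by exact: cube_measurable.
have UD : cube P (3 * (k * t)) `<=` D by move=> z /sub[].
have mB : measurable (eball y (2 * t) `&` D).
  by apply: measurableI => //; apply: open_measurable_row; exact: eball_open.
have energy : (\int[mu]_(x in cube P (3 * (k * t))) (enorm (weak_grad D u x) ^+ 2)%:E
    <= (W ^+ 2 * (k * t) ^+ d / (k * t) ^+ 2)%:E)%E.
  apply: (@le_trans _ _ (\int[mu]_(x in cube P (3 * (k * t)))
     ((2 / t)%:E * (enorm (weak_grad D u x) ^+ 2 * delta D x)%:E))%E).
    have [_ _ [mG _ _] _] := w12.
    apply: ge0_le_integral => //.
    - by move=> z _; rewrite lee_fin sqr_ge0.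
    - by apply: measurable_enorm2; exact: measurable_funS mG.
    - apply: measurable_funeM; exact: measurable_funS mGd.
    move=> z /dz h; rewrite -EFinM lee_fin mulrCA ler_peMr ?sqr_ge0//.
    by rewrite mulrAC ler_pdivlMr// mul1r mulrC -ler_pdivrMr.
  rewrite ge0_integralZl//; last 3 first.
  - exact: measurable_funS mGd.
  - by move=> z _; exact: weighted_gradient_ge0.
  - by rewrite lee_fin divr_ge0// ltW.
  have h := carleson_norm_le phi0 bD HN by_ t2.
  have h1 : (\int[mu]_(x in cube P (3 * (k * t))) (enorm (weak_grad D u x) ^+ 2 * delta D x)%:E
     <= ((N * phi (2 * t)) ^+ 2 * (2 * t) ^+ n)%:E)%E.
    apply: le_trans h; apply: ge0_subset_integral => //.
      by apply: measurable_funS mGd => // z [].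
    by move=> z _; exact: weighted_gradient_ge0.
  apply: le_trans (_ : ((2 / t)%:E * ((N * phi (2 * t)) ^+ 2 * (2 * t) ^+ n)%:E <= _)%E).
    by apply: lee_wpmul2l => //; rewrite lee_fin divr_ge0// ltW.
  rewrite -EFinM lee_fin /W [in leRHS]exprMn sqr_sqrtr ?(ltW q0)// /q !exprMn.
  rewrite le_eqVlt; apply/orP; left; apply/eqP.
  rewrite !exprS; move: (N ^+ n) (k ^+ n) (exprn_gt0 n k0) (t ^+ n) (2 ^+ n : R) (exprn_gt0 n t0).
  move=> a b b0 c e c0.
  by field; rewrite !gt_eqF.
have [c [_ H]] := HK D A u P (k * t) W oD ellA wu kt W0 PD energy.
apply: le_trans (H X Y PX PY XY) _.
by rewrite /W le_eqVlt; apply/orP; left; apply/eqP; ring.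
Qed.


Lemma holder_of_carleson Lam alpha C1 c0 K1 K2 Cphi : 1 <= C1 -> DeGiorgi_Nash d Lam alpha C1 ->
  0 < alpha < 1 -> 0 < c0 < 1 -> 1 < K1 -> 1 < K2 -> 0 < Cphi ->
  exists2 C, 0 < C & forall D (A : E -> 'M[R]_d) beta phi u N, open D -> boundary D !=set0 ->
    corkscrew c0 D -> harnack_chain K1 K2 D -> elliptic D Lam A -> 0 < beta -> beta <= alpha ->
    growth_function phi -> growth_class beta Cphi phi -> weak_solution D A u -> 0 < N ->
    (carleson_norm phi D u <= N%:E)%E -> forall X Y, D X -> D Y -> X != Y ->
    `|u X - u Y| <= C * N * phi (enorm (X - Y)).
Proof.
move=> C10 DGN /andP[a0 a1] c01 K11 K21 Cp0.
have [KO KO0 HO] := interior_oscillation C10 DGN.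
have /andP[c00 c0l] := c01.
have k0 := interior_ratio_gt0; have k1 := interior_ratio_le1.
have ki1 : 1 <= k^-1 by rewrite invf_ge1.
(* Corkscrew points at scales r / 2 and r have delta at least (c0 / 8) (r / 2). CC bounds, in units
   of the scale, the length of every link and the delta at its starting point. *)
pose cc := c0 / 16; pose CC := 8 / k + 8.
have cc0 : 0 < cc by rewrite divr_gt0.
have CC0 : 0 < CC by rewrite addr_gt0// divr_gt0.
have [b' [Kc [b'0 Kc0 HC]]] := @chain_osc R n K1 K2 cc CC k (lt_trans ltr01 K11) K21 cc0 CC0 k0.
(* The added 1 ensures 2 b >= 1, as [growth_scale] requires. *)
pose b := b' + 1.
have b0 : 0 < b by rewrite addr_gt0.
(* Cn serves the near case. In Cf, each of the two climbs costs 16 Cphi^2 b, and the link between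
   their ends 8 Cphi b. *)
pose Cn := KO * (4 * Cphi * (2 / k) `^ alpha).
pose Cf := Kc * KO * (32 * Cphi ^+ 2 * b + 8 * Cphi * b).
have Cn0 : 0 < Cn by rewrite !mulr_gt0// powR_gt0// divr_gt0.
have Cf0 : 0 < Cf.
  apply: mulr_gt0; first exact: mulr_gt0.
  by apply: addr_gt0; rewrite !mulr_gt0// exprn_gt0.
exists (Cn + Cf); first exact: addr_gt0.
move=> D A beta phi u N oD bD ck hc ellA be0 bea gphi cphi wu N0 HN X Y DX DY XY.
have phi0 := growth_gt0 gphi.
have int := HO D A u phi N oD bD ellA wu phi0 N0 HN.
set t := enorm (X - Y).
have t0 : 0 < t by rewrite enorm_gt0// subr_eq0.
have pt : 0 < N * phi t by rewrite mulr_gt0// phi0.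
(* [growth_upper] bounds phi(2 delta) by (2 delta / t)^alpha phi(t) up to a constant; against the
   Holder factor (t / (k delta))^alpha the distance delta cancels and (2 / k)^alpha remains. *)
have near P : D P -> t <= k * delta D P ->
    KO * N * phi (2 * delta D P) * (t / (k * delta D P)) `^ alpha <= Cn * (N * phi t).
  move=> DP tP; have dP := delta_gt0 oD bD DP.
  have kd : 0 < k * delta D P by rewrite mulr_gt0.
  have t2 : t <= 2 * delta D P.
    by apply: le_trans tP _; rewrite ler_wpM2r ?(ltW dP)// (le_trans k1)// ler1n.
  have h := growth_upper gphi cphi be0 bea a1 t0 t2.
  rewrite [leRHS](_ : _ = KO * N * (4 * Cphi * (2 / k) `^ alpha * phi t)); last by rewrite /Cn; ring.
  rewrite -mulrA; apply: ler_wpM2l; first by rewrite mulr_ge0// ltW.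
  apply: le_trans (ler_wpM2r _ h) _; first exact: powR_ge0.
  rewrite le_eqVlt; apply/orP; left; apply/eqP.
  rewrite (_ : 2 / k = (2 * delta D P / t) * (t / (k * delta D P))); last first.
    by field; rewrite !gt_eqF.
  rewrite (@powRM _ (2 * delta D P / t) (t / (k * delta D P))) ?divr_ge0 ?mulr_ge0 ?(ltW t0) ?(ltW dP) ?(ltW k0)//.
  ring.
rewrite -mulrA mulrDl.
have [tX|tX] := leP t (k * delta D X).
  have XX : eclosed_ball X (k * delta D X) X.
    by rewrite /eclosed_ball /= subrr enorm0 (le_trans (ltW t0)).
  have YX : eclosed_ball X (k * delta D X) Y by rewrite /eclosed_ball /= enormB.
  apply: le_trans (int X X Y DX XX YX XY) _; apply: le_trans (near X DX tX) _.
  by rewrite lerDl mulr_ge0 ?(ltW Cf0) ?(ltW pt).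
have [tY|tY] := leP t (k * delta D Y).
  have YY : eclosed_ball Y (k * delta D Y) Y.
    by rewrite /eclosed_ball /= subrr enorm0 (le_trans (ltW t0)).
  have YX : eclosed_ball Y (k * delta D Y) X by [].
  apply: le_trans (int Y X Y DY YX YY XY) _; apply: le_trans (near Y DY tY) _.
  by rewrite lerDl mulr_ge0 ?(ltW Cf0) ?(ltW pt).
pose M s := KO * N * phi (2 * b * s).
have M0 s : 0 < s -> 0 < M s by move=> s0; rewrite /M !mulr_gt0// phi0// !mulr_gt0.
(* Along a chain at scale s the points have delta at most b' s, and moves shorter than k delta have
   Holder factor at most 1; so each move changes u by at most [M s]. *)
have step s Z Z' : 0 < s -> D Z -> D Z' -> cc * s <= delta D Z -> cc * s <= delta D Z' ->
    delta D Z <= CC * s -> enorm (Z - Z') <= CC * s -> `|u Z - u Z'| <= Kc * M s.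
  move=> s0 DZ DZ' h1 h2 h3 h4.
  apply: (HC D u s (M s) Z Z') => //; first exact: ltW (M0 s s0).
  move=> P Q DP dP PQ; have [->|PQ'] := eqVneq P Q.
    by rewrite subrr normr0 ltW// M0.
  have dP0 := delta_gt0 oD bD DP.
  have kd : 0 < k * delta D P by rewrite mulr_gt0.
  have PP : eclosed_ball P (k * delta D P) P by rewrite /eclosed_ball /= subrr enorm0 ltW.
  have QP : eclosed_ball P (k * delta D P) Q by rewrite /eclosed_ball /= ltW.
  apply: le_trans (int P P Q DP PP QP PQ') _.
  have h5 : phi (2 * delta D P) <= phi (2 * b * s).
    apply: (growth_le gphi); first by rewrite mulr_gt0.
    rewrite -mulrA ler_wpM2l//; apply: le_trans dP _; rewrite ler_wpM2r ?(ltW s0)//.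
    by rewrite lerDl.
  rewrite /M -[leRHS]mulr1; apply: ler_pM => //.
  - by rewrite !mulr_ge0 ?(ltW KO0) ?(ltW N0)// ltW// phi0// mulr_gt0.
  - exact: powR_ge0.
  - by rewrite ler_wpM2l// mulr_ge0 ?ltW.
  rewrite [leRHS](_ : 1 = 1 `^ alpha); last by rewrite powR1.
  apply: ge0_ler_powR; rewrite ?nnegrE ?ltW//.
    by rewrite divr_gt0// enorm_gt0// subr_eq0.
  by rewrite ltr_pdivrMr// mul1r enormB.
have kr r : 0 < r -> 0 < 8 / k * r by move=> r0; rewrite mulr_gt0// divr_gt0.
(* The climb from Z to scale r, by induction on the number K of halvings that bring r below
   delta(Z). [direct] is the lowest link, used once r <= delta(Z); every further doubling adds one
   link between consecutive corkscrew points. W only witnesses that D reaches distance r from x. *)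
have up K : forall r x Z W, boundary D x -> D Z -> D W -> 0 < r -> r <= enorm (W - x) ->
    enorm (Z - x) <= 2 * delta D Z -> delta D Z <= 2 / k * r -> r / 2 ^+ K <= delta D Z ->
    exists Z', [/\ D Z', enorm (Z' - x) <= r, c0 / 8 * r <= delta D Z' &
      `|u Z - u Z'| <= \sum_(i < K.+1) Kc * M (r / 2 ^+ i)].
  have direct r x Z W J : boundary D x -> D Z -> D W -> 0 < r -> r <= enorm (W - x) ->
      enorm (Z - x) <= 2 * delta D Z -> delta D Z <= 2 / k * r -> r <= delta D Z ->
      exists Z', [/\ D Z', enorm (Z' - x) <= r, c0 / 8 * r <= delta D Z' &
        `|u Z - u Z'| <= \sum_(i < J.+1) Kc * M (r / 2 ^+ i)].
    move=> bx DZ DW r0 rW Zx dZ rZ.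
    have [Z' [DZ' Z'x cZ']] := corkscrew_point oD bD c01 ck bx DW r0 rW.
    exists Z'; split => //.
    apply: (@le_trans _ _ (Kc * M r)); last first.
      rewrite big_ord_recl expr0 divr1 lerDl sumr_ge0// => i _.
      by rewrite mulr_ge0 ?(ltW Kc0)// ltW// M0// divr_gt0// exprn_gt0.
    apply: step => //.
    - by apply: le_trans rZ; rewrite ler_piMl ?(ltW r0)// /cc ler_pdivrMr// mul1r (le_trans (ltW c0l))// ler1n.
    - apply: le_trans cZ'; rewrite ler_wpM2r ?(ltW r0)// /cc ler_wpM2l ?(ltW c00)//.
      by rewrite lef_pV2 ?posrE// ler_nat.
    - apply: le_trans dZ _; rewrite ler_wpM2r ?(ltW r0)// /CC; lra.
    apply: le_trans (enorm_tri x _ _) _; rewrite [enorm (x - Z')]enormB.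
    apply: le_trans (lerD Zx Z'x) _.
    apply: (@le_trans _ _ (2 * (2 / k * r) + r)); first by rewrite lerD2r ler_wpM2l.
    by rewrite /CC mulrDl; have := kr r r0; lra.
  elim: K => [|K IH] r x Z W bx DZ DW r0 rW Zx dZ rK.
    by apply: (direct _ _ _ W) => //; move: rK; rewrite expr0 divr1.
  have [rZ|rZ] := leP r (delta D Z); first exact: (direct _ _ _ W).
  have r20 : 0 < r / 2 by rewrite divr_gt0.
  have r2r : r / 2 <= r by rewrite ler_pdivrMr// ler_peMr ?ler1n// ltW.
  have [||Z' [DZ' Z'x cZ' uZ]] := IH (r / 2) x Z W bx DZ DW r20 (le_trans r2r rW) Zx.
  - apply: le_trans (ltW rZ) _; rewrite mulrC mulrA divfK// ler_peMr// ltW//.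
  - by rewrite exprS invfM mulrA in rK.
  have [Z2 [DZ2 Z2x cZ2]] := corkscrew_point oD bD c01 ck bx DW r0 rW.
  exists Z2; split => //.
  rewrite (_ : u Z - u Z2 = (u Z' - u Z2) + (u Z - u Z')); last by ring.
  apply: le_trans (ler_normD _ _) _; rewrite big_ord_recl expr0 divr1; apply: lerD; last first.
    apply: le_trans uZ _; rewrite le_eqVlt; apply/orP; left; apply/eqP.
    by apply: eq_bigr => i _; congr (_ * M _); rewrite lift0 exprS invfM mulrA.
  apply: step => //.
  - by apply: le_trans cZ'; rewrite /cc le_eqVlt; apply/orP; left; apply/eqP; field.
  - apply: le_trans cZ2; rewrite ler_wpM2r ?(ltW r0)// /cc ler_wpM2l ?(ltW c00)//.
    by rewrite lef_pV2 ?posrE// ler_nat.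
  - apply: le_trans (delta_le bD _ bx) _; apply: le_trans Z'x _; apply: le_trans r2r _.
    by rewrite /CC mulrDl; have := kr r r0; lra.
  apply: le_trans (enorm_tri x _ _) _; rewrite [enorm (x - Z2)]enormB.
  apply: le_trans (lerD (le_trans Z'x r2r) Z2x) _.
  by rewrite /CC mulrDl; have := kr r r0; lra.
(* Since |X - Y| = t, at least one of X and Y is at distance t / 2 or more from any given x, as
   [corkscrew_point] requires. *)
pose r := t / 2.
have r0 : 0 < r by rewrite divr_gt0.
have far Z : D Z -> k * delta D Z < t -> exists Z' x, [/\ D Z' /\ boundary D x,
    enorm (Z - x) <= 2 * delta D Z, enorm (Z' - x) <= r, c0 / 8 * r <= delta D Z' &
    `|u Z - u Z'| <= Kc * KO * N * (16 * Cphi ^+ 2 * b * phi t)].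
  move=> DZ tZ; have dZ := delta_gt0 oD bD DZ.
  have [x bx Zx] : exists2 x, boundary D x & enorm (Z - x) < 2 * delta D Z.
    by apply: (delta_lt bD); rewrite ltr_pMl// ltr1n.
  have [W DW rW] : exists2 W, D W & r <= enorm (W - x).
    have [h|h] := leP r (enorm (X - x)); first by exists X.
    exists Y => //; have := enorm_tri x X Y; rewrite -/t [enorm (x - Y)]enormB => h2.
    rewrite leNgt; apply/negP => h3; have := ltrD h h3.
    by apply/negP; rewrite -leNgt -mulr2n -mulr_natr /r divfK.
  (* Enough halvings, since 2^K > K > r / delta(Z). *)
  pose K := (Num.truncn (r / delta D Z)).+1.
  have rK : r / 2 ^+ K <= delta D Z.
    rewrite ler_pdivrMr ?exprn_gt0// mulrC -ler_pdivrMr//.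
    apply: (@le_trans _ _ K%:R); first by rewrite ltW// truncnS_gt.
    by rewrite -natrX ler_nat ltnW// ltn_expl.
  have dr : delta D Z <= 2 / k * r.
    rewrite /r mulrC mulrA divfK// ler_pdivlMr// mulrC; exact: ltW.
  have [Z' [DZ' Z'x cZ' uZ]] := up K r x Z W bx DZ DW r0 rW (ltW Zx) dr rK.
  exists Z', x; split => //; first exact: ltW.
  apply: le_trans uZ _.
  have bt : 0 < b * t by rewrite mulr_gt0.
  (* As 2 r = t, [M] at r / 2^i involves phi(b t / 2^i). The sum is at most 2 Cphi phi(2 b t), and
     [growth_scale] adds the factor 8 Cphi b. *)
  rewrite (_ : \sum_(i < K.+1) _ = Kc * KO * N * \sum_(i < K.+1) phi (b * t / 2 ^+ i)); last first.
    rewrite mulr_sumr; apply: eq_bigr => i _; rewrite /M !mulrA; congr (_ * phi _).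
    by rewrite /r; field; rewrite expf_neq0.
  apply: ler_wpM2l; first by rewrite !mulr_ge0// ltW.
  apply: le_trans (growth_sum gphi cphi K.+1 bt) _.
  have h2b : 1 <= 2 * b by rewrite mulrDr mulr1 -[leLHS]add0r lerD ?mulr_ge0 ?ler1n// ltW.
  have := growth_scale gphi cphi be0 bea a1 t0 h2b; rewrite -[2 * b * t]mulrA => h.
  apply: le_trans (ler_wpM2l _ h) _; first by rewrite mulr_ge0// ltW.
  by rewrite le_eqVlt; apply/orP; left; apply/eqP; ring.
have [ZX [x [[DZX bx] Xx ZXx cZX uX]]] := far X DX tX.
have [ZY [y [[DZY by_] Yy ZYy cZY uY]]] := far Y DY tY.
have mid : `|u ZX - u ZY| <= Kc * KO * N * (8 * Cphi * b * phi t).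
  have h2b : 1 <= 2 * b by rewrite mulrDr mulr1 -[leLHS]add0r lerD ?mulr_ge0 ?ler1n// ltW.
  have h := growth_scale gphi cphi be0 bea a1 t0 h2b.
  apply: (@le_trans _ _ (Kc * M t)); last first.
    rewrite /M !mulrA; apply: le_trans (ler_wpM2l _ h) _; first by rewrite !mulr_ge0// ltW.
    by rewrite le_eqVlt; apply/orP; left; apply/eqP; ring.
  have E1 : cc * t = c0 / 8 * r by rewrite /cc /r; field.
  have dX : delta D X <= t / k by rewrite ler_pdivlMr// mulrC ltW.
  have dY : delta D Y <= t / k by rewrite ler_pdivlMr// mulrC ltW.
  apply: step => //; rewrite ?E1//.
    apply: le_trans (delta_le bD _ bx) _; by apply: le_trans ZXx _; rewrite /CC mulrDl; have := kr t t0; rewrite /r; lra.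
  have h1 := enorm_tri x ZX ZY; have h2 := enorm_tri X x ZY; have h3 := enorm_tri Y X ZY.
  have h4 := enorm_tri y Y ZY.
  rewrite [enorm (x - X)]enormB in h2; rewrite [enorm (y - ZY)]enormB in h4.
  rewrite -/t in h3; rewrite /r in ZXx ZYy; rewrite /CC.
  have E2 : (8 / k + 8) * t = 8 * (t / k) + 8 * t by ring.
  have tk : 0 < t / k by rewrite divr_gt0.
  by rewrite E2; lra.
rewrite (_ : u X - u Y = (u X - u ZX) + (u ZX - u ZY) + (u ZY - u Y)); last by ring.
apply: le_trans (ler_normD _ _) _; apply: le_trans (lerD (ler_normD _ _) (lexx _)) _.
rewrite [`|u ZY - u Y|]distrC.
apply: le_trans (lerD (lerD uX mid) uY) _.
apply: (@le_trans _ _ (Cf * (N * phi t))); last by rewrite lerDr mulr_ge0 ?(ltW Cn0) ?(ltW pt).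
by rewrite /Cf le_eqVlt; apply/orP; left; apply/eqP; ring.
Qed.

End carleson_to_holder.

(** * Packing *)

Section nets.
Context {R : realType} {d : nat}.
Local Notation E := 'rV[R]_d.
Local Notation mu := (@lebesgue_row R d).
Implicit Types (A B S T : set E) (q : seq E) (x y z : E) (e r s v w : R).

Definition separated e q := pairwise (fun x y => e <= enorm (x - y)) q.

Definition covers q e S := forall z, S z -> exists2 y, y \in q & enorm (z - y) < e.

(** The bound on the length yields a longest separated sequence; a point that it left uncovered
    could be added to it. *)
Lemma maximal_net S e (m : nat) :
  (forall q, separated e q -> (forall y, y \in q -> S y) -> (size q <= m)%N) ->
  exists q, [/\ (size q <= m)%N, forall y, y \in q -> S y & covers q e S].
Proof.
move=> H.
pose P k := `[< exists q, [/\ separated e q, forall y, y \in q -> S y & size q = k] >].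
have P0 : exists k, P k by exists 0%N; apply/asboolP; exists [::].
have Pm k : P k -> (k <= m)%N by move=> /asboolP [q [sq Sq <-]]; exact: H.
case: (ex_maxnP P0 Pm) => k /asboolP [q [sq Sq qk]] kmax.
exists q; split => //; first exact: H.
move=> z Sz; apply: contrapT => nz.
have : P k.+1.
  apply/asboolP; exists (z :: q); split; last by rewrite /= qk.
    rewrite /separated /= -/(separated e q) sq andbT; apply/allP => y yq.
    by rewrite leNgt; apply/negP => zy; apply: nz; exists y.
  by move=> y; rewrite in_cons => /orP[/eqP->//|]; exact: Sq.
by move=> /kmax; rewrite ltnn.
Qed.

Lemma covers_refine q S e r (m : nat) : covers q r S ->
  (forall y, y \in q -> exists q',
    [/\ (size q' <= m)%N, forall z, z \in q' -> S z & covers q' e (S `&` eball y r)]) ->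
  exists q', [/\ (size q' <= size q * m)%N, forall z, z \in q' -> S z & covers q' e S].
Proof.
move=> Cq Hq.
have /choice [f Hf] : forall y, exists q', y \in q ->
    [/\ (size q' <= m)%N, forall z, z \in q' -> S z & covers q' e (S `&` eball y r)].
  move=> y; case: (boolP (y \in q)) => [/Hq [q' h]|_]; first by exists q'.
  by exists [::].
exists (flatten (map f q)); split.
- have Hs y : y \in q -> (size (f y) <= m)%N by move=> /Hf [].
  elim: q Hs {Cq Hq Hf} => [//|y q IH] Hs /=; rewrite size_cat mulSn leq_add//.
    by apply: Hs; rewrite mem_head.
  by apply: IH => z zq; apply: Hs; rewrite in_cons zq orbT.
- by move=> z /flattenP [l /mapP [y /Hf [_ h _] ->] zl]; exact: h.
move=> z Sz; have [y yq zy] := Cq z Sz.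
have [_ _ h] := Hf y yq; have [|p pf zp] := h z; first by split.
by exists p => //; apply/flattenP; exists (f y) => //; exact: map_f.
Qed.

(** Written as a fold, so that the measures of the separated pieces are added by induction on q. *)
Definition cells S e q : set E := foldr (fun y A => (S `&` eball y e) `|` A) set0 q.

Lemma cellsP S e q z : cells S e q z -> exists2 y, y \in q & S z /\ enorm (z - y) < e.
Proof.
elim: q => [//|y q IH] /= [[Sz zy]|/IH [p pq h]]; first by exists y; rewrite ?mem_head.
by exists p => //; rewrite in_cons pq orbT.
Qed.

(* For the Lebesgue measure G is the class of measurable sets. The Hausdorff
   measure is additive on positively separated sets, measurable or not, so that
   the theory of Caratheodory measurability is not needed. *)
Lemma packing (H : set E -> \bar R) (G : set E -> Prop) S e v q : 0 < e ->
  (0 <= H set0)%E -> G set0 -> (forall y, G (S `&` eball y (e / 4))) ->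
  (forall A B, G A -> G B -> G (A `|` B)) ->
  (forall A B, G A -> G B -> (forall x y, A x -> B y -> e / 2 <= enorm (x - y)) ->
    (H A + H B <= H (A `|` B))%E) ->
  (forall y, y \in q -> (v%:E <= H (S `&` eball y (e / 4)))%E) -> separated e q ->
  ((v *+ size q)%:E <= H (cells S (e / 4) q))%E.
Proof.
move=> e0 H0 G0 Gb GU HU.
have Gc q' : G (cells S (e / 4) q') by elim: q' => [//|y q' IH]; exact: GU.
elim: q => [|y q IH] vq; first by rewrite mulr0n.
rewrite /separated /= => /andP[/allP yq sq].
rewrite mulrS EFinD; apply: (le_trans _ (HU _ _ (Gb y) (Gc q) _)).
  apply: leeD; first by apply: vq; rewrite mem_head.
  by apply: IH => // z zq; apply: vq; rewrite in_cons zq orbT.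
move=> a b [_ ay] /cellsP [z zq [_ bz]].
have h := yq z zq; have h1 := enorm_tri a y z; have h2 := enorm_tri b a z.
rewrite /eball /= in ay; rewrite [enorm (y - a)]enormB in h1; lra.
Qed.

Lemma packing_volume y e r q : 0 < e -> 0 < r -> separated e q ->
  (forall z, z \in q -> eball y r z) ->
  (size q)%:R <= (4 * d.+1%:R * (r + e) / e) ^+ d.
Proof.
move=> e0 r0 sq qr.
have e4 : 0 < e / 4 by rewrite divr_gt0.
have re : 0 < r + e by rewrite addr_gt0.
have mb z t : measurable (eball z t) by apply: open_measurable_row; exact: eball_open.
have H := @packing mu measurable setT e ((2 * (e / 4 / d.+1%:R)) ^+ d) q e0 _ _ _ _ _ _ sq.
have : (((2 * (e / 4 / d.+1%:R)) ^+ d *+ size q)%:E <= mu (cells setT (e / 4) q))%E.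
  apply: H => //.
  - by move=> z; rewrite setTI.
  - exact: measurableU.
  - move=> A B mA mB AB; rewrite measureU//.
    apply/seteqP; split => // z [/= Az Bz].
    by have := AB z z Az Bz; rewrite subrr enorm0 leNgt divr_gt0.
  by move=> z _; rewrite setTI; exact: lebesgue_row_eball_ge.
have mc : measurable (cells setT (e / 4) q).
  elim: (q) => [|z q' IH] /=; first exact: measurable0.
  by rewrite setTI; exact: measurableU.
move=> h; have : (((2 * (e / 4 / d.+1%:R)) ^+ d *+ size q)%:E <= ((2 * (r + e)) ^+ d)%:E)%E.
  apply: le_trans h _; apply: le_trans (lebesgue_row_eball_le y re).
  apply: le_measure; rewrite ?inE// => z /cellsP [p /qr pr [_ zp]].
  rewrite /eball /= in pr *; apply: le_lt_trans (enorm_tri p _ _) _.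
  rewrite addrC; apply: ltrD => //; apply: lt_trans zp _.
  by rewrite ltr_pdivrMr// ltr_pMr// ltr1n.
rewrite lee_fin -mulr_natl => h2.
have h3 : 0 < (2 * (e / 4 / d.+1%:R)) ^+ d by rewrite exprn_gt0// mulr_gt0// divr_gt0.
rewrite -ler_pdivlMr// in h2; apply: le_trans h2 _.
rewrite -exprVn -exprMn le_eqVlt; apply/orP; left; apply/eqP; congr (_ ^+ _).
by field; rewrite gt_eqF//= gt_eqF.
Qed.

(** The bound of [packing_volume] is invariant under scaling, so m depends on k and d only. *)
Lemma volume_net (k : R) : 0 < k -> exists m : nat, forall y r S, 0 < r -> S `<=` eball y r ->
  exists q, [/\ (size q <= m)%N, forall z, z \in q -> S z & covers q (k * r) S].
Proof.
move=> k0; exists (Num.truncn ((4 * d.+1%:R * (1 + k) / k) ^+ d)) => y r S r0 Sy.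
apply: maximal_net => q sq qS.
have kr : 0 < k * r by rewrite mulr_gt0.
have := packing_volume kr r0 sq (fun z zq => Sy z (qS z zq)).
rewrite (_ : 4 * d.+1%:R * (r + k * r) / (k * r) = 4 * d.+1%:R * (1 + k) / k); last first.
  by field; rewrite !gt_eqF.
move=> h; rewrite -[leqRHS]/(Num.truncn _) truncn_ge_nat//.
by rewrite exprn_ge0// divr_ge0 ?mulr_ge0 ?addr_ge0// ltW.
Qed.

End nets.

(** * Hausdorff measure of separated sets *)

Section hausdorff_measure.
Context {R : realType} {d : nat}.
Local Notation E := 'rV[R]_d.
Implicit Types (A B S : set E) (e r s : R).

Lemma ediam_ge0 A : (0 <= ediam A)%E. Proof. by rewrite /ediam le_max lexx. Qed.

Lemma ediam0 : ediam (set0 : set E) = 0%E.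
Proof.
rewrite /ediam (_ : [set z | _] = set0) ?ereal_sup0//.
by apply/seteqP; split => // z [X [Y []]].
Qed.

Lemma hausdorff_pre_ge0 (n : nat) e A : (0 <= hausdorff_pre n e A)%E.
Proof.
apply: le_ereal_inf_tmp => _ [F _ <-]; apply: nneseries_ge0 => i _ _.
by rewrite expe_ge0// ediam_ge0.
Qed.

Lemma hausdorff_ge0 (n : nat) A : (0 <= hausdorff n A)%E.
Proof.
apply: le_trans (hausdorff_pre_ge0 n 1 A) _; apply: ereal_sup_ubound.
by exists 1 => //=.
Qed.

Lemma hausdorff_preS (n : nat) e A B : A `<=` B -> (hausdorff_pre n e A <= hausdorff_pre n e B)%E.
Proof.
move=> AB; apply: le_ereal_inf_tmp => _ [F [BF Fe] <-]; apply: ereal_inf_lbound.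
by exists F => //; split => //; exact: subset_trans BF.
Qed.

Lemma hausdorffS (n : nat) A B : A `<=` B -> (hausdorff n A <= hausdorff n B)%E.
Proof.
move=> AB; apply: ge_ereal_sup => _ [e e0 <-]; apply: le_trans (hausdorff_preS n e AB) _.
by apply: ereal_sup_ubound; exists e.
Qed.

Lemma hausdorff_pre_anti (n : nat) e e' A : e <= e' -> (hausdorff_pre n e' A <= hausdorff_pre n e A)%E.
Proof.
move=> ee; apply: le_ereal_inf_tmp => _ [F [BF Fe] <-]; apply: ereal_inf_lbound.
by exists F => //; split => // i; apply: le_trans (Fe i) _; rewrite lee_fin.
Qed.

Lemma hausdorff_pre_separated (n : nat) e s A B : (0 < n)%N -> e < s ->
  (forall x y, A x -> B y -> s <= enorm (x - y)) ->
  (hausdorff_pre n e A + hausdorff_pre n e B <= hausdorff_pre n e (A `|` B))%E.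
Proof.
move=> n0 es AB; apply: le_ereal_inf_tmp => _ [F [FU Fe] <-].
have z0 : (0 ^+ n = 0 :> \bar R)%E by case: (n) n0 => // m _; rewrite expeS mul0e.
pose G (S : set E) i := if `[< F i `&` S !=set0 >] then F i else set0.
have GF S : S `<=` A `|` B -> (hausdorff_pre n e S <= \sum_(0 <= i <oo) ediam (G S i) ^+ n)%E.
  move=> SU; apply: ereal_inf_lbound; exists (G S) => //; split.
    move=> z Sz; have [i _ Fz] := FU z (SU z Sz); exists i => //.
    by rewrite /G; case: asboolP => // -[]; exists z.
  move=> i; rewrite /G; case: asboolP => // _; rewrite ediam0.
  by apply: le_trans (Fe i); exact: ediam_ge0.
have p0 S i : (0 <= ediam (G S i) ^+ n)%E by rewrite expe_ge0// ediam_ge0.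
apply: le_trans (leeD (GF A _) (GF B _)) _; [by left|by right|].
rewrite -nneseriesD//; apply: lee_nneseries => i _ //; first by rewrite adde_ge0.
rewrite /G; case: asboolP => [[a [Fa Aa]]|_]; case: asboolP => [[b [Fb Bb]]|_].
- exfalso; have := AB a b Aa Bb; apply/negP; rewrite -ltNge.
  apply: le_lt_trans es; rewrite -lee_fin; apply: le_trans (Fe i).
  by rewrite /ediam le_max; apply/orP; right; apply: ereal_sup_ubound; exists a, b.
- by rewrite ediam0 z0 adde0.
- by rewrite ediam0 z0 add0e.
by rewrite ediam0 z0 add0e expe_ge0// ediam_ge0.
Qed.

Lemma ereal_sup_add_le (S1 S2 : set \bar R) (M : \bar R) : S1 !=set0 -> S2 !=set0 ->
  (forall a, S1 a -> 0 <= a)%E -> (forall b, S2 b -> 0 <= b)%E ->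
  (forall a b, S1 a -> S2 b -> a + b <= M)%E -> (ereal_sup S1 + ereal_sup S2 <= M)%E.
Proof.
move=> [a0 Sa0] [b0 Sb0] p1 p2 H.
have M0 : (0 <= M)%E by apply: le_trans (H _ _ Sa0 Sb0); exact: adde_ge0 (p1 _ Sa0) (p2 _ Sb0).
case: M M0 H => [M||] // M0 H; last by rewrite leey.
have fin2 b : S2 b -> b \is a fin_num.
  move=> Sb; rewrite ge0_fin_numE ?p2//; apply: le_lt_trans (ltry M).
  by apply: le_trans (H _ _ Sa0 Sb); rewrite leeDr// p1.
have H1 b : S2 b -> (ereal_sup S1 + b <= M%:E)%E.
  move=> Sb; rewrite -leeBrDr ?fin2//; apply: ge_ereal_sup => a Sa.
  by rewrite leeBrDr ?fin2// H.
have s10 : (0 <= ereal_sup S1)%E by apply: le_trans (p1 _ Sa0) _; exact: ereal_sup_ubound.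
have fin1 : ereal_sup S1 \is a fin_num.
  rewrite ge0_fin_numE//; apply: le_lt_trans (ltry M).
  by apply: le_trans (H1 _ Sb0); rewrite leeDl// p2.
rewrite addeC -leeBrDr//; apply: ge_ereal_sup => b Sb.
by rewrite leeBrDr// addeC H1.
Qed.

Lemma hausdorff_separated (n : nat) s A B : (0 < n)%N -> 0 < s ->
  (forall x y, A x -> B y -> s <= enorm (x - y)) ->
  (hausdorff n A + hausdorff n B <= hausdorff n (A `|` B))%E.
Proof.
move=> n0 s0 AB; apply: ereal_sup_add_le.
- by exists (hausdorff_pre n 1 A); exists 1 => //=.
- by exists (hausdorff_pre n 1 B); exists 1 => //=.
- by move=> _ [e _ <-]; exact: hausdorff_pre_ge0.
- by move=> _ [e _ <-]; exact: hausdorff_pre_ge0.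
move=> _ _ [e1 /= e10 <-] [e2 /= e20 <-].
pose e := Num.min (Num.min e1 e2) (s / 2).
have es : e < s by rewrite /e gt_min ltr_pdivrMr// ltr_pMr// ltr1n orbT.
have e0 : 0 < e by rewrite !lt_min e10 e20 divr_gt0.
have h1 : e <= e1 by rewrite !ge_min lexx.
have h2 : e <= e2 by rewrite !ge_min lexx orbT.
apply: le_trans (leeD (hausdorff_pre_anti n A h1) (hausdorff_pre_anti n B h2)) _.
apply: le_trans (hausdorff_pre_separated n0 es AB) _.
by apply: ereal_sup_ubound; exists e.
Qed.

End hausdorff_measure.

(** * From Holder to Carleson *)

Section holder_to_carleson.
Context {R : realType} {n : nat}.
Local Notation d := n.+1.
Local Notation E := 'rV[R]_d.
Local Notation mu := (@lebesgue_row R d).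
Implicit Types (D S B A : set E) (u f : E -> R) (x y z P Q X Y Z : E) (e r s c M N : R) (phi : R -> R).
Local Notation k := (@interior_ratio R n).

(** The traces of S on balls of radius s / 4 around the points of q are s / 2 apart, have measure at
    least C^-1 (s / 4)^n each, and lie within t / 2 + t / 4 < t of w, where the upper bound C t^n
    applies. *)
Lemma ADR_packing C S w t s (q : seq E) : (0 < n)%N -> 0 < C -> ADR C S -> S w -> 0 < s -> s <= t ->
  (t%:E < ediam S)%E -> separated s q -> (forall y, y \in q -> S y /\ enorm (y - w) < t / 2) ->
  (size q)%:R <= C ^+ 2 * 4 ^+ n * (t / s) ^+ n.
Proof.
move=> n0 C0 adr Sw s0 st tS sq Sq.
have s4 : 0 < s / 4 by rewrite divr_gt0.
have s4t : s / 4 < t by apply: lt_le_trans st; rewrite ltr_pdivrMr// ltr_pMr// ltr1n.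
have t0 : 0 < t by exact: lt_le_trans st.
have h : (((C^-1 * (s / 4) ^+ n) *+ size q)%:E <= hausdorff n (cells S (s / 4) q))%E.
  apply: (@packing _ _ _ (fun _ => True)) => //.
  - exact: hausdorff_ge0.
  - move=> A B _ _ AB; apply: (hausdorff_separated n0 _ AB); exact: divr_gt0.
  move=> y /Sq [Sy _].
  have s4S : ((s / 4)%:E < ediam S)%E by apply: lt_trans tS; rewrite lte_fin.
  by have /andP[] := adr y _ Sy s4 s4S.
have /andP[_ up] := adr w t Sw t0 tS.
have : (((C^-1 * (s / 4) ^+ n) *+ size q)%:E <= (C * t ^+ n)%:E)%E.
  apply: le_trans h _; apply: le_trans up; apply: hausdorffS => z /cellsP [y /Sq [Sy yw] [Sz zy]].
  split => //; rewrite /eball /=; apply: le_lt_trans (enorm_tri y _ _) _.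
  apply: lt_trans (ltrD zy yw) _.
  apply: (@le_lt_trans _ _ (t / 4 + t / 2)); first by rewrite lerD2r ler_wpM2r.
  by rewrite -mulrDr gtr_pMr//; lra.
have v0 : 0 < C^-1 * (s / 4) ^+ n by rewrite mulr_gt0 ?invr_gt0 ?exprn_gt0.
rewrite lee_fin -mulr_natl -ler_pdivlMr// => /le_trans; apply.
rewrite le_eqVlt; apply/orP; left; apply/eqP.
rewrite !exprMn !exprVn.
have sn : s ^+ n != 0 by rewrite expf_neq0// gt_eqF.
have fn : (4 : R) ^+ n != 0 by rewrite expf_neq0.
move: (s ^+ n) (4 ^+ n) (t ^+ n) sn fn => a b e a0 b0; field.
by rewrite a0 b0 gt_eqF.
Qed.

Lemma ADR_net C S w t s : (0 < n)%N -> 0 < C -> ADR C S -> S w -> 0 < s -> s <= t ->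
  (t%:E < ediam S)%E -> forall S', S' `<=` S -> exists q,
  [/\ (size q <= Num.truncn (C ^+ 2 * 4 ^+ n * (t / s) ^+ n))%N, forall y, y \in q -> S' y &
    covers q s (S' `&` eball w (t / 2))].
Proof.
move=> n0 C0 adr Sw s0 st tS S' SS.
have [q sq qS|q [qs qS qc]] := @maximal_net _ _ (S' `&` eball w (t / 2)) s
    (Num.truncn (C ^+ 2 * 4 ^+ n * (t / s) ^+ n)).
  rewrite truncn_ge_nat; last by rewrite !mulr_ge0 ?exprn_ge0 ?divr_ge0 ?(ltW C0) ?(ltW s0)// (le_trans (ltW s0)).
  by apply: (ADR_packing n0 C0 adr Sw s0 st tS sq) => y /qS [/SS].
by exists q; split => // y /qS [].
Qed.

(* If r is at least the diameter T of S, upper regularity is only available below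
   T: either s > T / 4 and one ball is enough, or S is first covered by boundedly
   many balls of radius T / 4. *)
Lemma boundary_cover C : (0 < n)%N -> 0 < C -> exists2 K : R, 0 < K & forall S x r s,
  ADR C S -> S x -> 0 < s -> s <= r -> exists q, (size q)%:R <= K * (r / s) ^+ n /\
    covers q (5 * s) [set z | enorm (z - x) < r /\ exists2 y, S y & enorm (z - y) < s].
Proof.
move=> n0 C0.
(* [ADR_net] covers balls of radius t / 2 only: 1/4 of 2 r is this radius for t = r, and 1/8 of 2 T
   is it for t = T / 2. *)
have q4 : 0 < 4^-1 :> R by rewrite invr_gt0.
have q8 : 0 < 8^-1 :> R by rewrite invr_gt0.
have [m1 H1] := @volume_net R d _ q4.
have [m2 H2] := @volume_net R d _ q8.
pose K0 : R := C ^+ 2 * 4 ^+ n.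
have K00 : 0 < K0 by rewrite mulr_gt0 ?exprn_gt0.
exists ((m1 + m2)%:R * K0 + 1); first by rewrite ltr_wpDl// mulr_ge0// ltW.
move=> S x r s adr Sx s0 sr.
have r0 : 0 < r by exact: lt_le_trans sr.
have rs1 : 1 <= (r / s) ^+ n by rewrite exprn_ege1// ler_pdivlMr// mul1r.
have rs0 : 0 <= (r / s) ^+ n by exact: le_trans ler01 rs1.
have size_le t j m (q : seq E) : 0 < t -> t <= r -> (j <= m1 + m2)%N -> (m <= j)%N ->
    (size q <= m * Num.truncn (K0 * (t / s) ^+ n))%N ->
    (size q)%:R <= ((m1 + m2)%:R * K0 + 1) * (r / s) ^+ n.
  move=> t0 tr jm mj qm.
  apply: (@le_trans _ _ ((m1 + m2)%:R * K0 * (r / s) ^+ n)); last by rewrite ler_wpM2r// lerDl.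
  apply: (@le_trans _ _ (m * Num.truncn (K0 * (t / s) ^+ n))%:R); first by rewrite ler_nat.
  rewrite natrM -mulrA; apply: ler_pM => //; first by rewrite ler_nat (leq_trans mj).
  have ts0 : 0 <= t / s by rewrite divr_ge0// ltW.
  apply: (@le_trans _ _ (K0 * (t / s) ^+ n)).
    by rewrite truncn_le mulr_ge0 ?(ltW K00) ?exprn_ge0.
  rewrite ler_wpM2l ?(ltW K00)// lerXn2r ?nnegrE// ?divr_ge0 ?(ltW r0) ?(ltW s0)//.
  by rewrite ler_wpM2r ?invr_ge0 ?(ltW s0).
have enlarge (q : seq E) (S' : set E) : covers q s S' ->
    (forall z y, enorm (z - x) < r -> S y -> enorm (z - y) < s -> S' y) ->
    covers q (5 * s) [set z | enorm (z - x) < r /\ exists2 y, S y & enorm (z - y) < s].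
  move=> qc HS z [zx [y Sy zy]]; have [p pq yp] := qc y (HS z y zx Sy zy).
  exists p => //; apply: le_lt_trans (enorm_tri y _ _) _.
  by have := ltrD zy yp; lra.
have [small|big] := ltP r%:E (ediam S).
  have r20 : 0 < 2 * r by rewrite mulr_gt0.
  have [q1 [q1m q1S q1c]] := H1 x (2 * r) (S `&` eball x (2 * r)) r20 (@subIsetr _ _ _).
  have r42 : 4^-1 * (2 * r) = r / 2 by field.
  rewrite r42 in q1c.
  have [q [qm _ qc]] : exists q', [/\ (size q' <= size q1 * Num.truncn (K0 * (r / s) ^+ n))%N,
      forall z, z \in q' -> (S `&` eball x (2 * r)) z & covers q' s (S `&` eball x (2 * r))].
    apply: covers_refine q1c _ => y /q1S [Sy _].
    exact: (ADR_net n0 C0 adr Sy s0 sr small (@subIsetl _ _ _)).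
  exists q; split; first by apply: (size_le r m1 (size q1)) => //; exact: leq_addr.
  apply: enlarge qc _ => z y zx Sy zy; split => //.
  rewrite /eball /=; apply: le_lt_trans (enorm_tri z _ _) _; rewrite [enorm (y - z)]enormB.
  by have := ltrD zy zx; lra.
have far y y' : S y -> S y' -> ((enorm (y - y'))%:E <= ediam S)%E.
  move=> Sy Sy'; rewrite /ediam le_max; apply/orP; right.
  by apply: ereal_sup_ubound; exists y, y'.
have [T ET] : exists T : R, ediam S = T%:E.
  exists (fine (ediam S)); rewrite fineK// ge0_fin_numE ?ediam_ge0//.
  by apply: le_lt_trans big (ltry _).
rewrite ET lee_fin in big.
have farT y y' : S y -> S y' -> enorm (y - y') <= T.
  by move=> Sy Sy'; have := far y y' Sy Sy'; rewrite ET lee_fin.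
(* A single ball around x suffices; this case dictates the factor 5 = 1 + 4. *)
have [sT|sT] := leP T (4 * s).
  exists [:: x]; split.
    rewrite /= -[leLHS]mulr1; apply: ler_pM => //.
    by rewrite lerDr mulr_ge0// ltW.
  move=> z [zx [y Sy zy]]; exists x; first by rewrite mem_head.
  apply: le_lt_trans (enorm_tri y _ _) _; have := farT y x Sy Sx; lra.
have T0 : 0 < T by apply: lt_trans sT; rewrite mulr_gt0.
have T20 : 0 < 2 * T by rewrite mulr_gt0.
have SB : S `<=` eball x (2 * T).
  move=> y Sy; rewrite /eball /=; apply: le_lt_trans (farT y x Sy Sx) _.
  by rewrite ltr_pMl// ltr1n.
have [q1 [q1m q1S q1c]] := H2 x (2 * T) S T20 SB.
have T82 : 8^-1 * (2 * T) = T / 2 / 2 by field.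
rewrite T82 in q1c.
have sT2 : s <= T / 2 by lra.
have T2S : ((T / 2)%:E < ediam S)%E by rewrite ET lte_fin; lra.
have [q [qm _ qc]] : exists q', [/\ (size q' <= size q1 * Num.truncn (K0 * (T / 2 / s) ^+ n))%N,
    forall z, z \in q' -> S z & covers q' s S].
  apply: covers_refine q1c _ => y /q1S Sy.
  exact: (ADR_net n0 C0 adr Sy s0 sT2 T2S (@subset_refl _ _)).
exists q; split; last by apply: enlarge qc _.
by apply: (size_le (T / 2) m2 (size q1)) => //; [lra|lra|exact: leq_addl].
Qed.

Lemma integral_cover D (f : E -> \bar R) (rad : E -> R) (b : R) : measurable D -> measurable_fun D f ->
  (forall z, 0 <= f z)%E -> forall (q : seq E) A, measurable A -> A `<=` D ->
  (forall p, p \in q -> eball p (rad p) `<=` D) ->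
  (forall p, p \in q -> (\int[mu]_(z in eball p (rad p)) f z <= b%:E)%E) ->
  (forall z, A z -> exists2 p, p \in q & eball p (rad p) z) ->
  (\int[mu]_(z in A) f z <= (b *+ size q)%:E)%E.
Proof.
move=> mD mf f0; elim=> [|p q IH] A mA AD qD qb qA.
  rewrite (_ : A = set0) ?integral_set0//.
  by apply/seteqP; split => // z /qA [].
have mB : measurable (eball p (rad p)) by apply: open_measurable_row; exact: eball_open.
have -> : A = (A `&` eball p (rad p)) `|` (A `\` eball p (rad p)).
  apply/seteqP; split => z; last by move=> [[]|[]].
  by move=> Az; have [h|h] := pselect (eball p (rad p) z); [left|right].
rewrite ge0_integral_setU//; last 4 first.
- exact: measurableI.
- exact: measurableD.
- by apply: measurable_funS mf => // z [[/AD]|[/AD]].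
- by apply/disj_setPLR => z [_ ?] [_].
rewrite mulrS EFinD; apply: leeD.
  apply: le_trans (qb p (mem_head _ _)).
  apply: ge0_subset_integral => //; first exact: measurableI.
  by apply: measurable_funS mf => //; apply: qD; rewrite mem_head.
apply: IH.
- exact: measurableD.
- by move=> z [/AD].
- by move=> p' p'q; apply: qD; rewrite in_cons p'q orbT.
- by move=> p' p'q; apply: qb; rewrite in_cons p'q orbT.
move=> z [/qA [p' + zp'] nz]; rewrite in_cons => /orP[/eqP E1|p'q]; last by exists p'.
by exfalso; apply: nz; rewrite -E1.
Qed.

(** Closed below and open above, so that the layers with s = r / 2^i partition the part of D in the
    ball around a boundary point x. *)
Definition layer D x r s : set E :=
  (eball x r `&` D) `&` ([set z | s / 2 <= delta D z] `&` [set z | delta D z < s]).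

Lemma layer_measurable D x r s : open D -> boundary D !=set0 -> measurable (layer D x r s).
Proof.
move=> oD bD; have cd := delta_continuous bD.
apply: measurableI; first by apply: measurableI; apply: open_measurable_row => //; exact: eball_open.
apply: measurableI.
  apply: closed_measurable_row.
  exact: (closed_comp (fun z _ => cd z) (@closed_ge R (s / 2))).
apply: open_measurable_row.
exact: (open_comp (fun z _ => cd z) (@open_lt R s)).
Qed.

Lemma layer_cover C : (0 < n)%N -> 0 < C -> exists2 K : R, 0 < K & forall D x r s,
  open D -> boundary D !=set0 -> ADR C (boundary D) -> boundary D x -> 0 < s -> s <= r ->
  exists q, [/\ (size q)%:R <= K * (r / s) ^+ n, forall p, p \in q -> layer D x r s p &
    covers q (k * (s / 2)) (layer D x r s)].
Proof.
move=> n0 C0; have [K K0 HK] := boundary_cover n0 C0.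
(* k / 10 of the radius 5 s is k s / 2; since delta is at least s / 2 on the layer, balls of this
   radius centred in it lie in Whitney balls. *)
have k0 : 0 < k / 10 by rewrite divr_gt0// interior_ratio_gt0.
have [m Hm] := @volume_net R d (k / 10) k0.
exists (K * (m%:R + 1)); first by rewrite mulr_gt0// ltr_wpDl.
move=> D x r s oD bD adr bx s0 sr.
have [q1 [q1s q1c]] := HK _ x r s adr bx s0 sr.
have s50 : 0 < 5 * s by rewrite mulr_gt0.
have q1c' : covers q1 (5 * s) (layer D x r s).
  move=> z [[zx _] [_ dz]]; apply: q1c; split => //.
  by have [y by_ zy] := delta_lt bD dz; exists y.
have E1 : k / 10 * (5 * s) = k * (s / 2) by field.
have [q [qm ql qc]] : exists q', [/\ (size q' <= size q1 * m)%N,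
    forall z, z \in q' -> layer D x r s z & covers q' (k * (s / 2)) (layer D x r s)].
  apply: covers_refine q1c' _ => y _; rewrite -E1.
  have [q' [h1 h2 h3]] := Hm y (5 * s) (layer D x r s `&` eball y (5 * s)) s50 (@subIsetr _ _ _).
  by exists q'; split => // z /h2 [].
exists q; split => //.
apply: (@le_trans _ _ ((size q1)%:R * m%:R)); first by rewrite -natrM ler_nat.
rewrite mulrAC; apply: ler_pM => //; by rewrite lerDl.
Qed.

(** Caccioppoli with c = u(P): the tripled cube stays within 3/8 delta(P) of P, so the Holder bound
    gives |u - u(P)| <= N phi(delta(P)) there. On the ball the weight delta is at most 2
    delta(P). *)
Lemma ball_energy Lam : 1 <= Lam -> exists2 C : R, 0 < C & forall D (A : E -> 'M[R]_d) u phi N P,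
  open D -> boundary D !=set0 -> elliptic D Lam A -> weak_solution D A u -> 0 <= N ->
  (forall t, 0 < t -> 0 < phi t) -> (forall s t, 0 < s -> s <= t -> phi s <= phi t) ->
  (forall X Y, D X -> D Y -> X != Y -> `|u X - u Y| <= N * phi (enorm (X - Y))) -> D P ->
  (\int[mu]_(z in eball P (k * delta D P)) (enorm (weak_grad D u z) ^+ 2 * delta D z)%:E
    <= (C * (N * phi (delta D P)) ^+ 2 * delta D P ^+ n)%:E)%E.
Proof.
move=> L1; have [C C0 HC] := @caccioppoli R d Lam L1.
have k0 := @interior_ratio_gt0 R n.
exists (2 * C * k ^+ d / k ^+ 2); first by rewrite divr_gt0 ?mulr_gt0 ?exprn_gt0.
move=> D A u phi N P oD bD ellA wu N0 phi0 phile Hu DP.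
have mD := open_measurable_row oD.
set t := delta D P.
have t0 : 0 < t by exact: delta_gt0.
have kt : 0 < k * t by rewrite mulr_gt0.
have kt1 : k * t <= t by rewrite ler_piMl ?interior_ratio_le1// ltW.
have E38 : 3 * d%:R * (k * t) = 3 / 8 * t.
  by rewrite /interior_ratio; field; rewrite gt_eqF.
have tt : 3 / 8 * t < t by rewrite gtr_pMl// ltr_pdivrMr// mul1r ltr_nat.
have kt3 : 0 <= 3 * (k * t) by rewrite mulr_ge0// ltW.
have near z : closed_cube P (3 * (k * t)) z -> enorm (z - P) < t.
  move=> zP; apply: le_lt_trans tt; rewrite -E38 [leRHS](_ : _ = d%:R * (3 * (k * t))); last by ring.
  by apply: enorm_le_coord => // i; have := zP i; rewrite !mxE.
have cD : closed_cube P (3 * (k * t)) `<=` D.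
  by move=> z /near zP; apply: (eball_delta_sub oD bD DP (lexx _)).
have osc z : cube P (3 * (k * t)) z -> `|u z - u P| <= N * phi t.
  move=> /cube_closed_cube zP; have [->|zP'] := eqVneq z P.
    by rewrite subrr normr0 mulr_ge0// ltW// phi0.
  apply: le_trans (Hu z P (cD z zP) DP zP') _; rewrite ler_wpM2l// phile//.
    by rewrite enorm_gt0// subr_eq0.
  by rewrite ltW// near.
have M0 : 0 <= N * phi t by rewrite mulr_ge0// ltW// phi0.
have H := HC D A u P (k * t) (u P) _ oD ellA wu kt cD M0 osc.
have [w12 _ _] := wu; have [_ _ [mG _ _] _] := w12.
have mGd := weighted_gradient_measurable oD bD w12.
have BD : eball P (k * t) `<=` D := eball_delta_sub oD bD DP kt1.
have mB : measurable (eball P (k * t)) by apply: open_measurable_row; exact: eball_open.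
have kt13 : k * t <= 3 * (k * t) by rewrite ler_peMl ?ler1n// ltW.
have QD : cube P (k * t) `<=` D by apply: subset_trans cD; apply: subset_trans (cubeS kt13) _; exact: cube_closed_cube.
apply: (@le_trans _ _ (\int[mu]_(z in eball P (k * t)) ((2 * t)%:E * (enorm (weak_grad D u z) ^+ 2)%:E))%E).
  apply: ge0_le_integral => //.
  - by move=> z _; exact: weighted_gradient_ge0.
  - exact: measurable_funS mGd.
  - by apply: measurable_funeM; apply: measurable_enorm2; exact: measurable_funS mG.
  move=> z zP; rewrite -EFinM lee_fin mulrC ler_wpM2r ?sqr_ge0//.
  apply: le_trans (delta_lipD bD z P) _.
  rewrite -/t mulr2n mulrDl mul1r lerD2l ltW//; exact: lt_le_trans kt1.
rewrite ge0_integralZl//; last 3 first.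
- by apply: measurable_enorm2; exact: measurable_funS mG.
- by move=> z _; rewrite lee_fin sqr_ge0.
- by rewrite lee_fin mulr_ge0// ltW.
apply: (@le_trans _ _ ((2 * t)%:E * (C * (N * phi t) ^+ 2 * (k * t) ^+ d / (k * t) ^+ 2)%:E)%E).
  apply: lee_wpmul2l; first by rewrite lee_fin mulr_ge0// ltW.
  apply: le_trans H; apply: ge0_subset_integral => //; first exact: cube_measurable.
  - by apply: measurable_enorm2; exact: measurable_funS mG.
  - by move=> z _; rewrite lee_fin sqr_ge0.
  exact: eball_cube.
rewrite -EFinM lee_fin le_eqVlt; apply/orP; left; apply/eqP.
rewrite !exprMn !exprS; move: (k ^+ n) (t ^+ n) => a b.
by field; rewrite !gt_eqF.
Qed.

(** The number (r / s)^n of Whitney balls compensates the factor s^n of each: every layer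
    contributes r^n, and only phi(s)^2 depends on the layer. *)
Lemma layer_energy Lam C : (0 < n)%N -> 1 <= Lam -> 0 < C -> exists2 K : R, 0 < K &
  forall D (A : E -> 'M[R]_d) u phi N x r s,
  open D -> boundary D !=set0 -> ADR C (boundary D) -> elliptic D Lam A -> weak_solution D A u -> 0 <= N ->
  (forall t, 0 < t -> 0 < phi t) -> (forall s t, 0 < s -> s <= t -> phi s <= phi t) ->
  (forall X Y, D X -> D Y -> X != Y -> `|u X - u Y| <= N * phi (enorm (X - Y))) ->
  boundary D x -> 0 < s -> s <= r ->
  (\int[mu]_(z in layer D x r s) (enorm (weak_grad D u z) ^+ 2 * delta D z)%:E
    <= (K * (N * phi s) ^+ 2 * r ^+ n)%:E)%E.
Proof.
move=> n0 L1 C0.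
have [Kl Kl0 HKl] := layer_cover n0 C0.
have [Ke Ke0 HKe] := ball_energy L1.
exists (Kl * Ke); first exact: mulr_gt0.
move=> D A u phi N x r s oD bD adr ellA wu N0 phi0 phile Hu bx s0 sr.
have r0 : 0 < r := lt_le_trans s0 sr.
have [q [qs ql qc]] := HKl D x r s oD bD adr bx s0 sr.
have [w12 _ _] := wu.
have k0 := @interior_ratio_gt0 R n.
have b0 : 0 <= Ke * (N * phi s) ^+ 2 * s ^+ n.
  apply: mulr_ge0; last by rewrite exprn_ge0// ltW.
  by apply: mulr_ge0; [exact: ltW|exact: sqr_ge0].
have H := @integral_cover D (fun z => (enorm (weak_grad D u z) ^+ 2 * delta D z)%:E)
  (fun p => k * delta D p) (Ke * (N * phi s) ^+ 2 * s ^+ n) (open_measurable_row oD)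
  (weighted_gradient_measurable oD bD w12) (fun z => weighted_gradient_ge0 u z bD) q _
  (layer_measurable x r s oD bD).
apply: (le_trans (H _ _ _ _)).
- by move=> z [[]].
- move=> p /ql [[_ Dp] _]; apply: (eball_delta_sub oD bD Dp).
  by rewrite ler_piMl ?interior_ratio_le1 ?delta_ge0.
- move=> p /ql [[_ Dp] [_ /= dp]]; apply: le_trans (HKe D A u phi N p oD bD ellA wu N0 phi0 phile Hu Dp) _.
  have dp0 := delta_gt0 oD bD Dp.
  have pp : phi (delta D p) <= phi s by apply: phile => //; exact: ltW.
  have pp0 := phi0 _ dp0.
  have h1 : (N * phi (delta D p)) ^+ 2 <= (N * phi s) ^+ 2.
    apply: lerXn2r; rewrite ?nnegrE ?mulr_ge0 ?(ltW pp0) ?(le_trans (ltW pp0) pp)//.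
    exact: ler_wpM2l.
  have h2 : delta D p ^+ n <= s ^+ n.
    by apply: lerXn2r; rewrite ?nnegrE ?(ltW dp0) ?(ltW s0)// ltW.
  rewrite lee_fin; apply: ler_pM => //.
  - by apply: mulr_ge0; [exact: ltW|exact: sqr_ge0].
  - by rewrite exprn_ge0// ltW.
  by apply: ler_wpM2l => //; exact: ltW.
- move=> z lz; have [p pq zp] := qc z lz; exists p => //.
  rewrite /eball /=; apply: lt_le_trans zp _; rewrite ler_wpM2l ?(ltW k0)//.
  by have [_ []] := ql p pq.
rewrite lee_fin -mulr_natl; apply: le_trans (ler_wpM2r b0 qs) _.
rewrite expr_div_n le_eqVlt; apply/orP; left; apply/eqP.
have sn : s ^+ n != 0 by rewrite expf_neq0// gt_eqF.
by move: (s ^+ n) sn (r ^+ n) => a a0 b; field.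
Qed.

Lemma layer_bigcup D x r : open D -> boundary D !=set0 -> boundary D x -> 0 < r ->
  eball x r `&` D = \bigcup_i layer D x r (r / 2 ^+ i).
Proof.
move=> oD bD bx r0; apply/seteqP; split=> [z [zx Dz]|z [i _ [[]]]]; last by [].
have dz := delta_gt0 oD bD Dz.
have dr : delta D z < r by apply: le_lt_trans zx; exact: delta_le.
have ex : exists i, r / 2 ^+ i.+1 <= delta D z.
  exists (Num.truncn (r / delta D z)).
  rewrite ler_pdivrMr ?exprn_gt0// mulrC -ler_pdivrMr//.
  apply: (@le_trans _ _ (Num.truncn (r / delta D z)).+1%:R); first by rewrite ltW// truncnS_gt.
  by rewrite -natrX ler_nat ltnW// ltn_expl.
(* Minimality of i is the upper bound of the layer; for i = 0 that bound is delta < r, which holds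
   because x is a boundary point. *)
case: (ex_minnP ex) => i iz imin; exists i => //; split; first by split.
split; first by rewrite /= -mulrA -invfM -exprSr.
case: i iz imin => [|i] iz imin; first by rewrite /= expr0 divr1.
rewrite /= ltNge; apply/negP => h.
by have := imin i h; rewrite ltnn.
Qed.

Lemma layer_trivIset D x r : 0 < r -> trivIset setT (fun i => layer D x r (r / 2 ^+ i)).
Proof.
move=> r0; apply: ltn_trivIset => i j ij; apply/seteqP; split => // z [[_ [/= h1 _]] [_ [_ /= h2]]].
have : r / 2 ^+ i <= r / 2 ^+ j / 2.
  rewrite -[leRHS]mulrA -invfM -exprSr ler_wpM2l ?(ltW r0)//.
  by rewrite lef_pV2 ?posrE ?exprn_gt0// ler_weXn2l// ler1n.
by move=> h; have := lt_le_trans h2 (le_trans h h1); rewrite ltxx.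
Qed.

Lemma carleson_of_holder Lam C Cphi : (0 < n)%N -> 1 <= Lam -> 0 < C -> 0 < Cphi ->
  exists2 K : R, 0 < K & forall D (A : E -> 'M[R]_d) alpha beta phi u N,
    open D -> boundary D !=set0 -> ADR C (boundary D) -> elliptic D Lam A ->
    0 < beta -> beta <= alpha -> alpha < 1 ->
    growth_function phi -> growth_class beta Cphi phi -> weak_solution D A u -> 0 <= N ->
    (forall X Y, D X -> D Y -> X != Y -> `|u X - u Y| <= N * phi (enorm (X - Y))) ->
    (carleson_norm phi D u <= (K * N)%:E)%E.
Proof.
move=> n0 L1 C0 Cp0.
have [K K0 HK] := layer_energy n0 L1 C0.
(* In the sum of phi(r / 2^i)^2 one factor is bounded by phi(r), the sum of the other by 2 Cphi
   phi(2 r), and phi(2 r) by 8 Cphi phi(r). *)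
exists (Num.sqrt (16 * Cphi ^+ 2 * K)); first by rewrite sqrtr_gt0 !mulr_gt0// exprn_gt0.
move=> D A alpha beta phi u N oD bD adr ellA be0 bea a1 gphi cphi wu N0 Hu.
have phi0 := growth_gt0 gphi; have phile := growth_le gphi.
have [w12 _ _] := wu.
apply: ge_ereal_sup => _ [x [r [bx r0 ->]]].
have pr := phi0 r r0.
have rn : 0 < r ^+ n by rewrite exprn_gt0.
set I := (\int[mu]_(X in _) _)%E.
pose b := 16 * Cphi ^+ 2 * K * (N * phi r) ^+ 2 * r ^+ n.
have Ib : (I <= b%:E)%E.
  rewrite /I (layer_bigcup oD bD bx r0) ge0_integral_bigcup//; last first.
  - exact: layer_trivIset.
  - by move=> z _; exact: weighted_gradient_ge0.
  - by apply: measurable_funS (weighted_gradient_measurable oD bD w12) => [|z [i _ [[]]]//]; exact: open_measurable_row.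
  - by move=> i; exact: layer_measurable.
  apply: lime_le; first by apply: is_cvg_nneseries => i _ _; apply: integral_ge0 => z _; exact: weighted_gradient_ge0.
  apply: nearW => m.
  apply: (@le_trans _ _ (\sum_(0 <= i < m) (K * (N * phi (r / 2 ^+ i)) ^+ 2 * r ^+ n)%:E)%E).
    apply: lee_sum => i _; apply: (HK D A u phi N x r _ oD bD adr ellA wu N0 phi0 phile Hu bx).
      by rewrite divr_gt0// exprn_gt0.
    by rewrite ler_pdivrMr ?exprn_gt0// ler_peMr ?(ltW r0)// exprn_ege1// ler1n.
  rewrite sumEFin lee_fin big_mkord.
  apply: (@le_trans _ _ (K * N ^+ 2 * phi r * r ^+ n * \sum_(i < m) phi (r / 2 ^+ i))).
    rewrite mulr_sumr; apply: ler_sum => i _.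
    have ri : 0 < r / 2 ^+ i by rewrite divr_gt0// exprn_gt0.
    have h : phi (r / 2 ^+ i) <= phi r.
      by apply: phile => //; rewrite ler_pdivrMr ?exprn_gt0// ler_peMr ?(ltW r0)// exprn_ege1// ler1n.
    have p0 := phi0 _ ri.
    rewrite [leLHS](_ : _ = K * N ^+ 2 * r ^+ n * phi (r / 2 ^+ i) * phi (r / 2 ^+ i)); last by ring.
    rewrite [leRHS](_ : _ = K * N ^+ 2 * r ^+ n * phi (r / 2 ^+ i) * phi r); last by ring.
    by rewrite ler_wpM2l// !mulr_ge0 ?sqr_ge0 ?(ltW p0) ?(ltW rn) ?(ltW K0).
  have h1 := growth_sum gphi cphi m r0.
  have h2 := growth_scale gphi cphi be0 bea a1 r0 (ler1n R 2 : 1 <= 2).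
  have c0 : 0 <= K * N ^+ 2 * phi r * r ^+ n by rewrite !mulr_ge0 ?sqr_ge0 ?(ltW pr) ?(ltW rn) ?(ltW K0).
  apply: le_trans (ler_wpM2l c0 h1) _.
  have c1 : 0 <= K * N ^+ 2 * phi r * r ^+ n * (2 * Cphi) by rewrite mulr_ge0// mulr_ge0// ltW.
  rewrite mulrA; apply: le_trans (ler_wpM2l c1 h2) _.
  by rewrite /b le_eqVlt; apply/orP; left; apply/eqP; ring.
have I0 : (0 <= I)%E by apply: integral_ge0 => z _; exact: weighted_gradient_ge0.
have If : I \is a fin_num by rewrite ge0_fin_numE// (le_lt_trans Ib)// ltry.
rewrite -(fineK If) lee_fin in Ib *.
rewrite -(fineK If) /= -EFinM lee_fin ler_pdivrMl//.
have -> : phi r * (Num.sqrt (16 * Cphi ^+ 2 * K) * N) = Num.sqrt (16 * Cphi ^+ 2 * K * (N * phi r) ^+ 2).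
  rewrite [in RHS]sqrtrM; last by rewrite !mulr_ge0 ?sqr_ge0 ?(ltW K0) ?(ltW Cp0).
  rewrite sqrtr_sqr ger0_norm; last by rewrite mulr_ge0// ltW.
  ring.
apply: ler_wsqrtr; rewrite ler_pdivrMl//; apply: le_trans Ib _.
by rewrite /b le_eqVlt; apply/orP; left; apply/eqP; ring.
Qed.

End holder_to_carleson.

(** * Equivalence of the norms *)

Section comparison.
Context {R : realType} {n : nat}.
Local Notation d := n.+1.
Local Notation E := 'rV[R]_d.
Local Notation mu := (@lebesgue_row R d).
Implicit Types (D : set E) (u v : E -> R) (phi : R -> R).

(** The Holder norm is nonnegative only if its supremum runs over a nonempty set, that is, if D has
    two distinct points. *)
Lemma boundary_two_points D : open D -> boundary D !=set0 -> exists X Y : E, [/\ D X, D Y & X != Y].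
Proof.
move=> oD [x [cx _]]; have [Y DY _] := (closure_eball D x).1 cx 1 ltr01.
have [r r0 rD] := open_eball oD DY.
exists Y, (Y + (r / 2) *: basis_row ord0); split => //.
  apply: rD; rewrite /eball /= addrC addKr enormZ enorm_basis mulr1 gtr0_norm ?divr_gt0//.
  by rewrite ltr_pdivrMr// ltr_pMr// ltr1n.
apply/eqP => /(congr1 (fun Z => enorm (Z - Y))) /esym /eqP.
rewrite subrr enorm0 addrC addKr enormZ enorm_basis mulr1 gtr0_norm ?divr_gt0//.
by rewrite gt_eqF// divr_gt0.
Qed.

Lemma holder_norm_ge0 phi D u : open D -> boundary D !=set0 -> (forall t, 0 < t -> 0 < phi t) ->
  (0 <= holder_norm phi D u)%E.
Proof.
move=> oD bD phi0; have [X [Y [DX DY XY]]] := boundary_two_points oD bD.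
apply: (@le_trans _ _ (`|u X - u Y| / phi (enorm (X - Y)))%:E).
  by rewrite lee_fin divr_ge0// ltW// phi0// enorm_gt0// subr_eq0.
by apply: ereal_sup_ubound; exists X, Y.
Qed.

Lemma carleson_norm_ge0 phi D u : boundary D !=set0 -> (forall t, 0 < t -> 0 < phi t) ->
  (0 <= carleson_norm phi D u)%E.
Proof.
move=> [x bx] phi0; set T := (X in (_ <= ereal_sup X)%E).
have : T (((phi 1)^-1%:E * sqrte ((1 ^+ n)^-1%:E *
      \int[mu]_(X in eball x 1 `&` D) (enorm (weak_grad D u X) ^+ 2 * delta D X)%:E))%E).
  by exists x, 1.
move/ereal_sup_ubound; apply: le_trans; rewrite mule_ge0 ?sqrte_ge0//.
by rewrite lee_fin invr_ge0 ltW// phi0.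
Qed.

Lemma holder_norm_shift phi D u v c : (forall X, D X -> v X = u X + c) ->
  holder_norm phi D v = holder_norm phi D u.
Proof.
move=> vu; congr ereal_sup; apply/seteqP; split => z [X [Y [DX DY XY ->]]]; exists X, Y; split => //.
  by rewrite !vu//; congr (`|_| / _)%:E; ring.
by rewrite !vu//; congr (`|_| / _)%:E; ring.
Qed.

(** Only u is assumed to be in [W12loc]; the local square integrability of v that [weak_grad_shift]
    requires is derived on each compact set. *)
Lemma carleson_norm_shift phi D u v c : open D -> W12loc D u -> (forall X, D X -> v X = u X + c) ->
  carleson_norm phi D v = carleson_norm phi D u.
Proof.
move=> oD [mu_ lu _ _] vu.
suff lv K : compact K -> K `<=` D -> (\int[mu]_(x in K) (v x ^+ 2)%:E < +oo)%E.
  by rewrite /carleson_norm (weak_grad_shift (open_measurable_row oD) mu_ lu lv vu).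
move=> cK KD; have mK := compact_measurable_row cK.
have Koo := compact_finite_measure cK.
have su : square_integrable K u.
  apply: square_integrableP; last exact: lu.
  exact: measurable_funS (open_measurable_row oD) KD mu_.
have sc : square_integrable K (cst c) by apply: (@bounded_square_integrable _ _ _ mK Koo (cst c) `|c|).
have := square_integrable_lty mK (square_integrableD mK su sc).
by under eq_integral => z /[!inE] /KD Dz do rewrite -(vu z Dz).
Qed.

(** Both norms ignore additive constants: the infimum runs over a single value. *)
Lemma quotient_norm_const (N : (E -> R) -> \bar R) (K : set (E -> R)) u :
  K u -> (forall v, K v -> N v = N u) -> quotient_norm N K = N u.
Proof.
move=> Ku KN; rewrite /quotient_norm (_ : N @` K = [set N u]) ?ereal_inf1//.
apply/seteqP; split => [_ [v Kv <-]|_ ->]; first exact: KN.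
by exists u.
Qed.

Lemma approx_eqP (C C1 C2 : R) (a b : \bar R) : 0 < C -> C1 <= C -> C2 <= C -> (0 <= a)%E -> (0 <= b)%E ->
  (a <= C1%:E * b)%E -> (b <= C2%:E * a)%E -> approx_eq C a b.
Proof.
move=> C0 c1 c2 a0 b0 ab ba; split.
  rewrite lee_pdivrMl//; apply: le_trans ab _; exact: lee_wpmul2r.
by apply: le_trans ba _; exact: lee_wpmul2r.
Qed.

Lemma holder_normP phi D u N : (forall t, 0 < t -> 0 < phi t) ->
  (holder_norm phi D u <= N%:E)%E <->
  forall X Y, D X -> D Y -> X != Y -> `|u X - u Y| <= N * phi (enorm (X - Y)).
Proof.
move=> phi0; split => [H X Y DX DY XY|H].
  have p0 : 0 < phi (enorm (X - Y)) by rewrite phi0// enorm_gt0// subr_eq0.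
  rewrite -ler_pdivrMr// -lee_fin; apply: le_trans H.
  by apply: ereal_sup_ubound; exists X, Y.
apply: ge_ereal_sup => _ [X [Y [DX DY XY ->]]].
by rewrite lee_fin ler_pdivrMr ?H// phi0// enorm_gt0// subr_eq0.
Qed.

End comparison.
Unset Implicit Arguments.
Set Strict Implicit.

Theorem theorem6p21 (R : realType) (n : nat) (Lambda alpha1 C1 Cadr c0 K1 K2 Cphi : R)
    (hn : (2 <= n)%N) (hLambda : 1 <= Lambda)
    (halpha1 : 0 < alpha1 < 1) (hC1 : 1 <= C1)
    (hDGN : DeGiorgi_Nash n.+1 Lambda alpha1 C1)
    (hCadr : 1 < Cadr) (hc0 : 0 < c0 < 1) (hK1 : 1 < K1) (hK2 : 1 < K2) :
  exists C : R, 1 <= C /\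
  forall (D : set 'rV[R]_n.+1) (A : 'rV[R]_n.+1 -> 'M[R]_n.+1)
         (beta : R) (phi : R -> R),
    one_sided_CAD Cadr c0 K1 K2 D ->
    elliptic D Lambda A ->
    0 < beta <= alpha1 ->
    growth_function phi ->
    growth_class beta Cphi phi ->
    [/\ forall u : 'rV[R]_n.+1 -> R, weak_solution D A u ->
          approx_eq C (holder_norm phi D u) (carleson_norm phi D u),
        holder_solutions phi D A = carleson_solutions phi D A,
        quotient_const D (holder_solutions phi D A) =
          quotient_const D (carleson_solutions phi D A) &
        forall K : set ('rV[R]_n.+1 -> R),
          quotient_const D (holder_solutions phi D A) K ->
          approx_eq C (quotient_norm (holder_norm phi D) K)
                   (quotient_norm (carleson_norm phi D) K)].
Proof.
have /andP[a0 a1] := halpha1.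
(* For Cphi <= 0 the growth class is empty by [growth_const_ge], and any constant will do. *)
have [Cp0|Cp0] := ltP 0 Cphi; last first.
  exists 1; split => // D A beta phi _ _ /andP[be0 bea] gphi cphi; exfalso.
  have := growth_const_ge gphi cphi be0 bea a1; lra.
have n0 : (0 < n)%N by exact: ltn_trans hn.
have Ca0 : 0 < Cadr by exact: lt_trans hCadr.
have [KA KA0 HA] := holder_of_carleson hC1 hDGN halpha1 hc0 hK1 hK2 Cp0.
have [KB KB0 HB] := @carleson_of_holder R n Lambda Cadr Cphi n0 hLambda Ca0 Cp0.
pose C := KA + KB + 1.
have C1' : 1 <= C by rewrite lerDr addr_ge0// ltW.
have C0 : 0 < C by exact: lt_le_trans C1'.
have CA : KA <= C by rewrite /C -addrA lerDl addr_ge0// ltW.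
have CB : KB <= C by rewrite /C addrAC lerDr addr_ge0// ltW.
exists C; split => // D A beta phi [oD bD adr ck hc] ellA /andP[be0 bea] gphi cphi.
have phi0 := growth_gt0 gphi.
have hge0 u : (0 <= holder_norm phi D u)%E by exact: holder_norm_ge0.
have cge0 u : (0 <= carleson_norm phi D u)%E by exact: carleson_norm_ge0.
have LA u : weak_solution D A u -> (holder_norm phi D u <= KA%:E * carleson_norm phi D u)%E.
  move=> wu; have := cge0 u; case Ec : (carleson_norm phi D u) => [N||] // N0; last first.
    by rewrite gt0_muley ?lte_fin// leey.
  (* The Carleson norm may be 0, whereas [holder_of_carleson] takes a positive bound: it is applied
     to N + e / KA, and e tends to 0. *)
  rewrite lee_fin in N0; apply/lee_addgt0Pr => e e0.
  have eK : 0 < e / KA by rewrite divr_gt0.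
  have N'0 : 0 < N + e / KA by rewrite ltr_wpDl.
  have h : (carleson_norm phi D u <= (N + e / KA)%:E)%E by rewrite Ec lee_fin lerDl ltW.
  rewrite -EFinM -EFinD (_ : KA * N + e = KA * (N + e / KA)); last by field; rewrite gt_eqF.
  apply/(holder_normP D u _ phi0) => X Y DX DY XY.
  exact: (HA D A beta phi u _ oD bD ck hc ellA be0 bea gphi cphi wu N'0 h X Y DX DY XY).
have LB u : weak_solution D A u -> (carleson_norm phi D u <= KB%:E * holder_norm phi D u)%E.
  move=> wu; have := hge0 u; case Eh : (holder_norm phi D u) => [N||] // N0; last first.
    by rewrite gt0_muley ?lte_fin// leey.
  rewrite lee_fin in N0; rewrite -EFinM.
  apply: (HB D A alpha1 beta phi u N oD bD adr ellA be0 bea a1 gphi cphi wu N0).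
  by apply/(holder_normP D u N phi0); rewrite Eh.
have approx u : weak_solution D A u -> approx_eq C (holder_norm phi D u) (carleson_norm phi D u).
  by move=> wu; apply: (approx_eqP C0 CA CB) => //; [exact: LA|exact: LB].
have eqS : holder_solutions phi D A = carleson_solutions phi D A.
  apply/seteqP; split => u [wu].
    move=> hu; split => //; split; first by have [] := wu.
    by apply: le_lt_trans (LB u wu) _; rewrite lte_mul_pinfty// ?lee_fin ?(ltW KB0)// ge0_fin_numE.
  move=> [_ cu]; split => //.
  by apply: le_lt_trans (LA u wu) _; rewrite lte_mul_pinfty// ?lee_fin ?(ltW KA0)// ge0_fin_numE.
split => //; first by rewrite eqS.
move=> K [u [wu _] <-].
have cu : const_class D u u by exists 0 => X _; rewrite addr0.
rewrite (quotient_norm_const cu) => [|v [c vu]]; last exact: holder_norm_shift vu.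
rewrite (quotient_norm_const cu) => [|v [c vu]]; last first.
  by apply: carleson_norm_shift vu => //; have [] := wu.
exact: approx.
Qed.
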